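(* Let $n\geq 3$ be an integer and let $g=e^{2u}|dx|^2$ be a smooth, complete conformal metric on $\mathbb{R}^n$ with finite total Q-curvature. Suppose that there is a constant $C>0$ such that the scalar curvature satisfies $R_g\geq C$ near infinity (i.e. outside some compact set). Then $\tau(g)=0$.
   Context: The Q-curvature $Q$ of $g=e^{2u}|dx|^2$ is defined by $(-\Delta)^{n/2}u=Qe^{nu}$ on $\mathbb{R}^n$; for odd $n$, $(-\Delta)^{n/2}:=(-\Delta)^{1/2}\circ(-\Delta)^{(n-1)/2}$, with the assumption $(-\Delta)^{(n-1)/2}u\in L_{1/2}(\mathbb{R}^n):=\{\varphi\in L^1_{loc}: \int\frac{|\varphi|}{1+|x|^{n+1}}<\infty\}$ and $(-\Delta)^{1/2}f(x)=C(n)\,\mathrm{P.V.}\int\frac{f(x)-f(y)}{|x-y|^{n+1}}dy$ (i.e. Fourier multiplier $|\xi|$). Finite total Q-curvature means $Q$ is well defined and $Qe^{nu}\in L^1(\mathbb{R}^n)$. The scalar curvature is $R_g=2(n-1)e^{-2u}\big(-\Delta u-\frac{n-2}{2}|\nabla u|^2\big)$. The volume entropy is $\tau(g):=\limsup_{R\to\infty}\frac{\log V_g(B_R(0))}{\log|B_R(0)|}$, where $V_g(B_R(0))=\int_{B_R(0)}e^{nu}dx$ and $|B_R(0)|$ is the Euclidean volume of the Euclidean ball of radius $R$ about the origin. *)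

(* Defs.v *)
From HB Require Import structures.
From mathcomp Require Import all_boot all_order all_algebra.
From mathcomp Require Import all_classical all_reals all_analysis.

Set Implicit Arguments.
Unset Strict Implicit.
Unset Printing Implicit Defensive.

Import Order.TTheory GRing.Theory Num.Theory.
Import numFieldNormedType.Exports.

Local Open Scope classical_set_scope.
Local Open Scope ring_scope.

Section QcurvDefs.
Variable R : realType.

(* Euclidean norm |x| (the library norm on 'rV is the max-norm). *)
Definition enorm {n : nat} (x : 'rV[R]_n) : R :=
  Num.sqrt (\sum_(i < n) x ord0 i ^+ 2).

Definition ebasis {n : nat} (i : 'I_n) : 'rV[R]_n := delta_mx ord0 i.

Definition partial {n : nat} (i : 'I_n) (f : 'rV[R]_n -> R) : 'rV[R]_n -> R :=
  fun x => 'D_(ebasis i) f x.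

Definition iter_partial {n : nat} (s : seq 'I_n) (f : 'rV[R]_n -> R) :=
  foldr (fun i g => partial i g) f s.

Definition smooth {n : nat} (f : 'rV[R]_n -> R) : Prop :=
  forall s : seq 'I_n,
    continuous (iter_partial s f) /\
    forall (i : 'I_n) (x : 'rV[R]_n), derivable (iter_partial s f) x (ebasis i).

Definition lap {n : nat} (f : 'rV[R]_n -> R) : 'rV[R]_n -> R :=
  fun x => \sum_(i < n) partial i (partial i f) x.

Definition neglap_pow {n : nat} (k : nat) (f : 'rV[R]_n -> R) : 'rV[R]_n -> R :=
  iter k (fun g x => - lap g x) f.

Definition grad_sq {n : nat} (f : 'rV[R]_n -> R) (x : 'rV[R]_n) : R :=
  \sum_(i < n) partial i f x ^+ 2.

(* Integral over R^n of a nonnegative (measurable) function, computed as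
   iterated one-dimensional Lebesgue integrals (Tonelli). *)
Fixpoint iint (k : nat) : ('rV[R]_k -> \bar R) -> \bar R :=
  match k with
  | 0 => fun f => f 0
  | k'.+1 => fun f =>
      (\int[@lebesgue_measure R]_t
         iint (fun y : 'rV[R]_k' => f (row_mx (\row_(j < 1) t) y)))%E
  end.

Definition integrable_Rn {n : nat} (f : 'rV[R]_n -> R) : Prop :=
  (iint (fun x => (`|f x|)%:E) < +oo)%E.

Definition integral_Rn {n : nat} (f : 'rV[R]_n -> R) : R :=
  fine (iint (fun x => (Num.max (f x) 0)%:E))
  - fine (iint (fun x => (Num.max (- f x) 0)%:E)).

Definition L_half {n : nat} (phi : 'rV[R]_n -> R) : Prop :=
  integrable_Rn (fun x => phi x / (1 + enorm x ^+ n.+1)).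

Definition pv_integrand {n : nat} (f : 'rV[R]_n -> R) (x : 'rV[R]_n) (eps : R)
  : 'rV[R]_n -> R :=
  fun y => if eps < enorm (x - y)
           then (f x - f y) / enorm (x - y) ^+ n.+1 else 0.

Definition pv_exists {n : nat} (f : 'rV[R]_n -> R) (x : 'rV[R]_n) : Prop :=
  (forall eps : R, 0 < eps -> integrable_Rn (pv_integrand f x eps)) /\
  cvg ((fun eps => integral_Rn (pv_integrand f x eps)) @ 0^'+).

(* C(n) = Gamma((n+1)/2) / pi^{(n+1)/2}  for odd n (so that (-Delta)^{1/2}
   is the Fourier multiplier |xi|); here (n+1)/2 = n./2 + 1 *)
Definition C_half (n : nat) : R := (n./2)`!%:R / pi ^+ (n./2).+1.

Definition half_lap {n : nat} (f : 'rV[R]_n -> R) (x : 'rV[R]_n) : R :=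
  C_half n * lim ((fun eps => integral_Rn (pv_integrand f x eps)) @ 0^'+).

Definition neglap_n {n : nat} (u : 'rV[R]_n -> R) : 'rV[R]_n -> R :=
  if odd n then half_lap (neglap_pow n./2 u) else neglap_pow n./2 u.

Definition Q_well_defined {n : nat} (u : 'rV[R]_n -> R) : Prop :=
  if odd n then L_half (neglap_pow n./2 u) /\
                forall x, pv_exists (neglap_pow n./2 u) x
  else True.

(* Q-curvature of g = e^{2u}|dx|^2 :  (-Delta)^{n/2} u = Q e^{nu} *)
Definition Qcurv {n : nat} (u : 'rV[R]_n -> R) (x : 'rV[R]_n) : R :=
  expR (- (n%:R * u x)) * neglap_n u x.

Definition finite_total_Q {n : nat} (u : 'rV[R]_n -> R) : Prop :=
  Q_well_defined u /\ integrable_Rn (fun x => Qcurv u x * expR (n%:R * u x)).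

Definition scalar_curv {n : nat} (u : 'rV[R]_n -> R) (x : 'rV[R]_n) : R :=
  2 * (n%:R - 1) * expR (- (2 * u x))
    * (- lap u x - (n%:R - 2) / 2 * grad_sq u x).

Definition C1curve {n : nat} (gam : R -> 'rV[R]_n) : Prop :=
  (forall t, derivable gam t 1) /\ continuous (derive1 gam).

Definition glength {n : nat} (u : 'rV[R]_n -> R) (gam : R -> 'rV[R]_n) : \bar R :=
  (\int[@lebesgue_measure R]_(t in `[0%R, 1%R])
     (expR (u (gam t)) * enorm (derive1 gam t))%:E)%E.

Definition gdist {n : nat} (u : 'rV[R]_n -> R) (x y : 'rV[R]_n) : \bar R :=
  ereal_inf [set glength u gam |
              gam in [set gam | C1curve gam /\ gam 0 = x /\ gam 1 = y]].

Definition complete_metric {n : nat} (u : 'rV[R]_n -> R) : Prop :=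
  forall p : nat -> 'rV[R]_n,
    (forall e : R, 0 < e -> exists N : nat, forall k l : nat,
        (N <= k)%N -> (N <= l)%N -> (gdist u (p k) (p l) < e%:E)%E) ->
    exists q : 'rV[R]_n, forall e : R, 0 < e -> exists N : nat, forall k : nat,
        (N <= k)%N -> (gdist u (p k) q < e%:E)%E.

Definition gvol_ball {n : nat} (u : 'rV[R]_n -> R) (r : R) : \bar R :=
  iint (fun x : 'rV[R]_n => if enorm x < r then (expR (n%:R * u x))%:E else 0%E).

Definition evol_ball (n : nat) (r : R) : \bar R :=
  iint (fun x : 'rV[R]_n => if enorm x < r then 1%E else 0%E).

Definition vol_entropy {n : nat} (u : 'rV[R]_n -> R) : \bar R :=
  limf_esup (fun r : R => (ln (fine (gvol_ball u r)) / ln (fine (evol_ball n r)))%:E)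
            (+oo : set_system R).

End QcurvDefs.

(* Main.v *)
(** The curvature bound reads [- lap u >= a |grad u|^2 + b e^(2u) - m] with [a, b > 0] and
    [m >= 0] integrable. Testing it against [(T^2 + |z - x|^2)^(-(n-1)/2)] gives
    [int (|grad u|^2 + e^(2u)) (T^2 + |z - x|^2)^(-(n-1)/2) dz <= C / T] for [T >= 1], uniformly
    in [x]. Hence, by Jensen, the Poisson average of [u] at height [T] is at most [- ln T + C],
    and its height derivatives of order [j >= 1], times [T^j], are bounded.

    The [n]-th height derivative of the Poisson average of [u] is, up to a constant, the Poisson
    average of [(-Delta)^(n/2) u], because the Poisson kernel [P_t] is harmonic in [(t, z)] and
    [(-Delta)^(1/2) P_t = - d_t P_t]. Taylor's formula in the height, between [0] and [T = |x|],
    therefore bounds [u x] by [- ln |x| + C] plus a logarithmic potential of the integrable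
    function [(-Delta)^(n/2) u]. The part of its mass in a large ball contributes [O(1)], and
    the rest has total mass [eta] as small as we like, so that [e^(n u)] is
    [O(|x|^(eta - n))] up to an exponential potential, which Jensen's inequality turns into an
    integrable one. So the volume of a ball of radius [r] is [O((1 + r)^(2 eta))] for every
    [eta > 0], while it is bounded below. *)
Require Import Defs.
From HB Require Import structures.
From mathcomp Require Import all_boot all_order all_algebra.
From mathcomp Require Import all_classical all_reals all_analysis.
From mathcomp Require Import measurable_realfun.
From mathcomp Require Import ring lra.
Set Implicit Arguments.
Unset Strict Implicit.
Unset Printing Implicit Defensive.
Import Order.TTheory GRing.Theory Num.Theory.
Import numFieldNormedType.Exports.
Local Open Scope classical_set_scope.
Local Open Scope ring_scope.

(** * Lebesgue measure on row vectors *)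

(** No splitting of [u] into a logarithmic potential plus a polynomial is established. A finite
    Taylor formula for the Poisson average, between two positive heights, plays that role: its
    coefficients at the upper height are controlled by the energy, so no polynomial part has to be
    excluded. The exponent [n - 1] of the test weight serves twice. With [N = N T z], one has
    [|grad N^(1-n)|^2 <= C N^(1-n) N^(-n-1)], whose last factor has mass of order [1/T]; and
    [T N^(-n-1) <= T^(-1) N^(1-n)], so that the energy controls Poisson averages. The constants
    depend on [m] only through its integral, which makes them the same for all translates of [u].
    The obstacle for odd [n] is to move a principal value onto the Poisson kernel, which decays only
    like [|z|^(-n-1)]. Regularised operators with kernel [N s z ^- n.+1] are symmetric by Fubini,
    and their action on Poisson kernels follows from the semigroup law, which is itself deduced from
    harmonicity. The lower height stays positive until the end, since the potential of an integrable
    function may be infinite at a point; Fatou's lemma removes it under the volume integral. *)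

Definition rV_display : measure_display -> measure_display.
Proof. exact. Qed.

Section measurable_rV.
Context {R : realType} (n : nat).

Let coor : 'I_n -> 'rV[R]_n -> measurableTypeR R := fun i x => x ord0 i.

Let rV_set0 : g_sigma_preimage coor set0.
Proof. exact: sigma_algebra0. Qed.

Let rV_setC A : g_sigma_preimage coor A -> g_sigma_preimage coor (~` A).
Proof. exact: sigma_algebraC. Qed.

Let rV_bigcup (F : _^nat) : (forall i, g_sigma_preimage coor (F i)) ->
  g_sigma_preimage coor (\bigcup_i (F i)).
Proof. exact: sigma_algebra_bigcup. Qed.

HB.instance Definition _ := @isMeasurable.Build (rV_display (measure_tuple_display default_measure_display))
  'rV[R]_n (g_sigma_preimage coor) rV_set0 rV_setC rV_bigcup.

Lemma measurable_coord (i : 'I_n) :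
  measurable_fun [set: 'rV[R]_n] (fun x : 'rV[R]_n => x ord0 i : measurableTypeR R).
Proof.
move=> _ Y mY; rewrite setTI; apply: sub_sigma_algebra => /=.
rewrite -bigcup_seq/=; exists i => /=; first by rewrite mem_index_enum.
by exists Y => //; rewrite setTI.
Qed.

Lemma measurable_fun_rVP d (T : measurableType d) (f : T -> 'rV[R]_n) :
  (forall i, measurable_fun [set: T] (fun x => f x ord0 i : measurableTypeR R)) ->
  measurable_fun [set: T] f.
Proof.
move=> mf; suff : g_sigma_preimage
    (fun i => coor i \o f) `<=` measurable.
  rewrite g_sigma_preimage_comp => prefS.
  by move=> _ A mA; apply: prefS; exists A.
apply: smallest_sub; first exact: sigma_algebra_measurable.
rewrite -bigcup_seq/=; apply: bigcup_sub => i _.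
by move=> A [B mB <-]; exact: (mf i measurableT B mB).
Qed.
End measurable_rV.

Section lebn.
Context {R : realType}.

Definition consrV n (p : measurableTypeR R * 'rV[R]_n) : 'rV[R]_n.+1 :=
  row_mx (\row_(j < 1) p.1) p.2.

Lemma consrV0 n (p : R * 'rV[R]_n) : consrV p ord0 ord0 = p.1.
Proof.
rewrite /consrV; have -> : @ord0 n = @lshift 1 n ord0 by exact/val_inj.
by rewrite (@row_mxEl _ 1 1 n) mxE.
Qed.

Lemma consrVS n (p : R * 'rV[R]_n) i : consrV p ord0 (lift ord0 i) = p.2 ord0 i.
Proof.
rewrite /consrV; have -> : lift ord0 i = @rshift 1 n i by exact/val_inj.
by rewrite (@row_mxEr _ 1 1 n).
Qed.

Definition unconsrV n (x : 'rV[R]_n.+1) : measurableTypeR R * 'rV[R]_n :=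
  (x ord0 ord0, \row_j x ord0 (lift ord0 j)).

Lemma consrVK n : cancel (@consrV n) (@unconsrV n).
Proof.
move=> [t y]; rewrite /unconsrV consrV0; congr pair.
by apply/rowP => j; rewrite mxE consrVS.
Qed.

Lemma measurable_unconsrV n : measurable_fun setT (@unconsrV n).
Proof.
apply: measurable_fun_pair; first exact: measurable_coord.
apply: measurable_fun_rVP => i; under eq_fun do rewrite mxE.
exact: measurable_coord.
Qed.

Lemma measurable_consrV n : measurable_fun setT (@consrV n).
Proof.
apply: measurable_fun_rVP => i.
case: (unliftP ord0 i) => [j ->|->].
  under eq_fun do rewrite consrVS.
  apply: (measurableT_comp (measurable_coord j)); exact: measurable_snd.
under eq_fun do rewrite consrV0.
exact: measurable_fst.
Qed.

Section step.
Variables (n : nat) (m : {sigma_finite_measure set 'rV[R]_n -> \bar R}).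

(** The new coordinate is put in front, in the same order as in [iint], so that Tonelli's theorem
    identifies the iterated integrals of the statement with integrals against [lebn]. *)
Definition lebstep : set 'rV[R]_n.+1 -> \bar R :=
  pushforward (@lebesgue_measure R \x m)%E (@consrV n).

HB.instance Definition _ := Measure.copy lebstep
  (measure_function_pushforward__canonical__measure_function_Measure
     (@lebesgue_measure R \x m)%E (@measurable_consrV n)).

(** Increasing exhaustions of both factors are multiplied and transported by the inverse of
    [consrV]; monotonicity lets one index, the maximum, serve both factors. *)
Lemma lebstep_sigma_finite : sigma_finite setT lebstep.
Proof.
have /sigma_finiteP[F [TF ndF Foo]] := sigma_finiteT (@lebesgue_measure R).
have /sigma_finiteP[G [TG ndG Goo]] := sigma_finiteT m.
exists (fun k => @unconsrV n @^-1` (F k `*` G k)).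
  rewrite predeqE => z; split => // _.
  have : setT (unconsrV z).1 by []. rewrite TF => -[i _ Fi].
  have : setT (unconsrV z).2 by []. rewrite TG => -[j _ Gj].
  exists (maxn i j) => //; split.
  - by move: Fi; exact/subsetPset/ndF/leq_maxl.
  - by move: Gj; exact/subsetPset/ndG/leq_maxr.
move=> i; have [mF Fio] := Foo i; have [mG Gio] := Goo i; split.
  rewrite -[X in measurable X]setTI; apply: measurable_unconsrV => //.
  exact: measurableX.
rewrite /lebstep /pushforward -comp_preimage.
have -> : @unconsrV n \o @consrV n = id by apply/funext => p; exact: consrVK.
rewrite preimage_id.
by rewrite product_measure1E// lte_mul_pinfty// ge0_fin_numE.
Qed.

HB.instance Definition _ := @Measure_isSigmaFinite.Build _ _ _ lebstep lebstep_sigma_finite.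
End step.

Fixpoint lebn n : {sigma_finite_measure set 'rV[R]_n -> \bar R} :=
  match n with
  | 0 => \d_(0 : 'rV[R]_0)
  | k.+1 => lebstep (lebn k)
  end.
End lebn.

Section lebn_theory.
Context {R : realType}.

Lemma integral_lebnS n (f : 'rV[R]_n.+1 -> \bar R) :
  measurable_fun setT f -> (forall x, 0 <= f x)%E ->
  (\int[lebn n.+1]_x f x =
   \int[@lebesgue_measure R]_t \int[lebn n]_y f (consrV (t, y)))%E.
Proof.
move=> mf f0; rewrite /= /lebstep ge0_integral_pushforward//.
- rewrite preimage_setT fubini_tonelli1//.
  exact: (measurableT_comp mf (@measurable_consrV R n)).
- by move=> p; exact: f0.
- exact: measurable_consrV.
Qed.

(** This is the bridge from the iterated integrals in the definitions to measure theory: Tonelli's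
    theorem peels off one coordinate at a time. *)
Lemma iintE n (f : 'rV[R]_n -> \bar R) :
  measurable_fun setT f -> (forall x, 0 <= f x)%E ->
  iint f = (\int[lebn n]_x f x)%E.
Proof.
elim: n f => [|n ih] f mf f0.
  by rewrite /= integral_dirac// diracT mul1e.
have mc t : measurable_fun setT (fun y : 'rV[R]_n => consrV (t, y)).
  apply: measurable_fun_rVP => i; case: (unliftP ord0 i) => [j ->|->].
    under eq_fun do rewrite (@consrVS R n (t, _)).
    exact: measurable_coord.
  by under eq_fun do rewrite (@consrV0 R n (t, _)); exact: measurable_cst.
rewrite integral_lebnS//=; apply: eq_integral => t _.
by apply: ih => //; exact: (measurableT_comp mf (mc t)).
Qed.

Lemma measurable_box n (q : 'rV[R]_n) (e : R) :
  measurable [set x : 'rV[R]_n | forall i, `|q ord0 i - x ord0 i| < e].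
Proof.
rewrite (_ : mkset _ = \bigcap_(i in [set: 'I_n])
   ((fun x : 'rV[R]_n => x ord0 i) @^-1` (ball (q ord0 i) e))); last first.
  by apply/seteqP; split=> x /= h i; [move=> _; exact: h|exact: h].
apply: fin_bigcap_measurable; first exact: finite_finset.
move=> i _; rewrite -[X in measurable X]setTI; apply: measurable_coord => //.
exact: measurable_ball.
Qed.

(** Balls of the max-norm are coordinate boxes, and an open set is the union of the countably many
    boxes with rational centre and radius that it contains. *)
Lemma open_measurable_rV n (A : set 'rV[R]_n) : open A -> measurable A.
Proof.
move=> oA.
pose box (p : 'rV[rat]_n * rat) := [set x : 'rV[R]_n |
  forall i, `|(map_mx ratr p.1) ord0 i - x ord0 i| < ratr p.2 :> R].
pose F k := if unpickle k is Some p then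
  (if `[< box p `<=` A >] then box p else set0) else set0.
rewrite (_ : A = \bigcup_k F k); last first.
  apply/seteqP; split => [x Ax|x [k _]]; last first.
    by rewrite /F; case: unpickle => // p; case: asboolP => // + bx; exact.
  have /nbhs_ballP[e /= e0 xeA] : nbhs x A by move: oA; rewrite openE; exact.
  have e20 : 0 < e / 2 by rewrite divr_gt0.
  have [r] := rat_in_itvoo e20; rewrite in_itv/= => /andP[r0 re].
  have /choice[q hq] (i : 'I_n) : exists q : rat, `|ratr q - x ord0 i| < ratr r :> R.
    have : x ord0 i - ratr r < x ord0 i + ratr r by rewrite ltrD2l (lt_trans _ r0)// oppr_lt0.
    move=> /rat_in_itvoo[q]; rewrite in_itv/= => qi; exists q.
    by rewrite ltr_distlC; move: qi => /andP[? ?]; apply/andP; split; lra.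
  pose p : 'rV[rat]_n * rat := (\row_i q i, r).
  exists (pickle p) => //; rewrite /F pickleK.
  have boxA : box p `<=` A.
    move=> y by_; apply: xeA; split => // i j; rewrite /ball/= (ord1 i).
    have := hq j; have := by_ j; rewrite !mxE/= => h1 h2.
    have := ler_distD (ratr (q j)) (x ord0 j) (y ord0 j).
    by rewrite (distrC (x ord0 j) (ratr _)); lra.
  by case: asboolP => // _ i; rewrite !mxE; exact: hq.
apply: bigcupT_measurable => k; rewrite /F; case: unpickle => // p.
by case: asboolP => // _; exact: measurable_box.
Qed.

Lemma continuous_measurable_rV n (f : 'rV[R]_n -> R) : continuous f ->
  measurable_fun setT f.
Proof.
move=> cf; apply: (measurability _ (RGenOpens.measurableE R)).
move=> _ [_ [x [y ->]] <-]; rewrite setTI; apply: open_measurable_rV.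
by apply: open_comp => [z _|]; [exact: cf|exact: interval_open].
Qed.

End lebn_theory.

(** * Real-valued integrals *)

Lemma cvgn_le_cst (R : realType) (v : nat -> R) (l C : R) :
  v @ \oo --> l -> (forall k, v k <= C) -> l <= C.
Proof.
move=> c vC; rewrite -(cvg_lim _ c)//; apply: limr_le; last exact: nearW.
by apply/cvg_ex; exists l.
Qed.

Lemma cvgn_ge_cst (R : realType) (v : nat -> R) (l C : R) :
  v @ \oo --> l -> (forall k, C <= v k) -> C <= l.
Proof.
move=> c vC; rewrite -(cvg_lim _ c)//; apply: limr_ge; last exact: nearW.
by apply/cvg_ex; exists l.
Qed.

Section real_integral.
Context d (T : measurableType d) (R : realType).
Variable mu : {measure set T -> \bar R}.
Implicit Types f g h : T -> R.

Definition intg f := mu.-integrable setT (EFin \o f).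
Definition RI f : R := \int[mu]_x f x.

Lemma intg_measurable f : intg f -> measurable_fun setT f.
Proof. by move=> /measurable_int /measurable_EFinP. Qed.

Lemma RI_EFin f : intg f -> (RI f)%:E = (\int[mu]_x (f x)%:E)%E.
Proof. by move=> If; rewrite /RI /Rintegral fineK//; exact: integrable_fin_num. Qed.

Lemma intg_le f g : measurable_fun setT f -> (forall x, `|f x| <= g x) ->
  intg g -> intg f.
Proof.
move=> mf fg Ig; apply: le_integrable Ig => //; first exact/measurable_EFinP.
by move=> x _ /=; rewrite lee_fin (le_trans (fg x)) ?ler_norm.
Qed.

Lemma intg0 : intg (cst 0).
Proof. exact: integrable0. Qed.

Lemma intgD f g : intg f -> intg g -> intg (fun x => f x + g x).
Proof. by move=> If Ig; exact: (@integrableD _ _ _ mu setT _ (EFin \o f) (EFin \o g)). Qed.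

Lemma intgB f g : intg f -> intg g -> intg (fun x => f x - g x).
Proof. by move=> If Ig; exact: (@integrableB _ _ _ mu setT _ (EFin \o f) (EFin \o g)). Qed.

Lemma intgN f : intg f -> intg (fun x => - f x).
Proof. by move=> If; exact: (@integrableN _ _ _ mu setT (EFin \o f)). Qed.

Lemma intgZ c f : intg f -> intg (fun x => c * f x).
Proof. by move=> If; exact: (@integrableZl _ _ _ mu setT measurableT c (EFin \o f)). Qed.

Lemma intg_norm f : intg f -> intg (fun x => `|f x|).
Proof. by move=> If; exact: (@integrable_norm _ _ _ mu setT f). Qed.

Lemma intg_sum (I : Type) (s : seq I) (F : I -> T -> R) :
  (forall i, intg (F i)) -> intg (fun x => \sum_(i <- s) F i x).
Proof.
move=> IF; elim: s => [|i s ih].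
  by under eq_fun do rewrite big_nil; exact: intg0.
by under eq_fun do rewrite big_cons; exact: intgD.
Qed.

Lemma RID f g : intg f -> intg g -> RI (fun x => f x + g x) = RI f + RI g.
Proof. by move=> If Ig; rewrite /RI RintegralD. Qed.

Lemma RIB f g : intg f -> intg g -> RI (fun x => f x - g x) = RI f - RI g.
Proof. by move=> If Ig; rewrite /RI RintegralB. Qed.

Lemma RIZ c f : intg f -> RI (fun x => c * f x) = c * RI f.
Proof. by move=> If; rewrite /RI RintegralZl. Qed.

Lemma RIN f : intg f -> RI (fun x => - f x) = - RI f.
Proof.
move=> If; have -> : (fun x => - f x) = (fun x => -1 * f x).
  by apply/funext => x; rewrite mulN1r.
by rewrite RIZ// mulN1r.
Qed.

Lemma RI0 : RI (cst 0) = 0.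
Proof. by rewrite /RI /Rintegral integral0. Qed.

Lemma RI_sum (I : Type) (s : seq I) (F : I -> T -> R) :
  (forall i, intg (F i)) ->
  RI (fun x => \sum_(i <- s) F i x) = \sum_(i <- s) RI (F i).
Proof.
move=> IF; elim: s => [|i s ih].
  by rewrite big_nil -[RHS]RI0; congr RI; apply/funext => x; rewrite big_nil.
rewrite big_cons -ih -RID//; last exact: intg_sum.
by congr RI; apply/funext => x; rewrite big_cons.
Qed.

Lemma RI_ge0 f : (forall x, 0 <= f x) -> 0 <= RI f.
Proof. by move=> f0; exact: Rintegral_ge0. Qed.

Lemma RI_le f g : intg f -> intg g -> (forall x, f x <= g x) -> RI f <= RI g.
Proof. by move=> If Ig fg; apply: le_Rintegral. Qed.

Lemma RI_norm f : intg f -> `|RI f| <= RI (fun x => `|f x|).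
Proof. by move=> If; exact: le_normr_Rintegral. Qed.

Lemma RI_norm_le f g : intg f -> intg g -> (forall x, `|f x| <= g x) ->
  `|RI f| <= RI g.
Proof.
move=> If Ig fg; apply: le_trans (RI_norm If) _.
by apply: RI_le => //; exact: intg_norm.
Qed.

Lemma intg_ge0P f : measurable_fun setT f -> (forall x, 0 <= f x) ->
  (\int[mu]_x (f x)%:E < +oo)%E -> intg f.
Proof.
move=> mf f0 lt; apply/integrableP; split; first exact/measurable_EFinP.
by under eq_integral do rewrite /= ger0_norm//.
Qed.

Lemma intg_lty f : intg f -> (\int[mu]_x (f x)%:E < +oo)%E.
Proof. by move=> If; rewrite -RI_EFin// ltry. Qed.

(** All limits in the sequel hold at every point, so nothing is stated almost everywhere; the limit
    is then measurable and no separate hypothesis on it is required. *)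
Lemma RI_dct (f_ : nat -> T -> R) f g : (forall k, measurable_fun setT (f_ k)) ->
  (forall x, f_ ^~ x @ \oo --> f x) ->
  (forall k x, `|f_ k x| <= g x) -> intg g ->
  intg f /\ RI (f_ k) @[k --> \oo] --> RI f.
Proof.
move=> mf cf fg Ig.
have mff : measurable_fun setT f by apply: (measurable_fun_cvg (h := f_)) => // x _; exact: cf.
have If : intg f.
  apply: (intg_le mff _ Ig) => x; have c := cvg_norm (cf x).
  exact: (cvgn_le_cst (c _) (fg^~ x)).
split=> //.
have c : (\int[mu]_x (f_ k x)%:E @[k --> \oo] --> \int[mu]_x (f x)%:E)%E.
  apply: (@dominated_cvg _ T R mu setT measurableT
    (fun k x => (f_ k x)%:E) (fun x => (f x)%:E) (fun x => (g x)%:E)) => //.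
  - by move=> k; exact/measurable_EFinP.
  - by move=> x _; apply: cvg_EFin; [exact: nearW|exact: cf].
  - by move=> k x _; rewrite lee_fin.
by apply: fine_cvg; rewrite RI_EFin.
Qed.

(** Its main use is to obtain integrability on the whole space: a bound on truncated integrals that
    is uniform in [k] passes to the limit. *)
Lemma RI_fatou (f_ : nat -> T -> R) f (C : R) : (forall k, intg (f_ k)) ->
  (forall k x, 0 <= f_ k x) ->
  (forall x, f_ ^~ x @ \oo --> f x) ->
  (forall k, RI (f_ k) <= C) ->
  intg f /\ RI f <= C.
Proof.
move=> If f0 cf fC.
have mf k : measurable_fun setT (f_ k) by exact: intg_measurable.
have mff : measurable_fun setT f by apply: (measurable_fun_cvg (h := f_)) => // x _; exact: cf.
have ff0 x : 0 <= f x := cvgn_ge_cst (cf x) (f0^~ x).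
have le : (\int[mu]_x (f x)%:E <= C%:E)%E.
  have /= := @fatou _ T R mu setT measurableT (fun k x => (f_ k x)%:E)
    (fun k => (measurable_EFinP setT (f_ k)).2 (mf k))
    (fun k x _ => f0 k x).
  have -> : (fun x => limn_einf (fun k => (f_ k x)%:E)) = (fun x => (f x)%:E).
    apply/funext => x; have c : (fun k => (f_ k x)%:E) @ \oo --> (f x)%:E.
      by apply: cvg_EFin; [exact: nearW|exact: cf].
    by rewrite is_cvg_limn_einfE//; [exact: cvg_lim|apply/cvg_ex; eexists; exact: c].
  move=> /le_trans; apply; rewrite limn_einf_lim.
  apply: lime_le; first exact: is_cvg_einfs.
  apply: nearW => k; apply: (@le_trans _ _ (\int[mu]_x (f_ k x)%:E)%E).
    by apply: ereal_inf_lbound; exists k => /=.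
  by rewrite -RI_EFin// lee_fin.
have If' : intg f by apply: intg_ge0P => //; exact: le_lt_trans le (ltry _).
by split=> //; rewrite -lee_fin RI_EFin.
Qed.
End real_integral.

(** * Fubini's theorem for real-valued integrals *)

Section fubini_real.
Context d1 d2 (T1 : measurableType d1) (T2 : measurableType d2) (R : realType).
Variable m1 : {sigma_finite_measure set T1 -> \bar R}.
Variable m2 : {sigma_finite_measure set T2 -> \bar R}.
Implicit Types f : T1 -> T2 -> R.

Definition intg2 f := (m1 \x m2)%E.-integrable setT (fun p : T1 * T2 => (f p.1 p.2)%:E).

Lemma intg2P f : measurable_fun setT (fun p : T1 * T2 => f p.1 p.2) ->
  (\int[m1]_x \int[m2]_y (`|f x y|)%:E < +oo)%E -> intg2 f.
Proof.
move=> mf h; apply/integrable12ltyP.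
  exact: ((measurable_EFinP setT (fun p : T1 * T2 => f p.1 p.2)).2 mf).
exact: h.
Qed.

Lemma intg2_le f (g : T1 -> R) : measurable_fun setT (fun p : T1 * T2 => f p.1 p.2) ->
  intg m1 g -> (forall x, intg m2 (f x)) ->
  (forall x, RI m2 (fun y => `|f x y|) <= g x) -> intg2 f.
Proof.
move=> mf Ig If fg; apply: intg2P => //.
apply: le_lt_trans (intg_lty Ig); apply: ge0_le_integral => //.
- by move=> x _; apply: integral_ge0 => y _; rewrite lee_fin.
- apply: (measurable_fun_fubini_tonelli_F (fun p : T1 * T2 => (`|f p.1 p.2|)%:E)).
    apply: ((measurable_EFinP setT (fun p : T1 * T2 => `|f p.1 p.2|)).2 _).
    exact: measurableT_comp.
  by move=> p; rewrite lee_fin.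
- exact: ((measurable_EFinP setT g).2 (intg_measurable Ig)).
- by move=> x _; rewrite -RI_EFin ?lee_fin//; exact: intg_norm.
Qed.

Lemma intg2_swap f : intg2 f ->
  (\int[m1]_x \int[m2]_y (f x y)%:E = \int[m2]_y \int[m1]_x (f x y)%:E)%E.
Proof. by move=> If; have := Fubini If. Qed.

(** The slices are integrable for every parameter, not just almost every one. The partial integrals
    are then genuine real functions and no null set has to be removed. *)
Lemma RI_fubini f : intg2 f ->
  (forall x, intg m2 (f x)) -> (forall y, intg m1 (f^~ y)) ->
  [/\ intg m1 (fun x => RI m2 (f x)), intg m2 (fun y => RI m1 (f^~ y)) &
  RI m1 (fun x => RI m2 (f x)) = RI m2 (fun y => RI m1 (f^~ y))].
Proof.
move=> If If1 If2.
have E1 : (fun x => (RI m2 (f x))%:E) = (fun x => \int[m2]_y (f x y)%:E)%E.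
  by apply/funext => x; rewrite RI_EFin.
have E2 : (fun y => (RI m1 (f^~ y))%:E) = (fun y => \int[m1]_x (f x y)%:E)%E.
  by apply/funext => y; rewrite RI_EFin.
split.
- by rewrite /intg /comp E1; exact: (integrable_fubini_F If).
- rewrite /intg /comp E2; apply/integrableP; split.
    exact: (measurable_fubini_G If).
  have mf := measurable_int _ If.
  have : (\int[m2]_y \int[m1]_x `|(f x y)%:E| < +oo)%E.
    by apply/(integrable21ltyP _ _ mf).
  apply: le_lt_trans; apply: ge0_le_integral => //.
  - by apply: measurableT_comp => //; exact: (measurable_fubini_G If).
  - apply: (measurable_fun_fubini_tonelli_G (fun p : T1 * T2 => `|(f p.1 p.2)%:E|)%E) => //.
    exact: measurableT_comp.
  - move=> y _; apply: le_abse_integral => //.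
    exact: (measurable_int _ (If2 y)).
- by rewrite [LHS]/RI [RHS]/RI /Rintegral; congr fine; rewrite E1 E2; exact: intg2_swap.
Qed.

Lemma RI_fubini_eq f F G : intg2 f ->
  (forall x, intg m2 (f x)) -> (forall y, intg m1 (f^~ y)) ->
  (fun x => RI m2 (f x)) = F -> (fun y => RI m1 (f^~ y)) = G ->
  [/\ intg m1 F, intg m2 G & RI m1 F = RI m2 G].
Proof. by move=> If If1 If2 <- <-; exact: RI_fubini. Qed.

End fubini_real.

(** * Affine changes of variables *)

Section change_of_variables.
Context d (T : measurableType d) (R : realType).
Variable mu : {measure set T -> \bar R}.

(** The factor [c] is the inverse of the Jacobian of [phi]. Stating the rule for nonnegative
    extended functions makes it compatible with composition and with Tonelli's theorem; integrable
    functions follow afterwards. *)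
Definition scales_measure (phi : T -> T) (c : R) :=
  [/\ measurable_fun setT phi, 0 <= c &
    forall f : T -> \bar R, measurable_fun setT f -> (forall x, 0 <= f x)%E ->
      (\int[mu]_x f (phi x) = c%:E * \int[mu]_x f x)%E].

Lemma scales_intg phi c (f : T -> R) : scales_measure phi c -> intg mu f ->
  intg mu (f \o phi).
Proof.
move=> [mphi c0 H] If; have mf := intg_measurable If.
apply/integrableP; split.
  by apply: ((measurable_EFinP setT (f \o phi)).2 _); exact: measurableT_comp.
have mN : measurable_fun setT (fun x => (`|f x|)%:E).
  apply: ((measurable_EFinP setT (fun x => `|f x|)).2 _).
  exact: intg_measurable (intg_norm If).
have N0 x : (0 <= (`|f x|)%:E)%E by rewrite lee_fin.
have -> : (\int[mu]_x `|(EFin \o (f \o phi)) x| = c%:E * \int[mu]_x (`|f x|)%:E)%E.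
  exact: (H _ mN N0).
have lt := intg_lty (intg_norm If).
rewrite -ge0_fin_numE; last by rewrite mule_ge0// ?lee_fin// integral_ge0.
by rewrite fin_numM// ge0_fin_numE//; exact: integral_ge0.
Qed.

Lemma scales_RI phi c (f : T -> R) : scales_measure phi c -> intg mu f ->
  RI mu (f \o phi) = c * RI mu f.
Proof.
move=> sc If; have Ifp := scales_intg sc If; have [mphi c0 H] := sc.
have mf := intg_measurable If.
have pos (g : T -> R) : intg mu g -> intg mu (g \o phi) -> (forall x, 0 <= g x) ->
    RI mu (g \o phi) = c * RI mu g.
  move=> Ig Igp g0; apply: EFin_inj; rewrite EFinM !RI_EFin//.
  have mg : measurable_fun setT (fun x => (g x)%:E).
    exact: ((measurable_EFinP setT g).2 (intg_measurable Ig)).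
  have ge0 x : (0 <= (g x)%:E)%E by rewrite lee_fin.
  exact: (H _ mg ge0).
(* The signed case uses [f = |f| - (|f| - f)], a difference of two nonnegative integrable
   functions. *)
have In : intg mu (fun x => `|f x| - f x) by apply: intgB => //; exact: intg_norm.
have Inp : intg mu ((fun x => `|f x| - f x) \o phi).
  exact: (@intgB _ _ _ _ (fun x => `|f (phi x)|) (f \o phi) (intg_norm Ifp) Ifp).
have IN := intg_norm If; have INp := intg_norm Ifp.
have h0 x : 0 <= `|f x| - f x by rewrite subr_ge0 ler_norm.
have E1 := pos _ In Inp h0.
have E2 : RI mu (fun x => `|f (phi x)|) = c * RI mu (fun x => `|f x|).
  exact: (pos _ IN INp (fun x => normr_ge0 (f x))).
have E3 : RI mu ((fun x => `|f x| - f x) \o phi) =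
  RI mu (fun x => `|f (phi x)|) - RI mu (f \o phi) := RIB INp Ifp.
rewrite E3 E2 (RIB IN If) mulrBr in E1.
by apply/eqP; rewrite -subr_eq0; apply/eqP; move: E1 => /eqP; rewrite -subr_eq0 => /eqP; lra.
Qed.
End change_of_variables.

Section affine.
Context {R : realType}.

(** The image measure, multiplied by [a], agrees with Lebesgue measure on half-open intervals, hence
    everywhere by uniqueness. *)
Lemma scales_lebesgue_pos (a b : R) : 0 < a ->
  scales_measure (@lebesgue_measure R) (fun t : measurableTypeR R => a * t + b) a^-1.
Proof.
move=> a0.
have mphi : measurable_fun setT ((fun t => a * t + b) : measurableTypeR R -> measurableTypeR R).
  by apply: measurable_funD => //; exact: measurable_funM.
split=> //; first by rewrite invr_ge0 ltW.
move=> f mf f0.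
pose push := measure_function_pushforward__canonical__measure_function_Measure
  (@lebesgue_measure R) mphi.
have aN : 0 <= a by exact: ltW.
have E A : measurable A -> lebesgue_measure A = mscale (NngNum aN) push A.
  move=> mA; apply: lebesgue_measure_unique => // _ [[x y] _ <-].
  have pre : (fun t => a * t + b) @^-1` `]x, y]%classic =
      `](x - b) / a, (y - b) / a]%classic.
    apply/seteqP; split => t; rewrite /= !in_itv/= => /andP[h1 h2]; apply/andP; split.
    - by rewrite ltr_pdivrMr//; lra.
    - by rewrite ler_pdivlMr//; lra.
    - by move: h1; rewrite ltr_pdivrMr//; lra.
    - by move: h2; rewrite ler_pdivlMr//; lra.
  pose I : set R := `](x - b) / a, (y - b) / a]%classic.
  transitivity (a%:E * lebesgue_measure I)%E; last by rewrite /I -pre.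
  rewrite /I.
  rewrite !lebesgue_measure_itv/= !lte_fin ltr_pM2r ?invr_gt0// ltrD2r.
  case: ifPn => _; last by rewrite mule0.
  by rewrite -!EFinD -EFinM; congr EFin; field; rewrite gt_eqF.
rewrite [in RHS](eq_measure_integral (mscale (NngNum aN) push)); last by move=> A mA _; exact: E.
rewrite ge0_integral_mscale//= muleA -EFinM mulVf ?gt_eqF// mul1e.
by rewrite ge0_integral_pushforward.
Qed.

Lemma scales_comp d (T : measurableType d) (mu : {measure set T -> \bar R})
  (p q : T -> T) (a b : R) :
  scales_measure mu p a -> scales_measure mu q b -> scales_measure mu (p \o q) (a * b).
Proof.
move=> [mp a0 Hp] [mq b0 Hq]; split; [exact: measurableT_comp|exact: mulr_ge0|].
move=> f mf f0 /=.
have mfp : measurable_fun setT (f \o p) by exact: measurableT_comp.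
have fp0 x : (0 <= (f \o p) x)%E by exact: f0.
by have := Hq _ mfp fp0; rewrite /= => ->; rewrite Hp// muleA -EFinM mulrC.
Qed.

Lemma scales_lebesgueN :
  scales_measure (@lebesgue_measure R) (fun t : measurableTypeR R => - t) 1.
Proof.
have mN : measurable_fun setT ((fun t => - t) : measurableTypeR R -> measurableTypeR R).
  exact: (@oppr_measurable R setT).
split=> // f mf f0; rewrite mul1e.
pose push := measure_function_pushforward__canonical__measure_function_Measure
  (@lebesgue_measure R) mN.
rewrite [RHS](eq_measure_integral push); last first.
  by move=> A mA _; exact: (esym (lebesgue_measureN mA)).
by rewrite ge0_integral_pushforward.
Qed.

Lemma scales_lebesgue (a b : R) : a != 0 ->
  scales_measure (@lebesgue_measure R) (fun t : measurableTypeR R => a * t + b) `|a|^-1.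
Proof.
move=> a0; have [ap|an] := ltP 0 a.
  by rewrite gtr0_norm//; exact: scales_lebesgue_pos.
have na : 0 < - a by rewrite oppr_gt0 lt_neqAle a0.
have := scales_comp (scales_lebesgue_pos b na) scales_lebesgueN.
rewrite ler0_norm// mulr1 (_ : _ \o _ = (fun t => a * t + b))//.
by apply/funext => t /=; rewrite mulrNN.
Qed.

Lemma measurable_affine n (a : R) (b : 'rV[R]_n) :
  measurable_fun setT (fun x : 'rV[R]_n => a *: x + b).
Proof.
apply: measurable_fun_rVP => i; under eq_fun do rewrite !mxE.
apply: measurable_funD => //; apply: measurable_funM => //.
exact: measurable_coord.
Qed.

(** A homothety followed by a translation acts on each coordinate separately, so each Tonelli step
    contributes one factor [|a|^-1]. *)
Lemma scales_lebn n (a : R) (b : 'rV[R]_n) : a != 0 ->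
  scales_measure (lebn n) (fun x => a *: x + b) (`|a|^-1 ^+ n).
Proof.
move=> a0; split; [exact: measurable_affine|by rewrite exprn_ge0// invr_ge0|].
elim: n b => [|n ih] b f mf f0.
  rewrite expr0 mul1e; apply: eq_integral => x _; congr f.
  by apply/rowP => -[].
have mc t : measurable_fun setT (fun y : 'rV[R]_n => consrV (t, y)).
  apply: measurable_fun_rVP => i; case: (unliftP ord0 i) => [j ->|->].
    under eq_fun do rewrite (@consrVS R n (t, _)).
    exact: measurable_coord.
  by under eq_fun do rewrite (@consrV0 R n (t, _)); exact: measurable_cst.
have mfa : measurable_fun setT (fun x : 'rV[R]_n.+1 => f (a *: x + b)).
  exact: (measurableT_comp mf (measurable_affine _ _)).
rewrite (integral_lebnS mf f0) (integral_lebnS mfa (fun x => f0 _)).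
pose b' : 'rV[R]_n := \row_j b ord0 (lift ord0 j).
have aff t y : a *: consrV (t, y) + b = consrV (a * t + b ord0 ord0, a *: y + b').
  apply/rowP => i; rewrite mxE [X in X + _]mxE; case: (unliftP ord0 i) => [j ->|->].
    by rewrite !consrVS/= !mxE.
  by rewrite !consrV0.
under eq_integral do under eq_integral do rewrite aff.
have ih' t : (\int[lebn n]_y f (consrV (t, (a *: y + b')%R)) =
    (`|a|^-1 ^+ n)%:E * \int[lebn n]_y f (consrV (t, y)))%E.
  apply: (ih b' (fun y => f (consrV (t, y)))) => //.
  exact: (measurableT_comp mf (mc _)).
under eq_integral do rewrite ih'.
have mF : measurable_fun setT (fun t : measurableTypeR R => \int[lebn n]_y f (consrV (t, y)))%E.
  apply: (measurable_fun_fubini_tonelli_F (f \o @consrV R n)) => //.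
    exact: (measurableT_comp mf (@measurable_consrV R n)).
  by move=> p; exact: f0.
have F0 t : (0 <= \int[lebn n]_y f (consrV (t, y)))%E by apply: integral_ge0.
have [mp _ H] := scales_lebesgue (b ord0 ord0) a0.
have mFp := measurableT_comp mF mp.
rewrite (@ge0_integralZl _ _ _ _ _ measurableT _ mFp); first last.
- by rewrite lee_fin exprn_ge0// invr_ge0.
- by move=> t _; exact: F0.
by rewrite (H _ mF F0) muleA -EFinM -exprSr.
Qed.

End affine.

(** * Continuity and the Euclidean norm *)

Lemma cvg_bigsum (R : realType) (T : Type) (F : set_system T) {FF : Filter F}
    (I : Type) (s : seq I) (f : I -> T -> R) (l : I -> R) :
  (forall i, f i x @[x --> F] --> l i) ->
  \sum_(i <- s) f i x @[x --> F] --> \sum_(i <- s) l i.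
Proof.
move=> fl; elim: s => [|i s ih].
  by under eq_fun do rewrite big_nil; rewrite big_nil; exact: cvg_cst.
under eq_fun do rewrite big_cons; rewrite big_cons.
exact: cvgD.
Qed.

Section continuity.
Context {R : realType}.

Lemma continuous_rV_at (T : topologicalType) n (f : T -> 'rV[R]_n) (x : T) :
  (forall i, {for x, continuous (fun t => f t ord0 i)}) -> {for x, continuous f}.
Proof.
move=> cf A [P PA sPA]; rewrite /nbhs/=.
have : \forall t \near x, forall i : 'I_n, P ord0 i (f t ord0 i).
  by apply: filter_forall => i; apply: cf; exact: PA.
by apply: filterS => t Pt; apply: sPA => i j; rewrite (ord1 i).
Qed.

Lemma continuous_rV (T : topologicalType) n (f : T -> 'rV[R]_n) :
  (forall i, continuous (fun t => f t ord0 i)) -> continuous f.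
Proof. by move=> cf x; apply: continuous_rV_at => i; exact: cf. Qed.

Lemma continuous_coord n (i : 'I_n) : continuous (fun x : 'rV[R]_n => x ord0 i).
Proof. exact: coord_continuous. Qed.

Lemma continuous_consrVl n (y : 'rV[R]_n) : continuous (fun t : R => consrV (t, y)).
Proof.
apply: continuous_rV => i; case: (unliftP ord0 i) => [j ->|->].
  by under eq_fun do rewrite (@consrVS R n (_, y)); exact: cst_continuous.
by under eq_fun do rewrite (@consrV0 R n (_, y)); move=> x; exact: cvg_id.
Qed.

Lemma continuous_consrVr n (t : R) : continuous (fun y : 'rV[R]_n => consrV (t, y)).
Proof.
apply: continuous_rV => i; case: (unliftP ord0 i) => [j ->|->].
  by under eq_fun do rewrite (@consrVS R n (t, _)); exact: continuous_coord.
by under eq_fun do rewrite (@consrV0 R n (t, _)); exact: cst_continuous.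
Qed.

Definition sqn n (x : 'rV[R]_n) : R := \sum_(i < n) x ord0 i ^+ 2.

Lemma sqn_ge0 n (x : 'rV[R]_n) : 0 <= sqn x.
Proof. by apply: sumr_ge0 => i _; exact: sqr_ge0. Qed.

Lemma coord_sqn n (x : 'rV[R]_n) i : x ord0 i ^+ 2 <= sqn x.
Proof.
rewrite /sqn (bigD1 i)//= lerDl; apply: sumr_ge0 => j _; exact: sqr_ge0.
Qed.

Lemma enormE n (x : 'rV[R]_n) : enorm x = Num.sqrt (sqn x).
Proof. by []. Qed.

Lemma coord_enorm n (x : 'rV[R]_n) i : `|x ord0 i| <= enorm x.
Proof. by rewrite enormE -sqrtr_sqr ler_wsqrtr// coord_sqn. Qed.

Lemma continuous_sqn n : continuous (@sqn n).
Proof.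
move=> x; apply: (@cvg_bigsum R _ (nbhs x) _ 'I_n (index_enum _)
  (fun i (y : 'rV[R]_n) => y ord0 i ^+ 2) (fun i => x ord0 i ^+ 2)) => i.
exact: (@continuous_comp _ _ _ (fun y : 'rV[R]_n => y ord0 i) (fun t : R => t ^+ 2)
  x (@continuous_coord n i x) (@exprn_continuous R 2 _)).
Qed.

Lemma continuous_enorm n : continuous (@enorm R n).
Proof.
by move=> x; exact: (@continuous_comp _ _ _ (@sqn n) Num.sqrt x (@continuous_sqn n x) (@sqrt_continuous R _)).
Qed.

Lemma compact_cube n (r : R) :
  compact [set x : 'rV[R]_n | forall i, `[- r, r]%classic (x ord0 i)].
Proof.
by apply: (@rV_compact _ n (fun=> `[- r, r]%classic)) => i; exact: segment_compact.
Qed.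

Lemma cube_bounded n (f : 'rV[R]_n -> R) (r : R) : continuous f ->
  exists2 M : R, 0 <= M & forall x : 'rV[R]_n, (forall i, `|x ord0 i| <= r) -> `|f x| <= M.
Proof.
move=> cf; have [r0|r0] := ltP r 0.
  case: n f cf => [|n] f cf.
    exists `|f 0| => // x _; suff -> : x = 0 by [].
    by apply/rowP => -[].
  exists 0 => // x /(_ ord0) h; exfalso.
  by have := le_lt_trans h r0; rewrite normr_lt0.
pose A := [set x : 'rV[R]_n | forall i, `[- r, r]%classic (x ord0 i)].
have A0 : A !=set0 by exists 0 => i; rewrite mxE /= in_itv/= oppr_le0 r0.
have cA : {within A, continuous (fun x => `|f x|)}.
  apply: continuous_subspaceT => x; apply: (continuous_comp (cf x)).
  exact: norm_continuous.
have [c _ cmax] := EVT_max_rV A0 (@compact_cube n r) cA.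
exists `|f c| => // x xr; apply: cmax; rewrite inE => i /=.
by rewrite in_itv/= -ler_norml.
Qed.

End continuity.

(** * Partial derivatives as derivatives along lines *)

Section line_derivative.
Context {R : realType} {n : nat}.
Implicit Types (f g : 'rV[R]_n -> R) (x v : 'rV[R]_n).

Lemma is_derive_line f x v (s d : R) :
  is_derive (x + s *: v) v f d <-> is_derive s 1 (fun t : R => f (x + t *: v)) d.
Proof.
have E : (fun h : R => h^-1 *: ((f \o shift (x + s *: v)) (h *: v) - f (x + s *: v))) =
  (fun h : R => h^-1 *: (((fun t : R => f (x + t *: v)) \o shift s) (h *: (1 : R^o)) -
     (fun t : R => f (x + t *: v)) s)).
  apply/funext => h /=; congr (_ *: (f _ - _)).
  rewrite addrCA; congr (_ + _).
  by rewrite -scalerDl [h *: _]mulr1.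
split=> -[df dE]; split.
- by rewrite /derivable -E.
- by rewrite -dE /derive -E.
- by rewrite /derivable E.
- by rewrite -dE /derive E.
Qed.

Lemma is_derive_line0 f x v (d : R) :
  is_derive x v f d <-> is_derive (0 : R) 1 (fun t : R => f (x + t *: v)) d.
Proof. by rewrite -is_derive_line scale0r addr0. Qed.

End line_derivative.

(** * Tensor products and integrals of derivatives *)

Lemma ge0_integral_scale d (T : measurableType d) (R : realType)
    (mu : {measure set T -> \bar R}) (c : R) (f : T -> R) : 0 <= c ->
  measurable_fun setT f -> (forall x, 0 <= f x) ->
  (\int[mu]_x (c * f x)%:E = c%:E * \int[mu]_x (f x)%:E)%E.
Proof.
move=> c0 mf f0; rewrite -ge0_integralZl//; last by move=> x _; rewrite lee_fin.
exact: ((measurable_EFinP setT f).2 mf).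
Qed.

Lemma RI_eq0 d (T : measurableType d) (R : realType)
    (mu : {measure set T -> \bar R}) (f : T -> R) :
  (forall x, f x = 0) -> RI mu f = 0.
Proof. by move=> f0; rewrite (_ : f = cst 0) ?RI0//; exact/funext. Qed.

Section tensor.
Context {R : realType}.

Lemma measurable_prod_coord n (h : R -> R) : measurable_fun setT h ->
  measurable_fun setT (fun x : 'rV[R]_n => \prod_i h (x ord0 i)).
Proof.
move=> mh; apply: measurable_prod => i _.
exact: (measurableT_comp mh (@measurable_coord R n i)).
Qed.

Lemma integral_tensor n (h : R -> R) : intg (@lebesgue_measure R) h ->
  (forall t, 0 <= h t) ->
  (\int[lebn n]_x (\prod_i h (x ord0 i))%:E = (RI (@lebesgue_measure R) h ^+ n)%:E)%E.
Proof.
move=> Ih h0; have mh := intg_measurable Ih.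
have p0 k (x : 'rV[R]_k) : 0 <= \prod_i h (x ord0 i) by apply: prodr_ge0.
have mp k : measurable_fun setT (fun x : 'rV[R]_k => (\prod_i h (x ord0 i))%:E).
  by apply/measurable_EFinP; exact: measurable_prod_coord.
elim: n => [|n ih].
  rewrite -(iintE (mp 0%N)) => [|x]; last by rewrite lee_fin. rewrite /= big_ord0 expr0. by [].  
have p0E k (x : 'rV[R]_k) : (0 <= (\prod_i h (x ord0 i))%:E)%E by rewrite lee_fin.
rewrite (integral_lebnS (mp n.+1) (@p0E n.+1)).
have E t : (\int[lebn n]_y (\prod_i h (consrV (t, y) ord0 i))%:E =
    (RI (@lebesgue_measure R) h ^+ n * h t)%:E)%E.
  under eq_integral => y _.
    rewrite big_ord_recl consrV0 /=.
    under eq_bigr do rewrite consrVS/=.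
    over.
  rewrite (ge0_integral_scale _ (h0 t) (@measurable_prod_coord n h mh) (p0 n)).
  by rewrite ih -EFinM mulrC.
under eq_integral do rewrite E.
rewrite (ge0_integral_scale _ _ mh h0); last by rewrite exprn_ge0// RI_ge0.
by rewrite -RI_EFin// -EFinM -exprSr.
Qed.

Lemma intg_tensor n (h : R -> R) : intg (@lebesgue_measure R) h ->
  (forall t, 0 <= h t) ->
  intg (lebn n) (fun x => \prod_i h (x ord0 i)).
Proof.
move=> Ih h0; apply: intg_ge0P.
- by apply: measurable_prod_coord; exact: intg_measurable Ih.
- by move=> x; apply: prodr_ge0.
- by rewrite integral_tensor// ltry.
Qed.

Lemma intg_cube n (r : R) :
  intg (lebn n) (fun x => \prod_i \1_(`[- r, r]%classic) (x ord0 i)).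
Proof.
apply: (@intg_tensor n (\1_(`[- r, r]%classic))) => [|t]; last by rewrite indicE.
by apply/integrable_indic_itv.
Qed.

(** The support is measured coordinate by coordinate, so that freezing some of the coordinates
    preserves the property with the same [r]. *)
Definition csupp n (f : 'rV[R]_n -> R) :=
  exists r : R, forall x : 'rV[R]_n, (exists i, r < `|x ord0 i|) -> f x = 0.

Lemma intg_csupp n (f : 'rV[R]_n -> R) : continuous f -> csupp f ->
  intg (lebn n) f.
Proof.
move=> cf [r fr]; have [M M0 fM] := cube_bounded r cf.
apply: (intg_le _ _ (intgZ M (@intg_cube n r))).
- exact: continuous_measurable_rV.
- move=> x; have [xr|/existsNP[i /negP]] := pselect (forall i, `|x ord0 i| <= r).
    rewrite big1 ?mulr1 ?fM// => i _; rewrite indicE mem_set//=.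
    by rewrite in_itv/= -ler_norml.
  rewrite -ltNge => xr; rewrite fr; last by exists i.
  by rewrite normr0 mulr_ge0// prodr_ge0// => j _; rewrite indicE.
Qed.

End tensor.

Section lebnS_real.
Context {R : realType}.

Lemma RI_lebnS n (f : 'rV[R]_n.+1 -> R) : intg (lebn n.+1) f ->
  (forall t, intg (lebn n) (fun y => f (consrV (t, y)))) ->
  (forall y, intg (@lebesgue_measure R) (fun t => f (consrV (t, y)))) ->
  RI (lebn n.+1) f = RI (@lebesgue_measure R) (fun t => RI (lebn n) (fun y => f (consrV (t, y)))) /\
  RI (lebn n.+1) f = RI (lebn n) (fun y => RI (@lebesgue_measure R) (fun t => f (consrV (t, y)))).
Proof.
move=> If I1 I2; have mf := intg_measurable If.
pose g (t : measurableTypeR R) (y : 'rV[R]_n) := f (consrV (t, y)).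
have mg : measurable_fun setT (fun p : measurableTypeR R * 'rV[R]_n => g p.1 p.2).
  rewrite (_ : (fun _ => _) = f \o @consrV R n); last by apply/funext => -[].
  exact: (measurableT_comp mf (@measurable_consrV R n)).
have Ig : intg2 (@lebesgue_measure R) (lebn n) g.
  apply: intg2P => //.
  have mN : measurable_fun setT (fun x => (`|f x|)%:E).
    by apply/measurable_EFinP; exact: intg_measurable (intg_norm If).
  have N0 x : (0 <= (`|f x|)%:E)%E by rewrite lee_fin.
  by have := intg_lty (intg_norm If); rewrite (integral_lebnS mN N0).
have [_ _ E] := RI_fubini Ig I1 I2.
suff : RI (lebn n.+1) f = RI (@lebesgue_measure R) (fun t => RI (lebn n) (g t)).
  by move=> h; rewrite -E.
have mEf : measurable_fun setT (EFin \o f) by exact/measurable_EFinP.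
have intf : (@lebesgue_measure R \x lebn n)%E.-integrable
    (@consrV R n @^-1` setT) ((EFin \o f) \o @consrV R n).
  by rewrite preimage_setT; move: Ig; rewrite /intg2; apply: eq_integrable => // -[].
rewrite {1}/RI /Rintegral /= /lebstep.
rewrite (integral_pushforward (@measurable_consrV R n) mEf intf)//.
rewrite preimage_setT /RI /Rintegral; congr fine.
transitivity (\int[@lebesgue_measure R \x lebn n]_p (g p.1 p.2)%:E)%E.
  by apply: eq_integral => -[].
rewrite -integral12_prod_meas1//; apply: eq_integral => t _.
exact: (esym (RI_EFin (I1 t))).
Qed.
End lebnS_real.

Section integral_partial.
Context {R : realType}.

Lemma intg_csupp1 (h : R -> R) (r : R) : continuous h ->
  (forall t, r < `|t| -> h t = 0) -> intg (@lebesgue_measure R) h.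
Proof.
move=> ch hr.
have : (@lebesgue_measure R).-integrable `[- r, r] (EFin \o h).
  apply: continuous_compact_integrable; first exact: segment_compact.
  exact: continuous_subspaceT.
move=> H; have ih := (integrable_mkcond (mu := @lebesgue_measure R) (EFin \o h) (measurable_itv `[- r, r])).1 H.
apply: eq_integrable ih => // x _.
rewrite patchE; case: ifPn => // /negP; rewrite inE/= in_itv/= -ler_norml => /negP.
by rewrite -ltNge => ax; rewrite /= hr.
Qed.

Lemma RI_derive_csupp (g g' : R -> R) (r : R) :
  (forall t : R, is_derive t 1 g (g' t)) -> continuous g' ->
  (forall t, r < `|t| -> g t = 0) ->
  RI (@lebesgue_measure R) g' = 0.
Proof.
move=> dg cg' gr.
have g'r t : r < `|t| -> g' t = 0.
  move=> rt; have [_ <-] := dg t.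
  rewrite (@near_eq_derive _ _ _ _ (cst 0)); first exact: derive_cst.
  have : \forall s \near t, r < `|s|.
    by apply: (cvgr_gt _ (@norm_continuous _ _ t)).
  by apply: filterS => s; exact: gr.
pose a := `|r| + 1.
have ra : r < a by rewrite /a (le_lt_trans (ler_norm _))// ltrDl.
have a0 : 0 < a by rewrite ltr_pwDr.
have E : (\int[@lebesgue_measure R]_x (g' x)%:E =
    \int[@lebesgue_measure R]_(x in `[(- a)%R, a]) (g' x)%:E)%E.
  rewrite [RHS]integral_mkcond; apply: eq_integral => x _.
  rewrite patchE; case: ifPn => // /negP; rewrite inE/= in_itv/= -ler_norml => /negP.
  by rewrite -ltNge => ax; rewrite g'r// (lt_trans ra).
have na : - a < a by rewrite (lt_trans _ a0)// oppr_lt0.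
have cg : continuous g.
  by move=> x; apply/differentiable_continuous/derivable1_diffP; have [] := dg x.
rewrite /RI /Rintegral E (@continuous_FTC2 _ g' g)//.
- by rewrite !gr ?normrN ?(ger0_norm (ltW a0))//= subr0.
- exact: continuous_subspaceT.
- split.
  + by move=> x _; have [] := dg x.
  + exact/cvg_at_right_filter/cg.
  + exact/cvg_at_left_filter/cg.
- by move=> x _; rewrite derive1E; have [] := dg x.
Qed.

Lemma consrV_line0 n (t s : R) (y : 'rV[R]_n) :
  consrV (t, y) + s *: ebasis R ord0 = consrV (t + s, y).
Proof.
apply/rowP => i; rewrite mxE [X in _ + X]mxE [X in _ * X]mxE.
case: (unliftP ord0 i) => [j ->|->].
  by rewrite !consrVS/= mulr0 addr0.
by rewrite !consrV0 /= mulr1.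
Qed.

Lemma consrV_lineS n (t s : R) (y : 'rV[R]_n) (j : 'I_n) :
  consrV (t, y) + s *: ebasis R (lift ord0 j) = consrV (t, y + s *: ebasis R j).
Proof.
apply/rowP => i; rewrite mxE [X in _ + X]mxE [X in _ * X]mxE.
case: (unliftP ord0 i) => [k ->|->].
  by rewrite !consrVS/= !mxE/= (inj_eq (@lift_inj _ ord0)).
by rewrite !consrV0 /= mulr0 addr0.
Qed.

Lemma is_derive_consrV0 n (f : 'rV[R]_n.+1 -> R) t y d :
  is_derive (consrV (t, y)) (ebasis R ord0) f d <->
  is_derive t 1 (fun s : R => f (consrV (s, y))) d.
Proof.
rewrite -{1}(add0r t) -(consrV_line0 0 t y) is_derive_line.
by under eq_fun do rewrite consrV_line0 add0r.
Qed.

Lemma is_derive_consrVS n (f : 'rV[R]_n.+1 -> R) t y j d :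
  is_derive (consrV (t, y)) (ebasis R (lift ord0 j)) f d <->
  is_derive y (ebasis R j) (fun y => f (consrV (t, y))) d.
Proof.
rewrite !is_derive_line0.
by under eq_fun do rewrite consrV_lineS.
Qed.

Lemma partial_csupp n (i : 'I_n) (f : 'rV[R]_n -> R) : csupp f -> csupp (partial i f).
Proof.
move=> [r fr]; exists r => x [j xj]; rewrite /partial.
rewrite (@near_eq_derive _ _ _ _ (cst 0)); first exact: derive_cst.
have : \forall y \near x, r < `|(y : 'rV[R]_n) ord0 j|.
  apply: (cvgr_gt _ (@continuous_comp _ _ _ (fun y : 'rV[R]_n => y ord0 j) Num.norm x
    (@continuous_coord R n j x) (@norm_continuous _ _ _)) _ xj).
by apply: filterS => y yj; apply: fr; exists j.
Qed.

(** Induction on the dimension. If the derivative is in the first variable, that variable is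
    integrated innermost and the fundamental theorem of calculus gives 0; otherwise it is integrated
    outermost and each slice falls under the induction hypothesis. *)
Lemma RI_partial0 n (i : 'I_n) (g : 'rV[R]_n -> R) :
  (forall x, derivable g x (ebasis R i)) -> continuous (partial i g) ->
  csupp g -> RI (lebn n) (partial i g) = 0.
Proof.
elim: n i g => [[]//|n ih] i g dg cg sg.
have sg' := partial_csupp i sg.
have [r' gr'] := sg'; have [r gr] := sg.
have Ig := intg_csupp cg sg'.
have cl y : continuous (fun t : R => partial i g (consrV (t, y))).
  by move=> t; exact: (continuous_comp (@continuous_consrVl R n y t) (cg _)).
have cr t : continuous (fun y : 'rV[R]_n => partial i g (consrV (t, y))).
  by move=> y; exact: (continuous_comp (@continuous_consrVr R n t y) (cg _)).
have I1 t : intg (lebn n) (fun y => partial i g (consrV (t, y))).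
  apply: intg_csupp => //; exists r' => y [j yj]; apply: gr'.
  by exists (lift ord0 j); rewrite consrVS.
have I2 y : intg (@lebesgue_measure R) (fun t => partial i g (consrV (t, y))).
  apply: (intg_csupp1 (cl y) (r := r')) => t tr; apply: gr'.
  by exists ord0; rewrite consrV0.
have [E1 E2] := RI_lebnS Ig I1 I2.
case: (unliftP ord0 i) => [j ij|i0].
  rewrite E1; apply: RI_eq0 => t.
  have Ep : (fun y => partial i g (consrV (t, y))) =
      partial j (fun y => g (consrV (t, y))).
    apply/funext => y; rewrite /partial; apply/esym/derive_val.
    by apply/is_derive_consrVS; rewrite -ij; exact: derivableP.
  rewrite Ep; apply: ih.
  - move=> y; have /is_derive_consrVS[] // : is_derive (consrV (t, y))
      (ebasis R (lift ord0 j)) g (partial i g (consrV (t, y))).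
    by rewrite -ij; exact: derivableP.
  - by rewrite -Ep.
  - exists r => y [k yk]; apply: gr; exists (lift ord0 k).
    by rewrite consrVS.
rewrite E2; apply: RI_eq0 => y.
apply: (@RI_derive_csupp (fun t => g (consrV (t, y))) _ r) => //.
  by move=> t; apply/is_derive_consrV0; rewrite -i0; exact: derivableP.
by move=> t rt; apply: gr; exists ord0; rewrite consrV0.
Qed.

End integral_partial.

(** * Smooth functions and integration by parts *)

Section smooth_calculus.
Context {R : realType} {n : nat}.
Implicit Types (f g h : 'rV[R]_n -> R) (i : 'I_n) (s : seq 'I_n).

Lemma partialD i f g x : derivable f x (ebasis R i) -> derivable g x (ebasis R i) ->
  partial i (fun y => f y + g y) x = partial i f x + partial i g x.
Proof. by move=> df dg; rewrite /partial; exact: deriveD. Qed.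

Lemma partialM i f g x : derivable f x (ebasis R i) -> derivable g x (ebasis R i) ->
  partial i (fun y => f y * g y) x = partial i f x * g x + f x * partial i g x.
Proof.
move=> df dg; have := deriveM df dg; rewrite -!/(partial i _ x) => E.
by rewrite [LHS]E addrC; congr (_ + _); exact: mulrC.
Qed.

Lemma partialZ i c f x : derivable f x (ebasis R i) ->
  partial i (fun y => c * f y) x = c * partial i f x.
Proof. by move=> df; rewrite /partial; exact: deriveZ. Qed.

Lemma partial_cst i (c : R) x : partial i (fun=> c) x = 0.
Proof. exact: derive_cst. Qed.

Lemma smoothP f : smooth f <-> forall s, continuous (iter_partial s f) /\
  forall i x, derivable (iter_partial s f) x (ebasis R i).
Proof. by []. Qed.

Lemma partialE i f x : partial i f x = 'D_(ebasis R i) f x.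
Proof. by []. Qed.

Lemma lapE f x : lap f x = \sum_i partial i (partial i f) x.
Proof. by []. Qed.

Lemma neglap_pow0 f : neglap_pow 0 f = f.
Proof. by []. Qed.

Lemma neglap_powS k f : neglap_pow k.+1 f = (fun x => - lap (neglap_pow k f) x).
Proof. by []. Qed.

Opaque smooth partial lap.

Lemma smooth_continuous f : smooth f -> continuous f.
Proof. by move=> /smoothP/(_ [::])[]. Qed.

Lemma smooth_derivable f i x : smooth f -> derivable f x (ebasis R i).
Proof. by move=> /smoothP/(_ [::])[]. Qed.

Lemma iter_partial_rcons s i f : iter_partial (rcons s i) f = iter_partial s (partial i f).
Proof. exact: foldr_rcons. Qed.

Lemma smooth_partial i f : smooth f -> smooth (partial i f).
Proof.
move=> /smoothP sf; apply/smoothP => s.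
by have := sf (rcons s i); rewrite iter_partial_rcons.
Qed.

Lemma smooth_iter_partial s f : smooth f -> smooth (iter_partial s f).
Proof. by move=> sf; elim: s => [|i s ih]; [exact: sf|exact: (smooth_partial i ih)]. Qed.

(** A coinduction principle: smoothness is shown by exhibiting a class of continuous, partially
    derivable functions that is stable under partial derivatives. It avoids closed formulas for
    iterated derivatives. *)
Lemma smooth_coind (F : set ('rV[R]_n -> R)) :
  (forall f, F f -> continuous f /\
    forall i, (forall x, derivable f x (ebasis R i)) /\ F (partial i f)) ->
  forall f, F f -> smooth f.
Proof.
move=> HF f Ff; apply/smoothP => s; have : F (iter_partial s f).
  by elim: s => //= i s ih; have [_ /(_ i)[]] := HF _ ih.
by move=> /HF[c d]; split=> // i x; have [] := d i.
Qed.

Lemma iter_partialD s f g : smooth f -> smooth g ->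
  iter_partial s (fun y => f y + g y) = (fun y => iter_partial s f y + iter_partial s g y).
Proof.
move=> sf sg; elim: s => [//|i s /= ->]; apply/funext => x.
exact: partialD (smooth_derivable (smooth_iter_partial s sf))
  (smooth_derivable (smooth_iter_partial s sg)).
Qed.

Lemma iter_partialZ s c f : smooth f ->
  iter_partial s (fun y => c * f y) = (fun y => c * iter_partial s f y).
Proof.
move=> sf; elim: s => [//|i s /= ->]; apply/funext => x.
by apply: partialZ; exact: smooth_derivable (smooth_iter_partial s sf).
Qed.

Lemma iter_partial_cst s c :
  iter_partial s (fun=> c : R) = (fun _ : 'rV[R]_n => if s is [::] then c else 0).
Proof.
elim: s => //= i s ->; apply/funext => x; exact: partial_cst.
Qed.

Lemma partialME i f g : smooth f -> smooth g -> partial i (fun y => f y * g y) =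
  (fun y => partial i f y * g y + f y * partial i g y).
Proof.
move=> sf sg; apply/funext => x.
exact: partialM (smooth_derivable sf) (smooth_derivable sg).
Qed.

Lemma smoothD f g : smooth f -> smooth g -> smooth (fun y => f y + g y).
Proof.
move=> sf sg; apply/smoothP => s; rewrite iter_partialD//.
have [cf df] := (smoothP f).1 sf s; have [cg dg] := (smoothP g).1 sg s; split=> [x|i x].
  exact: cvgD (cf x) (cg x).
exact: derivableD (df i x) (dg i x).
Qed.

Lemma smoothZ c f : smooth f -> smooth (fun y => c * f y).
Proof.
move=> sf; apply/smoothP => s; rewrite iter_partialZ//; have [cf df] := (smoothP f).1 sf s; split=> [x|i x].
  exact: cvgM (cvg_cst c) (cf x).
exact: derivableZ (df i x).
Qed.

Lemma smoothN f : smooth f -> smooth (fun y => - f y).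
Proof.
by move=> sf; rewrite (_ : (fun _ => _) = (fun y => -1 * f y));
  [exact: smoothZ|apply/funext => x; rewrite mulN1r].
Qed.

Lemma smooth_cst c : smooth (fun _ : 'rV[R]_n => c).
Proof.
apply/smoothP => s; rewrite iter_partial_cst; split=> [|i x]; first exact: cst_continuous.
exact: derivable_cst.
Qed.

Lemma smooth_sum (I : Type) (r : seq I) (F : I -> 'rV[R]_n -> R) :
  (forall j, smooth (F j)) -> smooth (fun x => \sum_(j <- r) F j x).
Proof.
move=> sF; elim: r => [|j r ih].
  by under eq_fun do rewrite big_nil; exact: smooth_cst.
by under eq_fun do rewrite big_cons; exact: (smoothD (sF j) ih).
Qed.

(** Products of two smooth functions are not visibly stable under partial derivatives, but finite
    sums of such products are, by the Leibniz rule. *)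
Inductive sum_of_products : ('rV[R]_n -> R) -> Prop :=
| sp_mul f g : smooth f -> smooth g -> sum_of_products (fun x => f x * g x)
| sp_add f g : sum_of_products f -> sum_of_products g ->
    sum_of_products (fun x => f x + g x).

Lemma smooth_sum_of_products f : sum_of_products f -> smooth f.
Proof.
apply: smooth_coind => {}f; elim=> {f} [f g sf sg|f g _ [cf df] _ [cg dg]].
  split=> [x|i].
    have cf := smooth_continuous sf; have cg := smooth_continuous sg.
    exact: cvgM (cf x) (cg x).
  split=> [x|]; first exact: (@derivableM R _ f g) (smooth_derivable sf) (smooth_derivable sg).
  rewrite (partialME i sf sg).
  exact: sp_add (sp_mul (smooth_partial i sf) sg) (sp_mul sf (smooth_partial i sg)).
split=> [x|i]; first exact: cvgD (cf x) (cg x).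
have [df1 df2] := df i; have [dg1 dg2] := dg i.
split=> [x|]; first exact: derivableD.
rewrite (_ : partial i _ = (fun y => partial i f y + partial i g y)).
  exact: sp_add.
by apply/funext => x; rewrite partialD.
Qed.

Lemma smoothM f g : smooth f -> smooth g -> smooth (fun y => f y * g y).
Proof. by move=> sf sg; exact: smooth_sum_of_products (sp_mul sf sg). Qed.

Lemma smooth_lap f : smooth f -> smooth (lap f).
Proof.
move=> sf; rewrite (_ : lap f = (fun x => \sum_i partial i (partial i f) x)).
  by apply: smooth_sum => i; exact: (smooth_partial i (smooth_partial i sf)).
by apply/funext => x; rewrite lapE.
Qed.

Lemma smooth_neglap_pow k f : smooth f -> smooth (neglap_pow k f).
Proof.
by move=> sf; elim: k => [//|k ih]; exact: (smoothN (smooth_lap ih)).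
Qed.

Lemma neglap_powSr k f : neglap_pow k.+1 f = neglap_pow k (fun x => - lap f x).
Proof. exact: iterSr. Qed.

Lemma csuppMl f g : csupp f -> csupp (fun x => f x * g x).
Proof. by move=> [r fr]; exists r => x xr; rewrite fr// mul0r. Qed.

Lemma csuppMr f g : csupp g -> csupp (fun x => f x * g x).
Proof. by move=> [r fr]; exists r => x xr; rewrite fr// mulr0. Qed.

Lemma csuppD f g : csupp f -> csupp g -> csupp (fun x => f x + g x).
Proof.
move=> [r fr] [q gq]; exists (Num.max r q) => x [i xi].
by rewrite fr ?gq ?addr0//; exists i; apply: le_lt_trans xi; rewrite le_max lexx ?orbT.
Qed.

Lemma csupp_sum (I : Type) (r : seq I) (F : I -> 'rV[R]_n -> R) :
  (forall j, csupp (F j)) -> csupp (fun x => \sum_(j <- r) F j x).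
Proof.
move=> sF; elim: r => [|j r ih].
  by exists 0 => x _; rewrite big_nil.
by under eq_fun do rewrite big_cons; exact: csuppD.
Qed.

Lemma csuppN f : csupp f -> csupp (fun x => - f x).
Proof. by move=> [r fr]; exists r => x xr; rewrite fr// oppr0. Qed.

Lemma csupp_lap f : csupp f -> csupp (lap f).
Proof.
move=> cf; rewrite (_ : lap f = (fun x => \sum_i partial i (partial i f) x)).
  by apply: csupp_sum => i; do 2 apply: partial_csupp.
by apply/funext => x; rewrite lapE.
Qed.

Lemma integration_by_parts_csupp i f g : smooth f -> smooth g -> csupp g ->
  RI (lebn n) (fun x => partial i f x * g x) =
  - RI (lebn n) (fun x => f x * partial i g x).
Proof.
move=> sf sg cg; have sfg := smoothM sf sg.
have cgi := partial_csupp i cg.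
have sfi := smooth_partial i sf; have sgi := smooth_partial i sg.
have I1 : intg (lebn n) (fun x => partial i f x * g x).
  exact: intg_csupp (smooth_continuous (smoothM sfi sg)) (csuppMr _ cg).
have I2 : intg (lebn n) (fun x => f x * partial i g x).
  exact: intg_csupp (smooth_continuous (smoothM sf sgi)) (csuppMr _ cgi).
apply/eqP; rewrite -addr_eq0 -(RID I1 I2) -(partialME i sf sg).
apply/eqP; apply: RI_partial0; last exact: csuppMr.
- by move=> x; exact: (smooth_derivable sfg).
- exact: smooth_continuous (smooth_partial i sfg).
Qed.

Lemma lap_by_parts_csupp f g : smooth f -> smooth g -> csupp g ->
  RI (lebn n) (fun x => lap f x * g x) = RI (lebn n) (fun x => f x * lap g x).
Proof.
move=> sf sg cg.
have E1 : (fun x => lap f x * g x) = (fun x => \sum_i (partial i (partial i f) x * g x)).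
  by apply/funext => x; rewrite lapE big_distrl.
have E2 : (fun x => f x * lap g x) = (fun x => \sum_i (f x * partial i (partial i g) x)).
  by apply/funext => x; rewrite lapE big_distrr.
have s1 i := smooth_partial i sg; have t1 i := smooth_partial i sf.
have s2 i := smooth_partial i (s1 i); have t2 i := smooth_partial i (t1 i).
have c1 i := partial_csupp i cg; have c2 i := partial_csupp i (c1 i).
rewrite E1 E2 !RI_sum => [|i|i]; last 2 first.
- exact: intg_csupp (smooth_continuous (smoothM sf (s2 i))) (csuppMr _ (c2 i)).
- exact: intg_csupp (smooth_continuous (smoothM (t2 i) sg)) (csuppMr _ cg).
apply: eq_bigr => i _; rewrite (integration_by_parts_csupp i (t1 i) sg cg).
have := integration_by_parts_csupp i sf (s1 i) (c1 i) => E.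
by rewrite [in LHS]E opprK.
Qed.

Lemma neglap_pow_by_parts_csupp k f g : smooth f -> smooth g -> csupp g ->
  RI (lebn n) (fun x => neglap_pow k f x * g x) =
  RI (lebn n) (fun x => f x * neglap_pow k g x).
Proof.
elim: k f g => // k ih f g sf sg cg.
rewrite neglap_powSr (ih _ _ (smoothN (smooth_lap sf)) sg cg).
have sgk := smooth_neglap_pow k sg.
have cgk : csupp (neglap_pow k g).
  by elim: k {ih sgk} => [//|k ih]; exact: csuppN (csupp_lap ih).
have E1 : (fun x => - lap f x * neglap_pow k g x) =
    (fun x => - (lap f x * neglap_pow k g x)).
  by apply/funext => x; rewrite mulNr.
have E2 : (fun x => f x * neglap_pow k.+1 g x) =
    (fun x => - (f x * lap (neglap_pow k g) x)).
  by apply/funext => x; rewrite neglap_powS mulrN.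
rewrite E1 E2 !RIN ?(lap_by_parts_csupp sf sgk cgk)//.
- exact: intg_csupp (smooth_continuous (smoothM sf (smooth_lap sgk))) (csuppMr _ (csupp_lap cgk)).
- exact: intg_csupp (smooth_continuous (smoothM (smooth_lap sf) sgk)) (csuppMr _ cgk).
Qed.

End smooth_calculus.

(** * Sequences whose derivatives of every order converge under a common weight *)

Section tame.
Context {R : realType} {n : nat}.
Implicit Types (W : 'rV[R]_n -> R) (f g : nat -> 'rV[R]_n -> R) (F G : 'rV[R]_n -> R).

(** Exactly what dominated convergence asks for after a differential operator has been applied: each
    derivative is bounded by a multiple of [W] uniformly in [k] and converges pointwise. Cut-offs
    are tame for the weight 1, a kernel (as a constant sequence) for its own decay. *)
Definition tame W f F := [/\ forall k, smooth (f k), smooth F &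
  forall s, (exists2 C, 0 <= C & forall k x, `|iter_partial s (f k) x| <= C * W x) /\
    forall x, iter_partial s (f k) x @[k --> \oo] --> iter_partial s F x].

Lemma tame_partial W f F i : tame W f F ->
  tame W (fun k => partial i (f k)) (partial i F).
Proof.
move=> [sf sF h]; split=> [k||s]; [exact: (smooth_partial i (sf k))|exact: (smooth_partial i sF)|].
have [[C C0 hC] l] := h (rcons s i); split=> [|x].
  by exists C => // k x; rewrite -iter_partial_rcons.
rewrite -iter_partial_rcons (_ : (fun k => _) = (fun k => iter_partial (rcons s i) (f k) x))//.
by apply/funext => k; rewrite iter_partial_rcons.
Qed.

Lemma tameD W f F g G : tame W f F -> tame W g G ->
  tame W (fun k x => f k x + g k x) (fun x => F x + G x).
Proof.
move=> [sf sF hf] [sg sG hg]; split=> [k||s]; [exact: (smoothD (sf k) (sg k))|exact: (smoothD sF sG)|].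
have [[C C0 fC] fl] := hf s; have [[D D0 gD] gl] := hg s.
split=> [|x]; last first.
  rewrite (iter_partialD s sF sG) (_ : (fun k => _) =
    (fun k => iter_partial s (f k) x + iter_partial s (g k) x)).
    exact: cvgD.
  by apply/funext => k; rewrite (iter_partialD s (sf k) (sg k)).
exists (C + D) => [|k x]; first exact: addr_ge0.
by rewrite (iter_partialD s (sf k) (sg k)) (le_trans (ler_normD _ _))// mulrDl lerD.
Qed.

Lemma tameZ W f F c : tame W f F -> tame W (fun k x => c * f k x) (fun x => c * F x).
Proof.
move=> [sf sF hf]; split=> [k||s]; [exact: (smoothZ c (sf k))|exact: (smoothZ c sF)|].
have [[C C0 fC] fl] := hf s; split=> [|x]; last first.
  rewrite (iter_partialZ s c sF) (_ : (fun k => _) = (fun k => c * iter_partial s (f k) x)).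
    exact: cvgM (cvg_cst c) (fl x).
  by apply/funext => k; rewrite (iter_partialZ s c (sf k)).
exists (`|c| * C) => [|k x]; first exact: mulr_ge0.
by rewrite (iter_partialZ s c (sf k)) normrM -mulrA ler_wpM2l.
Qed.

(** The multi-index is consumed from its last entry, which is the derivative taken first. The
    Leibniz rule then yields two products of tame sequences with a shorter multi-index. *)
Lemma tameM W f F g G : (forall x, 0 <= W x) -> tame W f F -> tame (fun=> 1) g G ->
  tame W (fun k x => f k x * g k x) (fun x => F x * G x).
Proof.
move=> W0 tf tg; have [sf0 sF0 _] := tf; have [sg0 sG0 _] := tg.
split=> [k||s]; [exact: (smoothM (sf0 k) (sg0 k))|exact: (smoothM sF0 sG0)|].
elim/last_ind: s f F g G tf tg {sf0 sF0 sg0 sG0} => [|s i ih] f F g G tf tg.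
  have [_ _ /(_ [::])[[C C0 fC] fl]] := tf; have [_ _ /(_ [::])[[D D0 gD] gl]] := tg.
  split=> [|x]; last exact: (cvgM (fl x) (gl x)).
  exists (C * D) => [|k x]; first exact: mulr_ge0.
  rewrite /= normrM mulrAC ler_pM//; first exact: fC.
  by have := gD k x; rewrite mulr1.
have [sf sF _] := tf; have [sg sG _] := tg.
have [[C C0 H1] L1] := ih _ _ _ _ (tame_partial i tf) tg.
have [[D D0 H2] L2] := ih _ _ _ _ tf (tame_partial i tg).
have E h k : smooth h -> smooth k -> iter_partial (rcons s i) (fun x : 'rV[R]_n => h x * k x) =
   (fun x => iter_partial s (fun x => partial i h x * k x) x +
     iter_partial s (fun x => h x * partial i k x) x).
  move=> sh sk; rewrite iter_partial_rcons (partialME i sh sk).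
  exact: iter_partialD (smoothM (smooth_partial i sh) sk) (smoothM sh (smooth_partial i sk)).
split=> [|x]; last first.
  rewrite (E _ _ sF sG) (_ : (fun k => _) =
    (fun k => iter_partial s (fun x => partial i (f k) x * g k x) x +
      iter_partial s (fun x => f k x * partial i (g k) x) x)).
    exact: cvgD.
  by apply/funext => k; rewrite (E _ _ (sf k) (sg k)).
exists (C + D) => [|k x]; first exact: addr_ge0.
by rewrite (E _ _ (sf k) (sg k)) (le_trans (ler_normD _ _))// mulrDl lerD.
Qed.

Lemma tame_sum W (I : Type) (r : seq I) (f : I -> nat -> 'rV[R]_n -> R)
    (F : I -> 'rV[R]_n -> R) : (forall x, 0 <= W x) ->
  (forall j, tame W (f j) (F j)) ->
  tame W (fun k x => \sum_(j <- r) f j k x) (fun x => \sum_(j <- r) F j x).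
Proof.
move=> W0 tF; elim: r => [|j r ih].
  rewrite (_ : (fun k x => _) = (fun _ _ => 0)); last first.
    by apply/funext => k; apply/funext => x; rewrite big_nil.
  rewrite (_ : (fun x => _) = (fun _ => 0)); last first.
    by apply/funext => x; rewrite big_nil.
  split=> [k||s]; [exact: (smooth_cst 0)|exact: (smooth_cst 0)|rewrite iter_partial_cst].
  split=> [|x]; last exact: cvg_cst.
  by exists 0 => // k x; case: s => *; rewrite normr0 mul0r.
rewrite (_ : (fun k x => _) = (fun k x => f j k x + \sum_(i <- r) f i k x)); last first.
  by apply/funext => k; apply/funext => x; rewrite big_cons.
rewrite (_ : (fun x => _) = (fun x => F j x + \sum_(i <- r) F i x)); last first.
  by apply/funext => x; rewrite big_cons.
exact: tameD (tF j) ih.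
Qed.

Lemma tame_neglap_pow W m f F : (forall x, 0 <= W x) -> tame W f F ->
  tame W (fun k => neglap_pow m (f k)) (neglap_pow m F).
Proof.
move=> W0 tf; elim: m => [//|m ih].
rewrite (_ : (fun k => neglap_pow m.+1 (f k)) =
    (fun k x => -1 * \sum_i partial i (partial i (neglap_pow m (f k))) x)); last first.
  by apply/funext => k; apply/funext => x; rewrite neglap_powS lapE mulN1r.
rewrite (_ : neglap_pow m.+1 F =
    (fun x => -1 * \sum_i partial i (partial i (neglap_pow m F)) x)); last first.
  by apply/funext => x; rewrite neglap_powS lapE mulN1r.
by apply: tameZ; apply: tame_sum => // i; exact: tame_partial (tame_partial i ih).
Qed.

Lemma tame_bound W f F : tame W f F ->
  exists2 C, 0 <= C & forall k x, `|f k x| <= C * W x.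
Proof. by move=> [_ _ /(_ [::])[hC _]]. Qed.

Lemma tame_cvg W f F x : tame W f F -> f k x @[k --> \oo] --> F x.
Proof. by move=> [_ _ /(_ [::])[_ hl]]; exact: hl. Qed.

End tame.

Section by_parts.
Context {R : realType} {n : nat}.
Implicit Types (W f h : 'rV[R]_n -> R).

Lemma intgM_cont W (v w h : 'rV[R]_n -> R) (C : R) : measurable_fun setT v ->
  measurable_fun setT h -> (forall x, `|h x| <= C * w x) ->
  intg (lebn n) (fun x => `|v x| * w x) -> intg (lebn n) (fun x => v x * h x).
Proof.
move=> mv mh hC Iv.
apply: (intg_le _ _ (intgZ C Iv)); first exact: measurable_funM.
by move=> x; rewrite normrM; apply: (le_trans (ler_wpM2l (normr_ge0 (v x)) (hC x))); rewrite mulrCA.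
Qed.

(* Integration by parts on the whole space: cut off by [chi k], then let k grow. *)
Lemma neglap_pow_by_parts (chi : nat -> 'rV[R]_n -> R) W m v h :
  (forall x, 0 <= W x) -> tame (fun=> 1) chi (fun=> 1) -> (forall k, csupp (chi k)) ->
  smooth v -> tame W (fun=> h) h ->
  intg (lebn n) (fun x => `|v x| * W x) ->
  intg (lebn n) (fun x => neglap_pow m v x * h x) ->
  RI (lebn n) (fun x => neglap_pow m v x * h x) =
  RI (lebn n) (fun x => v x * neglap_pow m h x).
Proof.
move=> W0 tchi cchi sv th IvW Ivh.
have [_ sh _] := th.
have [schi _ _] := tchi.
have thchi := tameM W0 th tchi.
have tL := tame_neglap_pow m W0 thchi.
have [C C0 hC] := tame_bound tL; have [D D0 hD] := tame_bound tchi.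
have sL k := smooth_neglap_pow m (smoothM sh (schi k)).
(* On this side the cut-off stands outside the operator, so the integrable product itself is the
   majorant. On the other side derivatives fall on [h * chi k], and the majorant is [|v| * W]. *)
have [||||_ L1] := @RI_dct _ _ R (lebn n) (fun k x => neglap_pow m v x * h x * chi k x)
  (fun x => neglap_pow m v x * h x) (fun x => D * `|neglap_pow m v x * h x|).
- move=> k; apply: measurable_funM; first exact: intg_measurable Ivh.
  exact: continuous_measurable_rV (smooth_continuous (schi k)).
- by move=> x; have := cvgM (cvg_cst (neglap_pow m v x * h x)) (tame_cvg (x := x) tchi); rewrite mulr1; exact.
- by move=> k x; rewrite normrM mulrC ler_wpM2r//; have := hD k x; rewrite mulr1.
- by apply: intgZ; exact: intg_norm.
have [||||_ L2] := @RI_dct _ _ R (lebn n) (fun k x => v x * neglap_pow m (fun y => h y * chi k y) x)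
  (fun x => v x * neglap_pow m (fun y => h y * 1) x) (fun x => C * (`|v x| * W x)).
- move=> k; exact: continuous_measurable_rV (smooth_continuous (smoothM sv (sL k))).
- move=> x; exact: cvgM (cvg_cst (v x)) (tame_cvg (x := x) tL).
- by move=> k x; rewrite normrM; apply: (le_trans (ler_wpM2l (normr_ge0 (v x)) (hC k x))); rewrite mulrCA.
- exact: intgZ.
have E : (fun y => h y * 1) = h by apply/funext => y; rewrite mulr1.
rewrite E in L2; apply: cvg_unique L1 _ => //.
rewrite (_ : (fun k => _) =
  (fun k => RI (lebn n) (fun x => v x * neglap_pow m (fun y => h y * chi k y) x)))//.
apply/funext => k.
rewrite -(neglap_pow_by_parts_csupp m sv (smoothM sh (schi k)) (csuppMr h (cchi k))).
by congr RI; apply/funext => x; rewrite mulrA.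
Qed.

End by_parts.

(** * The regularised norm *)

Section chain_rule.
Context {R : realType} {n : nat}.
Implicit Types (f : 'rV[R]_n -> R) (x v : 'rV[R]_n).

Lemma is_derive_chain (phi : R -> R) f x v d d' :
  is_derive x v f d -> is_derive (f x) 1 phi d' ->
  is_derive x v (fun y => phi (f y)) (d' * d).
Proof.
move=> /is_derive_line0 df dphi; apply/is_derive_line0.
have E : f x = f (x + 0 *: v) by rewrite scale0r addr0.
rewrite E in dphi.
exact: (@is_derive1_comp R phi (fun t : R => f (x + t *: v)) 0 d' d).
Qed.

Lemma is_derive_coord (i j : 'I_n) x :
  is_derive x (ebasis R i) (fun y : 'rV[R]_n => y ord0 j) (i == j)%:R.
Proof.
apply/is_derive_line0.
rewrite (_ : (fun t : R => _) = (fun t : R => x ord0 j + t * (i == j)%:R)); last first.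
  by apply/funext => t; rewrite !mxE/= eq_sym.
have d : is_derive (0 : R) 1 (fun t : R => t * (i == j)%:R) (i == j)%:R.
  by apply: is_derive_eq; rewrite scaler0 add0r [LHS]mulr1.
have d2 := is_deriveD (is_derive_cst (x ord0 j) (0 : R) 1) d.
by apply: (is_derive_eq d2); rewrite add0r.
Qed.

Lemma is_derive_sqn (i : 'I_n) x :
  is_derive x (ebasis R i) (@sqn R n) (2 * x ord0 i).
Proof.
have dj j : is_derive x (ebasis R i) (fun y : 'rV[R]_n => y ord0 j ^+ 2)
    (2 * x ord0 j * (i == j)%:R).
  have d := is_deriveM (is_derive_coord i j x) (is_derive_coord i j x).
  by apply: (is_derive_eq d); rewrite /GRing.scale/=; ring.
have d := @is_derive_sum R _ _ n (fun j (y : 'rV[R]_n) => y ord0 j ^+ 2) x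
  (ebasis R i) _ dj.
rewrite (_ : @sqn R n = \sum_(j < n) (fun y : 'rV[R]_n => y ord0 j ^+ 2)); last first.
  by apply/funext => y; rewrite /sqn fct_sumE.
apply: is_derive_eq; rewrite (bigD1 i)//= eqxx mulr1 big1 ?addr0// => j ji.
by rewrite eq_sym (negbTE ji) mulr0.
Qed.
End chain_rule.

Section Nnorm.
Context {R : realType} {n : nat}.
Implicit Types (x : 'rV[R]_n) (t : R).

(** The Euclidean length of [(t, x)] in one dimension more: smooth in [x] for [t > 0], and the
    Euclidean norm of [x] for [t = 0]. *)
Definition N t x := Num.sqrt (t ^+ 2 + sqn x).

Lemma N_gt0 t x : 0 < t -> 0 < N t x.
Proof. by move=> t0; rewrite sqrtr_gt0 ltr_wpDr ?sqn_ge0// exprn_gt0. Qed.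

Lemma N_ge0 t x : 0 <= N t x.
Proof. exact: sqrtr_ge0. Qed.

Lemma sqr_N t x : N t x ^+ 2 = t ^+ 2 + sqn x.
Proof. by rewrite sqr_sqrtr// addr_ge0 ?sqr_ge0 ?sqn_ge0. Qed.

Lemma le_t_N t x : 0 < t -> t <= N t x.
Proof.
move=> t0; rewrite -(@ler_sqr R) ?nnegrE ?N_ge0 ?(ltW t0)//.
by rewrite sqr_N lerDl sqn_ge0.
Qed.

Lemma le_coord_N t x i : `|x ord0 i| <= N t x.
Proof.
rewrite -(@ler_sqr R) ?nnegrE ?N_ge0// sqr_N real_normK ?num_real//.
by rewrite (le_trans (coord_sqn x i))// lerDr sqr_ge0.
Qed.

Lemma is_derive_N (i : 'I_n) t x : 0 < t ->
  is_derive x (ebasis R i) (N t) (x ord0 i / N t x).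
Proof.
move=> t0; have q0 : 0 < t ^+ 2 + sqn x by rewrite ltr_wpDr ?sqn_ge0// exprn_gt0.
have d1 : is_derive x (ebasis R i) (fun y => t ^+ 2 + sqn y) (2 * x ord0 i).
  by have := is_derive_sqn i x => ?; apply: is_derive_eq; rewrite add0r.
have := is_derive_chain d1 (is_derive1_sqrt q0).
move=> h; apply: (is_derive_eq h); rewrite -/(N t x).
by field; rewrite gt_eqF ?N_gt0.
Qed.

Lemma is_derive_Nt t x : 0 < t -> is_derive t 1 (fun s => N s x) (t / N t x).
Proof.
move=> t0; have q0 : 0 < t ^+ 2 + sqn x by rewrite ltr_wpDr ?sqn_ge0// exprn_gt0.
have d1 : is_derive t 1 (fun s : R => s ^+ 2 + sqn x) (2 * t).
  by apply: is_derive_eq; rewrite /GRing.scale/=; ring.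
have := @is_derive1_comp R Num.sqrt (fun s : R => s ^+ 2 + sqn x) t _ _ (is_derive1_sqrt q0) d1.
move=> h; apply: (is_derive_eq h); rewrite -/(N t x).
by field; rewrite gt_eqF ?N_gt0.
Qed.

(* [K b p t] is homogeneous of degree [- b] in [(t, x)]. On the polynomial [p], [opT] is the
   derivative in the height [t] and [opL] the operator [- lap] in [x]. *)
Definition K (b : nat) (p : {poly R}) t x := N t x ^- b * p.[t / N t x].

(** This is the radial derivative: differentiating [r^(-b) p(t/r)] in [r] gives [r^(-b-1)] times
    [opE b p] at [t/r]. *)
Definition opE (b : nat) (p : {poly R}) := - (b%:R *: p) - 'X * p^`().
Definition opT (b : nat) (p : {poly R}) := - (b%:R *: ('X * p)) + (1 - 'X^2) * p^`().
Definition opL (b : nat) (p : {poly R}) :=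
  - (n%:R *: opE b p + (1 - 'X^2) * opE b.+2 (opE b p)).

Let hrnE := (hornerD, hornerN, hornerM, hornerZ, hornerX, hornerXn, hornerC).

Lemma is_derive_invX (b : nat) (r : R) : 0 < r ->
  is_derive r 1 (fun s : R => s ^- b) (- b%:R * r ^- b.+1).
Proof.
move=> r0; have rn0 : r != 0 by rewrite gt_eqF.
have dV : is_derive r 1 (fun s : R => s^-1) (- r ^- 2).
  by have := @is_deriveV R id r 1 1 rn0 _ => d; apply: is_derive_eq; rewrite [LHS]mulr1.
elim: b => [|b ih].
  by rewrite (_ : (fun s => _) = cst 1);
    [apply: is_derive_eq; rewrite oppr0 mul0r|apply/funext => s; rewrite expr0 invr1].
rewrite (_ : (fun s => _) = (fun s => s ^- b * s^-1)); last first.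
  by apply/funext => s; rewrite exprS invfM mulrC.
have := is_deriveM ih dV => d; apply: (is_derive_eq d).
rewrite /GRing.scale/= -!exprVn; move: (r^-1) => q.
by rewrite !exprS expr0; ring.
Qed.

Lemma is_derive_radial (b : nat) (p : {poly R}) t (r : R) : 0 < r ->
  is_derive r 1 (fun s => s ^- b * p.[t / s]) (r ^- b.+1 * (opE b p).[t / r]).
Proof.
move=> r0; have rn0 : r != 0 by rewrite gt_eqF.
have dV : is_derive r 1 (fun s : R => t / s) (- t * r ^- 2).
  have := is_derive_invX 1 r0 => d1.
  rewrite (_ : (fun s => _) = (fun s => t * s ^- 1)); last by apply/funext => s; rewrite expr1.
  by have := is_deriveZ t d1 => d; apply: (is_derive_eq d); rewrite /GRing.scale/=; ring.
have dp : is_derive r 1 (fun s => p.[t / s]) (p^`().[t / r] * (- t * r ^- 2)).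
  exact: (@is_derive1_comp R (horner p) (fun s => t / s)).
have := is_deriveM (is_derive_invX b r0) dp => d; apply: (is_derive_eq d).
rewrite /opE /GRing.scale/= !hrnE -!exprVn; move: (r^-1) => q.
by rewrite !exprS expr0; ring.
Qed.

Lemma is_derive_K (i : 'I_n) b p t x : 0 < t ->
  is_derive x (ebasis R i) (K b p t) (x ord0 i * K b.+2 (opE b p) t x).
Proof.
move=> t0; have N0 := N_gt0 x t0.
have := is_derive_chain (is_derive_N i x t0) (@is_derive_radial b p t _ N0).
move=> h; apply: (is_derive_eq h); rewrite /K !exprSr.
by field; rewrite expf_neq0// gt_eqF.
Qed.

Lemma is_derive_Kt b p t x : 0 < t ->
  is_derive t 1 (fun s => K b p s x) (K b.+1 (opT b p) t x).
Proof.
move=> t0; have N0 := N_gt0 x t0; have dN := is_derive_Nt x t0.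
have dNb := @is_derive1_comp R (fun s => s ^- b) (fun s => N s x) t _ _
  (is_derive_invX b N0) dN.
have dNi := @is_derive1_comp R (fun s => s ^- 1) (fun s => N s x) t _ _
  (is_derive_invX 1 N0) dN.
have dq : is_derive t 1 (fun s => s / N s x) ((N t x)^-1 - t ^+ 2 * (N t x) ^- 3).
  rewrite (_ : (fun s => _) = (fun s => s * (N s x) ^- 1)); last first.
    by apply/funext => s; rewrite expr1.
  have := is_deriveM (is_derive_id t 1) dNi => d; apply: (is_derive_eq d).
  by rewrite /GRing.scale/= -!exprVn; move: ((N t x)^-1) => q; ring.
have dp : is_derive t 1 (fun s => p.[s / N s x])
    (p^`().[t / N t x] * ((N t x)^-1 - t ^+ 2 * (N t x) ^- 3)).
  exact: (@is_derive1_comp R (horner p) (fun s => s / N s x)).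
have := is_deriveM dNb dp => d; apply: (is_derive_eq d).
rewrite /K /opT /GRing.scale/= !hrnE -!exprVn; move: ((N t x)^-1) => q.
by rewrite !exprS expr0; ring.
Qed.

Lemma partial_K i b p t : 0 < t ->
  partial i (K b p t) = (fun x => x ord0 i * K b.+2 (opE b p) t x).
Proof.
by move=> t0; apply/funext => x; rewrite partialE; have [_ ->] := is_derive_K i b p x t0.
Qed.

(** Summing the second derivatives produces [sqn x], and [sqn x = (1 - (t/N)^2) N^2] brings it back
    to a polynomial in [t/N]; hence the factor [1 - 'X^2] in [opL]. *)
Lemma lap_K b p t x : 0 < t -> - lap (K b p t) x = K b.+2 (opL b p) t x.
Proof.
move=> t0; have N0 := N_gt0 x t0; rewrite lapE.
have E i : partial i (partial i (K b p t)) x =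
   K b.+2 (opE b p) t x + x ord0 i ^+ 2 * K b.+4 (opE b.+2 (opE b p)) t x.
  rewrite (partial_K i b p t0) partialE.
  have := is_deriveM (is_derive_coord i i x) (is_derive_K i b.+2 (opE b p) x t0).
  case=> _ E; rewrite [LHS]E eqxx /GRing.scale/=; ring.
under eq_bigr do rewrite E.
rewrite big_split/= sumr_const card_ord -mulr_suml -/(sqn x).
have -> : sqn x = (1 - (t / N t x) ^+ 2) * N t x ^+ 2.
  transitivity (N t x ^+ 2 - t ^+ 2); first by rewrite sqr_N addrAC subrr add0r.
  by field; rewrite gt_eqF.
rewrite /K /opL; move: (opE b.+2 (opE b p)) (opE b p) => E2 E1.
rewrite !hrnE -[in LHS]mulr_natl !(exprS (N t x)) expr0.
by field; rewrite expf_neq0 gt_eqF.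
Qed.

Let drvE := (derivD, derivN, derivB, derivM, derivZ, derivX, derivXn, derivC).

(** The height derivative commutes with the Laplacian in [x]; in terms of polynomials this is an
    identity that needs no exchange of limits. *)
Lemma opL_opT b p : opL b.+1 (opT b p) = opT b.+2 (opL b p).
Proof.
rewrite /opL /opT /opE !drvE (_ : 2.-1 = 1%N)// expr1 -!mul_polyC.
ring.
Qed.

(** Harmonicity of the Poisson kernel: [K n 'X t x = t N^(-n-1)], and minus its Laplacian in [x] is
    its second derivative in [t]. *)
Lemma opL_X : opL n 'X = opT n.+1 (opT n 'X).
Proof.
rewrite /opL /opT /opE !drvE (_ : 2.-1 = 1%N)// expr1 -!mul_polyC.
ring.
Qed.

End Nnorm.

(** * The Poisson kernel and its height derivatives *)

Section kernel_class.
Context {R : realType} {n : nat}.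
Implicit Types (x : 'rV[R]_n) (t : R) (f g : 'rV[R]_n -> R).

(** The index is a guaranteed order of decay. The factors [x_i / N] are bounded by 1 and cost
    nothing, each partial derivative raises the order by one, and [hk_up] forgets surplus decay. *)
Inductive homk t : nat -> ('rV[R]_n -> R) -> Prop :=
| hk_N b : homk t b (fun x => N t x ^- b)
| hk_X i b f : homk t b f -> homk t b (fun x => x ord0 i / N t x * f x)
| hk_D b f g : homk t b f -> homk t b g -> homk t b (fun x => f x + g x)
| hk_Z c b f : homk t b f -> homk t b (fun x => c * f x)
| hk_up b f : homk t b.+1 f -> homk t b f.

Lemma homk_ext t b f g : f =1 g -> homk t b f -> homk t b g.
Proof. by move=> /funext ->. Qed.

Lemma homk_divN t b f : homk t b f -> homk t b.+1 (fun x => (N t x)^-1 * f x).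
Proof.
elim=> {b f} [b|i b f _ ih|b f g _ ihf _ ihg|c b f _ ih|b f _ ih].
- by apply: homk_ext (hk_N t b.+1) => x; rewrite exprS invfM.
- by apply: homk_ext (hk_X i ih) => x; rewrite mulrCA.
- by apply: homk_ext (hk_D ihf ihg) => x; rewrite mulrDr.
- by apply: homk_ext (hk_Z c ih) => x; rewrite mulrCA.
- exact: hk_up.
Qed.

Lemma homk_is_derive t b f i : 0 < t -> homk t b f ->
  exists2 g, homk t b.+1 g & forall x, is_derive x (ebasis R i) f (g x).
Proof.
move=> t0; elim=> {b f} [b|j b f hf0 [g hg dg]|b f g _ [f' hf df] _ [g' hg dg]|c b f _ [g hg dg]|b f _ [g hg dg]].
- exists (fun x => - b%:R * (x ord0 i / N t x * N t x ^- b.+1)).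
    exact/hk_Z/hk_X/hk_N.
  move=> x; have N0 := N_gt0 x t0.
  have := is_derive_chain (is_derive_N i x t0) (is_derive_invX b N0) => d.
  by apply: (is_derive_eq d); ring.
- exists (fun x => (i == j)%:R * ((N t x)^-1 * f x) +
      (-1 * (x ord0 j / N t x * (x ord0 i / N t x * ((N t x)^-1 * f x))) +
       x ord0 j / N t x * g x)).
    apply: hk_D; first exact/hk_Z/homk_divN.
    by apply: hk_D; [exact/hk_Z/hk_X/hk_X/homk_divN|exact: hk_X].
  move=> x; have N0 := N_gt0 x t0.
  have d1 := is_derive_chain (is_derive_N i x t0) (is_derive_invX 1 N0).
  have d2 := is_deriveM (is_deriveM (is_derive_coord i j x) d1) (dg x).
  apply: (is_derive_eq d2).
  rewrite fctE /GRing.scale/= -!exprVn; move: (N t x)^-1 => q.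
  by rewrite !exprS expr0; ring.
- exists (fun x => f' x + g' x); first exact: hk_D.
  by move=> x; exact: is_deriveD (df x) (dg x).
- exists (fun x => c * g x); first exact: hk_Z.
  by move=> x; have d := is_deriveZ c (dg x); exact: (is_derive_eq d erefl).
- by exists g => //; exact: hk_up.
Qed.

Lemma continuous_N t : continuous (@N R n t).
Proof.
move=> x.
have c1 : {for x, continuous (fun y : 'rV[R]_n => t ^+ 2 + sqn y)}.
  exact: cvgD (cvg_cst (t ^+ 2)) (@continuous_sqn R n x).
exact: (@continuous_comp _ _ _ (fun y : 'rV[R]_n => t ^+ 2 + sqn y) Num.sqrt x c1
  (@sqrt_continuous R _)).
Qed.

Lemma homk_continuous t b f : 0 < t -> homk t b f -> continuous f.
Proof.
move=> t0; elim=> {b f} [b|j b f _ cf|b f g _ cf _ cg|c b f _ cf|//] x.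
- have N0 : N t x ^+ b != 0 by rewrite expf_neq0// gt_eqF ?N_gt0.
  have c1 : {for x, continuous (fun y : 'rV[R]_n => N t y ^+ b)}.
    exact: (@continuous_comp _ _ _ (@N R n t) (fun r => r ^+ b) x (@continuous_N t x)
      (@exprn_continuous R b _)).
  exact: cvgV N0 c1.
- have N0 : N t x != 0 by rewrite gt_eqF ?N_gt0.
  have c0 : {for x, continuous (fun y : 'rV[R]_n => y ord0 j)}.
    exact: continuous_coord.
  have c1 : {for x, continuous (fun y : 'rV[R]_n => (N t y)^-1)}.
    exact: cvgV N0 (@continuous_N t x).
  have c2 : {for x, continuous (fun y : 'rV[R]_n => y ord0 j / N t y)}.
    exact: cvgM c0 c1.
  exact: cvgM c2 (cf x).
- exact: cvgD (cf x) (cg x).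
- exact: cvgM (cvg_cst c) (cf x).
Qed.

Lemma homk_bound t b f : 0 < t -> homk t b f ->
  exists2 C, 0 <= C & forall x, `|f x| <= C * N t x ^- b.
Proof.
move=> t0; elim=> {b f} [b|j b f _ [C C0 fC]|b f g _ [C C0 fC] _ [D D0 gD]|c b f _ [C C0 fC]|b f _ [C C0 fC]].
- by exists 1 => // x; rewrite mul1r ger0_norm// invr_ge0 exprn_ge0// N_ge0.
- exists C => // x; rewrite normrM (le_trans _ (fC x))// ler_piMl//.
  rewrite normrM normfV (ger0_norm (N_ge0 _ _)) ler_pdivrMr ?N_gt0// mul1r.
  exact: le_coord_N.
- exists (C + D) => [|x]; first exact: addr_ge0.
  by rewrite (le_trans (ler_normD _ _))// mulrDl lerD.
- exists (`|c| * C) => [|x]; first exact: mulr_ge0.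
  by rewrite normrM -mulrA ler_wpM2l.
- exists (C / t) => [|x]; first by rewrite divr_ge0// ltW.
  rewrite (le_trans (fC x))// -mulrA ler_wpM2l// exprS invfM.
  rewrite ler_wpM2r ?invr_ge0 ?exprn_ge0 ?N_ge0// lef_pV2 ?posrE ?N_gt0//.
  exact: le_t_N.
Qed.

Lemma homk_partial t b f i : 0 < t -> homk t b f -> homk t b.+1 (partial i f).
Proof.
move=> t0 hf; have [g hg dg] := homk_is_derive i t0 hf.
by apply: homk_ext hg => x; rewrite partialE; have [_ ->] := dg x.
Qed.

Lemma homk_smooth t b f : 0 < t -> homk t b f -> smooth f.
Proof.
move=> t0 hf; apply: (smooth_coind (F := fun f => exists b, homk t b f)); last by exists b.
move=> {b hf} g [b hg]; split=> [|i]; first exact: homk_continuous hg.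
split=> [x|]; last by exists b.+1; exact: homk_partial.
by have [g' _ dg] := homk_is_derive i t0 hg; have [] := dg x.
Qed.

Lemma homk_addn t b k f : homk t (b + k)%N f -> homk t b f.
Proof. by elim: k => [|k ih]; [rewrite addn0|rewrite addnS => /hk_up/ih]. Qed.

Lemma homk_tame t b f : 0 < t -> homk t b f ->
  tame (fun x => N t x ^- b) (fun=> f) f.
Proof.
move=> t0 hf; have sf := homk_smooth t0 hf; split=> // s.
split=> [|x]; last exact: cvg_cst.
have : homk t (b + size s)%N (iter_partial s f).
  elim: s => [|i s ih]; first by rewrite addn0.
  by rewrite /= addnS; exact: homk_partial.
by move=> /homk_addn/(homk_bound t0)[C C0 hC]; exists C.
Qed.

(** At fixed height [t] the powers [t^k] are constants, so expanding [p] leaves a finite sum of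
    multiples of [N t x ^- (b + k)]. *)
Lemma homk_K t b p : 0 < t -> homk t b (K b p t).
Proof.
move=> t0; have hs k : homk t b (fun x => p`_k * t ^+ k * N t x ^- (b + k)%N).
  by apply: hk_Z; exact: homk_addn (hk_N t (b + k)%N).
have h0 : homk t b (fun=> 0).
  by apply: homk_ext (hk_Z 0 (hk_N t b)) => x; rewrite mul0r.
have H m : homk t b (fun x => \sum_(k < m) p`_k * t ^+ k * N t x ^- (b + k)%N).
  elim: m => [|m ih]; first by apply: homk_ext h0 => x; rewrite big_ord0.
  by apply: homk_ext (hk_D ih (hs m)) => x; rewrite big_ord_recr.
apply: homk_ext (H (size p)) => x; rewrite /K horner_coef big_distrr/=.
by apply: eq_bigr => k _; rewrite exprMn exprD invfM exprVn; ring.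
Qed.

Lemma K_bound b p : exists2 C : R, 0 <= C &
  forall t x, 0 < t -> `|K b p t x| <= C * N t x ^- b.
Proof.
exists (\sum_(k < size p) `|p`_k|) => [|t x t0]; first exact: sumr_ge0.
have N0 := N_gt0 x t0.
have Nb0 : 0 <= N t x ^- b by rewrite invr_ge0 exprn_ge0// ltW.
rewrite /K normrM mulrC (ger0_norm Nb0).
rewrite ler_wpM2r ?invr_ge0 ?exprn_ge0 ?(ltW N0)// horner_coef.
rewrite (le_trans (ler_norm_sum _ _ _))//; apply: ler_sum => k _.
rewrite normrM ler_piMr// ger0_norm; last by rewrite exprn_ge0// divr_ge0// ltW.
by rewrite exprn_ile1 ?divr_ge0 ?(ltW t0) ?(ltW N0)// ler_pdivrMr// mul1r le_t_N.
Qed.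

Fixpoint tau (j : nat) : {poly R} :=
  if j is k.+1 then opT (n + k) (tau k) else 'X.

(* The [j]-th height derivative of the unnormalised Poisson kernel [t * N t x ^- n.+1], whose
   integral is [kappa]. *)
Definition Dk (j : nat) t : 'rV[R]_n -> R := K (n + j) (tau j) t.

Lemma is_derive_Dk j t x : 0 < t -> is_derive t 1 (fun s => Dk j s x) (Dk j.+1 t x).
Proof. by move=> t0; rewrite /Dk addnS; exact: is_derive_Kt. Qed.

(** Harmonicity is inherited by all height derivatives through [opL_opT]: applying [- lap] amounts
    to two more derivatives in the height. *)
Lemma opL_tau j : @opL R n (n + j) (tau j) = tau j.+2.
Proof.
elim: j => [|j ih]; first by rewrite /= addn0 addn1; exact: opL_X.
have E1 : tau j.+1 = opT (n + j) (tau j) by [].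
have E3 : tau j.+3 = opT (n + j.+2) (tau j.+2) by [].
by rewrite E3 [in LHS]E1 addnS opL_opT ih !addnS.
Qed.

Lemma neglap_pow_Dk m j t : 0 < t -> neglap_pow m (Dk j t) = Dk (j + m.*2) t.
Proof.
move=> t0; elim: m => [|m ih]; first by rewrite addn0.
rewrite neglap_powS ih; apply/funext => x; rewrite /Dk lap_K// opL_tau.
by rewrite doubleS !addnS.
Qed.

Lemma Dk0 t x : Dk 0 t x = t * N t x ^- n.+1.
Proof. by rewrite /Dk /K /= hornerX addn0 exprS invfM; ring. Qed.

(** For [j = 0] the general bound for [K] only gives decay of order [n]; the missing power comes
    from the explicit form [t * N t x ^- n.+1]. *)
Lemma homk_Dk j t : 0 < t -> homk t n.+1 (Dk j t).
Proof.
move=> t0; case: j => [|j].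
  by apply: homk_ext (hk_Z t (hk_N t n.+1)) => x; rewrite Dk0.
by apply: (@homk_addn t n.+1 j); rewrite addSnnS; exact: homk_K.
Qed.

End kernel_class.

(** * Cut-off functions and weights *)

Section bump.
Context {R : realType}.

(** The classical flat function [exp(-1/x)] together with the factors that its derivatives create:
    the family is closed under derivatives, which is why all [j] are treated at once. *)
Definition theta (j : nat) (x : R) : R := if 0 < x then x ^- j * expR (- x^-1) else 0.

Lemma theta_le0 j x : x <= 0 -> theta j x = 0.
Proof. by move=> x0; rewrite /theta ltNge x0. Qed.

Lemma theta_gt0 j x : 0 < x -> theta j x = x ^- j * expR (- x^-1).
Proof. by move=> x0; rewrite /theta x0. Qed.

Lemma theta_ge0 j x : 0 <= theta j x.
Proof.
by rewrite /theta; case: ifP => // x0; rewrite mulr_ge0 ?expR_ge0// invr_ge0 exprn_ge0// ltW.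
Qed.

(** From [exp y >= y^(j+2) / (j+2)!] at [y = 1/x]; the two powers beyond [j] leave the factor [x^2],
    hence continuity at 0. *)
Lemma theta_bound j x : theta j x <= (j.+2)`!%:R * x ^+ 2.
Proof.
have [x0|x0] := leP x 0.
  by rewrite theta_le0// mulr_ge0 ?sqr_ge0.
rewrite theta_gt0//; have y0 : 0 < x^-1 by rewrite invr_gt0.
have h := expR_ge1Dxn j.+1 (ltW y0).
rewrite expRN ler_pdivrMr ?expR_gt0//.
have f0 : 0 < (j.+2)`!%:R :> R by rewrite ltr0n fact_gt0.
apply: (@le_trans _ _ ((j.+2)`!%:R * x ^+ 2 * (x^-1 ^+ j.+2 / (j.+2)`!%:R))).
  rewrite le_eqVlt; apply/orP; left; apply/eqP; rewrite [x^-1 ^+ _]exprS [x^-1 ^+ j.+1]exprS -exprVn.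
  by move: (x^-1 ^+ j) => Y; field; rewrite !gt_eqF.
rewrite ler_wpM2l//; first by rewrite mulr_ge0 ?sqr_ge0// ltW.
by apply: le_trans h; rewrite lerDr.
Qed.

Lemma continuous_theta0 j : {for 0, continuous (theta j)}.
Proof.
rewrite /prop_for /continuous_at theta_le0//.
apply: (@squeeze_cvgr _ _ _ _ (cst 0) (fun x => (j.+2)`!%:R * x ^+ 2)).
- by apply: nearW => x; rewrite theta_ge0 theta_bound.
- exact: cvg_cst.
- have := cvgM (cvg_cst ((j.+2)`!%:R : R)) (@exprn_continuous R 2 0).
  by rewrite expr0n/= mulr0; exact.
Qed.

Lemma is_derive_theta j (x : R) :
  is_derive x 1 (theta j) (- j%:R * theta j.+1 x + theta j.+2 x).
Proof.
have [x0|x0|->] := ltgtP x 0.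
- rewrite !theta_le0 ?ltW// mulr0 addr0.
  have d0 : is_derive x 1 (fun=> 0 : R) 0 by exact: is_derive_cst.
  apply: near_eq_is_derive d0.
  have : \forall y \near x, y < 0 by exact: lt_nbhsl.
  by apply: filterS => y y0; rewrite theta_le0// ltW.
- rewrite !theta_gt0//.
  have dV : is_derive x 1 (fun y : R => - y^-1) (x ^- 2).
    have d := is_deriveN (is_derive_invX 1 x0).
    by apply: (is_derive_eq d); rewrite mulN1r opprK.
  have dE : is_derive x 1 (fun y : R => expR (- y^-1)) (expR (- x^-1) * x ^- 2).
    exact: (@is_derive1_comp R expR (fun y => - y^-1)).
  have dg : is_derive x 1 (fun y : R => y ^- j * expR (- y^-1))
      (- j%:R * (x ^- j.+1 * expR (- x^-1)) + x ^- j.+2 * expR (- x^-1)).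
    have d := is_deriveM (is_derive_invX j x0) dE.
    apply: (is_derive_eq d); rewrite /GRing.scale/= -!exprVn.
    by move: (x^-1) => q; rewrite !exprS expr0; ring.
  apply: near_eq_is_derive dg.
  have : \forall y \near x, 0 < y by exact: lt_nbhsr.
  by apply: filterS => y y0; rewrite theta_gt0.
(* At 0 the difference quotient [theta j z / z] is [theta j.+1 z], which is continuous there with
   value 0. *)
- rewrite !theta_le0// mulr0 addr0; apply/is_derive1_caratheodory.
  exists (theta j.+1); split; [|exact: continuous_theta0|by rewrite theta_le0].
  move=> z; rewrite (theta_le0 j (lexx 0)) !subr0; have [z0|z0] := leP z 0.
    by rewrite !theta_le0// mul0r.
  by rewrite !theta_gt0// exprS invfM; field; rewrite expf_neq0 gt_eqF.
Qed.

Lemma continuous_theta j : continuous (theta j).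
Proof.
move=> x; apply/differentiable_continuous/derivable1_diffP.
by have [] := is_derive_theta j x.
Qed.

Lemma theta_le1 j x : x <= 1 -> theta j x <= (j.+2)`!%:R.
Proof.
move=> x1; have [x0|x0] := leP x 0; first by rewrite theta_le0.
by rewrite (le_trans (theta_bound j x))// ler_piMr// exprn_ile1// ltW.
Qed.

Context {n : nat}.
Implicit Types (x : 'rV[R]_n) (eps : R).

(** The index counts the powers of [eps] that derivatives bring out. The factors [eps * x_i] are not
    counted, because they are bounded by 1 where the bump does not vanish. *)
Inductive bumpk : nat -> (R -> 'rV[R]_n -> R) -> Prop :=
| bk_theta j : bumpk 0 (fun eps x => theta j (1 - eps ^+ 2 * sqn x))
| bk_X i l f : bumpk l f -> bumpk l (fun eps x => eps * x ord0 i * f eps x)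
| bk_eps l f : bumpk l f -> bumpk l.+1 (fun eps x => eps * f eps x)
| bk_D l f g : bumpk l f -> bumpk l g -> bumpk l (fun eps x => f eps x + g eps x)
| bk_Z c l f : bumpk l f -> bumpk l (fun eps x => c * f eps x).

Lemma is_derive_theta_sqn i j eps x :
  is_derive x (ebasis R i) (fun y => theta j (1 - eps ^+ 2 * sqn y))
   ((- j%:R * theta j.+1 (1 - eps ^+ 2 * sqn x) + theta j.+2 (1 - eps ^+ 2 * sqn x)) *
    (- 2 * (eps * (eps * x ord0 i)))).
Proof.
have d1 := is_deriveZ (eps ^+ 2) (is_derive_sqn i x).
have d2 : is_derive x (ebasis R i) (fun y => 1 - eps ^+ 2 * sqn y)
    (- 2 * (eps * (eps * x ord0 i))).
  have d := is_deriveB (is_derive_cst (1 : R) x (ebasis R i)) d1.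
  by apply: (is_derive_eq d); rewrite /GRing.scale/=; ring.
exact: is_derive_chain d2 (is_derive_theta j _).
Qed.

Lemma bumpk_is_derive i l f : bumpk l f ->
  exists2 g, bumpk l.+1 g & forall eps x, is_derive x (ebasis R i) (f eps) (g eps x).
Proof.
elim=> {l f} [j|j l f hf [g hg dg]|l f _ [g hg dg]|l f g _ [f' hf df] _ [g' hg dg]|c l f _ [g hg dg]].
- exists (fun eps x => - 2 * (- j%:R * (eps * (eps * x ord0 i * theta j.+1 (1 - eps ^+ 2 * sqn x))) +
      eps * (eps * x ord0 i * theta j.+2 (1 - eps ^+ 2 * sqn x)))).
    apply: bk_Z; apply: bk_D; last exact/bk_eps/bk_X/bk_theta.
    exact/bk_Z/bk_eps/bk_X/bk_theta.
  move=> eps x; have d := is_derive_theta_sqn i j eps x.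
  by apply: (is_derive_eq d); ring.
- exists (fun eps x => (i == j)%:R * (eps * f eps x) + eps * x ord0 j * g eps x).
    by apply: bk_D; [exact/bk_Z/bk_eps|exact: bk_X].
  move=> eps x; have d1 := is_deriveZ eps (is_derive_coord i j x).
  have d2 := is_deriveM d1 (dg eps x).
  by apply: (is_derive_eq d2); rewrite /= /GRing.scale/=; ring.
- exists (fun eps x => eps * g eps x); first exact: bk_eps.
  by move=> eps x; have d := is_deriveZ eps (dg eps x); exact: (is_derive_eq d erefl).
- exists (fun eps x => f' eps x + g' eps x); first exact: bk_D.
  by move=> eps x; exact: is_deriveD (df eps x) (dg eps x).
- exists (fun eps x => c * g eps x); first exact: bk_Z.
  by move=> eps x; have d := is_deriveZ c (dg eps x); exact: (is_derive_eq d erefl).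
Qed.

Lemma continuous_theta_sqn j eps :
  continuous (fun x : 'rV[R]_n => theta j (1 - eps ^+ 2 * sqn x)).
Proof.
move=> x; have c1 : {for x, continuous (fun y : 'rV[R]_n => 1 - eps ^+ 2 * sqn y)}.
  exact: cvgB (cvg_cst (1 : R)) (cvgM (cvg_cst (eps ^+ 2)) (@continuous_sqn R n x)).
exact: (@continuous_comp _ _ _ _ (theta j) x c1 (@continuous_theta j _)).
Qed.

Lemma bumpk_continuous l f eps : bumpk l f -> continuous (f eps).
Proof.
elim=> {l f} [j|j l f _ cf|l f _ cf|l f g _ cf _ cg|c l f _ cf] x.
- exact: continuous_theta_sqn.
- exact: cvgM (cvgM (cvg_cst eps) (@continuous_coord R n j x)) (cf x).
- exact: cvgM (cvg_cst eps) (cf x).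
- exact: cvgD (cf x) (cg x).
- exact: cvgM (cvg_cst c) (cf x).
Qed.

Lemma bumpk_supp l f eps x : bumpk l f -> 1 <= eps ^+ 2 * sqn x -> f eps x = 0.
Proof.
move=> + h; elim=> {l f} [j|j l f _ e|l f _ e|l f g _ e1 _ e2|c l f _ e].
- by rewrite theta_le0// subr_le0.
- by rewrite e mulr0.
- by rewrite e mulr0.
- by rewrite e1 e2 addr0.
- by rewrite e mulr0.
Qed.

Lemma bumpk_bound l f : bumpk l f -> exists2 C, 0 <= C &
  forall eps x, 0 <= eps -> `|f eps x| <= C * eps ^+ l.
Proof.
elim=> {l f} [j|j l f hf [C C0 fC]|l f _ [C C0 fC]|l f g _ [C C0 fC] _ [D D0 gD]|c l f _ [C C0 fC]].
- exists (j.+2)`!%:R => // eps x e0; rewrite mulr1 ger0_norm ?theta_ge0// theta_le1//.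
  by rewrite gerBl mulr_ge0 ?sqr_ge0 ?sqn_ge0.
- exists C => // eps x e0; have [h|h] := leP 1 (eps ^+ 2 * sqn x).
    by rewrite (bumpk_supp hf h) mulr0 normr0 mulr_ge0// exprn_ge0.
  rewrite normrM (le_trans _ (fC eps x e0))// ler_piMl//.
  rewrite -(@ler_sqr R) ?nnegrE// expr1n real_normK ?num_real// exprMn.
  by rewrite (le_trans _ (ltW h))// ler_wpM2l ?sqr_ge0// coord_sqn.
- exists C => // eps x e0; rewrite normrM ger0_norm// exprS mulrCA.
  by rewrite ler_wpM2l// fC.
- exists (C + D) => [|eps x e0]; first exact: addr_ge0.
  by rewrite (le_trans (ler_normD _ _))// mulrDl lerD// ?fC ?gD.
- exists (`|c| * C) => [|eps x e0]; first exact: mulr_ge0.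
  by rewrite normrM -mulrA ler_wpM2l// fC.
Qed.

Lemma bumpk_ext l f g : (forall eps x, f eps x = g eps x) -> bumpk l f -> bumpk l g.
Proof.
move=> fg; suff -> : f = g by [].
by apply/funext => eps; apply/funext => x; exact: fg.
Qed.

Lemma bumpk_partial i l f : bumpk l f -> bumpk l.+1 (fun eps => partial i (f eps)).
Proof.
move=> /(bumpk_is_derive i)[g hg dg]; apply: bumpk_ext hg => eps x.
by rewrite partialE; have [_ ->] := dg eps x.
Qed.

Lemma bumpk_iter_partial s l f : bumpk l f ->
  bumpk (l + size s)%N (fun eps => iter_partial s (f eps)).
Proof.
move=> hf; elim: s => [|i s ih]; first by rewrite addn0.
by rewrite /= addnS; exact: bumpk_partial.
Qed.

Lemma bumpk_smooth l f eps : bumpk l f -> smooth (f eps).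
Proof.
move=> hf; apply: (smooth_coind (F := fun g => exists l f, bumpk l f /\ g = f eps));
  last by exists l, f.
move=> {hf} _ [{}l [{}f [hf ->]]]; split=> [|i]; first exact: bumpk_continuous hf.
split=> [x|]; last by exists l.+1, (fun eps => partial i (f eps)); split => //; exact: bumpk_partial.
by have [g _ dg] := bumpk_is_derive i hf; have [] := dg eps x.
Qed.

(** Since [theta 0 1 = exp(-1)], the factor [expR 1] makes the value at the origin 1; the support is
    the ball of radius [1/eps]. *)
Definition chi eps x : R := expR 1 * theta 0 (1 - eps ^+ 2 * sqn x).

Lemma bumpk_chi : bumpk 0 chi.
Proof. exact: (bk_Z (expR 1) (bk_theta 0)). Qed.

Lemma chi_ge0 eps x : 0 <= chi eps x.
Proof. by rewrite mulr_ge0 ?expR_ge0 ?theta_ge0. Qed.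

Lemma chi_le1 eps x : chi eps x <= 1.
Proof.
rewrite /chi; have [h|h] := leP (1 - eps ^+ 2 * sqn x) 0.
  by rewrite theta_le0// mulr0.
rewrite theta_gt0// expr0 invr1 mul1r -expRD -[leRHS]expR0 ler_expR subr_le0 invf_ge1//.
by rewrite gerBl mulr_ge0 ?sqr_ge0 ?sqn_ge0.
Qed.

Lemma chi_csupp eps : 0 < eps -> csupp (chi eps).
Proof.
move=> e0; exists eps^-1 => x [i xi]; rewrite (bumpk_supp bumpk_chi)//.
rewrite (@le_trans _ _ (eps ^+ 2 * x ord0 i ^+ 2))//; last first.
  by rewrite ler_wpM2l ?sqr_ge0// coord_sqn.
rewrite -[_ ^+ 2 in X in _ * X]real_normK ?num_real// -exprMn.
by rewrite exprn_ege1// -ler_pdivrMl// mulr1 ltW.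
Qed.

Lemma partial_chi i eps x : partial i (chi eps) x =
  - (eps ^+ 2 * x ord0 i) * (2 * expR 1 * theta 2 (1 - eps ^+ 2 * sqn x)).
Proof.
rewrite partialE; have d := is_deriveZ (expR 1) (is_derive_theta_sqn i 0 eps x).
by case: d => _ E; rewrite [LHS]E /GRing.scale/=; ring.
Qed.

Lemma partial_chi_bound : exists2 C, 0 <= C &
  forall i eps x, 0 <= eps -> `|partial i (chi eps) x| <= C * eps.
Proof.
have H i : {C | 0 <= C & forall eps x, 0 <= eps -> `|partial i (chi eps) x| <= C * eps}.
  apply/cid2; have [C C0 hC] := bumpk_bound (bumpk_partial i bumpk_chi).
  by exists C => // eps x e0; have := hC eps x e0; rewrite expr1.
exists (\sum_i s2val (H i)) => [|i eps x e0].
  by apply: sumr_ge0 => i _; case: (H i).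
case E : (H i) => [C C0 hC]; rewrite (le_trans (hC eps x e0))// ler_wpM2r//.
rewrite (bigD1 i)//= E/= lerDl; apply: sumr_ge0 => j _; by case: (H j).
Qed.

Lemma chi_tame (eps : nat -> R) : (forall k, 0 < eps k <= 1) -> eps @ \oo --> 0 ->
  tame (fun=> 1) (fun k => chi (eps k)) (fun=> 1).
Proof.
move=> e01 e0; have ek0 k : 0 <= eps k by have /andP[/ltW] := e01 k.
split=> [k||s]; [exact: bumpk_smooth bumpk_chi|exact: smooth_cst|].
have [C C0 hC] := bumpk_bound (bumpk_iter_partial s bumpk_chi).
split=> [|x].
  exists C => // k x; rewrite (le_trans (hC (eps k) x (ek0 k)))// ler_wpM2l//.
  by rewrite exprn_ile1//; have /andP[] := e01 k.
(* A derivative of positive order carries at least one factor [eps k] and tends to 0; only the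
   function itself has the limit 1. *)
rewrite iter_partial_cst; case: s hC => [|i s] hC; last first.
  have c : C * eps k ^+ (0 + size (i :: s))%N @[k --> \oo] --> 0.
    have ce : eps k ^+ (0 + size (i :: s))%N @[k --> \oo] --> 0.
      have := @cvg_comp _ _ _ eps (fun r => r ^+ (0 + size (i :: s))%N) _ _ _ e0
        (@exprn_continuous R (0 + size (i :: s)) 0).
      by rewrite expr0n/=; exact.
    by have := cvgM (cvg_cst C) ce; rewrite mulr0; exact.
  apply/cvgr0Pnorm_lt; have /cvgr0Pnorm_lt c' := c.
  move=> e e_gt0; have := c' e e_gt0; apply: filterS => k; apply: le_lt_trans.
  by rewrite (le_trans (hC (eps k) x (ek0 k)))// ler_norm.
have c1 : 1 - eps k ^+ 2 * sqn x @[k --> \oo] --> (1 : R).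
  have ce : eps k ^+ 2 @[k --> \oo] --> 0.
    have := @cvg_comp _ _ _ eps (fun r => r ^+ 2) _ _ _ e0 (@exprn_continuous R 2 0).
    by rewrite expr0n/=; exact.
  have := cvgB (cvg_cst (1 : R)) (cvgM ce (cvg_cst (sqn x))).
  by rewrite mul0r subr0; exact.
have c2 := @cvg_comp _ _ _ _ (theta 0) _ _ _ c1 (@continuous_theta 0 1).
have := cvgM (cvg_cst (expR 1)) c2.
by rewrite theta_gt0// expr0 invr1 mul1r -expRD subrr expR0; exact.
Qed.

End bump.

Section weights.
Context {R : realType}.

Definition hw (a s : R) : R := (1 + `|s|) `^ (- (1 + a)).

Lemma is_derive_1DpowR (r s : R) : - 1 < s ->
  is_derive s 1 (fun s => (1 + s) `^ r) (r * (1 + s) `^ (r - 1)).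
Proof.
move=> s1; have s0 : 0 < 1 + s by lra.
have d1 : is_derive s 1 (fun s : R => 1 + s) 1.
  have d := is_deriveD (is_derive_cst (1 : R) s 1) (is_derive_id s 1).
  by apply: (is_derive_eq d); rewrite add0r.
have d := @is_derive1_comp R (fun y => y `^ r) (fun s => 1 + s) s _ _ (is_derive1_powR r s0) d1.
by apply: (is_derive_eq d); rewrite mulr1.
Qed.

Lemma continuous_1DpowR (r s : R) : - 1 < s -> {for s, continuous (fun y : R => (1 + y) `^ r)}.
Proof.
move=> s1; apply/differentiable_continuous/derivable1_diffP.
by have [] := is_derive_1DpowR r s1.
Qed.

Lemma continuous_hw a : continuous (hw a).
Proof.
move=> s; have s1 : - 1 < `|s| by rewrite (lt_le_trans _ (normr_ge0 s))// oppr_lt0.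
have -> : hw a = (fun y : R => (1 + y) `^ (- (1 + a))) \o Num.norm by [].
apply: continuous_comp; first exact: norm_continuous.
exact: continuous_1DpowR.
Qed.

Lemma hw_ge0 a s : 0 <= hw a s.
Proof. exact: powR_ge0. Qed.

Lemma intg_hw a : 0 < a -> intg (@lebesgue_measure R) (hw a).
Proof.
move=> a0; apply: intg_ge0P.
- exact: continuous_measurable_fun (@continuous_hw a).
- exact: hw_ge0.
rewrite ge0_symfun_integralT//; last 3 first.
- exact: hw_ge0.
- exact: continuous_hw.
- by move=> s; rewrite /hw /= normrN.
rewrite -set_itvcy lte_mul_pinfty// ?lee_fin//.
apply: (@le_lt_trans _ _ (a^-1)%:E); last exact: ltry.
have c := @ge0_cvgn_integral R (@lebesgue_measure R) (hw a) (hw_ge0 a)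
  (continuous_measurable_fun (@continuous_hw a)).
rewrite -(cvg_lim _ c)//; apply: lime_le; first by apply/cvg_ex; eexists; exact: c.
exists 1%N => // k /= k1; have k0 : 0 < k%:R :> R by rewrite ltr0n.
rewrite (@continuous_FTC2 _ (hw a) (fun s => - a^-1 * (1 + s) `^ (- a)))//.
- rewrite -EFinB lee_fin addr0 powR1 mulr1 opprK addrC gerDl mulNr oppr_le0.
  by rewrite mulr_ge0 ?powR_ge0// invr_ge0 ltW.
- exact/continuous_subspaceT/continuous_hw.
- have cF (s : R) : - 1 < s -> {for s, continuous (fun y : R => - a^-1 * (1 + y) `^ (- a))}.
    by move=> s1; exact: cvgM (cvg_cst (- a^-1)) (@continuous_1DpowR _ _ s1).
  split.
  + move=> s; rewrite in_itv/= => /andP[s0 _].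
    have s1 : - 1 < s by rewrite (lt_trans _ s0)// oppr_lt0.
    by have [] := is_deriveZ (- a^-1) (is_derive_1DpowR (- a) s1).
  + by apply/cvg_at_right_filter/cF; rewrite oppr_lt0.
  + by apply/cvg_at_left_filter/cF; rewrite (lt_trans _ k0)// oppr_lt0.
- move=> s; rewrite in_itv/= => /andP[s0 _].
  have s1 : - 1 < s by rewrite (lt_trans _ s0)// oppr_lt0.
  have [_ E] := is_deriveZ (- a^-1) (is_derive_1DpowR (- a) s1).
  rewrite derive1E [LHS]E /hw (ger0_norm (ltW s0)) /GRing.scale/= mulrA.
  by rewrite mulrNN mulVf ?gt_eqF// mul1r; congr (_ `^ _); lra.
Qed.

Context {n : nat}.
Implicit Types x : 'rV[R]_n.

Lemma N_ge1 x : 1 <= N 1 x.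
Proof. exact: le_t_N. Qed.

(** Instead of polar coordinates, the decay is shared among the coordinates: [1 + |x_i| <= 2 N]
    bounds the function by a tensor product of one-dimensional weights with exponent [1 + a/n]. *)
Lemma intg_powN a : 0 < a -> (0 < n)%N ->
  intg (lebn n) (fun x => N 1 x `^ (- (n%:R + a))).
Proof.
move=> a0 n0; have n0' : 0 < n%:R :> R by rewrite ltr0n.
pose b := a / n%:R; have b0 : 0 < b by rewrite divr_gt0.
have I := intg_tensor n (intg_hw b0) (hw_ge0 b).
apply: (intg_le _ _ (intgZ (2 `^ (n%:R + a)) I)).
  apply: continuous_measurable_rV => x.
  have N0 : 0 < N 1 x := N_gt0 x ltr01.
  have c : {for N 1 x, continuous (fun r : R => r `^ (- (n%:R + a)))}.
    apply/differentiable_continuous/derivable1_diffP.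
    by have [] := is_derive1_powR (- (n%:R + a)) N0.
  exact: (@continuous_comp _ _ _ (@N R n 1) _ x (@continuous_N R n 1 x) c).
move=> x; rewrite ger0_norm ?powR_ge0//.
have N0 : 0 < N 1 x := N_gt0 x ltr01; have N1 := N_ge1 x.
have -> : N 1 x `^ (- (n%:R + a)) = 2 `^ (n%:R + a) * \prod_(i < n) (2 * N 1 x) `^ (- (1 + b)).
  rewrite prodr_const card_ord -powR_mulrn ?powR_ge0// -powRrM.
  rewrite (_ : - (1 + b) * n%:R = - (n%:R + a)); last by rewrite /b; field; rewrite gt_eqF.
  rewrite powRM ?N_ge0// mulrA -powRD ?subrr ?powRr0 ?mul1r//.
  by apply/implyP => _; rewrite pnatr_eq0.
rewrite ler_wpM2l ?powR_ge0//; apply: ler_prod => i _; rewrite powR_ge0/= /hw.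
have x0 : 0 < 1 + `|x ord0 i| by rewrite ltr_pwDl.
have hle : 1 + `|x ord0 i| <= 2 * N 1 x.
  by have := le_coord_N 1 x i; lra.
rewrite !powRN lef_pV2 ?posrE ?powR_gt0 ?mulr_gt0//.
apply: (ge0_ler_powR _ _ _ hle); rewrite ?nnegrE ?(ltW x0)//.
  by rewrite addr_ge0// ltW.
by rewrite mulr_ge0// ltW.
Qed.

Lemma continuous_NX t b : 0 < t -> continuous (fun x : 'rV[R]_n => N t x ^- b).
Proof. by move=> t0; exact: homk_continuous t0 (hk_N t b). Qed.

Lemma NX_ge0 t b x : 0 <= N t x ^- b.
Proof. by rewrite invr_ge0 exprn_ge0// N_ge0. Qed.

Lemma intg_N1X : (0 < n)%N -> intg (lebn n) (fun x => N 1 x ^- n.+1).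
Proof.
move=> n0; have := intg_powN ltr01 n0; congr intg; apply/funext => x.
by rewrite natr1 powRN powR_mulrn ?N_ge0.
Qed.

Lemma N_scale t x : 0 < t -> N t (t *: x) = t * N 1 x.
Proof.
move=> t0; rewrite /N /sqn.
under eq_bigr do rewrite mxE exprMn.
rewrite -mulr_sumr expr1n -{1}[t ^+ 2]mulr1 -mulrDr sqrtrM ?sqr_ge0//.
by rewrite sqrtr_sqr gtr0_norm.
Qed.

(** By scaling [x = t y]: the Jacobian contributes [t^n] against [t^(-n-1)]. Consequently the kernel
    [t * N t x ^- n.+1] has the same mass at all heights. *)
Lemma intg_RI_NX (t : R) : 0 < t -> (0 < n)%N ->
  intg (lebn n) (fun x => N t x ^- n.+1) /\
  RI (lebn n) (fun x => N t x ^- n.+1) = t^-1 * RI (lebn n) (fun x => N 1 x ^- n.+1).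
Proof.
move=> t0 n0; have I1 := intg_N1X n0; have tn0 : t != 0 by rewrite gt_eqF.
have ti0 : t^-1 != 0 by rewrite invr_neq0.
have sc := @scales_lebn R n t^-1 0 ti0.
have E : (fun x => N t x ^- n.+1) = (fun x => t ^- n.+1 *
    ((fun x : 'rV[R]_n => N 1 x ^- n.+1) \o (fun x : 'rV[R]_n => t^-1 *: x + 0)) x).
  apply/funext => x /=; rewrite addr0.
  rewrite (_ : N t x = t * N 1 (t^-1 *: x)); first by rewrite exprMn invfM.
  by rewrite -N_scale// scalerA mulfV// scale1r.
have Is := scales_intg sc I1.
rewrite E; split; first exact: intgZ.
rewrite (RIZ _ Is) (scales_RI sc I1) mulrA normfV invrK gtr0_norm//.
congr (_ * _); rewrite exprS invfM -mulrA mulVf ?mulr1//.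
by rewrite expf_neq0.
Qed.

End weights.

(** * The curvature inequality and the energy estimate *)

Section energy.
Context {R : realType} {n : nat}.
Implicit Types (v m g rho : 'rV[R]_n -> R) (x : 'rV[R]_n).

(** The inverse of the usual normalising constant of the Poisson kernel; [Dk 0 t] divided by [kappa]
    is a probability density. *)
Definition kappa : R := RI (lebn n) (fun x : 'rV[R]_n => N 1 x ^- n.+1).

Lemma grad_sq_ge0 v x : 0 <= grad_sq v x.
Proof. by apply: sumr_ge0 => i _; exact: sqr_ge0. Qed.

Lemma smooth_grad_sq v : smooth v -> smooth (grad_sq v).
Proof.
move=> sv; apply: smooth_sum => i.
rewrite (_ : (fun x => _) = (fun x => partial i v x * partial i v x)).
  exact: smoothM (smooth_partial i sv) (smooth_partial i sv).
by apply/funext => x; rewrite expr2.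
Qed.

Lemma continuous_expR_comp c v : continuous v -> continuous (fun x : 'rV[R]_n => expR (c * v x)).
Proof.
move=> cv x; have c1 : {for x, continuous (fun y : 'rV[R]_n => c * v y)}.
  exact: cvgM (cvg_cst c) (cv x).
exact: (@continuous_comp _ _ _ (fun y : 'rV[R]_n => c * v y) expR x c1 (@continuous_expR R _)).
Qed.

Lemma continuousM_fun (f g : 'rV[R]_n -> R) : continuous f -> continuous g ->
  continuous (fun x => f x * g x).
Proof. by move=> cf cg x; exact: cvgM (cf x) (cg x). Qed.

Lemma continuousD_fun (f g : 'rV[R]_n -> R) : continuous f -> continuous g ->
  continuous (fun x => f x + g x).
Proof. by move=> cf cg x; exact: cvgD (cf x) (cg x). Qed.

Lemma intgM_bounded m rho (B : R) : intg (lebn n) m -> measurable_fun setT rho ->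
  (forall x, `|rho x| <= B) -> intg (lebn n) (fun x => m x * rho x).
Proof.
move=> Im mrho rB; apply: (intg_le _ _ (intgZ B (intg_norm Im))).
  by apply: measurable_funM => //; exact: intg_measurable Im.
by move=> x; rewrite normrM mulrC ler_wpM2r.
Qed.

Variables (a b : R) (a0 : 0 < a) (b0 : 0 < b).

(** The function [m] absorbs the region where the curvature bound fails. The estimates see it only
    through its integral, which translations do not change. *)
Definition curv_ineq v m := [/\ smooth v, intg (lebn n) m, forall x, 0 <= m x &
  forall x, a * grad_sq v x + b * expR (2 * v x) <= - lap v x + m x].

(** The inequality is multiplied by [rho] and integrated by parts; Young's inequality gives half of
    the gradient term back. The condition on [g] is [|grad rho|^2 / rho <= g], written so that it
    makes sense where [rho] vanishes. *)
Lemma energy_csupp v m rho g (B : R) : curv_ineq v m ->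
  smooth rho -> csupp rho -> (forall x, 0 <= rho x <= B) ->
  intg (lebn n) g -> (forall x, grad_sq rho x <= rho x * g x) -> (forall x, 0 <= g x) ->
  RI (lebn n) (fun x => rho x * (a / 2 * grad_sq v x + b * expR (2 * v x))) <=
  (2 * a)^-1 * RI (lebn n) g + B * RI (lebn n) m.
Proof.
move=> [sv Im m0 H] srho crho rB Ig rg g0.
have cv := smooth_continuous sv; have cr := smooth_continuous srho.
have rho0 x : 0 <= rho x by have /andP[] := rB x.
have Imr : intg (lebn n) (fun x => m x * rho x).
  apply: (intgM_bounded (B := B)) Im (continuous_measurable_rV cr) _ => x.
  by rewrite ger0_norm//; have /andP[] := rB x.
have I1 : intg (lebn n) (fun x => rho x * (a / 2 * grad_sq v x + b * expR (2 * v x))).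
  apply: intg_csupp; last exact: csuppMl.
  apply: continuousM_fun => //; apply: continuousD_fun.
    exact: continuousM_fun (@cst_continuous _ _ _) (smooth_continuous (smooth_grad_sq sv)).
  exact: continuousM_fun (@cst_continuous _ _ _) (continuous_expR_comp cv).
have s2 i := smooth_partial i (smooth_partial i sv).
have I2 i : intg (lebn n) (fun x => partial i (partial i v) x * rho x).
  exact: intg_csupp (smooth_continuous (smoothM (s2 i) srho)) (csuppMr _ crho).
have I3 i : intg (lebn n) (fun x => partial i v x * partial i rho x).
  exact: intg_csupp (smooth_continuous (smoothM (smooth_partial i sv) (smooth_partial i srho)))
    (csuppMr _ (partial_csupp i crho)).
have I4 : intg (lebn n) (fun x => rho x * (a / 2 * grad_sq v x)).
  apply: intg_csupp; last exact: csuppMl.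
  apply: continuousM_fun => //.
  exact: continuousM_fun (@cst_continuous _ _ _) (smooth_continuous (smooth_grad_sq sv)).
have E : RI (lebn n) (fun x => \sum_i (partial i v x * partial i rho x)) =
    RI (lebn n) (fun x => - (\sum_i partial i (partial i v) x * rho x)).
  rewrite RI_sum// RIN; last exact: intg_sum.
  rewrite RI_sum// -sumrN; apply: eq_bigr => i _.
  by rewrite (integration_by_parts_csupp i (smooth_partial i sv) srho crho) opprK.
have young x : \sum_i (partial i v x * partial i rho x) <=
    rho x * (a / 2 * grad_sq v x) + (2 * a)^-1 * g x.
  (* Where [rho] vanishes, the condition on [g] forces its gradient to vanish too, so both sides are
     harmless. *)
  have [r0|r0] := eqVneq (rho x) 0.
    rewrite r0 mul0r add0r big1 ?mulr_ge0 ?invr_ge0 ?mulr_ge0 ?(ltW a0)// => i _.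
    have : grad_sq rho x <= 0 by rewrite (le_trans (rg x))// r0 mul0r.
    rewrite le_eqVlt ltNge grad_sq_ge0 orbF psumr_eq0 => [/allP/(_ i)|j _]; last exact: sqr_ge0.
    by rewrite mem_index_enum sqrf_eq0 => /(_ isT)/eqP ->; rewrite mulr0.
  have rp : 0 < rho x by rewrite lt_neqAle eq_sym r0 rho0.
  apply: (@le_trans _ _ (\sum_i (a / 2 * rho x * partial i v x ^+ 2 +
      (2 * a * rho x)^-1 * partial i rho x ^+ 2))).
    apply: ler_sum => i _; set p := partial i v x; set q := partial i rho x.
    have ar : 0 < a * rho x by rewrite mulr_gt0.
    rewrite -subr_ge0 (_ : _ - _ = (2 * a * rho x)^-1 * (a * rho x * p - q) ^+ 2).
      by rewrite mulr_ge0 ?sqr_ge0// invr_ge0 !mulr_ge0// ltW.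
    by field; rewrite gt_eqF//= gt_eqF.
  rewrite big_split/= -!mulr_sumr -!/(grad_sq _ x); apply: lerD.
    by rewrite mulrCA mulrA.
  rewrite invfM -mulrA ler_wpM2l ?invr_ge0 ?mulr_ge0 ?(ltW a0)//.
  by rewrite ler_pdivrMl.
have key x : rho x * (a / 2 * grad_sq v x + b * expR (2 * v x)) <=
   (- (\sum_i partial i (partial i v) x * rho x) - rho x * (a / 2 * grad_sq v x)) + m x * rho x.
  have := ler_wpM2l (rho0 x) (H x); rewrite lapE -mulr_suml; lra.
have Is : intg (lebn n) (fun x => - (\sum_i partial i (partial i v) x * rho x)).
  by apply: intgN; exact: intg_sum.
apply: (le_trans (RI_le I1 (intgD (intgB Is I4) Imr) key)).
rewrite RID//; last exact: intgB.
rewrite RIB// -E; apply: lerD.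
  rewrite lerBlDl -RIZ// -RID//; last exact: intgZ.
  by apply: RI_le => //; [exact: intg_sum|apply: intgD => //; exact: intgZ].
rewrite -RIZ//; apply: RI_le => //; first exact: intgZ.
by move=> x; rewrite mulrC ler_wpM2r//; have /andP[] := rB x.
Qed.

(** The cut-off radius is a multiple of the height [T], so that gradients of cut-offs are bounded by
    a multiple of [1 / N T x], with a constant free of [T] and [k]. *)
Definition cutoff (T : R) (k : nat) : R := (T * k.+1%:R)^-1.

Lemma cutoff_cvg T : 0 < T -> cutoff T k @[k --> \oo] --> 0.
Proof.
move=> T0; rewrite /cutoff (_ : (fun k => _) = (fun k => T^-1 * k.+1%:R^-1)).
  by have := cvgM (cvg_cst T^-1) (@cvg_harmonic R); rewrite mulr0; exact.
by apply/funext => k; rewrite invfM.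
Qed.

Lemma cutoff_gt0 T k : 0 < T -> 0 < cutoff T k.
Proof. by move=> T0; rewrite invr_gt0 mulr_gt0. Qed.

Lemma cutoff_le T k : 0 < T -> cutoff T k * T <= 1.
Proof.
move=> T0; rewrite /cutoff mulrC ler_pdivrMr ?mulr_gt0// mul1r ler_peMr ?(ltW T0)//.
by rewrite ler1n.
Qed.

Lemma cutoff_tame T : 1 <= T ->
  tame (fun=> 1) (fun k => @chi R n (cutoff T k)) (fun=> 1).
Proof.
move=> T1; have T0 : 0 < T := lt_le_trans ltr01 T1.
apply: chi_tame; last exact: cutoff_cvg.
move=> k; rewrite cutoff_gt0//= (le_trans _ (cutoff_le k T0))//.
by rewrite ler_peMr// ltW// cutoff_gt0.
Qed.

Lemma cutoff_csupp T k : 0 < T -> csupp (@chi R n (cutoff T k)).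
Proof. by move=> T0; apply: chi_csupp; exact: cutoff_gt0. Qed.

Lemma smooth_N T c : 0 < T -> smooth (fun x : 'rV[R]_n => N T x ^- c).
Proof. by move=> T0; exact: homk_smooth T0 (hk_N T c). Qed.

Lemma partial_NX i T c x : 0 < T ->
  partial i (fun x : 'rV[R]_n => N T x ^- c) x = - c%:R * x ord0 i * N T x ^- c.+2.
Proof.
move=> T0; rewrite partialE.
have N0 := N_gt0 x T0.
have [_ E] := is_derive_chain (is_derive_N i x T0) (is_derive_invX c N0).
by rewrite [LHS]E [in RHS]exprS invfM; ring.
Qed.

(** The cut-off is squared because the gradient of its square still contains the cut-off, and
    [|grad rho|^2] is then divisible by [rho]. *)
Lemma energy_cutoff : exists2 C, 0 <= C & forall T k x, 1 <= T ->
  grad_sq (fun y => N T y ^- n.-1 * (chi (cutoff T k) y * chi (cutoff T k) y)) x <=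
  N T x ^- n.-1 * (chi (cutoff T k) x * chi (cutoff T k) x) * (C * N T x ^- n.-1.+2).
Proof.
have [D D0 hD] := @partial_chi_bound R n.
(* From [(r + s)^2 <= 2 r^2 + 2 s^2] in each of the [n] directions: the weight contributes
   [2 (n-1)^2], the squared cut-off [8 d^2] with [d^2 <= 2 D^2 / N^2]. *)
exists (n%:R * (2 * n.-1%:R ^+ 2 + 16 * D ^+ 2)) => [|T k x T1].
  by rewrite mulr_ge0// addr_ge0 ?mulr_ge0 ?sqr_ge0.
have T0 : 0 < T := lt_le_trans ltr01 T1.
set eps := cutoff T k; have e0 : 0 < eps by exact: cutoff_gt0.
have N0 := N_gt0 x T0; set q := (N T x)^-1.
have q0 : 0 < q by rewrite invr_gt0.
have sc : smooth (@chi R n eps) by exact: bumpk_smooth bumpk_chi.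
set c := chi eps x; have c0 : 0 <= c := chi_ge0 eps x; have c1 : c <= 1 := chi_le1 eps x.
rewrite /grad_sq [leRHS](_ : _ = \sum_(i < n) (q ^+ n.-1 * (c * c)) *
    ((2 * n.-1%:R ^+ 2 + 16 * D ^+ 2) * q ^+ n.-1.+2)); last first.
  by rewrite sumr_const card_ord -mulr_natl -!exprVn -/q; ring.
apply: ler_sum => i _.
rewrite (partialME i (smooth_N _ T0) (smoothM sc sc)) partial_NX// (partialME i sc sc) -/c.
set d := partial i (chi eps) x.
rewrite -!exprVn -/q; set y := x ord0 i.
have yq : (y * q) ^+ 2 <= 1.
  rewrite -[leLHS]real_normK ?num_real// exprn_ile1// /q normrM normfV.
  by rewrite (gtr0_norm N0) ler_pdivrMr// mul1r le_coord_N.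
(* On the support [eps^2 |x|^2 < 1], and [eps T <= 1]; together [eps^2 N^2 <= 2]. *)
have dq : d ^+ 2 <= 2 * D ^+ 2 * q ^+ 2.
  have [h|h] := leP 1 (eps ^+ 2 * sqn x).
    rewrite /d (bumpk_supp (bumpk_partial i bumpk_chi) h) expr0n/=.
    by rewrite !mulr_ge0// ?sqr_ge0// ltW.
  apply: (@le_trans _ _ (D ^+ 2 * eps ^+ 2)).
    by rewrite -exprMn -[leLHS]real_normK ?num_real// ler_pXn2r ?nnegrE ?mulr_ge0 ?(ltW e0)// hD// ltW.
  have -> : 2 * D ^+ 2 * q ^+ 2 = D ^+ 2 * (2 * q ^+ 2) by ring.
  rewrite ler_wpM2l ?sqr_ge0//.
  rewrite /q exprVn ler_pdivlMr ?exprn_gt0// sqr_N mulrDr.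
  have : (eps * T) ^+ 2 <= 1 by rewrite exprn_ile1 ?mulr_ge0 ?(ltW e0) ?(ltW T0)// cutoff_le.
  rewrite exprMn; lra.
set Q := q ^+ n.-1.
have Q0 : 0 <= Q by rewrite exprn_ge0// ltW.
have -> : q ^+ n.-1.+2 = Q * q ^+ 2 by rewrite -exprD addn2.
apply: (@le_trans _ _ (2 * (n.-1%:R * (y * q) * (Q * q) * (c * c)) ^+ 2 +
   8 * (Q ^+ 2 * (c ^+ 2 * d ^+ 2)))).
  have h (r s : R) : (r + s) ^+ 2 <= 2 * r ^+ 2 + 2 * s ^+ 2.
    by have := sqr_ge0 (r - s); rewrite !expr2; lra.
  apply: le_trans (h _ _) _; rewrite le_eqVlt; apply/orP; left; apply/eqP; ring.
have cc : (c * c) ^+ 2 <= c * c.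
  have cc1 : c * c <= 1 by rewrite -expr2 exprn_ile1.
  by rewrite expr2; apply: ler_piMr => //; exact: mulr_ge0.
have t1 : 2 * (n.-1%:R * (y * q) * (Q * q) * (c * c)) ^+ 2 <=
    2 * n.-1%:R ^+ 2 * (Q * q) ^+ 2 * (c * c).
  rewrite [leLHS](_ : _ = 2 * n.-1%:R ^+ 2 * (Q * q) ^+ 2 * ((y * q) ^+ 2 * (c * c) ^+ 2)); last by ring.
  have Z0 : 0 <= 2 * n.-1%:R ^+ 2 * (Q * q) ^+ 2 :> R.
    by apply: mulr_ge0; [apply: mulr_ge0 => //; exact: sqr_ge0|exact: sqr_ge0].
  apply: (ler_wpM2l Z0); apply: le_trans cc; apply: ler_piMl => //; exact: sqr_ge0.
have t2 : 8 * (Q ^+ 2 * (c ^+ 2 * d ^+ 2)) <= 16 * D ^+ 2 * (Q * q) ^+ 2 * (c * c).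
  rewrite [leRHS](_ : _ = 8 * (Q ^+ 2 * (c ^+ 2 * (2 * D ^+ 2 * q ^+ 2)))); last by ring.
  by rewrite ler_wpM2l// ler_wpM2l ?sqr_ge0// ler_wpM2l ?sqr_ge0.
apply: le_trans (lerD t1 t2) _.
rewrite le_eqVlt; apply/orP; left; apply/eqP; ring.
Qed.

End energy.

Ltac nneg := repeat first [ assumption | apply: ltW; assumption | exact: sqr_ge0
  | exact: expR_ge0 | exact: normr_ge0 | exact: NX_ge0 | exact: chi_ge0 | exact: grad_sq_ge0
  | exact: ler0n | exact: ler01 | exact: theta_ge0
  | match goal with
    | |- is_true (0 <= _ * _) => apply: mulr_ge0
    | |- is_true (0 <= _ + _) => apply: addr_ge0
    | |- is_true (0 <= _ ^+ _) => apply: exprn_ge0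
    | |- is_true (0 <= _^-1) => rewrite invr_ge0
    end ].

(** * Weighted energy, growth of the function, and Jensen's inequality for Poisson averages *)

Section energy_estimates.
Context {R : realType} {n : nat}.
Implicit Types (v m g : 'rV[R]_n -> R) (x : 'rV[R]_n).

Lemma kappa_gt0 : (0 < n)%N -> 0 < @kappa R n.
Proof.
move=> n0; pose I := fun t : R => \1_(`[- 1, 1]%classic) t : R.
have I0 t : 0 <= I t by rewrite /I indicE ler0n.
have Ii : intg (@lebesgue_measure R) I.
  by apply/integrable_indic_itv.
have RI1 : RI (@lebesgue_measure R) I = 2.
  apply: EFin_inj; rewrite RI_EFin// /I integral_indic//= setIT lebesgue_measure_itv/= lte_fin.
  by rewrite ifT; [rewrite -EFinD; congr EFin; lra|lra].
have E : RI (lebn n) (fun x : 'rV[R]_n => \prod_i I (x ord0 i)) = 2 ^+ n.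
  by apply: EFin_inj; rewrite RI_EFin ?integral_tensor ?RI1//; exact: intg_tensor.
pose d := (1 + n%:R : R) ^- n.+1.
have d0 : 0 < d by rewrite invr_gt0 exprn_gt0// ltr_pwDl.
apply: (@lt_le_trans _ _ (d * 2 ^+ n)); first by rewrite mulr_gt0// exprn_gt0.
rewrite -E -RIZ; last exact: intg_tensor.
apply: RI_le; [by apply: intgZ; exact: intg_tensor|exact: intg_N1X|] => x.
have [h|/existsNP[i /= xi]] := pselect (forall i, `[- 1, 1]%classic (x ord0 i)).
  rewrite big1 ?mulr1 => [|i _]; last by rewrite /I indicE mem_set.
  rewrite lef_pV2 ?posrE ?exprn_gt0 ?N_gt0 ?ltr_pwDl//.
  apply: lerXn2r; rewrite ?nnegrE ?N_ge0 ?addr_ge0//.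
  rewrite -(@ler_sqr R) ?nnegrE ?N_ge0 ?addr_ge0// sqr_N expr1n.
  apply: (@le_trans _ _ (1 + n%:R)); last by rewrite expr2 ler_peMr ?addr_ge0// lerDl.
  rewrite lerD2l /sqn (le_trans (ler_sum _ (G := fun=> 1) _))//.
    move=> i _; rewrite -[leLHS]real_normK ?num_real// exprn_ile1//.
    by have := h i; rewrite /= in_itv/= ler_norml.
  by rewrite sumr_const card_ord.
rewrite (bigD1 i)//= [I _]indicE memNset// mul0r mulr0.
exact: NX_ge0.
Qed.

Variables (a b : R) (a0 : 0 < a) (b0 : 0 < b).
Hypothesis n2 : (2 <= n)%N.

Let n0 : (0 < n)%N := ltnW n2.

Lemma NXn_le T x : 1 <= T -> N T x ^- n.-1 <= T^-1.
Proof.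
move=> T1; have T0 : 0 < T := lt_le_trans ltr01 T1.
rewrite lef_pV2 ?posrE ?exprn_gt0 ?N_gt0//.
have N1 : T <= N T x := le_t_N x T0.
rewrite (le_trans N1)// -[leLHS]expr1 ler_weXn2l//; first exact: le_trans N1.
by case: n n2 => [|[]].
Qed.

(** Both error terms are of order [1/T]: [N^(-n-1)] has mass [kappa / T], and the test weight is at
    most [1/T], which multiplies the mass of [m]. The constant precedes [v] and [m], hence is
    uniform over translates. *)
Lemma energy_T : exists2 A, 0 < A & forall v m T, curv_ineq a b v m -> 1 <= T ->
  intg (lebn n) (fun x => N T x ^- n.-1 * (a / 2 * grad_sq v x + b * expR (2 * v x))) /\
  RI (lebn n) (fun x => N T x ^- n.-1 * (a / 2 * grad_sq v x + b * expR (2 * v x)))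
    <= A * (1 + RI (lebn n) m) / T.
Proof.
have [C C0 HC] := @energy_cutoff R n.
have k0 := kappa_gt0 n0.
exists ((2 * a)^-1 * (C * @kappa R n) + 1) => [|v m T H T1].
  by rewrite ltr_wpDl// !mulr_ge0 ?invr_ge0 ?mulr_ge0// ltW.
have [sv Im m0 _] := H; have cv := smooth_continuous sv.
have T0 : 0 < T := lt_le_trans ltr01 T1.
have M0 : 0 <= RI (lebn n) m by apply: RI_ge0.
have e0 x : 0 <= a / 2 * grad_sq v x + b * expR (2 * v x).
  by rewrite addr_ge0// mulr_ge0 ?expR_ge0 ?grad_sq_ge0 ?divr_ge0// ltW.
have [INX RNX] := intg_RI_NX T0 n0.
pose rho k x := N T x ^- n.-1 * (chi (cutoff T k) x * chi (cutoff T k) x).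
have srho k : smooth (rho k).
  apply: smoothM; first exact: smooth_N.
  by apply: smoothM; exact: bumpk_smooth bumpk_chi.
have crho k : csupp (rho k) by apply: csuppMr; apply: csuppMr; exact: cutoff_csupp.
have rho_bd k x : 0 <= rho k x <= T^-1.
  have -> : 0 <= rho k x by rewrite /rho; nneg.
  apply: le_trans (NXn_le x T1).
  by apply: ler_piMr; [exact: NX_ge0|rewrite -expr2 exprn_ile1 ?chi_ge0 ?chi_le1].
have En : n.-1.+2 = n.+1 by rewrite prednK.
have Ig : intg (lebn n) (fun x => C * N T x ^- n.-1.+2) by rewrite En; exact: intgZ.
have bd k : RI (lebn n) (fun x => rho k x * (a / 2 * grad_sq v x + b * expR (2 * v x))) <=
    ((2 * a)^-1 * (C * @kappa R n) + 1) * (1 + RI (lebn n) m) / T.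
  apply: (le_trans (energy_csupp a0 H (srho k) (crho k) (rho_bd k) Ig _ _)).
  - by move=> x; exact: HC.
  - by move=> x; apply: mulr_ge0 => //; exact: NX_ge0.
  rewrite RIZ En// RNX -/(@kappa R n).
  rewrite (_ : (2 * a)^-1 * (C * (T^-1 * @kappa R n)) + T^-1 * RI (lebn n) m =
     ((2 * a)^-1 * (C * @kappa R n) + RI (lebn n) m) / T); last by ring.
  rewrite ler_pM2r ?invr_gt0//.
  have : 0 <= (2 * a)^-1 * (C * @kappa R n) by nneg.
  move: ((2 * a)^-1 * _) => Z Z0; have := mulr_ge0 Z0 M0; lra.
apply: (RI_fatou (f_ := fun k x => rho k x * (a / 2 * grad_sq v x + b * expR (2 * v x)))) => //.
- move=> k; apply: intg_csupp; last exact: csuppMl.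
  apply: continuousM_fun; first exact: smooth_continuous (srho k).
  apply: continuousD_fun.
    exact: continuousM_fun (@cst_continuous _ _ _) (smooth_continuous (smooth_grad_sq sv)).
  exact: continuousM_fun (@cst_continuous _ _ _) (continuous_expR_comp (c := 2) cv).
- by move=> k x; apply: mulr_ge0 => //; have /andP[] := rho_bd k x.
- move=> x; apply: cvgM (cvg_cst _).
  have c := tame_cvg (x := x) (cutoff_tame T1).
  by have := cvgM (cvg_cst (N T x ^- n.-1)) (cvgM c c); rewrite !mulr1; exact.
Qed.

(** A Hardy-type argument: the field [x N^(-n-1)] has divergence [- N^(-n-1) + (n+1) N^(-n-3)].
    Paired with a smooth substitute for [|v|], it bounds the weighted integral by that of
    [|grad v| N^(-n)] and a compact part, and [|grad v| N^(-n) <= |grad v|^2 N^(1-n) + N^(-n-1)] is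
    covered by the energy. *)
Lemma growth v m : curv_ineq a b v m -> intg (lebn n) (fun x => `|v x| * N 1 x ^- n.+1).
Proof.
move=> H; have [sv Im m0 _] := H; have cv := smooth_continuous sv.
have [A A0 /(_ v m 1 H (lexx 1))[IE _]] := energy_T.
have I1 := @intg_N1X R n n0.
have sgv := smooth_grad_sq sv.
have cgv := smooth_continuous sgv.
have IG : intg (lebn n) (fun x => grad_sq v x * N 1 x ^- n.-1).
  apply: (intg_le _ _ (intgZ (2 / a) IE)).
    by apply: continuous_measurable_rV; apply: continuousM_fun => //; exact: continuous_NX.
  move=> x; rewrite ger0_norm ?mulr_ge0 ?grad_sq_ge0 ?NX_ge0//.
  rewrite [leRHS](_ : _ = grad_sq v x * N 1 x ^- n.-1 +
     N 1 x ^- n.-1 * (2 / a * b * expR (2 * v x))); last by field; rewrite !gt_eqF ?exprn_gt0 ?N_gt0.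
  by rewrite lerDl; nneg.
(* A smooth substitute for [|v|], with [|v| <= w] and [|grad w| <= |grad v|]. *)
pose w x := Num.sqrt (1 + v x ^+ 2).
have w1 x : 1 <= w x.
  by rewrite /w -{1}(@sqrtr1 R) ler_sqrt ?lerDl ?sqr_ge0// addr_ge0 ?sqr_ge0.
have w0 x : 0 < w x := lt_le_trans ltr01 (w1 x).
have w2 x : w x ^+ 2 = 1 + v x ^+ 2 by rewrite sqr_sqrtr// addr_ge0 ?sqr_ge0.
have vw x : `|v x| <= w x.
  by rewrite -(@ler_sqr R) ?nnegrE ?(ltW (w0 x))// w2 real_normK ?num_real// lerDr.
have cw : continuous w.
  move=> x; have c1 : {for x, continuous (fun y => 1 + v y ^+ 2)}.
    exact: cvgD (cvg_cst (1 : R)) (cvgM (cv x) (cv x)).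
  exact: (@continuous_comp _ _ _ (fun y => 1 + v y ^+ 2) Num.sqrt x c1 (@sqrt_continuous R _)).
have dw i x : is_derive x (ebasis R i) w (v x * partial i v x / w x).
  have dv : is_derive x (ebasis R i) v (partial i v x).
    by rewrite partialE; apply/derivableP; exact: smooth_derivable.
  have q0 : 0 < 1 + v x ^+ 2 by rewrite ltr_pwDl// sqr_ge0.
  have d1 : is_derive x (ebasis R i) (fun y => 1 + v y ^+ 2) (2 * v x * partial i v x).
    have d2 := is_deriveD (is_derive_cst (1 : R) x (ebasis R i)) (is_deriveM dv dv).
    by apply: (is_derive_eq d2); rewrite /GRing.scale/=; ring.
  have h := is_derive_chain d1 (is_derive1_sqrt q0); apply: (is_derive_eq h).
  by rewrite -/(w x); field; rewrite gt_eqF.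
(* Where [N^2 >= 2 (n+1)], the term [(n+1) N^(-n-3)] is at most half of [N^(-n-1)] and is absorbed;
   elsewhere the coordinates are bounded by [N <= N^2], and [w] by [B]. *)
have [B B0 wB] : exists2 B, 0 <= B & forall x, 
    (forall i, `|x ord0 i| <= n.+1.*2%:R) -> `|w x| <= B := cube_bounded _ cw.
pose c k : 'rV[R]_n -> R := chi (cutoff 1 k).
have c0 k x : 0 <= c k x := chi_ge0 _ x.
have c1 k x : c k x <= 1 := chi_le1 _ x.
have sc k : smooth (c k) by exact: bumpk_smooth bumpk_chi.
have ccvg x : c k x @[k --> \oo] --> (1 : R) := tame_cvg (x := x) (cutoff_tame (lexx 1)).
pose h i k x : R := x ord0 i * N 1 x ^- n.+1 * c k x.
have sX i : smooth (fun x : 'rV[R]_n => x ord0 i * N 1 x ^- n.+1).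
  apply: (homk_smooth ltr01); apply: homk_ext (hk_X i (hk_N 1 n)) => x.
  by rewrite exprS invfM mulrA.
have sh i k : smooth (h i k) := smoothM (sX i) (sc k).
have dh i k x : partial i (h i k) x = N 1 x ^- n.+1 * c k x +
    x ord0 i ^+ 2 * (- n.+1%:R * N 1 x ^- n.+3 * c k x) +
    x ord0 i * partial i (c k) x * N 1 x ^- n.+1.
  rewrite /h (partialME i (sX i) (sc k)).
  have -> : partial i (fun x : 'rV[R]_n => x ord0 i * N 1 x ^- n.+1) x =
     N 1 x ^- n.+1 + x ord0 i * (- n.+1%:R * x ord0 i * N 1 x ^- n.+3).
    rewrite partialE; have d1 := is_derive_chain (is_derive_N i x ltr01) (is_derive_invX n.+1 (N_gt0 x ltr01)).
    have d := is_deriveM (is_derive_coord i i x) d1.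
    have [_ E] := d; rewrite [LHS]E /GRing.scale/= eqxx /= -!exprVn; move: ((N 1 x)^-1) => q; rewrite !exprS; ring.
  by ring.
pose g i k x := w x * h i k x.
pose g' i k x := w x * partial i (h i k) x + h i k x * (v x * partial i v x / w x).
have dg i k x : is_derive x (ebasis R i) (g i k) (g' i k x).
  have dhx : is_derive x (ebasis R i) (h i k) (partial i (h i k) x).
    by rewrite partialE; apply/derivableP; exact: smooth_derivable (sh i k).
  exact: is_deriveM (dw i x) dhx.
have pg i k : partial i (g i k) = g' i k.
  by apply/funext => x; rewrite partialE; have [_ ->] := dg i k x.
have cg' i k : continuous (g' i k).
  apply: continuousD_fun; apply: continuousM_fun => //.
  - exact: smooth_continuous (smooth_partial i (sh i k)).
  - exact: smooth_continuous (sh i k).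
  apply: continuousM_fun; first exact: continuousM_fun (smooth_continuous (smooth_partial i sv)).
  by move=> x; exact: cvgV (lt0r_neq0 (w0 x)) (cw x).
have csg i k : csupp (g i k) by apply: csuppMr; apply: csuppMr; exact: cutoff_csupp.
have csg' i k : csupp (g' i k) by rewrite -pg; exact: partial_csupp.
have Ig' i k : intg (lebn n) (g' i k) by apply: intg_csupp.
have R0 k : RI (lebn n) (fun x => \sum_i g' i k x) = 0.
  rewrite RI_sum// big1// => i _; rewrite -pg; apply: RI_partial0 => //.
  by rewrite pg.
pose S x := (n.+1%:R * B) * N 1 x ^- n.+1 + (grad_sq v x * N 1 x ^- n.-1 + n%:R * N 1 x ^- n.+1).
have IS : intg (lebn n) S.
  by apply: intgD; [exact: intgZ|apply: intgD => //; exact: intgZ].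
have key k x : 2^-1 * (w x * N 1 x ^- n.+1 * c k x) <= S x - \sum_i g' i k x.
  have N1 := N_ge1 x; have N0 : 0 < N 1 x := lt_le_trans ltr01 N1.
  set q := (N 1 x)^-1; have q0 : 0 < q by rewrite invr_gt0.
  have q1 : q <= 1 by rewrite invf_le1.
  have term i : g' i k x <= w x * partial i (h i k) x + (partial i v x ^+ 2 * q ^+ n.-1 + q ^+ n.+1).
    rewrite /g' lerD2l.
    have p1 : `|v x * partial i v x / w x| <= `|partial i v x|.
      rewrite !normrM normfV (gtr0_norm (w0 x)) mulrAC ler_piMl// ler_pdivrMr// mul1r.
      exact: vw.
    have h1 : `|h i k x| <= q ^+ n.
      move: (c0 k x) (c1 k x); rewrite /h; move: (c k x) => e e0 e1.
      rewrite normrM (ger0_norm e0) normrM (ger0_norm (NX_ge0 _ _ _)) -exprVn -/q exprS.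
      apply: (@le_trans _ _ (`|x ord0 i| * (q * q ^+ n))).
        by apply: ler_piMr => //; nneg.
      rewrite mulrA; apply: ler_piMl; first by nneg.
      by rewrite /q ler_pdivrMr// mul1r; exact: le_coord_N.
    apply: le_trans (ler_norm _) _; rewrite normrM.
    apply: (@le_trans _ _ (q ^+ n * `|partial i v x|)); first exact: ler_pM.
    have -> : q ^+ n = q ^+ n.-1 * q by rewrite -exprSr prednK.
    have -> : q ^+ n.+1 = q ^+ n.-1 * q ^+ 2 by rewrite -exprD addn2 prednK.
    rewrite -mulrA (mulrC (_ ^+ 2) (q ^+ n.-1)) -mulrDr ler_wpM2l ?exprn_ge0 ?(ltW q0)//.
    rewrite -[X in _ <= X + _]real_normK ?num_real//.
    have := sqr_ge0 (q - `|partial i v x|); have := mulr_ge0 (ltW q0) (normr_ge0 (partial i v x)).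
    rewrite !expr2; lra.
  have divh : \sum_i partial i (h i k) x <= c k x * (n.+1%:R * q ^+ n.+3 - q ^+ n.+1).
    under eq_bigr do rewrite dh.
    rewrite !big_split/= sumr_const card_ord -!mulr_suml -!exprVn -/q -/(sqn x).
    have E : sqn x = N 1 x ^+ 2 - 1 by rewrite sqr_N expr1n; ring.
    have E2 : N 1 x ^+ 2 * q ^+ 2 = 1 by rewrite -exprMn /q divff ?expr1n// gt_eqF.
    (* The cut-off decreases along rays, so the term with its gradient has the favourable sign and
       needs no estimate. *)
    have P : \sum_i x ord0 i * partial i (c k) x <= 0.
      rewrite -oppr_ge0 -sumrN; apply: sumr_ge0 => i _; rewrite partial_chi.
      rewrite (_ : x ord0 i * _ = - ((cutoff 1 k * x ord0 i) ^+ 2 *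
         (2 * expR 1 * theta 2 (1 - cutoff 1 k ^+ 2 * sqn x)))); last by ring.
      by rewrite opprK; nneg.
    have := mulr_le0_ge0 P (exprn_ge0 n.+1 (ltW q0)).
    suff -> : q ^+ n.+1 * c k x *+ n + sqn x * (- n.+1%:R * q ^+ n.+3 * c k x) =
      c k x * (n.+1%:R * q ^+ n.+3 - q ^+ n.+1) by lra.
    rewrite E -mulr_natl -(natr1 n) (_ : q ^+ n.+3 = q ^+ n.+1 * q ^+ 2); last by rewrite -exprD addn2.
    transitivity (c k x * q ^+ n.+1 * (n%:R + (n%:R + 1) * q ^+ 2 - (n%:R + 1) * (N 1 x ^+ 2 * q ^+ 2))).
      ring.
    by rewrite E2; ring.
  have pt : n.+1%:R * w x * q ^+ n.+3 <= 2^-1 * w x * q ^+ n.+1 + n.+1%:R * B * q ^+ n.+1.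
    have E3 : q ^+ n.+3 = q ^+ n.+1 * q ^+ 2 by rewrite -exprD addn2.
    have Q0 : 0 <= q ^+ n.+1 by rewrite exprn_ge0// ltW.
    have [far|near] := leP (n.+1.*2%:R) (N 1 x ^+ 2).
      apply: (@le_trans _ _ (2^-1 * w x * q ^+ n.+1)); last by rewrite lerDl; nneg.
      rewrite E3 [leLHS](_ : _ = (n.+1%:R * q ^+ 2) * (w x * q ^+ n.+1)); last by ring.
      rewrite -[leRHS]mulrA; apply: ler_wpM2r; first by apply: mulr_ge0 => //; exact: ltW.
      rewrite /q exprVn ler_pdivrMr ?exprn_gt0//.
      by rewrite ler_pdivlMl// -natrM mul2n.
    have wb : w x <= B.
      rewrite (le_trans (ler_norm _))// wB// => i; rewrite (le_trans (le_coord_N 1 x i))//.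
      by rewrite (le_trans _ (ltW near))// expr2 ler_peMr// ltW.
    apply: (@le_trans _ _ (n.+1%:R * B * q ^+ n.+1)); last by rewrite lerDr; have wx0 := ltW (w0 x); nneg.
    have wx0 := ltW (w0 x).
    apply: ler_pM; [by nneg|by nneg|by rewrite ler_wpM2l|].
    by rewrite E3; apply: ler_piMr => //; rewrite exprn_ile1// ltW.
  have : \sum_i g' i k x <= w x * (\sum_i partial i (h i k) x) +
      (grad_sq v x * q ^+ n.-1 + n%:R * q ^+ n.+1).
    apply: le_trans (ler_sum _ (fun i _ => term i)) _.
    by rewrite big_split/= big_split/= sumr_const card_ord mulr_natl /grad_sq mulr_suml mulr_sumr.
  rewrite /S -!exprVn -/q.
  have := ler_wpM2l (ltW (w0 x)) divh; have := ler_wpM2l (c0 k x) pt.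
  have bb : c k x * (n.+1%:R * B * q ^+ n.+1) <= n.+1%:R * B * q ^+ n.+1.
    by apply: ler_piMl => //; nneg.
  move: bb; move: (q ^+ n.+3) (q ^+ n.+1) (\sum_i partial i (h i k) x) (\sum_i g' i k x)
    (c k x) (w x) (n.+1%:R : R) (grad_sq v x * _) (n%:R * _) => q3 q1' s1 s2 cx wx nn gg nq.
  lra.
have [] := @RI_fatou _ _ R (lebn n) (fun k x => w x * N 1 x ^- n.+1 * c k x)
  (fun x => w x * N 1 x ^- n.+1) (2 * RI (lebn n) S).
- move=> k; apply: intg_csupp; last by apply: csuppMr; exact: cutoff_csupp.
  apply: continuousM_fun (smooth_continuous (sc k)).
  by apply: continuousM_fun => //; exact: continuous_NX.
- by move=> k x; have wx0 := ltW (w0 x); nneg.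
- by move=> x; have := cvgM (cvg_cst (w x * N 1 x ^- n.+1)) (ccvg x); rewrite mulr1; exact.
- move=> k; rewrite -ler_pdivrMl// -[leRHS]subr0 -(R0 k) -RIB//; last exact: intg_sum.
  have Iw : intg (lebn n) (fun x => w x * N 1 x ^- n.+1 * c k x).
    apply: intg_csupp; last by apply: csuppMr; exact: cutoff_csupp.
    apply: continuousM_fun (smooth_continuous (sc k)).
    by apply: continuousM_fun => //; exact: continuous_NX.
  rewrite -RIZ//; apply: RI_le => //; first exact: intgZ.
  by apply: intgB => //; exact: intg_sum.
move=> Iw _; apply: (intg_le _ _ Iw).
  apply: continuous_measurable_rV; apply: continuousM_fun; last exact: continuous_NX.
  by move=> x; exact: (@continuous_comp _ _ _ v (fun r : R => `|r|) x (cv x) (@norm_continuous _ R _)).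
by move=> x; rewrite ger0_norm ?mulr_ge0 ?NX_ge0// ler_wpM2r ?NX_ge0.
Qed.

(** Since [T N^(-n-1) <= T^(-1) N^(1-n)], the energy bounds the Poisson average of [exp(2v)] by a
    multiple of [(1 + RI m) / T^2]. Jensen's inequality turns the power of [T] into [- ln T]. *)
Lemma jensen_poisson : exists C : R, forall v m T, curv_ineq a b v m -> 1 <= T ->
  RI (lebn n) (fun x => v x * Dk 0 T x) <=
    @kappa R n * (- ln T + 2^-1 * ln (1 + RI (lebn n) m) + C).
Proof.
have [A A0 HA] := energy_T; have k0 := kappa_gt0 n0.
exists (2^-1 * ln (A / (b * @kappa R n))) => v m T H T1.
have [sv Im m0 _] := H; have cv := smooth_continuous sv.
have T0 : 0 < T := lt_le_trans ltr01 T1.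
have [IE bE] := HA v m T H T1.
have [INX RNX] := intg_RI_NX T0 n0.
have [I1 _] := intg_RI_NX (@ltr01 R) n0.
have Iw : intg (lebn n) (Dk 0 T).
  by rewrite (_ : Dk 0 T = fun x => T * N T x ^- n.+1); [exact: intgZ|apply/funext => x; rewrite Dk0].
have w0 x : 0 <= Dk 0 T x by rewrite Dk0 mulr_ge0 ?NX_ge0// ltW.
have Rw : RI (lebn n) (Dk 0 T) = @kappa R n.
  rewrite (_ : Dk 0 T = fun x => T * N T x ^- n.+1); last by apply/funext => x; rewrite Dk0.
  by rewrite RIZ// RNX mulrA divff ?mul1r// gt_eqF.
have cw : continuous (@Dk R n 0 T) by apply: homk_continuous T0 (homk_Dk _ T0).
have Ivw : intg (lebn n) (fun x => v x * Dk 0 T x).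
  apply: (@intgM_cont R n (fun=> 0) v (fun x => N 1 x ^- n.+1) (Dk 0 T) T _ _ _ (growth H)).
  - exact: continuous_measurable_rV cv.
  - exact: continuous_measurable_rV cw.
  move=> x; rewrite ger0_norm// Dk0 ler_wpM2l ?(ltW T0)//.
  rewrite lef_pV2 ?posrE ?exprn_gt0 ?N_gt0//.
  apply: lerXn2r; rewrite ?nnegrE ?N_ge0//.
  by rewrite -(@ler_sqr R) ?nnegrE ?N_ge0// !sqr_N lerD2r ler_sqr ?nnegrE ?(ltW T0).
have M0 : 0 <= RI (lebn n) m by apply: RI_ge0.
(* The upper bound for the Poisson average of [exp(2v)]. Jensen's inequality is used through the
   tangent of the exponential at [ln s]. *)
pose s := A * (1 + RI (lebn n) m) / (b * @kappa R n * T ^+ 2).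
have s0 : 0 < s by rewrite divr_gt0 ?mulr_gt0 ?exprn_gt0// ltr_pwDl.
have tangent x : Dk 0 T x * (s * (1 - ln s)) + 2 * s * (v x * Dk 0 T x) <=
   (b * T)^-1 * (N T x ^- n.-1 * (a / 2 * grad_sq v x + b * expR (2 * v x))).
  have t1 : s * (1 - ln s) + 2 * s * v x <= expR (2 * v x).
    have -> : expR (2 * v x) = s * expR (2 * v x - ln s).
      by rewrite expRD expRN lnK ?posrE// mulrCA divff ?mulr1// gt_eqF.
    rewrite -subr_ge0 (_ : _ - _ = s * (expR (2 * v x - ln s) - (1 + (2 * v x - ln s)))); last by ring.
    by rewrite mulr_ge0 ?(ltW s0)// subr_ge0 expR_ge1Dx.
  apply: (@le_trans _ _ (Dk 0 T x * expR (2 * v x))).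
    rewrite [leLHS](_ : _ = Dk 0 T x * (s * (1 - ln s) + 2 * s * v x)); last by ring.
    exact: ler_wpM2l.
  apply: (@le_trans _ _ (T^-1 * (N T x ^- n.-1 * expR (2 * v x)))).
    rewrite mulrA ler_wpM2r ?expR_ge0// Dk0.
    have -> : n.+1 = n.-1.+2 by rewrite prednK.
    have N0 := N_gt0 x T0.
    rewrite -!exprVn -addn2 exprD mulrCA [leRHS]mulrC ler_wpM2l ?exprn_ge0 ?invr_ge0 ?(ltW N0)//.
    rewrite exprVn ler_pdivrMr ?exprn_gt0// ler_pdivlMl// -expr2.
    by rewrite ler_sqr ?nnegrE ?(ltW T0) ?(ltW N0)// le_t_N.
  rewrite (_ : (b * T)^-1 = T^-1 * b^-1); last by rewrite invfM mulrC.
  rewrite -[leRHS]mulrA; apply: ler_wpM2l; first by rewrite invr_ge0 ltW.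
  rewrite mulrCA ler_wpM2l ?NX_ge0// ler_pdivlMl// lerDr mulr_ge0 ?grad_sq_ge0//.
  by rewrite divr_ge0// ltW.
have I0 : intg (lebn n) (fun x => Dk 0 T x * (s * (1 - ln s))).
  rewrite (_ : (fun x => _) = fun x => (s * (1 - ln s)) * Dk 0 T x); first exact: intgZ.
  by apply/funext => x; rewrite mulrC.
have := RI_le (intgD I0 (intgZ (2 * s) Ivw)) (intgZ (b * T)^-1 IE) tangent.
have -> : (fun x => Dk 0 T x * (s * (1 - ln s)) + 2 * s * (v x * Dk 0 T x)) =
   fun x => (s * (1 - ln s)) * Dk 0 T x + 2 * s * (v x * Dk 0 T x).
  by apply/funext => x; rewrite (mulrC (Dk 0 T x)).
rewrite RID; [|exact: intgZ|exact: intgZ].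
rewrite RIZ// RIZ// Rw RIZ// => le1.
have le2 : (b * T)^-1 * (A * (1 + RI (lebn n) m) / T) = s * @kappa R n.
  by rewrite /s; field; rewrite !gt_eqF.
have le3 : s * (1 - ln s) * @kappa R n + 2 * s * RI (lebn n) (fun x => v x * Dk 0 T x) <= s * @kappa R n.
  by apply: (le_trans le1); rewrite -le2; apply: ler_wpM2l bE; nneg.
have le4 : 2 * RI (lebn n) (fun x => v x * Dk 0 T x) <= @kappa R n * ln s.
  rewrite -(ler_pM2l s0); move: le3; lra.
have Es : ln s = - (2 * ln T) + ln (1 + RI (lebn n) m) + ln (A / (b * @kappa R n)).
  have -> : s = T ^- 2 * (1 + RI (lebn n) m) * (A / (b * @kappa R n)).
    by rewrite /s; field; rewrite !gt_eqF.
  have M1 : 0 < 1 + RI (lebn n) m by rewrite ltr_pwDl.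
  have -> : ln (T ^- 2 * (1 + RI (lebn n) m) * (A / (b * @kappa R n))) =
      ln (T ^- 2) + ln (1 + RI (lebn n) m) + ln (A / (b * @kappa R n)).
    have T2 : 0 < T ^- 2 by rewrite invr_gt0 exprn_gt0.
    have P1 : 0 < T ^- 2 * (1 + RI (lebn n) m) by rewrite mulr_gt0.
    have P2 : 0 < A / (b * @kappa R n) by rewrite divr_gt0// mulr_gt0.
    by rewrite lnM ?posrE// lnM ?posrE.
  congr (_ + _ + _); rewrite lnV ?posrE ?exprn_gt0//.
  by rewrite expr2 lnM ?posrE//; ring.
move: le4; rewrite Es; lra.
Qed.

End energy_estimates.

(** * Taylor expansion of the Poisson kernel in its height *)

Section taylor_kernel.
Context {R : realType} {n : nat}.
Implicit Types (v f h : 'rV[R]_n -> R) (x z : 'rV[R]_n) (t e T : R).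

(** Euler's relation: [Dk j] is homogeneous of degree [- (n + j)] in [(t, x)]. The divergence of
    [x Dk j] supplies the [n] and leaves [- j]. *)
Lemma Dk_euler j t x : 0 < t ->
  t * Dk j.+1 t x = - (\sum_i partial i (fun y : 'rV[R]_n => y ord0 i * Dk j t y) x) - j%:R * Dk j t x.
Proof.
move=> t0; have N0 := N_gt0 x t0.
have E i : partial i (fun y : 'rV[R]_n => y ord0 i * Dk j t y) x =
   Dk j t x + x ord0 i ^+ 2 * K (n + j).+2 (opE (n + j) (@tau R n j)) t x.
  rewrite partialE.
  have := is_deriveM (is_derive_coord i i x) (is_derive_K i (n + j) (@tau R n j) x t0).
  by case=> _ E; rewrite [LHS]E eqxx /GRing.scale/= /Dk; ring.
under eq_bigr do rewrite E.
rewrite big_split/= sumr_const card_ord -mulr_suml -/(sqn x).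
have -> : sqn x = (1 - (t / N t x) ^+ 2) * N t x ^+ 2.
  transitivity (N t x ^+ 2 - t ^+ 2); first by rewrite sqr_N addrAC subrr add0r.
  by field; rewrite gt_eqF.
rewrite /Dk addnS /K /= /opT /opE !(hornerD, hornerN, hornerM, hornerZ, hornerX, hornerXn, hornerC).
rewrite -[in RHS]mulr_natl natrD !(exprS (N t x)) expr0.
by field; rewrite expf_neq0 gt_eqF.
Qed.

Lemma Dk_bound j : exists2 C : R, 0 <= C &
  forall t x, 0 < t -> t ^+ j * `|Dk j t x| <= C * (t * N t x ^- n.+1).
Proof.
case: j => [|j].
  exists 1 => // t x t0; rewrite expr0 !mul1r Dk0 ger0_norm//; nneg.
have [C C0 HC] := @K_bound R n (n + j.+1) (@tau R n j.+1).
exists C => // t x t0; have N0 := N_gt0 x t0.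
apply: (@le_trans _ _ (t ^+ j.+1 * (C * N t x ^- (n + j.+1)))).
  by apply: ler_wpM2l; [nneg|exact: HC].
rewrite mulrCA ler_wpM2l// exprS -mulrA ler_wpM2l ?(ltW t0)//.
rewrite -addSnnS -!exprVn exprD mulrCA ler_piMr ?exprn_ge0 ?invr_ge0 ?(ltW N0)//.
rewrite -exprMn exprn_ile1 ?mulr_ge0 ?invr_ge0 ?(ltW N0) ?(ltW t0)//.
by rewrite ler_pdivrMr// mul1r le_t_N.
Qed.

Lemma N_lower (d t : R) x : 0 <= d <= 1 -> d <= t -> d * N 1 x <= N t x.
Proof.
move=> /andP[d0 d1] dt.
rewrite -(@ler_sqr R) ?nnegrE ?mulr_ge0 ?N_ge0// exprMn !sqr_N expr1n mulrDr mulr1.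
apply: lerD; first by rewrite ler_sqr ?nnegrE// (le_trans d0).
by rewrite ler_piMl ?sqn_ge0// exprn_ile1.
Qed.

Lemma NX_lower (d t : R) b x : 0 < d <= 1 -> d <= t -> N t x ^- b <= d ^- b * N 1 x ^- b.
Proof.
move=> /andP[d0 d1] dt; have t0 := lt_le_trans d0 dt.
rewrite -!exprVn -exprMn -invfM; apply: lerXn2r; rewrite ?nnegrE ?invr_ge0 ?mulr_ge0 ?N_ge0 ?(ltW d0)//.
rewrite lef_pV2 ?posrE ?mulr_gt0 ?N_gt0//; apply: N_lower => //.
by rewrite (ltW d0).
Qed.

Lemma intg_vNX v t : intg (lebn n) (fun x => `|v x| * N 1 x ^- n.+1) -> measurable_fun setT v ->
  0 < t -> intg (lebn n) (fun x => `|v x| * N t x ^- n.+1).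
Proof.
move=> Iv mv t0; pose d := Num.min t 1.
have d0 : 0 < d by rewrite lt_min t0 ltr01.
have d1 : d <= 1 by rewrite ge_min lexx orbT.
have dt : d <= t by rewrite ge_min lexx.
apply: (intg_le _ _ (intgZ (d ^- n.+1) Iv)).
  apply: measurable_funM; first exact: (measurableT_comp (@normr_measurable R setT) mv).
  by apply: continuous_measurable_rV; exact: continuous_NX.
move=> x; rewrite ger0_norm; last by nneg.
by rewrite mulrCA ler_wpM2l// NX_lower// d0.
Qed.

Lemma intg_vDk j v t : intg (lebn n) (fun x => `|v x| * N 1 x ^- n.+1) -> measurable_fun setT v ->
  0 < t -> intg (lebn n) (fun x => v x * Dk j t x).
Proof.
move=> Iv mv t0; have [C C0 HC] := Dk_bound j.
apply: (@intgM_cont R n (fun=> 0) v (fun x => N t x ^- n.+1) (Dk j t) (C * t * t ^- j) _ _ _ (intg_vNX Iv mv t0)) => //.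
  exact: continuous_measurable_rV (homk_continuous t0 (homk_Dk _ t0)).
move=> x; rewrite -(@ler_pM2l _ (t ^+ j)) ?exprn_gt0// (le_trans (HC t x t0))//.
rewrite le_eqVlt; apply/orP; left; apply/eqP.
by field; rewrite !expf_neq0 ?gt_eqF ?N_gt0.
Qed.

Lemma smooth_coord (i : 'I_n) : smooth (fun x : 'rV[R]_n => x ord0 i).
Proof.
apply: (smooth_coind (F := fun f => (exists j, f = fun x : 'rV[R]_n => x ord0 j) \/
  exists c, f = fun=> c)); last by left; exists i.
move=> _ [[j ->]|[c ->]].
  split=> [|k]; first exact: continuous_coord.
  split=> [x|]; first by have [] := is_derive_coord k j x.
  right; exists (k == j)%:R; apply/funext => x; rewrite partialE.
  by have [_ ->] := is_derive_coord k j x.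
split=> [|k]; first exact: cst_continuous.
split=> [x|]; first exact: derivable_cst.
by right; exists 0; apply/funext => x; rewrite partial_cst.
Qed.

Lemma partial_cutoff_bound : exists2 D, 0 <= D & forall T k i x, 1 <= T ->
  `|partial i (@chi R n (cutoff T k)) x| <= D / N T x.
Proof.
have [D D0 hD] := @partial_chi_bound R n.
exists (2 * D) => [|T k i x T1]; first by nneg.
have T0 : 0 < T := lt_le_trans ltr01 T1.
set eps := cutoff T k; have e0 : 0 < eps by exact: cutoff_gt0.
have N0 := N_gt0 x T0.
have [h|h] := leP 1 (eps ^+ 2 * sqn x).
  by rewrite (bumpk_supp (bumpk_partial i bumpk_chi) h) normr0 divr_ge0//; nneg.
rewrite (le_trans (hD i eps x (ltW e0)))// (mulrC 2) -mulrA ler_wpM2l// ler_pdivlMr//.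
rewrite -(@ler_sqr R) ?nnegrE ?mulr_ge0 ?(ltW e0) ?(ltW N0)// exprMn sqr_N mulrDr.
have : (eps * T) ^+ 2 <= 1 by rewrite exprn_ile1 ?mulr_ge0 ?(ltW e0) ?(ltW T0)// cutoff_le.
by rewrite exprMn; move: h; move: (eps ^+ 2 * sqn x) (eps ^+ 2 * T ^+ 2) => y z; rewrite expr2; lra.
Qed.

(** Here [h] decays one power less than the weight against which [v] is integrable. In the cut-off
    term the gradient of the cut-off, of size [1 / N T x], supplies the missing power. *)
Lemma partial_by_parts_slow T i v h (C : R) : 1 <= T -> smooth v -> smooth h -> 0 <= C ->
  (forall x, `|h x| <= C * N T x ^- n) ->
  (forall x, `|partial i h x| <= C * N T x ^- n.+1) ->
  intg (lebn n) (fun x => `|v x| * N T x ^- n.+1) ->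
  intg (lebn n) (fun x => partial i v x * h x) ->
  RI (lebn n) (fun x => partial i v x * h x) = - RI (lebn n) (fun x => v x * partial i h x).
Proof.
move=> T1 sv sh C0 hC dC Iv Ivh; have T0 : 0 < T := lt_le_trans ltr01 T1.
have [D D0 hD] := partial_cutoff_bound.
pose c k : 'rV[R]_n -> R := chi (cutoff T k).
have sc k : smooth (c k) by exact: bumpk_smooth bumpk_chi.
have cc k : csupp (c k) by exact: cutoff_csupp.
have tc := @cutoff_tame R n T T1.
have c1 k x : `|c k x| <= 1 by rewrite ger0_norm; [exact: chi_le1|exact: chi_ge0].
have cv := smooth_continuous sv; have ch := smooth_continuous sh.
have cdv := smooth_continuous (smooth_partial i sv).
have cdh := smooth_continuous (smooth_partial i sh).
have shc k : smooth (fun x => h x * c k x) := smoothM sh (sc k).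
have E k : RI (lebn n) (fun x => partial i v x * (h x * c k x)) =
   - RI (lebn n) (fun x => v x * partial i (fun x => h x * c k x) x).
  by rewrite (integration_by_parts_csupp i sv (shc k) (csuppMr h (cc k))).
have [||||_ L1] := @RI_dct _ _ R (lebn n) (fun k x => partial i v x * (h x * c k x))
  (fun x => partial i v x * h x) (fun x => `|partial i v x * h x|).
- move=> k; apply: continuous_measurable_rV.
  exact: continuousM_fun cdv (smooth_continuous (shc k)).
- move=> x; have cx := tame_cvg (x := x) tc.
  have := cvgM (cvg_cst (partial i v x)) (cvgM (cvg_cst (h x)) cx).
  by rewrite mulr1; exact.
- by move=> k x; rewrite mulrA normrM ler_piMr.
- exact: intg_norm.
have bnd k x : `|partial i (fun x => h x * c k x) x| <= (C + C * D) * N T x ^- n.+1.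
  rewrite (partialME i sh (sc k)) (le_trans (ler_normD _ _))// mulrDl; apply: lerD.
    rewrite normrM (le_trans _ (dC x))//; exact: ler_piMr.
  rewrite normrM exprSr invfM [leRHS](_ : _ = (C * N T x ^- n) * (D / N T x)); last by ring.
  by apply: ler_pM => //; exact: hD.
have [||||_ L2] := @RI_dct _ _ R (lebn n) (fun k x => v x * partial i (fun x => h x * c k x) x)
  (fun x => v x * partial i h x) (fun x => (C + C * D) * (`|v x| * N T x ^- n.+1)).
- move=> k; apply: continuous_measurable_rV.
  exact: continuousM_fun cv (smooth_continuous (smooth_partial i (shc k))).
- move=> x; have cx := tame_cvg (x := x) tc.
  have dx := tame_cvg (x := x) (tame_partial i tc).
  rewrite partial_cst in dx.
  rewrite (_ : (fun k => _) = (fun k => v x * (partial i h x * c k x + h x * partial i (c k) x))); last first.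
    by apply/funext => k; rewrite (partialME i sh (sc k)).
  rewrite (_ : v x * partial i h x = v x * (partial i h x * 1 + h x * 0)); last first.
    by rewrite mulr1 mulr0 addr0.
  exact: cvgM (cvg_cst (v x)) (cvgD (cvgM (cvg_cst (partial i h x)) cx) (cvgM (cvg_cst (h x)) dx)).
- by move=> k x; rewrite normrM mulrCA ler_wpM2l.
- exact: intgZ.
rewrite (_ : (fun k => _) = (fun k => - RI (lebn n) (fun x => v x * partial i (fun x => h x * c k x) x))) in L1.
  by apply: cvg_unique L1 _ => //; exact: cvgN.
by apply/funext => k; rewrite E.
Qed.

Variables (a b : R) (a0 : 0 < a) (b0 : 0 < b).
Hypothesis n2 : (2 <= n)%N.
Let n0 : (0 < n)%N := ltnW n2.

(** By Euler's relation [T Dk j.+1] is a divergence up to [j Dk j], so an integration by parts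
    leaves [grad v] against [x Dk j]. As [T^j |x Dk j| <= C T N^(-n)], the pairing is split into the
    energy and [N^(-n-1)], both of order [1/T]. *)
Lemma middle_step j : exists2 C, 0 <= C & forall v m T, curv_ineq a b v m -> 1 <= T ->
  `|T ^+ j.+1 * RI (lebn n) (fun x => v x * Dk j.+1 T x)| <= C * (1 + RI (lebn n) m) +
  j%:R * `|T ^+ j * RI (lebn n) (fun x => v x * Dk j T x)|.
Proof.
have [A A0 HA] := energy_T a0 b0 n2.
have k0 := @kappa_gt0 R n n0.
have [C C0 HC] := Dk_bound j.
have HP : exists2 P : R, 0 <= P & forall t x i, 0 < t ->
    t ^+ j * `|partial i (fun y : 'rV[R]_n => y ord0 i * Dk j t y) x| <= P * (t * N t x ^- n.+1).
  have [P P0 hP] := @K_bound R n (n + j).+2 (opE (n + j) (@tau R n j)).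
  (* For [j = 0] the bound through [K] loses a factor [t / N]; the derivative of the explicit
     Poisson kernel restores it. *)
  case: j C C0 HC P P0 hP => [|j] C C0 HC P P0 hP.
    exists (1 + n.+1%:R) => [|t x i t0]; first by nneg.
    rewrite expr0 mul1r.
    have -> : partial i (fun y : 'rV[R]_n => y ord0 i * Dk 0 t y) x =
       t * (N t x ^- n.+1 - n.+1%:R * ((x ord0 i / N t x) ^+ 2 * N t x ^- n.+1)).
      rewrite partialE (_ : (fun y : 'rV[R]_n => _) = (fun y => y ord0 i * (t * N t y ^- n.+1))); last first.
        by apply/funext => y; rewrite Dk0.
      have d1 := is_deriveZ t (is_derive_chain (is_derive_N i x t0) (is_derive_invX n.+1 (N_gt0 x t0))).
      have d := is_deriveM (is_derive_coord i i x) d1.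
      have [_ E] := d; rewrite [LHS]E /GRing.scale/= eqxx /= -!exprVn; move: ((N t x)^-1) => q.
      rewrite /GRing.scale/= !exprS; ring.
    rewrite normrM (gtr0_norm t0) [leRHS]mulrCA; apply: ler_wpM2l; first exact: ltW.
    have q1 : (x ord0 i / N t x) ^+ 2 <= 1.
      rewrite -[leLHS]real_normK ?num_real// exprn_ile1// normrM normfV (gtr0_norm (N_gt0 x t0)).
      by rewrite ler_pdivrMr ?N_gt0// mul1r le_coord_N.
    have N0 := @NX_ge0 R n t n.+1 x; move: q1 N0; move: (N t x ^- n.+1) (_ ^+ 2) (sqr_ge0 (x ord0 i / N t x)) => M q q0 q1 M0.
    apply: (le_trans (ler_normB _ _)); rewrite mulrDl mul1r (ger0_norm M0) lerD2l.
    by rewrite ger0_norm; [apply: ler_wpM2l => //; exact: ler_piMl|nneg].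
  exists (C + P) => [|t x i t0]; first by nneg.
  have N0 := N_gt0 x t0.
  have -> : partial i (fun y : 'rV[R]_n => y ord0 i * Dk j.+1 t y) x =
     Dk j.+1 t x + x ord0 i ^+ 2 * K (n + j.+1).+2 (opE (n + j.+1) (@tau R n j.+1)) t x.
    rewrite partialE.
    have := is_deriveM (is_derive_coord i i x) (is_derive_K i (n + j.+1) (@tau R n j.+1) x t0).
    by case=> _ E; rewrite [LHS]E eqxx /GRing.scale/= /Dk; ring.
  apply: (@le_trans _ _ (t ^+ j.+1 * `|Dk j.+1 t x| + t ^+ j.+1 *
     `|x ord0 i ^+ 2 * K (n + j.+1).+2 (opE (n + j.+1) (@tau R n j.+1)) t x|)).
    by rewrite -mulrDr; apply: ler_wpM2l; [nneg|exact: ler_normD].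
  rewrite mulrDl; apply: lerD; first exact: HC.
  apply: (@le_trans _ _ (t ^+ j.+1 * (N t x ^+ 2 * (P * N t x ^- (n + j.+1).+2)))).
    apply: ler_wpM2l; first by nneg.
    rewrite normrM; apply: ler_pM => //; last exact: hP.
    by rewrite normrX; apply: lerXn2r; rewrite ?nnegrE ?N_ge0// le_coord_N.
  rewrite [leLHS](_ : _ = P * (t * (N t x ^- n.+1 * (t / N t x) ^+ j))); last first.
    by rewrite -addSnnS !exprS exprD expr_div_n; field; rewrite !expf_neq0 ?gt_eqF.
  apply: ler_wpM2l => //; apply: ler_wpM2l; first exact: ltW.
  apply: ler_piMr; first exact: NX_ge0.
  rewrite exprn_ile1 ?divr_ge0 ?(ltW t0) ?(ltW N0)//.
  by rewrite ler_pdivrMr// mul1r le_t_N.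
have [P P0 hP] := HP.
exists (C * (2 * A / a + n%:R * @kappa R n)) => [|v m T H T1].
  by apply: mulr_ge0 => //; apply: addr_ge0; [apply: divr_ge0|]; nneg.
have T0 : 0 < T := lt_le_trans ltr01 T1.
have [sv Im m0 _] := H; have cv := smooth_continuous sv.
have mv := continuous_measurable_rV cv.
have [IE bE] := HA v m T H T1.
have M0 : 0 <= RI (lebn n) m by apply: RI_ge0.
have Iv := growth a0 b0 n2 H.
have IvT := intg_vNX Iv mv T0.
have [INX RNX] := intg_RI_NX T0 n0.
pose h i (y : 'rV[R]_n) : R := y ord0 i * Dk j T y.
have Dh i x : is_derive x (ebasis R i) (h i) (partial i (h i) x).
  have d := is_deriveM (is_derive_coord i i x) (is_derive_K i (n + j) (@tau R n j) x T0).
  by apply: (is_derive_eq d); rewrite partialE; have [_ <-] := d.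
have sh i : smooth (h i) := smoothM (smooth_coord i) (homk_smooth T0 (homk_Dk j T0)).
have Tj : 0 < T ^+ j by rewrite exprn_gt0.
have hb i x : T ^+ j * `|h i x| <= C * (T * N T x ^- n).
  rewrite /h normrM mulrCA; have N0 := N_gt0 x T0.
  apply: (@le_trans _ _ (N T x * (C * (T * N T x ^- n.+1)))).
    by apply: ler_pM => //; [nneg|exact: le_coord_N|exact: HC].
  by rewrite exprS le_eqVlt; apply/orP; left; apply/eqP; field; rewrite expf_neq0 ?gt_eqF.
pose G x := grad_sq v x * N T x ^- n.-1.
have IG : intg (lebn n) G /\ RI (lebn n) G <= 2 / a * (A * (1 + RI (lebn n) m) / T).
  have mG : measurable_fun setT G.
    apply: continuous_measurable_rV; apply: continuousM_fun; last exact: continuous_NX.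
    exact: smooth_continuous (smooth_grad_sq sv).
  have Gle x : G x <= 2 / a * (N T x ^- n.-1 * (a / 2 * grad_sq v x + b * expR (2 * v x))).
    rewrite [leRHS](_ : _ = G x + N T x ^- n.-1 * (2 / a * b * expR (2 * v x))).
      by rewrite lerDl; nneg.
    by rewrite /G; field; rewrite !gt_eqF ?exprn_gt0 ?N_gt0.
  have G0 x : 0 <= G x by rewrite /G; nneg.
  have I : intg (lebn n) G.
    by apply: (intg_le mG _ (intgZ (2 / a) IE)) => x; rewrite ger0_norm.
  split=> //; apply: (le_trans (RI_le I (intgZ (2 / a) IE) Gle)).
  rewrite RIZ//; apply: ler_wpM2l bE; apply: divr_ge0; nneg.
have [{}IG RG] := IG.
have pt i x : T ^+ j * `|partial i v x * h i x| <= C * T * (partial i v x ^+ 2 * N T x ^- n.-1 + N T x ^- n.+1).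
  apply: (@le_trans _ _ (`|partial i v x| * (C * (T * N T x ^- n)))).
    by rewrite normrM mulrCA; apply: ler_wpM2l.
  rewrite [leLHS](_ : _ = C * T * (`|partial i v x| * N T x ^- n)); last by ring.
  apply: ler_wpM2l; first by nneg.
  rewrite -!exprVn; set q := (N T x)^-1; have q0 : 0 <= q by rewrite invr_ge0 N_ge0.
  have -> : q ^+ n = q ^+ n.-1 * q by rewrite -exprSr prednK.
  have -> : q ^+ n.+1 = q ^+ n.-1 * q ^+ 2 by rewrite -exprD addn2 prednK.
  rewrite (mulrC (_ ^+ 2) (q ^+ n.-1)) -mulrDr mulrCA ler_wpM2l ?exprn_ge0//.
  rewrite -[X in _ <= X + _]real_normK ?num_real//.
  have := sqr_ge0 (q - `|partial i v x|); have := mulr_ge0 q0 (normr_ge0 (partial i v x)).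
  rewrite !expr2; lra.
have Ipt i : intg (lebn n) (fun x => partial i v x ^+ 2 * N T x ^- n.-1).
  apply: (intg_le _ _ IG).
    apply: continuous_measurable_rV; apply: continuousM_fun; last exact: continuous_NX.
    have c := smooth_continuous (smooth_partial i sv).
    exact: (continuousM_fun c c).
  move=> x; rewrite ger0_norm; last by nneg.
  rewrite /G ler_wpM2r ?NX_ge0// /grad_sq (bigD1 i)//= lerDl.
  by apply: sumr_ge0 => k _; exact: sqr_ge0.
have Ivh i : intg (lebn n) (fun x => partial i v x * h i x).
  apply: (intg_le _ _ (intgZ (T ^- j * (C * T)) (intgD (Ipt i) INX))).
    apply: continuous_measurable_rV; apply: continuousM_fun.
      exact: smooth_continuous (smooth_partial i sv).
    exact: smooth_continuous (sh i).
  by move=> x; rewrite -mulrA ler_pdivlMl// pt.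
have E : RI (lebn n) (fun x => v x * (T * Dk j.+1 T x)) =
   \sum_i RI (lebn n) (fun x => partial i v x * h i x) - j%:R * RI (lebn n) (fun x => v x * Dk j T x).
  have Ivph i : intg (lebn n) (fun x => v x * partial i (h i) x).
    apply: (@intgM_cont R n (fun=> 0) v (fun x => N T x ^- n.+1) _ (T ^- j * (P * T)) _ _ _ IvT) => //.
      exact: continuous_measurable_rV (smooth_continuous (smooth_partial i (sh i))).
    by move=> x; rewrite -mulrA ler_pdivlMl// -mulrA hP.
  have Ivj := intg_vDk j Iv mv T0.
  transitivity (RI (lebn n) (fun x => - (\sum_i v x * partial i (h i) x) - j%:R * (v x * Dk j T x))).
    congr RI; apply/funext => x; rewrite Dk_euler// mulrBr mulrN mulr_sumr; congr (_ - _); ring.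
  rewrite RIB; [|by apply: intgN; exact: intg_sum|exact: intgZ].
  rewrite RIZ// RIN; last exact: intg_sum.
  rewrite RI_sum// -sumrN; congr (_ - _); apply: eq_bigr => i _.
  have CP : 0 <= T ^- j * (C * T) + T ^- j * (P * T) by nneg.
  rewrite (partial_by_parts_slow (T := T) (C := T ^- j * (C * T) + T ^- j * (P * T)) (h := h i))// ?opprK//.
    move=> x; rewrite mulrDl (@le_trans _ _ (T ^- j * (C * T) * N T x ^- n))//.
      by rewrite -mulrA ler_pdivlMl// -mulrA hb.
    by rewrite lerDl; nneg.
  move=> x; rewrite mulrDl (@le_trans _ _ (T ^- j * (P * T) * N T x ^- n.+1))//.
    by rewrite -mulrA ler_pdivlMl// -mulrA hP.
  by rewrite lerDr; nneg.
have E2 : T ^+ j.+1 * RI (lebn n) (fun x => v x * Dk j.+1 T x) =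
   \sum_i T ^+ j * RI (lebn n) (fun x => partial i v x * h i x) -
   j%:R * (T ^+ j * RI (lebn n) (fun x => v x * Dk j T x)).
  rewrite exprSr -mulrA -RIZ; last exact: intg_vDk.
  rewrite (_ : RI _ _ = RI (lebn n) (fun x => v x * (T * Dk j.+1 T x))); last first.
    by congr RI; apply/funext => x; rewrite mulrCA.
  by rewrite E mulrBr mulr_sumr; congr (_ - _); rewrite mulrCA.
rewrite E2; apply: (le_trans (ler_normB _ _)); rewrite normrM (@ger0_norm _ j%:R)// lerD2r.
apply: (le_trans (ler_norm_sum _ _ _)).
have S1 : \sum_i `|T ^+ j * RI (lebn n) (fun x => partial i v x * h i x)| <=
   \sum_(i < n) C * T * (RI (lebn n) (fun x => partial i v x ^+ 2 * N T x ^- n.-1) + @kappa R n / T).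
  apply: ler_sum => i _; rewrite -RIZ//.
  have -> : C * T * (RI (lebn n) (fun x => partial i v x ^+ 2 * N T x ^- n.-1) + @kappa R n / T) =
      RI (lebn n) (fun x => C * T * (partial i v x ^+ 2 * N T x ^- n.-1 + N T x ^- n.+1)).
    rewrite RIZ; last by apply: intgD.
    by rewrite RID// RNX [_^-1 * _]mulrC.
  apply: RI_norm_le; [exact: intgZ|by apply: intgZ; exact: intgD|] => x.
  by rewrite normrM (gtr0_norm Tj).
apply: (le_trans S1); rewrite -mulr_sumr big_split/= -RI_sum//.
have -> : RI (lebn n) (fun x => \sum_i partial i v x ^+ 2 * N T x ^- n.-1) = RI (lebn n) G.
  by congr RI; apply/funext => x; rewrite /G /grad_sq mulr_suml.
rewrite sumr_const card_ord.
rewrite -[leLHS]mulrA -[leRHS]mulrA; apply: ler_wpM2l => //.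
rewrite mulrDr -[_ *+ n]mulr_natl [X in _ + X <= _](_ : _ = n%:R * @kappa R n); last by field; rewrite gt_eqF.
rewrite mulrDl; apply: lerD.
  apply: (@le_trans _ _ (T * (2 / a * (A * (1 + RI (lebn n) m) / T)))).
    by apply: ler_wpM2l => //; exact: ltW.
  by rewrite le_eqVlt; apply/orP; left; apply/eqP; field; rewrite !gt_eqF.
apply: ler_peMr; first by nneg.
by rewrite lerDl.
Qed.

(** The recursion starts because the lower-order term of [middle_step] has the factor [j]. For
    [j = 0] it disappears, so the average itself, which is of logarithmic size, never enters. *)
Lemma middle_terms j : exists2 C, 0 <= C & forall v m T, curv_ineq a b v m -> 1 <= T ->
  `|T ^+ j.+1 * RI (lebn n) (fun x => v x * Dk j.+1 T x)| <= C * (1 + RI (lebn n) m).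
Proof.
elim: j => [|j [C C0 HC]].
  have [C C0 HC] := middle_step 0; exists C => // v m T H T1.
  by have := HC v m T H T1; rewrite mul0r addr0.
have [D D0 HD] := middle_step j.+1.
exists (D + j.+1%:R * C) => [|v m T H T1]; first by nneg.
apply: (le_trans (HD v m T H T1)); rewrite mulrDl lerD2l -mulrA.
by apply: ler_wpM2l => //; exact: HC.
Qed.

End taylor_kernel.

(** * Taylor comparison between two heights and the limit at height 0 *)

Section taylor.
Context {R : realType} {n : nat}.
Implicit Types (v f h : 'rV[R]_n -> R) (x z : 'rV[R]_n) (t e T : R).

(** The Taylor polynomial, based at height [t] and evaluated at the lower height [e], of the kernel
    as a function of its height; the signs come from [(e - t)^j]. *)
Definition taylor (m : nat) e t z : R :=
  \sum_(j < m) (-1) ^+ j * ((t - e) ^+ j / j`!%:R) * Dk j t z.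

Lemma is_derive_subX m e t :
  is_derive t 1 (fun s : R => (s - e) ^+ m) (m%:R * (t - e) ^+ m.-1).
Proof.
have d0 : is_derive t 1 (fun s : R => s - e) 1.
  have d1 := is_deriveB (is_derive_id t (1 : R)) (is_derive_cst e t (1 : R)).
  by apply: (is_derive_eq d1); rewrite subr0.
elim: m => [|m ih].
  rewrite (_ : (fun s => _) = cst 1); last by apply/funext => s; rewrite expr0.
  by rewrite mul0r; exact: is_derive_cst.
rewrite (_ : (fun s => _) = (fun s => (s - e) * (s - e) ^+ m)); last first.
  by apply/funext => s; rewrite exprS.
have d := is_deriveM d0 ih; apply: (is_derive_eq d); rewrite /GRing.scale/=.
by case: m {ih d} => [|m]; rewrite ?mul0r ?mulr0 ?add0r ?expr0 ?mulr1//= -(natr1 m.+1) !exprS; ring.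
Qed.

(** When the base point moves, the derivatives of consecutive terms cancel and only the top one
    remains: the integral form of the Taylor remainder. *)
Lemma is_derive_taylor m e t z : 0 < t -> is_derive t 1 (fun s => taylor m.+1 e s z)
  ((-1) ^+ m * ((t - e) ^+ m / m`!%:R) * Dk m.+1 t z).
Proof.
move=> t0; elim: m => [|m ih].
  rewrite (_ : (fun s => _) = (fun s => Dk 0 s z)); last first.
    by apply/funext => s; rewrite /taylor big_ord_recl big_ord0 !expr0 fact0 divr1 !mul1r addr0.
  by apply: (is_derive_eq (is_derive_Dk 0 z t0)); rewrite !expr0 fact0 divr1 !mul1r.
rewrite (_ : (fun s => _) = (fun s => taylor m.+1 e s z +
    (-1) ^+ m.+1 / m.+1`!%:R * ((s - e) ^+ m.+1 * Dk m.+1 s z))); last first.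
  by apply/funext => s; rewrite /taylor big_ord_recr/=; congr (_ + _); ring.
have dX := is_derive_subX m.+1 e t.
have d := is_deriveD ih (is_deriveZ ((-1) ^+ m.+1 / m.+1`!%:R) (is_deriveM dX (is_derive_Dk m.+1 z t0))).
apply: (is_derive_eq d); rewrite /GRing.scale/= factS natrM exprS.
have f0 : m`!%:R != 0 :> R by rewrite pnatr_eq0 -lt0n fact_gt0.
have f1 : m.+1%:R != 0 :> R by rewrite pnatr_eq0.
move: (m.+1%:R : R) (m`!%:R : R) f0 f1 => p q f0 f1.
by rewrite exprS; field; rewrite f0.
Qed.

Lemma taylor_diag m e z : taylor m.+1 e e z = Dk 0 e z.
Proof.
rewrite /taylor big_ord_recl big1 ?addr0 => [|j _].
  by rewrite !expr0 fact0 divr1 !mul1r.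
by rewrite subrr [0 ^+ _]exprS !mul0r mulr0 mul0r.
Qed.

Lemma is_derive_lnN t z : 0 < t -> is_derive t 1 (fun s => ln (N s z)) (t / N t z ^+ 2).
Proof.
move=> t0; have N0 := N_gt0 z t0.
have d := @is_derive1_comp R (@ln R) (fun s => N s z) t _ _ (is_derive1_ln N0) (is_derive_Nt z t0).
by apply: (is_derive_eq d); field; rewrite gt_eqF.
Qed.

Lemma lnN_diff e T z : 0 < e -> e <= T -> 0 <= ln (N T z) - ln (N e z) <= ln (T / e).
Proof.
move=> e0 eT; have T0 := lt_le_trans e0 eT; have N0 := N_gt0 z e0; have N1 := N_gt0 z T0.
have Te0 : 0 < T / e by rewrite divr_gt0.
rewrite subr_ge0 ler_ln ?posrE// lerBlDl -lnM ?posrE// ler_ln ?posrE ?mulr_gt0 ?invr_gt0//.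
apply/andP; split.
  by rewrite -(@ler_sqr R) ?nnegrE ?N_ge0// !sqr_N lerD2r ler_sqr ?nnegrE// ltW.
have P0 : 0 <= N e z * (T / e) by apply: mulr_ge0; exact: ltW.
rewrite -(@ler_sqr R) ?nnegrE ?N_ge0// exprMn !sqr_N mulrDl.
apply: lerD; first by rewrite -exprMn mulrCA divff ?mulr1// gt_eqF.
rewrite ler_peMr ?sqn_ge0// expr_div_n ler_pdivlMr ?exprn_gt0// mul1r.
by rewrite ler_sqr ?nnegrE// ltW.
Qed.

Lemma measurable_lnN t : 0 < t -> measurable_fun setT (fun z : 'rV[R]_n => ln (N t z)).
Proof.
move=> t0; apply: continuous_measurable_rV => z.
exact: (@continuous_comp _ _ _ (N t) (@ln R) z (@continuous_N R n t z) (continuous_ln (N_gt0 z t0))).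
Qed.

Lemma intg_lnN f e T : intg (lebn n) f -> 0 < e -> e <= T ->
  intg (lebn n) (fun z => `|f z| * (ln (N T z) - ln (N e z))).
Proof.
move=> If e0 eT; have T0 := lt_le_trans e0 eT.
apply: (intg_le _ _ (intgZ (ln (T / e)) (intg_norm If))).
  apply: measurable_funM.
    exact: (measurableT_comp (@normr_measurable R setT) (intg_measurable If)).
  by apply: measurable_funB; exact: measurable_lnN.
move=> z; have /andP[h0 h1] := lnN_diff z e0 eT.
by rewrite normrM normr_id (ger0_norm h0) mulrC ler_wpM2r.
Qed.

Lemma intg_taylor m e t v : intg (lebn n) (fun x => `|v x| * N 1 x ^- n.+1) ->
  measurable_fun setT v -> 0 < t -> intg (lebn n) (fun z => v z * taylor m e t z).
Proof.
move=> Iv mv t0.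
rewrite (_ : (fun z => _) = fun z => \sum_(j < m) ((-1) ^+ j * ((t - e) ^+ j / j`!%:R)) * (v z * Dk j t z)).
  by apply: intg_sum => j; apply: intgZ; exact: intg_vDk.
by apply/funext => z; rewrite /taylor mulr_sumr; apply: eq_bigr => j _; rewrite mulrCA.
Qed.

(** One majorant for a whole interval of heights away from 0, as differentiation under the integral
    requires. *)
Lemma Dk_dom j (e T : R) : 0 < e -> e <= T -> exists2 C, 0 <= C & forall t z, e <= t <= T ->
  `|Dk j t z| <= C * N 1 z ^- n.+1.
Proof.
move=> e0 eT; have T0 := lt_le_trans e0 eT; have [C C0 HC] := @Dk_bound R n j.
pose d := Num.min e 1.
have d0 : 0 < d by rewrite lt_min e0 ltr01.
have d1 : d <= 1 by rewrite ge_min lexx orbT.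
have de : d <= e by rewrite ge_min lexx.
exists (e ^- j * (C * (T * d ^- n.+1))) => [|t z /andP[et tT]].
  by apply: mulr_ge0; [|apply: mulr_ge0 => //; apply: mulr_ge0]; nneg.
have t0 := lt_le_trans e0 et.
rewrite -mulrA ler_pdivlMl ?exprn_gt0//.
apply: (@le_trans _ _ (t ^+ j * `|Dk j t z|)).
  by apply: ler_wpM2r => //; apply: lerXn2r; rewrite ?nnegrE// ltW.
apply: (le_trans (HC t z t0)); rewrite -mulrA; apply: ler_wpM2l => //.
rewrite -mulrA; apply: ler_pM => //; [exact: ltW|exact: NX_ge0|].
by apply: NX_lower; [rewrite d0|exact: le_trans de et].
Qed.

Hypothesis n0 : (0 < n)%N.

(* The logarithms come from the Taylor remainder: [t ^+ n * N t z ^- n.+1 <= t / N t z ^+ 2],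
   which is the height derivative of [ln (N t z)]. *)
Lemma taylor_compare v f (lam e T : R) : intg (lebn n) (fun x => `|v x| * N 1 x ^- n.+1) ->
  measurable_fun setT v -> intg (lebn n) f ->
  (forall t, 0 < t -> RI (lebn n) (fun z => v z * Dk n t z) = lam * RI (lebn n) (fun z => f z * Dk 0 t z)) ->
  0 < e -> e <= T ->
  RI (lebn n) (fun z => v z * Dk 0 e z) <= RI (lebn n) (fun z => v z * taylor n e T z) +
    `|lam| * RI (lebn n) (fun z => `|f z| * (ln (N T z) - ln (N e z))).
Proof.
move=> Iv mv If rep e0 eT; have T0 := lt_le_trans e0 eT.
(* The integral of [F t] is nondecreasing on [[e, T]]: the logarithmic term grows at least as fast
   as the Taylor remainder can decrease. Its values at [e] and [T] are the two sides of the
   claim. *)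
pose F t z := v z * taylor n e t z + `|lam| * (`|f z| * (ln (N t z) - ln (N e z))).
have [m nm] : exists m, n = m.+1 by exists n.-1; rewrite prednK.
pose co t : R := (-1) ^+ m * ((t - e) ^+ m / m`!%:R).
pose dF t z := v z * (co t * Dk n t z) + `|lam| * (`|f z| * (t / N t z ^+ 2)).
have dFP t z : 0 < t -> is_derive t 1 (F ^~ z) (dF t z).
  move=> t0.
  have d1 : is_derive t 1 (fun s => taylor n e s z) (co t * Dk n t z).
    by have := is_derive_taylor m e z t0; rewrite -nm.
  have d2 : is_derive t 1 (fun s => ln (N s z) - ln (N e z)) (t / N t z ^+ 2).
    have d3 := is_deriveB (is_derive_lnN z t0) (is_derive_cst (ln (N e z)) t (1 : R)).
    by apply: (is_derive_eq d3); rewrite subr0.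
  have d := is_deriveD (is_deriveZ (v z) d1) (is_deriveZ `|lam| (is_deriveZ `|f z| d2)).
  by apply: (is_derive_eq d).
(* Derivatives under the integral are taken on the open interval from [e / 2] to [T + 1], which
   contains [[e, T]] and stays away from height 0. *)
have e2 : 0 < e / 2 by rewrite divr_gt0.
have e2e : e / 2 <= e by lra.
pose T' := T + 1; have TT' : T <= T' by rewrite lerDl.
have T'1 : 1 <= T' by rewrite lerDr ltW.
have [C C0 HC] := Dk_dom n e2 (le_trans e2e (le_trans eT TT')).
have mDk j t : 0 < t -> measurable_fun setT (@Dk R n j t).
  by move=> t0; exact: continuous_measurable_rV (homk_continuous t0 (homk_Dk _ t0)).
have mf := intg_measurable If.
have IF t : 0 < t -> intg (lebn n) (F t).
  move=> t0; apply: intgD; first exact: intg_taylor.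
  apply: intgZ; have [te|et] := leP t e; last exact: intg_lnN (ltW et).
  rewrite (_ : (fun z => _) = fun z => - (`|f z| * (ln (N e z) - ln (N t z)))).
    by apply: intgN; exact: intg_lnN.
  by apply/funext => z; rewrite -mulrN opprB.
have cob t : e / 2 <= t <= T' -> `|co t| <= T' ^+ m.
  move=> /andP[et tT]; rewrite /co normrM normrX normrN1 expr1n mul1r normrM normfV.
  rewrite (@ger0_norm _ m`!%:R)// ler_pdivrMr ?ltr0n ?fact_gt0//.
  apply: (@le_trans _ _ (T' ^+ m)).
    by rewrite normrX; apply: lerXn2r; rewrite ?nnegrE ?(le_trans ler01 T'1)// ler_norml; lra.
  by apply: ler_peMr; [rewrite exprn_ge0// (le_trans ler01 T'1)|rewrite ler1n fact_gt0].
pose G z := T' ^+ m * C * (`|v z| * N 1 z ^- n.+1) + `|lam| * (2 / e * `|f z|).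
have G0 z : 0 <= G z.
  have T'0 := le_trans ler01 T'1; rewrite /G; apply: addr_ge0; first by nneg.
  by apply: mulr_ge0 => //; apply: mulr_ge0 => //; rewrite divr_ge0// ltW.
have IG : intg (lebn n) G.
  by apply: intgD; [exact: intgZ|do 2 apply: intgZ; exact: intg_norm].
have tN t z : 0 < t -> 0 <= t / N t z ^+ 2 <= t^-1.
  move=> t0; have N0 := N_gt0 z t0; rewrite divr_ge0 ?exprn_ge0 ?(ltW t0) ?(ltW N0)//=.
  rewrite ler_pdivrMr ?exprn_gt0// ler_pdivlMl// -expr2.
  by rewrite ler_sqr ?nnegrE ?(ltW t0) ?(ltW N0)// le_t_N.
have inI t : `](e / 2), T'[%classic t -> [/\ 0 < t, e / 2 <= t & t <= T'].
  by rewrite /= in_itv/= => /andP[h1 h2]; split; [exact: lt_trans e2 h1|exact: ltW|exact: ltW].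
have GP t z : `](e / 2), T'[%classic t -> setT z -> `|partial1of2 F t z| <= G z.
  move=> /inI[t0 et tT] _.
  have -> : partial1of2 F t z = dF t z by rewrite partial1of2E; have [_ ->] := dFP t z t0.
  rewrite /dF /G (le_trans (ler_normD _ _))//; apply: lerD.
    rewrite [leRHS](_ : _ = `|v z| * (T' ^+ m * (C * N 1 z ^- n.+1))); last by ring.
    rewrite [leLHS]normrM; apply: ler_wpM2l => //.
    rewrite normrM; apply: ler_pM => //.
      by apply: cob; rewrite et.
    by apply: HC; rewrite et.
  rewrite normrM normr_id; apply: ler_wpM2l => //; rewrite normrM normr_id mulrC.
  apply: ler_wpM2r => //; have /andP[h0 h1] := tN t z t0; rewrite ger0_norm// (le_trans h1)//.
  by rewrite -[2 / e]invrK invf_div lef_pV2.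
pose Phi t := RI (lebn n) (F t).
have dPhi t : `](e / 2), T'[%classic t -> is_derive t 1 Phi (RI (lebn n) (dF t)).
  move=> It; have [t0 _ _] := inI t It.
  have intF (x : R) : `](e / 2), T'[%classic x -> intg (lebn n) (F x).
    by move=> /inI[x0 _ _]; exact: IF.
  have derF (x : R) (y : 'rV[R]_n) : `](e / 2), T'[%classic x -> setT y -> derivable (F ^~ y) x 1.
    by move=> /inI[x0 _ _] _; have [] := dFP x y x0.
  have D1 := derivable_under_integral measurableT It intF derF G0 IG GP.
  have D2 := differentiation_under_integral measurableT It intF derF G0 IG GP.
  apply: (DeriveDef D1); rewrite -derive1E D2; congr RI.
  by apply/funext => z; rewrite partial1of2E; have [_ ->] := dFP t z t0.
have eI t : e <= t <= T -> `](e / 2), T'[%classic t.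
  move=> /andP[et tT]; rewrite /= in_itv/=; apply/andP; split.
    by rewrite (lt_le_trans _ et)// ltr_pdivrMr// ltr_pMr// ltr1n.
  by rewrite (le_lt_trans tT)// ltrDl.
have dF0 t : e <= t <= T -> 0 <= RI (lebn n) (dF t).
  move=> /andP[et tT]; have t0 := lt_le_trans e0 et.
  have IvD := intg_vDk n Iv mv t0.
  have IfN : intg (lebn n) (fun z => `|f z| * (t / N t z ^+ 2)).
    apply: (intg_le _ _ (intgZ t^-1 (intg_norm If))).
      apply: measurable_funM; first exact: (measurableT_comp (@normr_measurable R setT) mf).
      apply: measurable_funM => //; exact: continuous_measurable_rV (@continuous_NX R n t 2 t0).
    move=> z; have /andP[h0 h1] := tN t z t0.
    by rewrite normrM normr_id (ger0_norm h0) mulrC; exact: ler_wpM2r.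
  rewrite (_ : dF t = fun z => co t * (v z * Dk n t z) + `|lam| * (`|f z| * (t / N t z ^+ 2))); last first.
    by apply/funext => z; rewrite /dF mulrCA.
  rewrite RID; [|exact: intgZ|exact: intgZ].
  rewrite !RIZ// rep//.
  have P0 z : 0 <= @Dk R n 0 t z by rewrite Dk0; nneg.
  (* As [|co t| <= t^(n-1)], the left side is at most [(t/N)^(n-1)] times [t / N^2], and
     [t <= N]. *)
  have P1 z : `|co t| * @Dk R n 0 t z <= t / N t z ^+ 2.
    have N0 := N_gt0 z t0; have /andP[h0 h1] := tN t z t0.
    apply: (@le_trans _ _ (t ^+ m * (t * N t z ^- n.+1))).
      rewrite Dk0; apply: ler_wpM2r; first by nneg.
      rewrite /co normrM normrX normrN1 expr1n mul1r normrM normfV (@ger0_norm _ m`!%:R)//.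
      rewrite ler_pdivrMr ?ltr0n ?fact_gt0// (@le_trans _ _ (t ^+ m))//.
        by rewrite normrX; apply: lerXn2r; rewrite ?nnegrE ?(ltW t0)// ler_norml; lra.
      by apply: ler_peMr; [nneg|rewrite ler1n fact_gt0].
    have -> : n.+1 = m.+2 by rewrite nm.
    rewrite [leLHS](_ : _ = (t / N t z) ^+ m * (t / N t z ^+ 2)).
      apply: ler_piMl => //; rewrite exprn_ile1 ?divr_ge0 ?(ltW t0) ?(ltW N0)//.
      by rewrite ler_pdivrMr// mul1r le_t_N.
    by rewrite expr_div_n !exprS expr0; field; rewrite expf_neq0 ?gt_eqF.
  have IfD : intg (lebn n) (fun z => f z * Dk 0 t z).
    apply: (intg_le _ _ (intgZ (t * t ^- n.+1) (intg_norm If))).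
      by apply: measurable_funM => //; exact: mDk.
    move=> z; rewrite normrM (ger0_norm (P0 z)) mulrC Dk0; apply: ler_wpM2r => //.
    apply: ler_wpM2l; first exact: ltW.
    rewrite lef_pV2 ?posrE ?exprn_gt0 ?N_gt0//; apply: lerXn2r; rewrite ?nnegrE ?N_ge0 ?(ltW t0)//.
    exact: le_t_N.
  have : `|co t * (lam * RI (lebn n) (fun z => f z * Dk 0 t z))| <=
      `|lam| * RI (lebn n) (fun z => `|f z| * (t / N t z ^+ 2)).
    rewrite mulrCA normrM; apply: ler_wpM2l => //.
    rewrite -RIZ//; apply: RI_norm_le; [exact: intgZ|exact: IfN|] => z.
    by rewrite mulrCA normrM; apply: ler_wpM2l => //; rewrite normrM (ger0_norm (P0 z)); exact: P1.
  by rewrite ler_norml => /andP[+ _]; rewrite -subr_ge0 opprK addrC.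
have mono : Phi e <= Phi T.
  apply: (@ger0_derive1_ndecr R Phi e T) => //.
  - by move=> t; rewrite in_itv/= => /andP[h1 h2]; have [] := dPhi t (eI t _) => //; rewrite !ltW.
  - move=> t; rewrite in_itv/= => /andP[/ltW h1 /ltW h2].
    have [_ E] := dPhi t (eI t (introT andP (conj h1 h2))).
    by rewrite derive1E E; apply: dF0; rewrite h1.
  - apply: derivable_within_continuous => t; rewrite in_itv/= => h.
    by have [] := dPhi t (eI t h).
move: mono; rewrite /Phi /F RID; [|exact: intg_taylor|by apply: intgZ; exact: intg_lnN].
rewrite RID; [|exact: intg_taylor|by apply: intgZ; exact: intg_lnN].
rewrite [RI _ (fun z => `|lam| * (_ * (ln (N e z) - _)))]RI_eq0; last first.
  by move=> z; rewrite subrr !mulr0.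
rewrite addr0 [X in _ <= _ + X]RIZ; last exact: intg_lnN.
rewrite (_ : (fun z => v z * taylor n e e z) = (fun z => v z * Dk 0 e z))//.
by apply/funext => z; have := taylor_diag m e z; rewrite -nm => ->.
Qed.

Lemma poisson_mass e : 0 < e -> intg (lebn n) (@Dk R n 0 e) /\ RI (lebn n) (@Dk R n 0 e) = @kappa R n.
Proof.
move=> e0; have [I E] := intg_RI_NX e0 n0.
rewrite (_ : Dk 0 e = fun x => e * N e x ^- n.+1); last by apply/funext => x; rewrite Dk0.
by split; [exact: intgZ|rewrite RIZ// E mulrA divff ?mul1r// gt_eqF].
Qed.

Lemma poisson_scale e z : 0 < e -> Dk 0 e (e *: z) = e ^- n * @Dk R n 0 1 z.
Proof.
move=> e0; rewrite !Dk0 N_scale// exprMn exprS mul1r.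
by field; rewrite !expf_neq0 ?gt_eqF// N_gt0.
Qed.

Lemma sqn_scale e z : sqn (e *: z) = e ^+ 2 * sqn z.
Proof. by rewrite /sqn mulr_sumr; apply: eq_bigr => i _; rewrite mxE exprMn. Qed.

(** Rescaling to height 1 and dominated convergence would settle a bounded [v]. As [v] is only
    integrable against the weight, the part away from the origin is treated apart, where the kernel
    is at most [e k]. *)
Lemma poisson_approx v (e : nat -> R) : intg (lebn n) (fun x => `|v x| * N 1 x ^- n.+1) ->
  continuous v -> (forall k, 0 < e k <= 1) -> e k @[k --> \oo] --> 0 ->
  RI (lebn n) (fun z => v z * Dk 0 (e k) z) @[k --> \oo] --> @kappa R n * v 0.
Proof.
move=> Iv cv e01 ecv; have mv := continuous_measurable_rV cv.
have ep k : 0 < e k by have /andP[] := e01 k.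
have e1 k : e k <= 1 by have /andP[] := e01 k.
have [I1 E1] := poisson_mass (@ltr01 R).
(* A sharp truncation is enough, since no derivative is taken; [v * phi] is bounded and is
   continuous near the origin. *)
pose phi z : R := if sqn z < 1 then 1 else 0.
have mphi : measurable_fun setT phi.
  apply: measurable_fun_if => //; try exact: measurable_cst.
  apply: measurable_fun_ltr => //; exact: continuous_measurable_rV (@continuous_sqn R n).
have phi01 z : 0 <= phi z <= 1 by rewrite /phi; case: ifP; rewrite ?lexx ?ler01.
have [B B0 vB] : exists2 B, 0 <= B & forall z : 'rV[R]_n, (forall i, `|z ord0 i| <= 1) -> `|v z| <= B :=
  cube_bounded 1 cv.
have vphi z : `|v z * phi z| <= B.
  rewrite /phi; case: ifPn => [h|_]; last by rewrite mulr0 normr0.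
  rewrite mulr1 vB// => i; rewrite -(@ler_sqr R) ?nnegrE// expr1n real_normK ?num_real//.
  by rewrite (le_trans (coord_sqn z i))// ltW.
have scv z : e k *: z @[k --> \oo] --> (0 : 'rV[R]_n).
  by rewrite -(scale0r z); apply: cvgZl.
have P1 k z : 0 <= @Dk R n 0 (e k) z by rewrite Dk0; have ek0 := ltW (ep k); nneg.
have mDk t : 0 < t -> measurable_fun setT (@Dk R n 0 t).
  by move=> t0; exact: continuous_measurable_rV (homk_continuous t0 (homk_Dk _ t0)).
have mvphi : measurable_fun setT (fun z => v z * phi z) by exact: measurable_funM.
have I2 k : intg (lebn n) (fun z => (v z * phi z) * Dk 0 (e k) z).
  have [Ik _] := poisson_mass (ep k).
  apply: (intg_le _ _ (intgZ B Ik)).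
    by apply: measurable_funM => //; exact: mDk.
  by move=> z; rewrite normrM (ger0_norm (P1 k z)); exact: ler_wpM2r.
have near_part : RI (lebn n) (fun z => (v z * phi z) * Dk 0 (e k) z) @[k --> \oo] --> @kappa R n * v 0.
  have E k : RI (lebn n) (fun z => (v z * phi z) * Dk 0 (e k) z) =
     RI (lebn n) (fun z => (v (e k *: z) * phi (e k *: z)) * Dk 0 1 z).
    have en : e k != 0 by rewrite gt_eqF.
    have S := scales_RI (scales_lebn (0 : 'rV[R]_n) en) (I2 k).
    have -> : RI (lebn n) (fun z => (v z * phi z) * Dk 0 (e k) z) = (e k) ^+ n *
       (`|e k|^-1 ^+ n * RI (lebn n) (fun z => (v z * phi z) * Dk 0 (e k) z)).
      by rewrite mulrA -exprMn (gtr0_norm (ep k)) divff// expr1n mul1r.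
    rewrite -S -RIZ; last exact: scales_intg (scales_lebn (0 : 'rV[R]_n) en) (I2 k).
    congr RI; apply/funext => z /=; rewrite addr0 poisson_scale//.
    by field; rewrite expf_neq0.
  rewrite (_ : (fun k => _) = (fun k => RI (lebn n) (fun z => (v (e k *: z) * phi (e k *: z)) * Dk 0 1 z)));
    last by apply/funext => k; exact: E.
  have P10 z : 0 <= @Dk R n 0 1 z by rewrite Dk0; nneg.
  have [||||_ L] := @RI_dct _ _ R (lebn n) (fun k z => (v (e k *: z) * phi (e k *: z)) * Dk 0 1 z)
    (fun z => v 0 * Dk 0 1 z) (fun z => B * Dk 0 1 z).
  - move=> k; apply: measurable_funM; last exact: mDk.
    have ms : measurable_fun setT (fun z : 'rV[R]_n => e k *: z).
      have := @measurable_affine R n (e k) 0.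
      by rewrite (_ : (fun x : 'rV[R]_n => _) = (fun z => e k *: z))//; apply/funext => z; rewrite addr0.
    exact: (measurableT_comp mvphi ms).
  - move=> z; apply: cvgM (cvg_cst _).
    rewrite -[v 0]mulr1; apply: cvgM.
      have cv0 : v @ nbhs (0 : 'rV[R]_n) --> v 0 := cv 0.
      exact: (cvg_comp _ _ (scv z) cv0).
    have s0 : sqn (e k *: z) @[k --> \oo] --> (0 : R).
      rewrite (_ : (fun k => _) = fun k => e k * e k * sqn z); last first.
        by apply/funext => k; rewrite sqn_scale expr2.
      by have := cvgM (cvgM ecv ecv) (cvg_cst (sqn z)); rewrite mulr0 mul0r; exact.
    apply: cvg_near_cst.
    have : \forall k \near \oo, sqn (e k *: z) < 1 by exact: (cvgr_lt 0 s0 1 ltr01).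
    by apply: filterS => k h; rewrite /phi h.
  - by move=> k z; rewrite normrM (ger0_norm (P10 z)); exact: ler_wpM2r.
  - exact: intgZ.
  by move: L; rewrite RIZ// E1 mulrC; exact.
have d0 : 0 < (2 : R)^-1 by [].
have [||||_ far] := @RI_dct _ _ R (lebn n) (fun k z => v z * (1 - phi z) * Dk 0 (e k) z)
  (fun=> 0) (fun z => 2 ^+ n.+1 * (`|v z| * N 1 z ^- n.+1)).
- move=> k; apply: measurable_funM; last exact: mDk.
  by apply: measurable_funM => //; apply: measurable_funB.
- move=> z; rewrite /phi; case: ifPn => [h|].
    by rewrite subrr mulr0; under eq_fun do rewrite mul0r; exact: cvg_cst.
  rewrite -leNgt subr0 => h.
  apply: (@squeeze_cvgr _ _ _ _ (fun k => - (`|v z| * e k)) (fun k => `|v z| * e k)).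
  - apply: nearW => k; rewrite -ler_norml mulr1 normrM ler_wpM2l// (ger0_norm (P1 k z)) Dk0.
    rewrite ler_piMr ?(ltW (ep k))// invf_le1 ?exprn_gt0 ?N_gt0// exprn_ege1//.
    rewrite -(@ler_sqr R) ?nnegrE ?N_ge0// sqr_N expr1n (le_trans h)// lerDr; exact: sqr_ge0.
  - by have := cvgN (cvgM (cvg_cst `|v z|) ecv); rewrite mulr0 oppr0; exact.
  - by have := cvgM (cvg_cst `|v z|) ecv; rewrite mulr0; exact.
- move=> k z; rewrite normrM (ger0_norm (P1 k z)) normrM -mulrA [leRHS]mulrCA.
  apply: ler_wpM2l => //.
  rewrite /phi; case: ifPn => [h|].
    by rewrite subrr normr0 mul0r; apply: mulr_ge0; nneg.
  rewrite -leNgt subr0 normr1 mul1r => h.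
  rewrite Dk0 -[leRHS]mul1r; apply: ler_pM; [exact: ltW|exact: NX_ge0|exact: e1|].
  rewrite -!exprVn -[2 in leRHS]invrK exprVn -!exprVn.
  rewrite -exprMn -invfM; apply: lerXn2r; rewrite ?nnegrE ?invr_ge0 ?mulr_ge0 ?N_ge0//.
  rewrite lef_pV2 ?posrE ?mulr_gt0 ?N_gt0//.
  rewrite -(@ler_sqr R) ?nnegrE ?mulr_ge0 ?N_ge0// exprMn !sqr_N expr1n.
  have := sqr_ge0 (e k); rewrite exprVn (_ : 2 ^+ 2 = 4); last by rewrite expr2 -natrM.
  move: h; lra.
- exact: intgZ.
have Isum k : RI (lebn n) (fun z => v z * Dk 0 (e k) z) =
   RI (lebn n) (fun z => (v z * phi z) * Dk 0 (e k) z) + RI (lebn n) (fun z => v z * (1 - phi z) * Dk 0 (e k) z).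
  have Iv0 := intg_vDk 0 Iv mv (ep k).
  rewrite -RID//; last first.
    rewrite (_ : (fun z => _) = fun z => v z * Dk 0 (e k) z - (v z * phi z) * Dk 0 (e k) z).
      exact: intgB.
    by apply/funext => z; ring.
  by congr RI; apply/funext => z; ring.
rewrite (_ : (fun k => _) = (fun k => RI (lebn n) (fun z => (v z * phi z) * Dk 0 (e k) z) +
   RI (lebn n) (fun z => v z * (1 - phi z) * Dk 0 (e k) z))); last by apply/funext.
have := cvgD near_part far; rewrite (_ : RI (lebn n) (fun=> 0) = 0); last exact: RI_eq0.
by rewrite addr0; exact.
Qed.

End taylor.

(** * The Poisson semigroup *)

Section derivative_under_integral.
Context d (S : measurableType d) (R : realType).
Variable mu : {measure set S -> \bar R}.

Lemma RI_is_derive (F dF : R -> S -> R) (G : S -> R) (u v t : R) : u < t < v ->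
  (forall s, u < s < v -> intg mu (F s)) ->
  (forall s z, u < s < v -> is_derive s 1 (F ^~ z) (dF s z)) ->
  intg mu G -> (forall s z, u < s < v -> `|dF s z| <= G z) ->
  is_derive t 1 (fun s => RI mu (F s)) (RI mu (dF t)).
Proof.
move=> uv IF dFP IG GP.
have inI s : `]u, v[%classic s -> u < s < v by rewrite /= in_itv.
have G0 z : 0 <= G z by rewrite (le_trans _ (GP t z uv)).
have It : `]u, v[%classic t by rewrite /= in_itv.
have intF s : `]u, v[%classic s -> intg mu (F s) by move=> /inI; exact: IF.
have derF s z : `]u, v[%classic s -> setT z -> derivable (F ^~ z) s 1.
  by move=> /inI h _; have [] := dFP s z h.
have GP' s z : `]u, v[%classic s -> setT z -> `|partial1of2 F s z| <= G z.
  by move=> /inI h _; rewrite partial1of2E; have [_ ->] := dFP s z h; exact: GP.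
have D1 := derivable_under_integral measurableT It intF derF G0 IG GP'.
have D2 := differentiation_under_integral measurableT It intF derF G0 IG GP'.
apply: (DeriveDef D1); rewrite -derive1E D2; congr RI.
by apply/funext => z; rewrite partial1of2E; have [_ ->] := dFP t z uv.
Qed.

End derivative_under_integral.

Lemma eq_of_derive0 (R : realType) (V : R -> R) (a b : R) : a <= b ->
  (forall t, a <= t <= b -> is_derive t 1 V 0) -> V a = V b.
Proof.
move=> ab dV.
have [||c _ E] := @MVT_segment R V (fun=> 0) a b ab _ _.
- by move=> t; rewrite in_itv/= => /andP[h1 h2]; apply: dV; rewrite !ltW.
- by apply: derivable_within_continuous => t; rewrite in_itv/= => h; have [] := dV t h.
by apply/eqP; rewrite eq_sym -subr_eq0 E mul0r.
Qed.

(** * Translations and reflections *)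

Section shift.
Context {R : realType} {n : nat}.
Implicit Types (f g : 'rV[R]_n -> R) (x z : 'rV[R]_n).

Lemma intg_shift f x : intg (lebn n) f -> intg (lebn n) (fun z => f (x + z)).
Proof.
move=> If; have := scales_intg (scales_lebn x (oner_neq0 R)) If.
by congr intg; apply/funext => z; rewrite /= scale1r addrC.
Qed.

Lemma RI_shift f x : intg (lebn n) f -> RI (lebn n) (fun z => f (x + z)) = RI (lebn n) f.
Proof.
move=> If; have := scales_RI (scales_lebn x (oner_neq0 R)) If.
rewrite normr1 invr1 expr1n mul1r => <-.
by congr RI; apply/funext => z; rewrite /= scale1r addrC.
Qed.

Lemma intg_reflect f x : intg (lebn n) f -> intg (lebn n) (fun z => f (x - z)).
Proof.
move=> If; have m1 : (-1 : R) != 0 by rewrite oppr_eq0 oner_neq0.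
have := scales_intg (scales_lebn x m1) If.
by congr intg; apply/funext => z; rewrite /= scaleN1r addrC.
Qed.

Lemma RI_reflect f x : intg (lebn n) f -> RI (lebn n) (fun z => f (x - z)) = RI (lebn n) f.
Proof.
move=> If; have m1 : (-1 : R) != 0 by rewrite oppr_eq0 oner_neq0.
have := scales_RI (scales_lebn x m1) If.
rewrite normrN1 invr1 expr1n mul1r => <-.
by congr RI; apply/funext => z; rewrite /= scaleN1r addrC.
Qed.

Lemma is_derive_shift f x z i l : is_derive (x + z) (ebasis R i) f l ->
  is_derive z (ebasis R i) (fun y => f (x + y)) l.
Proof.
move=> /is_derive_line0 h; apply/is_derive_line0.
by move: h; rewrite (_ : (fun t : R => f (x + z + t *: ebasis R i)) =
  (fun t : R => f (x + (z + t *: ebasis R i))))//; apply/funext => t; rewrite addrA.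
Qed.

Lemma partial_shift f x i : smooth f ->
  partial i (fun y => f (x + y)) = (fun y => partial i f (x + y)).
Proof.
move=> sf; apply/funext => z; rewrite partialE.
have d : is_derive (x + z) (ebasis R i) f (partial i f (x + z)).
  by rewrite partialE; apply/derivableP; exact: smooth_derivable sf.
by have [_ ->] := is_derive_shift d.
Qed.

Lemma continuous_shift f x : continuous f -> continuous (fun y => f (x + y)).
Proof.
move=> cf z; have c1 : {for z, continuous (fun y : 'rV[R]_n => x + y)}.
  apply: continuous_rV_at => i.
  rewrite (_ : (fun y => _) = (fun y : 'rV[R]_n => x ord0 i + y ord0 i)).
    exact: cvgD (cvg_cst (x ord0 i)) (@continuous_coord R n i z).
  by apply/funext => y; rewrite mxE.
exact: (@continuous_comp _ _ _ (fun y : 'rV[R]_n => x + y) f z c1 (cf (x + z))).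
Qed.

Lemma smooth_shift f x : smooth f -> smooth (fun y => f (x + y)).
Proof.
move=> sf; apply: (smooth_coind (F := fun g => exists2 f, smooth f & g = fun y => f (x + y))).
  move=> _ [{sf}f sf ->]; split=> [|i].
    exact: continuous_shift (smooth_continuous sf).
  split=> [z|].
    have d : is_derive (x + z) (ebasis R i) f (partial i f (x + z)).
      by rewrite partialE; apply/derivableP; exact: smooth_derivable sf.
    by have [] := is_derive_shift d.
  exists (partial i f); first exact: smooth_partial.
  exact: partial_shift.
by exists f.
Qed.

Lemma lap_shift f x : smooth f -> lap (fun y => f (x + y)) = (fun y => lap f (x + y)).
Proof.
move=> sf; apply/funext => z; rewrite !lapE; apply: eq_bigr => i _.
by rewrite (partial_shift x i sf) (partial_shift x i (smooth_partial i sf)).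
Qed.

Lemma neglap_pow_shift k f x : smooth f ->
  neglap_pow k (fun y => f (x + y)) = (fun y => neglap_pow k f (x + y)).
Proof.
move=> sf; elim: k => [|k ih]; first by rewrite !neglap_pow0.
by rewrite !neglap_powS ih (lap_shift x (smooth_neglap_pow k sf)).
Qed.

End shift.

Section semigroup.
Context {R : realType} {n : nat}.
Hypothesis n0 : (0 < n)%N.
Variable x : 'rV[R]_n.
Implicit Types (z : 'rV[R]_n) (a b t : R).

Lemma NX_le1 (b : nat) z : N 1 z ^- b <= 1 :> R.
Proof. by rewrite invf_le1 ?exprn_gt0 ?N_gt0// exprn_ege1// N_ge1. Qed.

Lemma measurable_Dk j t : 0 < t -> measurable_fun setT (@Dk R n j t).
Proof. by move=> t0; exact: continuous_measurable_rV (homk_continuous t0 (homk_Dk _ t0)). Qed.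

Lemma measurable_Dk_shift j t : 0 < t -> measurable_fun setT (fun z => @Dk R n j t (x + z)).
Proof.
move=> t0; apply: continuous_measurable_rV.
exact: continuous_shift (homk_continuous t0 (homk_Dk _ t0)).
Qed.

Lemma intg_DkDk i j a b : 0 < a -> 0 < b ->
  intg (lebn n) (fun z => Dk i a z * Dk j b (x + z)).
Proof.
move=> a0 b0; have [C C0 HC] := @Dk_dom R n i a a a0 (lexx a).
have [D D0 HD] := @Dk_dom R n j b b b0 (lexx b).
apply: (intg_le _ _ (intgZ (C * D) (@intg_N1X R n n0))).
  by apply: measurable_funM; [exact: measurable_Dk|exact: measurable_Dk_shift].
move=> z; rewrite normrM [leRHS](_ : _ = (C * N 1 z ^- n.+1) * (D * 1)); last by ring.
apply: ler_pM => //; first by apply: HC; rewrite !lexx.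
apply: (le_trans (HD b _ _)); rewrite ?lexx//; apply: ler_wpM2l => //; exact: NX_le1.
Qed.

(** The kernels are even in the space variable, so this is their convolution at the fixed point
    [x]. *)
Definition DkDk i j a b := RI (lebn n) (fun z => Dk i a z * Dk j b (x + z)).

Lemma is_derive_affine a (s t : R) : is_derive t 1 (fun r : R => a + s * r) s.
Proof.
have d := is_deriveD (is_derive_cst a t (1 : R)) (is_deriveZ s (is_derive_id t (1 : R))).
by apply: (is_derive_eq d); rewrite add0r [LHS]mulr1.
Qed.

(** The slope [s] covers three motions in the plane of heights: both rise together (1), their sum is
    kept (-1), only the first moves (0). *)
Lemma is_derive_DkDk i j a b (s t : R) : 0 < a + t -> 0 < b + s * t ->
  is_derive t 1 (fun r => DkDk i j (a + r) (b + s * r))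
   (DkDk i.+1 j (a + t) (b + s * t) + s * DkDk i j.+1 (a + t) (b + s * t)).
Proof.
move=> a0 b0.
(* Within this radius each height stays between half and twice its value, so one majorant serves the
   whole interval. *)
pose e := Num.min ((a + t) / 2) ((b + s * t) / (2 * (1 + `|s|))).
have s1 : 0 < 1 + `|s| by rewrite ltr_pwDl.
have e0 : 0 < e by rewrite lt_min !divr_gt0// mulr_gt0.
have ea : e <= (a + t) / 2 by rewrite ge_min lexx.
have eb : e * (1 + `|s|) <= (b + s * t) / 2.
  by rewrite -ler_pdivlMr// -mulrA -invfM ge_min lexx orbT.
have rI r : t - e < r < t + e -> (a + t) / 2 <= a + r <= 2 * (a + t) /\
    (b + s * t) / 2 <= b + s * r <= 2 * (b + s * t).
  move=> /andP[h1 h2]; split; first by apply/andP; split; lra.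
  have : `|s * (r - t)| <= (b + s * t) / 2.
    apply: le_trans eb; rewrite normrM mulrC; apply: ler_pM => //.
      by rewrite ler_norml; lra.
    by rewrite lerDr.
  by rewrite ler_norml => /andP[g1 g2]; apply/andP; split; lra.
have a2 : 0 < (a + t) / 2 by rewrite divr_gt0.
have b2 : 0 < (b + s * t) / 2 by rewrite divr_gt0.
have a24 : (a + t) / 2 <= 2 * (a + t) by lra.
have b24 : (b + s * t) / 2 <= 2 * (b + s * t) by lra.
have [C1 C10 HC1] := @Dk_dom R n i _ _ a2 a24.
have [C2 C20 HC2] := @Dk_dom R n i.+1 _ _ a2 a24.
have [D1 D10 HD1] := @Dk_dom R n j _ _ b2 b24.
have [D2 D20 HD2] := @Dk_dom R n j.+1 _ _ b2 b24.
have E : DkDk i.+1 j (a + t) (b + s * t) + s * DkDk i j.+1 (a + t) (b + s * t) =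
   RI (lebn n) (fun z => Dk i.+1 (a + t) z * Dk j (b + s * t) (x + z) +
     s * (Dk i (a + t) z * Dk j.+1 (b + s * t) (x + z))).
  by rewrite RID ?RIZ//; [exact: intg_DkDk|exact: intg_DkDk|apply: intgZ; exact: intg_DkDk].
rewrite E.
apply: (@RI_is_derive _ _ R (lebn n) (fun r z => Dk i (a + r) z * Dk j (b + s * r) (x + z))
  (fun r z => Dk i.+1 (a + r) z * Dk j (b + s * r) (x + z) +
     s * (Dk i (a + r) z * Dk j.+1 (b + s * r) (x + z)))
  (fun z => (C2 * D1 + `|s| * (C1 * D2)) * N 1 z ^- n.+1) (t - e) (t + e)).
- by apply/andP; split; lra.
- by move=> r /rI[/andP[h1 _] /andP[h2 _]]; apply: intg_DkDk; exact: lt_le_trans h1 || exact: lt_le_trans h2.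
- move=> r z /rI[/andP[h1 _] /andP[h2 _]].
  have ar : 0 < a + r := lt_le_trans a2 h1; have br : 0 < b + s * r := lt_le_trans b2 h2.
  have da : is_derive r 1 (fun r => Dk i (a + r) z) (Dk i.+1 (a + r) z).
    have d1 := is_derive_affine a 1 r.
    have d2 : is_derive (a + 1 * r) 1 (fun r => Dk i r z) (Dk i.+1 (a + 1 * r) z).
      by apply: is_derive_Dk; rewrite mul1r.
    have d := @is_derive1_comp R (fun r => Dk i r z) (fun r => a + 1 * r) r _ _ d2 d1.
    rewrite (_ : (fun r0 => _) = (fun r => Dk i r z) \o (fun r => a + 1 * r)).
      by apply: (is_derive_eq d); rewrite mulr1 mul1r.
    by apply/funext => q /=; rewrite mul1r.
  have db : is_derive r 1 (fun r => Dk j (b + s * r) (x + z)) (s * Dk j.+1 (b + s * r) (x + z)).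
    have d := @is_derive1_comp R (fun r => Dk j r (x + z)) (fun r => b + s * r) r _ _
      (is_derive_Dk j (x + z) br) (is_derive_affine b s r).
    by apply: (is_derive_eq d); rewrite mulrC.
  have d := is_deriveM da db.
  by apply: (is_derive_eq d); rewrite /GRing.scale/=; ring.
- by apply: intgZ; exact: intg_N1X.
- move=> r z /rI[hr1 hr2].
  rewrite mulrDl; apply: (le_trans (ler_normD _ _)); apply: lerD.
    rewrite normrM [leRHS](_ : _ = (C2 * N 1 z ^- n.+1) * (D1 * 1)); last by ring.
    apply: ler_pM => //; first exact: HC2.
    by apply: (le_trans (HD1 _ _ hr2)); apply: ler_wpM2l => //; exact: NX_le1.
  rewrite normrM -[leRHS]mulrA; apply: ler_wpM2l => //.
  rewrite normrM [leRHS](_ : _ = (C1 * N 1 z ^- n.+1) * (D2 * 1)); last by ring.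
  apply: ler_pM => //; first exact: HC1.
  by apply: (le_trans (HD2 _ _ hr2)); apply: ler_wpM2l => //; exact: NX_le1.
Qed.

(** Green's identity: by harmonicity two height derivatives equal [- lap], which may be moved from
    one factor to the other. *)
Lemma DkDk_sym a b : 0 < a -> 0 < b -> DkDk 2 0 a b = DkDk 0 2 a b.
Proof.
move=> a0 b0; have sb := homk_smooth b0 (@homk_Dk R n 0 b b0).
have sv := smooth_shift x sb.
have ta := homk_tame a0 (@homk_Dk R n 0 a a0).
have tc := @cutoff_tame R n 1 (lexx 1).
have cc k : csupp (@chi R n (cutoff 1 k)) by exact: cutoff_csupp.
have W0 z : 0 <= N a z ^- n.+1 :> R by exact: NX_ge0.
have Iv : intg (lebn n) (fun z => `|Dk 0 b (x + z)| * N a z ^- n.+1).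
  have := intg_norm (intgZ a^-1 (intg_DkDk 0 0 a0 b0)).
  congr intg; apply/funext => z; rewrite [Dk 0 a z]Dk0 mulrA mulrA mulVf ?mul1r ?gt_eqF//.
  by rewrite normrM mulrC (ger0_norm (NX_ge0 _ _ _)).
have E1 : neglap_pow 1 (fun z => Dk 0 b (x + z)) = (fun z => Dk 2 b (x + z)).
  by rewrite (neglap_pow_shift 1 x sb) (neglap_pow_Dk 1 0 b0).
have := neglap_pow_by_parts (m := 1) W0 tc cc sv ta Iv.
rewrite E1 (neglap_pow_Dk 1 0 a0) => /(_ _) H.
rewrite /DkDk; transitivity (RI (lebn n) (fun z => Dk 0 b (x + z) * Dk 2 a z)).
  by congr RI; apply/funext => z; rewrite mulrC.
rewrite -H; first by congr RI; apply/funext => z; rewrite mulrC.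
by have := intg_DkDk 0 2 a0 b0; congr intg; apply/funext => z; rewrite mulrC.
Qed.

(** When both heights rise by the same amount, the difference of the two sides has zero derivative
    by [DkDk_sym]; it is also [O(1/T)] after a rise of [T], so it vanishes. *)
Lemma DkDk_wronskian a b : 0 < a -> 0 < b -> DkDk 1 0 a b = DkDk 0 1 a b.
Proof.
move=> a0 b0; pose V t := DkDk 1 0 (a + t) (b + 1 * t) - DkDk 0 1 (a + t) (b + 1 * t).
have cst T : 0 <= T -> V 0 = V T.
  move=> T0; apply: eq_of_derive0 => // t /andP[t0 _].
  have at0 : 0 < a + t by rewrite ltr_pwDl.
  have bt0 : 0 < b + 1 * t by rewrite mul1r ltr_pwDl.
  have d := is_deriveB (is_derive_DkDk 1 0 at0 bt0) (is_derive_DkDk 0 1 at0 bt0).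
  by apply: (is_derive_eq d); rewrite DkDk_sym//; ring.
have [C C0 HC] := @Dk_bound R n 1.
have k0 := @kappa_gt0 R n n0.
have bnd s t : 1 <= s -> 1 <= t -> `|DkDk 1 0 s t| <= C * @kappa R n / s /\
    `|DkDk 0 1 s t| <= C * @kappa R n / t.
  move=> s1 t1; have s0 : 0 < s := lt_le_trans ltr01 s1; have t0 : 0 < t := lt_le_trans ltr01 t1.
  have P01 r z : 1 <= r -> 0 <= @Dk R n 0 r z <= 1.
    move=> r1; have r0 : 0 < r := lt_le_trans ltr01 r1.
    have Nr := N_gt0 z r0; have rN := le_t_N z r0.
    rewrite Dk0; apply/andP; split; first by have rr := ltW r0; nneg.
    rewrite ler_pdivrMr ?exprn_gt0// mul1r exprS (le_trans rN)//.
    by rewrite ler_peMr ?(ltW Nr)// exprn_ege1// (le_trans r1).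
  have D1 r z : 1 <= r -> `|@Dk R n 1 r z| <= C * N r z ^- n.+1.
    move=> r1; have r0 : 0 < r := lt_le_trans ltr01 r1.
    by have := HC r z r0; rewrite expr1 mulrCA ler_pM2l.
  have [Is Es] := intg_RI_NX s0 n0; have [It Et] := intg_RI_NX t0 n0.
  split.
    rewrite [leRHS](_ : _ = RI (lebn n) (fun z => C * N s z ^- n.+1)); last first.
      by rewrite (RIZ C Is) Es /kappa; move: (RI _ _) => X; ring.
    apply: RI_norm_le; [exact: intg_DkDk|exact: intgZ|] => z.
    have /andP[h0 h1] := P01 t (x + z) t1.
    rewrite normrM (ger0_norm h0) -[leRHS]mulr1; apply: ler_pM => //; exact: D1.
  rewrite [leRHS](_ : _ = RI (lebn n) (fun z => C * N t (x + z) ^- n.+1)); last first.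
    by rewrite (RI_shift x (f := fun z => C * N t z ^- n.+1)) ?(RIZ C It) ?Et /kappa; [move: (RI _ _) => X; ring|exact: intgZ].
  apply: RI_norm_le; [exact: intg_DkDk|by apply: (intg_shift x (f := fun z => C * N t z ^- n.+1)); exact: intgZ|] => z.
  have /andP[h0 h1] := P01 s z s1.
  rewrite normrM (ger0_norm h0) -[leRHS]mul1r; apply: ler_pM => //; exact: D1.
have Vb T : 1 <= T -> `|V 0| <= 2 * C * @kappa R n / T.
  move=> T1; have T0 : 0 < T := lt_le_trans ltr01 T1.
  rewrite (cst T (ltW T0)) /V mul1r (le_trans (ler_normB _ _))//.
  have [h1 h2] : `|DkDk 1 0 (a + T) (b + T)| <= C * @kappa R n / (a + T) /\
    `|DkDk 0 1 (a + T) (b + T)| <= C * @kappa R n / (b + T).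
    by apply: bnd; rewrite (le_trans T1)// lerDr ltW.
  have Ck : 0 <= C * @kappa R n by rewrite mulr_ge0// ltW.
  have l1 r : 0 < r -> C * @kappa R n / (r + T) <= C * @kappa R n / T.
    move=> r0; apply: ler_wpM2l => //; rewrite lef_pV2 ?posrE ?addr_gt0//.
    by rewrite lerDr ltW.
  have := l1 a a0; have := l1 b b0; move: h1 h2; rewrite -!mulrA; lra.
have V0 : V 0 = 0.
  apply/eqP; rewrite -normr_le0; apply/ler_addgt0Pr => e e0; rewrite add0r.
  pose T := 1 + 2 * C * @kappa R n / e.
  have Q0 : 0 <= 2 * C * @kappa R n / e.
    by apply: divr_ge0; [apply: mulr_ge0; [nneg|exact: ltW]|exact: ltW].
  have T1 : 1 <= T by rewrite lerDl.
  have T0 : 0 < T := lt_le_trans ltr01 T1.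
  apply: (le_trans (Vb T T1)); rewrite ler_pdivrMr// /T mulrDr mulr1.
  rewrite [e * (_ / e)](_ : _ = 2 * C * @kappa R n); first by rewrite lerDr ltW.
  by field; rewrite gt_eqF.
by apply/eqP; rewrite -subr_eq0 -V0 /V mul1r !addr0.
Qed.

(** Along a segment of constant sum the derivative is the difference that [DkDk_wronskian] shows to
    be 0. *)
Lemma DkDk_sum a b c e : 0 < a -> 0 < b -> 0 < c -> 0 < e -> a + b = c + e -> DkDk 0 0 a b = DkDk 0 0 c e.
Proof.
move: a b c e; suff H a b c e : a <= c -> 0 < a -> 0 < b -> 0 < c -> 0 < e -> a + b = c + e ->
    DkDk 0 0 a b = DkDk 0 0 c e.
  move=> a b c e a0 b0 c0 e0 abce; have [ac|/ltW ca] := leP a c; first exact: H.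
  by apply/esym; exact: H.
move=> ac a0 b0 c0 e0 abce.
pose q t := DkDk 0 0 (0 + t) (a + b + (-1) * t).
have -> : DkDk 0 0 a b = q a by rewrite /q add0r mulN1r addrAC subrr add0r.
have -> : DkDk 0 0 c e = q c by rewrite /q add0r mulN1r abce addrAC subrr add0r.
apply: eq_of_derive0 => // t /andP[h1 h2].
have t0 : 0 < 0 + t by rewrite add0r (lt_le_trans a0).
have bt : 0 < a + b + (-1) * t by rewrite mulN1r abce; lra.
by apply: (is_derive_eq (is_derive_DkDk 0 0 t0 bt)); rewrite DkDk_wronskian//; ring.
Qed.

(* Convolutions of Poisson kernels depend on the heights only through their sum; let one
   height tend to 0. *)
Lemma poisson_semigroup a b : 0 < a -> 0 < b -> DkDk 0 0 a b = @kappa R n * Dk 0 (a + b) x.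
Proof.
move=> a0 b0; pose T := a + b; have T0 : 0 < T by rewrite addr_gt0.
have T2 : 0 < T / 2 by rewrite divr_gt0.
rewrite (@DkDk_sum a b (T / 2) (T / 2))//; last by rewrite -splitr.
pose e k : R := k.+1%:R^-1.
have ep k : 0 < e k by rewrite invr_gt0.
have e01 k : 0 < e k <= 1 by rewrite ep/= invf_le1// ler1n.
have ecv : e k @[k --> \oo] --> 0 by exact: cvg_harmonic.
have sT := smooth_shift x (homk_smooth T0 (homk_Dk 0 T0)).
have IvT : intg (lebn n) (fun z => `|Dk 0 T (x + z)| * N 1 z ^- n.+1).
  have := intg_norm (intg_DkDk 0 0 ltr01 T0).
  congr intg; apply/funext => z; rewrite normrM [Dk 0 1 z]Dk0 mul1r mulrC.
  by rewrite (ger0_norm (NX_ge0 _ _ _)).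
have L1 := poisson_approx n0 IvT (smooth_continuous sT) e01 ecv.
rewrite addr0 in L1.
have d0 : is_derive (0 : R) 1 (fun r => DkDk 0 0 (T / 2 + r) (T / 2 + 0 * r))
   (DkDk 1 0 (T / 2 + 0) (T / 2 + 0 * 0) + 0 * DkDk 0 1 (T / 2 + 0) (T / 2 + 0 * 0)).
  by apply: is_derive_DkDk; rewrite ?mul0r addr0.
have c0 : {for (0 : R), continuous (fun r => DkDk 0 0 (T / 2 + r) (T / 2 + 0 * r))}.
  by apply/differentiable_continuous/derivable1_diffP; have [] := d0.
have L2 : DkDk 0 0 (T / 2 + e k) (T / 2 + 0 * e k) @[k --> \oo] --> DkDk 0 0 (T / 2) (T / 2).
  have : (fun r => DkDk 0 0 (T / 2 + r) (T / 2 + 0 * r)) @ nbhs (0 : R) -->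
    DkDk 0 0 (T / 2 + 0) (T / 2 + 0 * 0) by exact: c0.
  by rewrite mul0r !addr0 => c1; exact: (cvg_comp _ _ ecv c1).
(* The sum [T + e k] is redistributed as [e k] and [T]. Continuity at the balanced heights thus
   gives the limit in which one height tends to 0, where [poisson_approx] evaluates it. *)
have E2 : (fun k => DkDk 0 0 (T / 2 + e k) (T / 2 + 0 * e k)) =
    (fun k => RI (lebn n) (fun z => Dk 0 T (x + z) * Dk 0 (e k) z)).
  apply/funext => k; have s0 : 0 < T / 2 + e k by exact: addr_gt0.
  have Te : T / 2 + e k + T / 2 = e k + T by lra.
  rewrite mul0r addr0 (DkDk_sum s0 T2 (ep k) T0 Te).
  by congr RI; apply/funext => z; rewrite mulrC.
rewrite E2 in L2.
exact: (cvg_unique (@Rhausdorff R) L2 L1).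
Qed.

End semigroup.

(** * Convolution of weights *)

Section second_differences.
Context {R : realType} {n : nat}.
Implicit Types (f g : 'rV[R]_n -> R) (x y z w : 'rV[R]_n).

Lemma segment_lip (p p' : R -> R) (M b : R) :
  (forall t : R, is_derive t 1 p (p' t)) -> (forall t : R, `|t| <= `|b| -> `|p' t| <= M) ->
  `|p b - p 0| <= M * `|b|.
Proof.
move=> dp hM; have cp : continuous p.
  by move=> t; apply/differentiable_continuous/derivable1_diffP; have [] := dp t.
have wc a c : {within `[a, c], continuous p} by apply: continuous_subspaceT.
have [b0|b0] := leP 0 b.
  have [c] := MVT_segment b0 (fun t _ => dp t) (wc 0 b).
  rewrite in_itv/= => /andP[c0 cb] ->; rewrite subr0 normrM; apply: ler_wpM2r => //.
  by apply: hM; rewrite !ger0_norm.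
have [c] := MVT_segment (ltW b0) (fun t _ => dp t) (wc b 0).
rewrite in_itv/= => /andP[c0 cb] E; rewrite distrC E sub0r normrM normrN; apply: ler_wpM2r => //.
by apply: hM; rewrite !ler0_norm ?lerN2// ltW.
Qed.

(** The path from 0 to [z] changes one coordinate at a time and stays in the cube, so one-variable
    mean values and partial derivatives suffice. *)
Lemma cube_lip f (f' : 'I_n -> 'rV[R]_n -> R) (M r : R) z :
  (forall i w, is_derive w (ebasis R i) f (f' i w)) ->
  (forall i w, (forall j, `|w ord0 j| <= r) -> `|f' i w| <= M) ->
  (forall j, `|z ord0 j| <= r) -> 0 <= M -> 0 <= r -> `|f z - f 0| <= n%:R * (M * r).
Proof.
move=> df hM zr M0 r0.
pose zk k : 'rV[R]_n := \row_i (if (i < k)%N then z ord0 i else 0).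
have E0 : zk 0 = 0 by apply/rowP => i; rewrite !mxE.
have En : zk n = z by apply/rowP => i; rewrite !mxE ltn_ord.
rewrite -{1}En -E0.
suff H k : (k <= n)%N -> `|f (zk k) - f (zk 0)| <= k%:R * (M * r) by exact: H.
elim: k => [|k ih] kn; first by rewrite subrr normr0 mul0r.
pose i := Ordinal kn.
have Ek s : zk k + s *: ebasis R i = \row_j (if (j < k)%N then z ord0 j else if j == i then s else 0).
  apply/rowP => j; rewrite !mxE eqxx/=; case: ifPn => [jk|jk].
    by rewrite (_ : j == i = false) ?mulr0 ?addr0//; apply/eqP => ji; rewrite ji ltnn in jk.
  by case: (j == i); rewrite ?mulr1 ?mulr0 add0r.
have ES : zk k.+1 = zk k + z ord0 i *: ebasis R i.
  rewrite Ek; apply/rowP => j; rewrite !mxE ltnS leq_eqVlt.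
  case: (ltnP j k) => jk; first by rewrite orbT.
  rewrite orbF; have [->|ji] := eqVneq j i; first by rewrite eqxx.
  by rewrite ifF//; apply/negbTE; apply: contra ji => /eqP ji; apply/eqP/val_inj.
have step : `|f (zk k.+1) - f (zk k)| <= M * r.
  pose p s := f (zk k + s *: ebasis R i).
  have dp (s : R) : is_derive s 1 p (f' i (zk k + s *: ebasis R i)).
    by apply/is_derive_line; exact: df.
  rewrite ES -[X in f _ - f X]addr0 -(scale0r (ebasis R i)).
  apply: (le_trans (segment_lip (p := p) (M := M) dp _)); last by apply: ler_wpM2l.
  move=> s sz; apply: hM => j; rewrite Ek mxE.
  by case: ifPn => // _; case: ifPn => // _; [exact: le_trans (zr i)|rewrite normr0].
rewrite -(natr1 k) mulrDl mul1r [leRHS]addrC.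
rewrite (_ : f (zk k.+1) - f (zk 0) = (f (zk k.+1) - f (zk k)) + (f (zk k) - f (zk 0))); last by ring.
by apply: (le_trans (ler_normD _ _)); apply: lerD => //; apply: ih; exact: ltnW.
Qed.

Lemma is_derive_refl f x z i l : is_derive (x - z) (ebasis R i) f l ->
  is_derive z (ebasis R i) (fun y => f (x - y)) (- l).
Proof.
move=> /is_derive_line0 h; apply/is_derive_line0.
have d1 : is_derive (0 : R) 1 (fun t : R => - t) (- 1).
  by have d := is_deriveN (is_derive_id (0 : R) (1 : R)); apply: (is_derive_eq d).
have h' : is_derive (- (0 : R)) 1 (fun t : R => f (x - z + t *: ebasis R i)) l by rewrite oppr0.
have d := @is_derive1_comp R (fun t : R => f (x - z + t *: ebasis R i)) (fun t : R => - t) 0 _ _ h' d1.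
rewrite (_ : (fun t => _) = (fun t : R => f (x - z + t *: ebasis R i)) \o (fun t : R => - t)).
  by apply: (is_derive_eq d); rewrite mulrN1.
by apply/funext => t /=; rewrite scaleNr opprD addrA.
Qed.

Definition sdiff g x z := 2 * g x - g (x + z) - g (x - z).

Lemma sdiff0 g x : sdiff g x 0 = 0.
Proof. by rewrite /sdiff addr0 subr0; ring. Qed.

(** A second-order Taylor bound by two first-order ones: the even part of [g] about [x] has zero
    gradient at the centre, so the Lipschitz bound is applied to it and then to its partial
    derivatives. *)
Lemma sdiff_bound g x (M r : R) z : smooth g ->
  (forall i j w, (forall l, `|w ord0 l| <= r) -> `|partial i (partial j g) (x + w)| <= M) ->
  (forall j, `|z ord0 j| <= r) -> 0 <= M -> 0 <= r ->
  `|sdiff g x z| <= n%:R * (n%:R * (2 * M * r) * r).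
Proof.
move=> sg hM zr M0 r0.
have dg f i w : smooth f -> is_derive w (ebasis R i) f (partial i f w).
  by move=> sf; rewrite partialE; apply/derivableP; exact: smooth_derivable sf.
pose G y := g (x + y) + g (x - y).
have dG i w : is_derive w (ebasis R i) G (partial i g (x + w) - partial i g (x - w)).
  exact: is_deriveD (is_derive_shift (dg g i (x + w) sg)) (is_derive_refl (dg g i (x - w) sg)).
have -> : sdiff g x z = - (G z - G 0) by rewrite /sdiff /G addr0 subr0; ring.
rewrite normrN; apply: (cube_lip dG) => //; last by rewrite !mulr_ge0.
move=> i w wr; pose H y := partial i g (x + y) - partial i g (x - y).
have si := smooth_partial i sg.
have dH j y : is_derive y (ebasis R j) H
    (partial j (partial i g) (x + y) - - partial j (partial i g) (x - y)).
  exact: is_deriveB (is_derive_shift (dg _ j (x + y) si)) (is_derive_refl (dg _ j (x - y) si)).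
have -> : partial i g (x + w) - partial i g (x - w) = H w - H 0.
  by rewrite /H addr0 subr0 subrr subr0.
apply: (cube_lip dH) => //; last by rewrite mulr_ge0.
move=> j y yr; rewrite opprK (le_trans (ler_normD _ _))// mulrDl mul1r; apply: lerD; apply: hM => // l.
by rewrite mxE normrN.
Qed.

End second_differences.

(** * Comparison, convolution and uniform mass of the weights *)

Section weights.
Context {R : realType} {n : nat}.
Hypothesis n0 : (0 < n)%N.
Implicit Types (f g h F : 'rV[R]_n -> R) (x y z w : 'rV[R]_n) (s t : R).

Lemma N_opp s z : N s (- z) = N s z.
Proof. by rewrite /N /sqn; congr Num.sqrt; congr (_ + _); apply: eq_bigr => i _; rewrite mxE sqrrN. Qed.

Lemma sqnD x z : sqn (x + z) <= 2 * sqn x + 2 * sqn z.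
Proof.
rewrite /sqn !mulr_sumr -big_split/=; apply: ler_sum => i _; rewrite mxE.
by have := sqr_ge0 (x ord0 i - z ord0 i); rewrite !expr2; lra.
Qed.

Lemma N_submul x z : N 1 (x + z) <= 2 * (N 1 x * N 1 z).
Proof.
rewrite -(@ler_sqr R) ?nnegrE ?mulr_ge0 ?N_ge0// !exprMn !sqr_N expr1n.
have := sqnD x z; have := sqn_ge0 x; have := sqn_ge0 z; have := mulr_ge0 (sqn_ge0 x) (sqn_ge0 z).
rewrite (_ : 2 ^+ 2 = 4 :> R); last by rewrite expr2 -natrM.
lra.
Qed.

Lemma NX_submul (b : nat) x z : N 1 z ^- b <= 2 ^+ b * N 1 x ^+ b * N 1 (x + z) ^- b.
Proof.
rewrite ler_pdivlMr ?exprn_gt0 ?N_gt0// ler_pdivrMl ?exprn_gt0 ?N_gt0// -!exprMn.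
apply: lerXn2r; rewrite ?nnegrE ?mulr_ge0 ?N_ge0//.
by rewrite mulrCA (le_trans (N_submul x z))// le_eqVlt; apply/orP; left; apply/eqP; ring.
Qed.

(** At least one of [N 1 (x + z)] and [N 1 z] is no smaller than half of [N 1 x]; that factor is
    replaced by the weight at [x], and the other one is kept. *)
Lemma NX_max (b : nat) x z : N 1 (x + z) ^- b * N 1 z ^- b <=
  2 ^+ b * N 1 x ^- b * (N 1 z ^- b + N 1 (x + z) ^- b).
Proof.
have P y : 0 < N 1 y by exact: N_gt0.
have tri : N 1 x <= 2 * Num.max (N 1 (x + z)) (N 1 z).
  set m := Num.max _ _.
  have m0 : 0 <= m by rewrite le_max N_ge0.
  have m1 : N 1 (x + z) <= m by rewrite le_max lexx.
  have m2 : N 1 z <= m by rewrite le_max lexx orbT.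
  rewrite -(@ler_sqr R) ?nnegrE ?mulr_ge0 ?N_ge0// exprMn.
  have : N 1 (x + z) ^+ 2 <= m ^+ 2 by apply: lerXn2r; rewrite ?nnegrE ?N_ge0.
  have : N 1 z ^+ 2 <= m ^+ 2 by apply: lerXn2r; rewrite ?nnegrE ?N_ge0.
  rewrite !sqr_N expr1n; have := sqnD (x + z) (- z); rewrite addrK.
  have -> : sqn (- z) = sqn z by rewrite /sqn; apply: eq_bigr => i _; rewrite mxE sqrrN.
  rewrite (_ : 2 ^+ 2 = 4 :> R); last by rewrite expr2 -natrM.
  lra.
have key p q : 0 < p -> 0 < q -> N 1 x <= 2 * p -> p ^- b * q ^- b <= 2 ^+ b * N 1 x ^- b * (q ^- b + p ^- b).
  move=> p0 q0 xp; apply: (@le_trans _ _ (2 ^+ b * N 1 x ^- b * q ^- b)); last first.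
    by apply: ler_wpM2l; [nneg|rewrite lerDl; nneg].
  apply: ler_wpM2r; first by nneg.
  rewrite -ler_pdivrMl ?exprn_gt0// -invfM -exprMn lef_pV2 ?posrE ?exprn_gt0 ?mulr_gt0//.
  by apply: lerXn2r; rewrite ?nnegrE ?N_ge0 ?mulr_ge0// ltW.
have [h|h] := leP (N 1 (x + z)) (N 1 z).
  by rewrite [leLHS]mulrC (addrC (N 1 z ^- b)); apply: key => //; rewrite (le_trans tri)// max_r.
by apply: key => //; rewrite (le_trans tri)// max_l// ltW.
Qed.

Notation W := (fun z : 'rV[R]_n => N 1 z ^- n.+1).

(** The weight reproduces itself under convolution up to a constant; this is what preserves the
    decay [N^(-n-1)] under the half-Laplacian. *)
Lemma intg_WW x : intg (lebn n) (fun z => W (x + z) * W z) /\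
  RI (lebn n) (fun z => W (x + z) * W z) <= 2 ^+ n.+1 * 2 * @kappa R n * W x.
Proof.
have I1 := @intg_N1X R n n0; have I2 := intg_shift x I1.
have I : intg (lebn n) (fun z => W (x + z) * W z).
  apply: (intg_le _ _ (intgZ (2 ^+ n.+1 * W x) (intgD I1 I2))).
    have c1 := @continuous_NX R n 1 n.+1 ltr01.
    have c2 : continuous (fun z : 'rV[R]_n => N 1 (x + z) ^- n.+1) := continuous_shift (x := x) c1.
    exact: continuous_measurable_rV (continuousM_fun c2 c1).
  by move=> z; rewrite ger0_norm ?NX_max//; nneg.
split=> //; apply: (le_trans (RI_le I (intgZ (2 ^+ n.+1 * W x) (intgD I1 I2)) (fun z => NX_max _ x z))).
rewrite RIZ; last exact: intgD.
rewrite RID// (RI_shift x I1) -/(@kappa R n) le_eqVlt; apply/orP; left; apply/eqP; ring.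
Qed.

Lemma intg_gW g x : measurable_fun setT g -> intg (lebn n) (fun z => `|g z| * W z) ->
  intg (lebn n) (fun z => `|g (x + z)| * W z) /\
  RI (lebn n) (fun z => `|g (x + z)| * W z) <=
    2 ^+ n.+1 * N 1 x ^+ n.+1 * RI (lebn n) (fun z => `|g z| * W z).
Proof.
move=> mg Ig; have I2 := intg_shift x Ig.
have le z : `|g (x + z)| * W z <= 2 ^+ n.+1 * N 1 x ^+ n.+1 * (`|g (x + z)| * W (x + z)).
  by rewrite mulrCA; apply: ler_wpM2l => //; exact: NX_submul.
have ms : measurable_fun setT (fun z : 'rV[R]_n => x + z).
  have := @measurable_affine R n 1 x; congr measurable_fun.
  by apply/funext => z; rewrite scale1r addrC.
have I : intg (lebn n) (fun z => `|g (x + z)| * W z).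
  apply: (intg_le _ _ (intgZ (2 ^+ n.+1 * N 1 x ^+ n.+1) I2)).
    apply: measurable_funM; last exact: continuous_measurable_rV (@continuous_NX R n 1 n.+1 ltr01).
    exact: (measurableT_comp (@normr_measurable R setT) (measurableT_comp mg ms)).
  by move=> z; rewrite ger0_norm ?le//; nneg.
split=> //; apply: (le_trans (RI_le I (intgZ _ I2) le)).
by rewrite (RIZ _ I2) (RI_shift x Ig).
Qed.

(** The size of a second difference against the kernel: at [s = 0] it is like [|z|^(1-n)] near the
    origin, which is integrable, and like [|z|^(-n-1)] at infinity. *)
Definition omega s z := sqn z * N s z ^- n.+1 * N 1 z ^- 2.

Lemma omega_ge0 s z : 0 <= omega s z.
Proof. by rewrite /omega; apply: mulr_ge0; [apply: mulr_ge0; [exact: sqn_ge0|]|]; nneg. Qed.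

Lemma continuous_omega s : 0 < s -> continuous (omega s).
Proof.
move=> s0; apply: continuousM_fun; last exact: continuous_NX.
by apply: continuousM_fun; [exact: continuous_sqn|exact: continuous_NX].
Qed.

Definition riesz s z := N s z ^- n.-1 * N 1 z ^- 2.

Lemma riesz_ge0 s z : 0 <= riesz s z.
Proof. by rewrite /riesz; nneg. Qed.

(* The field [z_i N_s^(1-n) N_1^-2] has zero total divergence, and near the origin its
   divergence controls [N_s^(1-n)]. *)
Lemma riesz_mass : exists2 C, 0 <= C & forall s, 0 < s <= 1 ->
  intg (lebn n) (riesz s) /\ RI (lebn n) (riesz s) <= C.
Proof.
have I1 := @intg_N1X R n n0; have k0 := @kappa_gt0 R n n0.
(* Away from the origin the divergence is at least [- om], so [om <= 2 div + 3 om]; the last term is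
   controlled by [om <= 2^(n-1) N^(-n-1)]. *)
pose K : R := 3 * 2 ^+ n.-1.
exists (K * @kappa R n) => [|s /andP[s0 s1]]; first by apply: mulr_ge0; [rewrite /K; nneg|exact: ltW].
have En : n.+1 = n.-1.+2 by rewrite prednK.
pose om := riesz s.
pose h i z := z ord0 i * om z.
have som : smooth om := smoothM (smooth_N n.-1 s0) (smooth_N 2 ltr01).
have sh i : smooth (h i) := smoothM (smooth_coord i) som.
have dh i z : partial i (h i) z = om z + z ord0 i ^+ 2 *
   (- n.-1%:R * N s z ^- n.+1 * N 1 z ^- 2 - 2 * N s z ^- n.-1 * N 1 z ^- 4).
  rewrite (partialME i (smooth_coord i) som).
  rewrite (partialME i (smooth_N n.-1 s0) (smooth_N 2 ltr01)) !partial_NX// -En.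
  have -> : partial i (fun x : 'rV[R]_n => x ord0 i) z = 1.
    by rewrite partialE; have [_ ->] := is_derive_coord i i z; rewrite eqxx.
  by rewrite /om /riesz; ring.
have sN b z : N s z ^- b <= s ^- b * N 1 z ^- b by apply: NX_lower; rewrite ?s0.
have sX : 1 <= s ^- n.+1 by rewrite invf_ge1 ?exprn_gt0// exprn_ile1// ltW.
have sX' : s ^- n.-1 <= s ^- n.+1.
  by rewrite lef_pV2 ?posrE ?exprn_gt0// ler_wiXn2l// ?(ltW s0)// (leq_trans (leq_pred _)).
have NE t z : N t z ^- n.+1 = N t z ^- n.-1 * N t z ^- 2 :> R.
  by rewrite -!exprVn -exprD addn2 -En.
have om_le z : om z <= s ^- n.+1 * N 1 z ^- n.+1.
  rewrite /om /riesz NE mulrA; apply: ler_wpM2r; first exact: NX_ge0.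
  by rewrite (le_trans (sN _ _))//; apply: ler_wpM2r => //; exact: NX_ge0.
have zi i z : z ord0 i ^+ 2 * N 1 z ^- 2 <= 1.
  rewrite ler_pdivrMr ?exprn_gt0 ?N_gt0// mul1r sqr_N (le_trans (coord_sqn z i))// lerDr.
  exact: sqr_ge0.
pose Cs := s ^- n.+1 * (1 + n%:R + 2).
have Cs0 : 0 <= Cs by rewrite /Cs; have ss := ltW s0; nneg.
have om0 z : 0 <= om z := riesz_ge0 s z.
have bh i z : `|h i z| <= Cs * N 1 z ^- n.
  rewrite /h normrM (ger0_norm (om0 z)).
  apply: (@le_trans _ _ (N 1 z * (s ^- n.+1 * N 1 z ^- n.+1))).
    by apply: ler_pM => //; exact: le_coord_N.
  rewrite [leLHS](_ : _ = s ^- n.+1 * N 1 z ^- n); last first.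
    by rewrite (exprS (N 1 z)); field; rewrite !expf_neq0 ?gt_eqF ?N_gt0.
  apply: ler_wpM2r; first exact: NX_ge0.
  by rewrite /Cs; apply: ler_peMr; [have ss := ltW s0; nneg|rewrite -addrA lerDl; nneg].
have bdh i z : `|partial i (h i) z| <= Cs * N 1 z ^- n.+1.
  rewrite dh mulrBr.
  have A0 : 0 <= z ord0 i ^+ 2 * (n.-1%:R * N s z ^- n.+1 * N 1 z ^- 2) by nneg.
  have B0 : 0 <= z ord0 i ^+ 2 * (2 * N s z ^- n.-1 * N 1 z ^- 4) by nneg.
  have A1 : z ord0 i ^+ 2 * (n.-1%:R * N s z ^- n.+1 * N 1 z ^- 2) <= n%:R * (s ^- n.+1 * N 1 z ^- n.+1).
    rewrite (_ : z ord0 i ^+ 2 * _ = n.-1%:R * (N s z ^- n.+1 * (z ord0 i ^+ 2 * N 1 z ^- 2))); last by ring.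
    apply: ler_pM; [nneg|nneg|by rewrite ler_nat leq_pred|].
    apply: le_trans (sN n.+1 z); apply: ler_piMr; first exact: NX_ge0.
    exact: zi.
  have B1 : z ord0 i ^+ 2 * (2 * N s z ^- n.-1 * N 1 z ^- 4) <= 2 * (s ^- n.+1 * N 1 z ^- n.+1).
    rewrite (_ : z ord0 i ^+ 2 * _ = 2 * (om z * (z ord0 i ^+ 2 * N 1 z ^- 2))); last first.
      by rewrite /om /riesz -!exprVn; ring.
    apply: ler_wpM2l => //; apply: le_trans (om_le z); apply: ler_piMr => //.
  have := om_le z; have := om0 z.
  have -> : Cs * N 1 z ^- n.+1 = (1 + n%:R + 2) * (s ^- n.+1 * N 1 z ^- n.+1) by rewrite /Cs; ring.
  rewrite (_ : om z + _ = om z - z ord0 i ^+ 2 * (n.-1%:R * N s z ^- n.+1 * N 1 z ^- 2) -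
    z ord0 i ^+ 2 * (2 * N s z ^- n.-1 * N 1 z ^- 4)); last by ring.
  move: A0 A1 B0 B1; move: (s ^- n.+1 * N 1 z ^- n.+1) (om z) (z ord0 i ^+ 2 * (n.-1%:R * _ * _))
    (z ord0 i ^+ 2 * (2 * _ * _)) (n%:R : R) (ler0n R n) => X o p q nn nn0 p0 p1 q0 q1 o0 o1.
  have nX : 0 <= nn * X by apply: mulr_ge0 => //; exact: le_trans o0 o1.
  by rewrite ler_norml; apply/andP; split; lra.
(* Integration by parts against the constant function 1; the field decays only like [N^(-n)], hence
   the slow version. *)
have Rh i : RI (lebn n) (partial i (h i)) = 0.
  have I1' : intg (lebn n) (fun x => `|(1 : R)| * N 1 x ^- n.+1).
    by move: I1; congr intg; apply/funext => z; rewrite normr1 mul1r.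
  have I0' : intg (lebn n) (fun x => partial i (fun=> (1 : R)) x * h i x).
    rewrite (_ : (fun x => _) = cst 0); first exact: intg0.
    by apply/funext => z; rewrite partial_cst mul0r.
  have := partial_by_parts_slow (lexx 1) (smooth_cst (1 : R)) (sh i) Cs0 (bh i) (bdh i) I1' I0'.
  rewrite [LHS]RI_eq0 => [/eqP|z]; last by rewrite partial_cst mul0r.
  rewrite eq_sym oppr_eq0 => /eqP <-; congr RI; apply/funext => z.
  by rewrite mul1r.
have Idh i : intg (lebn n) (partial i (h i)).
  apply: (intg_le _ _ (intgZ Cs I1)); last exact: bdh.
  exact: continuous_measurable_rV (smooth_continuous (smooth_partial i (sh i))).
have Iom : intg (lebn n) om.
  apply: (intg_le _ _ (intgZ (s ^- n.+1) I1)).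
    exact: continuous_measurable_rV (smooth_continuous som).
  by move=> z; rewrite ger0_norm.
have pt z : om z <= 2 * (\sum_i partial i (h i) z) + K * N 1 z ^- n.+1.
  have Ns := N_gt0 z s0; have N1 := @N_gt0 R n 1 z ltr01.
  have E : \sum_i partial i (h i) z = om z * (n%:R - n.-1%:R * (sqn z * N s z ^- 2) - 2 * (sqn z * N 1 z ^- 2)).
    under eq_bigr do rewrite dh.
    rewrite big_split/= sumr_const card_ord -mulr_suml -/(sqn z) -mulr_natl /om /riesz En.
    rewrite !exprS !expr0; field; rewrite !expf_neq0 ?gt_eqF//.
  have r1 : sqn z * N s z ^- 2 <= 1.
    by rewrite ler_pdivrMr ?exprn_gt0// mul1r sqr_N lerDr sqr_ge0.
  have nn : n%:R = n.-1%:R + 1 :> R by rewrite natr1 prednK.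
  have low : om z * (1 - 2 * (sqn z * N 1 z ^- 2)) <= \sum_i partial i (h i) z.
    rewrite E; apply: ler_wpM2l => //; rewrite nn.
    have : n.-1%:R * (sqn z * N s z ^- 2) <= n.-1%:R by apply: ler_piMr.
    lra.
  (* For [|z|^2 <= 1/3] the quotient [|z|^2 / (1 + |z|^2)] is at most [1/4] and the divergence is at
     least [om / 2]; for larger [|z|] one has [N 1 z <= 2 N s z]. *)
  have [near|far] := leP (3 * sqn z) 1.
    have r2 : sqn z * N 1 z ^- 2 <= 4^-1.
      by rewrite ler_pdivrMr ?exprn_gt0// ler_pdivlMl// sqr_N expr1n; lra.
    have : 2^-1 * om z <= om z * (1 - 2 * (sqn z * N 1 z ^- 2)).
      by rewrite mulrC; apply: ler_wpM2l => //; lra.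
    have : 0 <= K * N 1 z ^- n.+1 by rewrite /K; nneg.
    move: low; lra.
  have r3 : sqn z * N 1 z ^- 2 <= 1.
    by rewrite ler_pdivrMr ?exprn_gt0// mul1r sqr_N lerDr sqr_ge0.
  have : om z * (- 1) <= om z * (1 - 2 * (sqn z * N 1 z ^- 2)).
    by apply: ler_wpM2l => //; lra.
  have o3 : om z <= 2 ^+ n.-1 * N 1 z ^- n.+1.
    rewrite /om /riesz NE mulrA; apply: ler_wpM2r; first exact: NX_ge0.
    rewrite -!exprVn -exprMn; apply: lerXn2r; rewrite ?nnegrE ?mulr_ge0 ?invr_ge0 ?N_ge0//.
    rewrite ler_pdivlMr// mulrC ler_pdivrMr//.
    rewrite -(@ler_sqr R) ?nnegrE ?mulr_ge0 ?N_ge0// exprMn !sqr_N expr1n.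
    rewrite (_ : 2 ^+ 2 = 4 :> R); last by rewrite expr2 -natrM.
    have := sqr_ge0 s; lra.
  move: low; rewrite /K; move: (2 ^+ n.-1) (N 1 z ^- n.+1) o3 => X Y o3; lra.
split=> //.
have Is : intg (lebn n) (fun z => \sum_i partial i (h i) z) by exact: intg_sum.
apply: (le_trans (RI_le Iom (intgD (intgZ 2 Is) (intgZ K I1)) pt)).
rewrite RID; [|exact: intgZ|exact: intgZ].
rewrite RIZ// RIZ// RI_sum// big1 ?mulr0 ?add0r// => i _; exact: Rh.
Qed.

Lemma omega_mass : exists2 C, 0 <= C & forall s, 0 < s <= 1 ->
  intg (lebn n) (omega s) /\ RI (lebn n) (omega s) <= C.
Proof.
have [C C0 HC] := riesz_mass; exists C => // s s01; have /andP[s0 s1] := s01.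
have [I E] := HC s s01.
have le z : omega s z <= riesz s z.
  rewrite /omega /riesz; apply: ler_wpM2r; first exact: NX_ge0.
  have NE : N s z ^- n.+1 = N s z ^- n.-1 * N s z ^- 2 :> R.
    by rewrite -!exprVn -exprD addn2 prednK.
  rewrite NE mulrCA; apply: ler_piMr; first exact: NX_ge0.
  by rewrite ler_pdivrMr ?exprn_gt0 ?N_gt0// mul1r sqr_N lerDr sqr_ge0.
have Iomega : intg (lebn n) (omega s).
  apply: (intg_le _ _ I); first exact: continuous_measurable_rV (continuous_omega s0).
  by move=> z; rewrite ger0_norm ?omega_ge0.
by split=> //; exact: le_trans (RI_le Iomega I le) E.
Qed.

End weights.

(** * The truncated half-Laplacian *)

Section half_laplacian.
Context {R : realType} {n : nat}.
Hypothesis n0 : (0 < n)%N.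
Implicit Types (f g h F : 'rV[R]_n -> R) (x y z w : 'rV[R]_n) (s t : R).
Notation W := (fun z : 'rV[R]_n => N 1 z ^- n.+1).
Let cW : continuous W := @continuous_NX R n 1 n.+1 ltr01.
Let IW : intg (lebn n) W := @intg_N1X R n n0.

Definition harm k : R := k.+1%:R^-1.
Lemma harm_gt0 k : 0 < harm k. Proof. by rewrite invr_gt0. Qed.
Lemma harm01 k : 0 < harm k <= 1. Proof. by rewrite harm_gt0 invf_le1// ler1n. Qed.
Lemma harm_cvg : harm k @[k --> \oo] --> 0. Proof. exact: cvg_harmonic. Qed.

Lemma sqn_eq0 z : sqn z = 0 -> z = 0.
Proof.
move=> h; apply/rowP => i; rewrite mxE; apply/eqP; rewrite -sqrf_eq0 -(rwP eqP).
by apply/eqP; rewrite eq_le sqr_ge0 andbT -h coord_sqn.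
Qed.

Lemma N0E z : N 0 z = enorm z.
Proof. by rewrite /N enormE expr0n add0r. Qed.

Lemma NX_cvg0 (b : nat) z : sqn z != 0 -> N (harm k) z ^- b @[k --> \oo] --> N 0 z ^- b.
Proof.
move=> z0; have zp : 0 < sqn z by rewrite lt_neqAle eq_sym z0 sqn_ge0.
have Np : 0 < N 0 z by rewrite /N expr0n add0r sqrtr_gt0.
have c1 : N (harm k) z @[k --> \oo] --> N 0 z.
  have c0 : harm k * harm k + sqn z @[k --> \oo] --> 0 * 0 + sqn z.
    exact: cvgD (cvgM harm_cvg harm_cvg) (cvg_cst (sqn z)).
  have := @sqrt_continuous R (0 * 0 + sqn z) => cs.
  have := cvg_comp _ _ c0 cs; rewrite /N expr2; apply: cvg_trans.
  by rewrite (_ : (fun k => Num.sqrt (harm k ^+ 2 + sqn z)) =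
    Num.sqrt \o (fun k => harm k * harm k + sqn z))//; apply/funext => k /=; rewrite expr2.
have c2 : {for N 0 z, continuous (fun r : R => r ^- b)}.
  by apply/differentiable_continuous/derivable1_diffP; have [] := is_derive_invX b Np.
exact: (cvg_comp _ _ c1 c2).
Qed.

Lemma NX_le0 (b : nat) s z : 0 <= s -> sqn z != 0 -> N s z ^- b <= N 0 z ^- b.
Proof.
move=> s0 z0; have zp : 0 < sqn z by rewrite lt_neqAle eq_sym z0 sqn_ge0.
have Np : 0 < N 0 z by rewrite /N expr0n add0r sqrtr_gt0.
have le : N 0 z <= N s z.
  by rewrite -(@ler_sqr R) ?nnegrE ?N_ge0// !sqr_N expr0n/= lerD2r sqr_ge0.
have Ns := lt_le_trans Np le.
by rewrite lef_pV2 ?posrE ?exprn_gt0//; apply: lerXn2r; rewrite ?nnegrE ?N_ge0.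
Qed.

Lemma intg_omega0 : intg (lebn n) (@omega R n 0).
Proof.
have [C C0 HC] := @omega_mass R n n0.
have [||||] := @RI_fatou _ _ R (lebn n) (fun k => omega (harm k)) (omega 0) C => //.
- by move=> k; have [] := HC _ (harm01 k).
- by move=> k z; exact: omega_ge0.
- move=> z; rewrite /omega; apply: cvgM (cvg_cst _).
  have [->|z0] := eqVneq (sqn z) 0; last exact: cvgM (cvg_cst (sqn z)) (NX_cvg0 z0).
  by rewrite mul0r; under eq_fun do rewrite mul0r; exact: cvg_cst.
- by move=> k; have [] := HC _ (harm01 k).
Qed.

(** The first term serves [|z| <= 1]: [2 n^2] from the Hessian bound, doubled by [N 1 z ^+ 2 <= 2].
    The second serves [|z| > 1]: a factor 2 from the second difference and [2^(n+1)] from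
    [N 1 z <= 2 N 0 z]. *)
Definition sdiff_const : R := 4 * n%:R ^+ 2 + 2 ^+ n.+2.

Lemma sdiff_const_ge0 : 0 <= sdiff_const.
Proof. by rewrite /sdiff_const; nneg. Qed.

Definition sdiff_major g x M z := sdiff_const * (M * omega 0 z + (`|g x| + `|g (x + z)| + `|g (x - z)|) * W z).

Definition hess_bound g x M := forall i j w, (forall l, `|w ord0 l| <= 1) ->
  `|partial i (partial j g) (x + w)| <= M.

Lemma sdiff_le g x M s z : smooth g -> 0 <= M -> hess_bound g x M -> 0 <= s ->
  `|sdiff g x z * N s z ^- n.+1| <= sdiff_major g x M z.
Proof.
move=> sg M0 hM s0.
have maj0 : 0 <= sdiff_major g x M z.
  apply: mulr_ge0 sdiff_const_ge0 _; apply: addr_ge0; first by apply: mulr_ge0 => //; exact: omega_ge0.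
  by apply: mulr_ge0; nneg.
(* At [z = 0] the second difference vanishes, and so does the product, whatever the value of the
   inverse power. *)
have [z0|z0] := eqVneq (sqn z) 0.
  by rewrite (sqn_eq0 z0) sdiff0 mul0r normr0 -(sqn_eq0 z0).
have zp : 0 < sqn z by rewrite lt_neqAle eq_sym z0 sqn_ge0.
rewrite normrM (ger0_norm (NX_ge0 _ _ _)).
apply: (@le_trans _ _ (`|sdiff g x z| * N 0 z ^- n.+1)).
  by apply: ler_wpM2l => //; exact: NX_le0.
pose A := `|g x| + `|g (x + z)| + `|g (x - z)|.
have A0 : 0 <= A by rewrite /A; nneg.
have N02 : N 0 z ^+ 2 = sqn z by rewrite sqr_N expr0n add0r.
have Np : 0 < N 0 z by rewrite /N expr0n add0r sqrtr_gt0.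
have [z1|z1] := leP (sqn z) 1.
  apply: (@le_trans _ _ (4 * n%:R ^+ 2 * (M * omega 0 z))); last first.
    rewrite /sdiff_major /sdiff_const -/A.
    have o0 := mulr_ge0 M0 (omega_ge0 0 z); have a1 := mulr_ge0 A0 (NX_ge0 1 n.+1 z).
    have b0 : 0 <= 2 ^+ n.+2 :> R by nneg.
    have c0 : 0 <= 4 * n%:R ^+ 2 :> R by nneg.
    have := mulr_ge0 b0 o0; have := mulr_ge0 b0 a1; have := mulr_ge0 c0 a1.
    move: (A * _) (M * _) (2 ^+ n.+2) (4 * _) => p q r u; lra.
  have zr j : `|z ord0 j| <= N 0 z := le_coord_N 0 z j.
  have Nle1 : N 0 z <= 1 by rewrite -(@ler_sqr R) ?nnegrE ?N_ge0// N02 expr1n.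
  have b1 : `|sdiff g x z| <= n%:R * (n%:R * (2 * M * N 0 z) * N 0 z).
    apply: sdiff_bound => //; last exact: ltW.
    by move=> i j w wr; apply: hM => l; exact: le_trans (wr l) Nle1.
  apply: (@le_trans _ _ (n%:R * (n%:R * (2 * M * N 0 z) * N 0 z) * N 0 z ^- n.+1)).
    by apply: ler_wpM2r => //; exact: NX_ge0.
  have E : n%:R * (n%:R * (2 * M * N 0 z) * N 0 z) = 2 * n%:R ^+ 2 * M * sqn z by rewrite -N02; ring.
  rewrite E /omega [leRHS](_ : _ = (2 * n%:R ^+ 2 * M * sqn z * N 0 z ^- n.+1) * (2 * N 1 z ^- 2)); last by ring.
  apply: ler_peMr.
    by apply: mulr_ge0; [apply: mulr_ge0; [nneg|exact: ltW]|nneg].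
  by rewrite ler_pdivlMr ?exprn_gt0 ?N_gt0// mul1r sqr_N expr1n; lra.
have dA : `|sdiff g x z| <= 2 * A.
  rewrite /sdiff (le_trans (ler_normB _ _))// (le_trans (lerD (ler_normB _ _) (lexx _)))//.
  rewrite normrM (@ger0_norm _ 2)// /A; have := normr_ge0 (g (x + z)); have := normr_ge0 (g (x - z)); lra.
have NW : N 0 z ^- n.+1 <= 2 ^+ n.+1 * W z.
  rewrite -!exprVn -exprMn; apply: lerXn2r; rewrite ?nnegrE ?mulr_ge0 ?invr_ge0 ?N_ge0//.
  rewrite ler_pdivlMr ?N_gt0// mulrC ler_pdivrMr//.
  rewrite -(@ler_sqr R) ?nnegrE ?mulr_ge0 ?N_ge0// exprMn !sqr_N expr1n expr0n add0r.
  rewrite (_ : 2 ^+ 2 = 4 :> R); last by rewrite expr2 -natrM.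
  lra.
apply: (@le_trans _ _ (2 * A * (2 ^+ n.+1 * W z))); first by apply: ler_pM => //; exact: NX_ge0.
rewrite /sdiff_major /sdiff_const -/A.
have o0 := mulr_ge0 M0 (omega_ge0 0 z); have a1 := mulr_ge0 A0 (NX_ge0 1 n.+1 z).
have b0 : 0 <= 2 ^+ n.+2 :> R by nneg.
have c0 : 0 <= 4 * n%:R ^+ 2 :> R by nneg.
have := mulr_ge0 b0 o0; have := mulr_ge0 c0 o0; have := mulr_ge0 c0 a1.
rewrite [2 * A * _](_ : _ = 2 ^+ n.+2 * (A * W z)); last by rewrite (exprS 2 n.+1); ring.
move: (A * _) (M * _) (2 ^+ n.+2) (4 * _) => p q r u; lra.
Qed.

(* At [s = 0] this is [(-Delta)^(1/2) g] without its normalising constant. *)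
Definition lapker g s x := 2^-1 * RI (lebn n) (fun z => sdiff g x z * N s z ^- n.+1).

Lemma continuous_refl f x : continuous f -> continuous (fun z => f (x - z)).
Proof.
move=> cf z; have c1 : {for z, continuous (fun y : 'rV[R]_n => x - y)}.
  apply: continuous_rV_at => i.
  rewrite (_ : (fun y => _) = (fun y : 'rV[R]_n => x ord0 i - y ord0 i)).
    exact: cvgB (cvg_cst (x ord0 i)) (@continuous_coord R n i z).
  by apply/funext => y; rewrite !mxE.
exact: (@continuous_comp _ _ _ (fun y : 'rV[R]_n => x - y) f z c1 (cf (x - z))).
Qed.

Section one_function.
Variable g : 'rV[R]_n -> R.
Hypotheses (sg : smooth g) (Ig : intg (lebn n) (fun z => `|g z| * W z)).
Let cg := smooth_continuous sg.
Let mg := continuous_measurable_rV cg.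

Lemma measurable_sdiff x : measurable_fun setT (sdiff g x).
Proof.
apply: continuous_measurable_rV.
have c1 := continuous_shift (x := x) cg; have c2 := continuous_refl (x := x) cg.
by move=> z; exact: cvgB (cvgB (cvg_cst (2 * g x)) (c1 z)) (c2 z).
Qed.

Lemma intg_gW_refl x : intg (lebn n) (fun z => `|g (x - z)| * W z) /\
  RI (lebn n) (fun z => `|g (x - z)| * W z) = RI (lebn n) (fun z => `|g (x + z)| * W z).
Proof.
have [I _] := intg_gW x mg Ig.
have E : (fun z => `|g (x - z)| * W z) = (fun z => (fun y => `|g (x + y)| * W y) (0 - z)).
  by apply/funext => z; rewrite sub0r N_opp.
by rewrite E; split; [exact: (intg_reflect 0 I)|exact: (RI_reflect 0 I)].
Qed.

Lemma intg_major x M : intg (lebn n) (sdiff_major g x M) /\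
  RI (lebn n) (sdiff_major g x M) = sdiff_const * (M * RI (lebn n) (omega 0) +
    (`|g x| * @kappa R n + 2 * RI (lebn n) (fun z => `|g (x + z)| * W z))).
Proof.
have I0 := intg_omega0; have [I1 _] := intg_gW x mg Ig; have [I2 E2] := intg_gW_refl x.
have E : sdiff_major g x M = (fun z => sdiff_const * (M * omega 0 z + (`|g x| * W z +
   (`|g (x + z)| * W z + `|g (x - z)| * W z)))).
  by apply/funext => z; rewrite /sdiff_major; congr (_ * (_ + _)); ring.
have Is := intgD I1 I2; have Ix := intgZ `|g x| IW; have Im := intgZ M I0.
have It := intgD Im (intgD Ix Is).
rewrite E; split; first exact: intgZ.
by rewrite RIZ// RID// ?RID// ?RID// ?E2 ?RIZ// -?/(@kappa R n); [congr (_ * (_ + (_ + _))); ring|exact: intgD].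
Qed.

Lemma sdiff_cvg x M : 0 <= M -> hess_bound g x M ->
  intg (lebn n) (fun z => sdiff g x z * N 0 z ^- n.+1) /\
  lapker g (harm k) x @[k --> \oo] --> lapker g 0 x.
Proof.
move=> M0 hM; have [I _] := intg_major x M.
have [||||I0 L] := @RI_dct _ _ R (lebn n) (fun k z => sdiff g x z * N (harm k) z ^- n.+1)
  (fun z => sdiff g x z * N 0 z ^- n.+1) (sdiff_major g x M) => //.
- move=> k; apply: measurable_funM; first exact: measurable_sdiff.
  by apply: continuous_measurable_rV; exact: continuous_NX (harm_gt0 k).
- move=> z; have [z0|z0] := eqVneq (sqn z) 0; last exact: cvgM (cvg_cst (sdiff g x z)) (NX_cvg0 z0).
  by rewrite (sqn_eq0 z0) sdiff0 mul0r; under eq_fun do rewrite mul0r; exact: cvg_cst.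
- by move=> k z; apply: sdiff_le => //; exact: ltW (harm_gt0 k).
by split => //; exact: cvgM (cvg_cst _) L.
Qed.

Lemma intg_sdiffN x M s : 0 <= M -> hess_bound g x M -> 0 <= s ->
  intg (lebn n) (fun z => sdiff g x z * N s z ^- n.+1).
Proof.
move=> M0 hM s0; have [I _] := intg_major x M.
have [->|sn] := eqVneq s 0; first by have [] := sdiff_cvg M0 hM.
apply: (intg_le _ _ I); last by move=> z; exact: sdiff_le.
apply: measurable_funM; first exact: measurable_sdiff.
by apply: continuous_measurable_rV; apply: continuous_NX; rewrite lt_neqAle eq_sym sn.
Qed.

Lemma lapker_bound x M s : 0 <= M -> hess_bound g x M -> 0 <= s ->
  `|lapker g s x| <= RI (lebn n) (sdiff_major g x M).
Proof.
move=> M0 hM s0; have [I _] := intg_major x M.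
have h : `|RI (lebn n) (fun z => sdiff g x z * N s z ^- n.+1)| <= RI (lebn n) (sdiff_major g x M).
  by apply: RI_norm_le => //; [exact: intg_sdiffN hM s0|move=> z; exact: sdiff_le].
rewrite /lapker normrM gtr0_norm// (le_trans _ h)//; apply: ler_piMl => //.
by rewrite invf_le1// ler1n.
Qed.

Lemma intg_gN x s : 0 < s -> intg (lebn n) (fun z => g (x + z) * N s z ^- n.+1).
Proof.
move=> s0; have [I _] := intg_gW x mg Ig.
have mgs : measurable_fun setT (fun z => g (x + z)).
  exact: continuous_measurable_rV (continuous_shift (x := x) cg).
apply: (@intgM_cont R n (fun=> 0) _ _ _ 1 mgs _ _ (intg_vNX I mgs s0)).
  by apply: continuous_measurable_rV; exact: continuous_NX.
by move=> z; rewrite mul1r ger0_norm ?NX_ge0.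
Qed.

(** For [s > 0] the kernel is integrable, so the second difference splits into a multiple of [g x]
    and two reflected convolutions that are equal. *)
Lemma lapkerE x s : 0 < s -> lapker g s x =
  @kappa R n / s * g x - RI (lebn n) (fun z => g (x + z) * N s z ^- n.+1).
Proof.
move=> s0; have I := intg_gN x s0; have [In En] := intg_RI_NX s0 n0.
have E : (fun z => g (x - z) * N s z ^- n.+1) = (fun z => (fun y => g (x + y) * N s y ^- n.+1) (0 - z)).
  by apply/funext => z; rewrite sub0r N_opp.
have I2 : intg (lebn n) (fun z => g (x - z) * N s z ^- n.+1) by rewrite E; exact: (intg_reflect 0 I).
have E2 : RI (lebn n) (fun z => g (x - z) * N s z ^- n.+1) = RI (lebn n) (fun z => g (x + z) * N s z ^- n.+1).
  by rewrite E; exact: (RI_reflect 0 I).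
rewrite /lapker (_ : (fun z => sdiff g x z * N s z ^- n.+1) = (fun z => (2 * g x) * N s z ^- n.+1 -
   g (x + z) * N s z ^- n.+1 - g (x - z) * N s z ^- n.+1)); last first.
  by apply/funext => z; rewrite /sdiff; ring.
have I0 := intgZ (2 * g x) In.
rewrite RIB ?RIB ?RIZ// ?E2 ?En -/(@kappa R n); last exact: intgB.
by field; rewrite gt_eqF.
Qed.

End one_function.

Lemma le_big_term (F : 'I_n -> R) i : (forall j, 0 <= F j) -> F i <= \sum_j F j.
Proof. by move=> F0; rewrite (bigD1 i)//= lerDl; exact: sumr_ge0. Qed.

Lemma hess_cube g (r : R) : smooth g -> exists2 M, 0 <= M &
  forall x, (forall l, `|x ord0 l| <= r) -> hess_bound g x M.
Proof.
move=> sg; pose H y := \sum_i \sum_j `|partial i (partial j g) y|.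
have cH : continuous H.
  move=> y; apply: (@cvg_bigsum R _ (nbhs y) _ 'I_n (index_enum _)
    (fun i y => \sum_j `|partial i (partial j g) y|) (fun i => \sum_j `|partial i (partial j g) y|)) => i.
  apply: (@cvg_bigsum R _ (nbhs y) _ 'I_n (index_enum _)
    (fun j y => `|partial i (partial j g) y|) (fun j => `|partial i (partial j g) y|)) => j.
  have c := smooth_continuous (smooth_partial i (smooth_partial j sg)).
  exact: (@continuous_comp _ _ _ (partial i (partial j g)) (fun r : R => `|r|) y (c y) (@norm_continuous _ R _)).
have [M M0 HM] := cube_bounded (r + 1) cH; exists M => // x xr i j w w1.
have := HM (x + w); have H0 y : 0 <= H y by do 2 apply: sumr_ge0 => ? _.
rewrite ger0_norm// => h; apply: le_trans (h _).
  apply: le_trans (le_big_term (F := fun i => \sum_j `|partial i (partial j g) (x + w)|) i _).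
    exact: (le_big_term (F := fun j => `|partial i (partial j g) (x + w)|)).
  by move=> k; apply: sumr_ge0.
by move=> l; rewrite mxE (le_trans (ler_normD _ _))// lerD.
Qed.

Lemma hess_exists g x : smooth g -> exists2 M, 0 <= M & hess_bound g x M.
Proof.
move=> sg; have [M M0 HM] := @hess_cube g (enorm x) sg.
by exists M => //; apply: HM => l; exact: coord_enorm.
Qed.

(** After [lapkerE] only the convolution part matters, and its kernel [N s (y - x) ^- n.+1] is
    symmetric. Fubini applies because [h] has compact support and [F] is integrable against the
    weight. *)
Lemma lapker_sym F h s : 0 < s -> smooth F -> intg (lebn n) (fun z => `|F z| * W z) ->
  smooth h -> csupp h ->
  [/\ intg (lebn n) (fun x => lapker F s x * h x),
     intg (lebn n) (fun x => F x * lapker h s x) &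
   RI (lebn n) (fun x => lapker F s x * h x) = RI (lebn n) (fun x => F x * lapker h s x)].
Proof.
move=> s0 sF IF sh ch.
have cF := smooth_continuous sF; have mF := continuous_measurable_rV cF.
have chh := smooth_continuous sh; have mh := continuous_measurable_rV chh.
have Ih : intg (lebn n) h by exact: intg_csupp.
have IhW : intg (lebn n) (fun z => `|h z| * W z).
  apply: (intg_le _ _ (intg_norm Ih)).
    apply: measurable_funM; last exact: continuous_measurable_rV cW.
    exact: (measurableT_comp (@normr_measurable R setT) mh).
  move=> z; rewrite ger0_norm; last by nneg.
  by apply: ler_piMr => //; exact: NX_le1.
have mN : measurable_fun setT (fun p : 'rV[R]_n * 'rV[R]_n => N s (p.2 - p.1) ^- n.+1).
  have m1 : measurable_fun setT (fun p : 'rV[R]_n * 'rV[R]_n => p.2 - p.1).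
    apply/measurable_fun_rVP => i.
    rewrite (_ : (fun p => _) = (fun p : 'rV[R]_n * 'rV[R]_n => p.2 ord0 i - p.1 ord0 i)); last first.
      by apply/funext => p; rewrite !mxE.
    apply: measurable_funB.
      exact: (measurableT_comp (@measurable_coord R n i) measurable_snd).
    exact: (measurableT_comp (@measurable_coord R n i) measurable_fst).
  exact: (measurableT_comp (continuous_measurable_rV (@continuous_NX R n s n.+1 s0)) m1).
pose G x y := h x * (F y * N s (y - x) ^- n.+1).
have shiftF x : (fun y => F y * N s (y - x) ^- n.+1) = (fun y => (fun z => F (x + z) * N s z ^- n.+1) (- x + y)).
  by apply/funext => y; rewrite addrA subrr add0r addrC.
have IFx x : intg (lebn n) (fun y => F y * N s (y - x) ^- n.+1).
  by rewrite shiftF; apply: (intg_shift (f := fun z => F (x + z) * N s z ^- n.+1)); exact: intg_gN.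
have RFx x : RI (lebn n) (fun y => F y * N s (y - x) ^- n.+1) = RI (lebn n) (fun z => F (x + z) * N s z ^- n.+1).
  by rewrite shiftF; apply: (RI_shift (f := fun z => F (x + z) * N s z ^- n.+1)); exact: intg_gN.
have shifth y : (fun x => h x * N s (y - x) ^- n.+1) = (fun x => (fun z => h (y + z) * N s z ^- n.+1) (- y + x)).
  apply/funext => x; rewrite addrA subrr add0r; congr (_ * _ ^- _).
  by rewrite -[LHS]N_opp; congr N; rewrite opprB addrC.
have Ihy y : intg (lebn n) (fun x => h x * N s (y - x) ^- n.+1).
  by rewrite shifth; apply: (intg_shift (f := fun z => h (y + z) * N s z ^- n.+1)); exact: intg_gN.
have Rhy y : RI (lebn n) (fun x => h x * N s (y - x) ^- n.+1) = RI (lebn n) (fun z => h (y + z) * N s z ^- n.+1).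
  by rewrite shifth; apply: (RI_shift (f := fun z => h (y + z) * N s z ^- n.+1)); exact: intg_gN.
pose d := Num.min s 1.
have d0 : 0 < d by rewrite lt_min s0 ltr01.
have d1 : d <= 1 by rewrite ge_min lexx orbT.
have ds : d <= s by rewrite ge_min lexx.
pose MF := RI (lebn n) (fun z => `|F z| * W z).
have IG1 x : intg (lebn n) (G x) by apply: intgZ.
have mG : measurable_fun setT (fun p : 'rV[R]_n * 'rV[R]_n => G p.1 p.2).
  apply: measurable_funM; first exact: (measurableT_comp mh measurable_fst).
  by apply: measurable_funM => //; exact: (measurableT_comp mF measurable_snd).
have Igx : intg (lebn n) (fun x => `|h x| * (d ^- n.+1 * (2 ^+ n.+1 * N 1 x ^+ n.+1 * MF))).
  have c : csupp (fun x => `|h x|).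
    by have [r hr] := ch; exists r => x xr; rewrite hr// normr0.
  apply: intg_csupp; last exact: csuppMl.
  apply: continuousM_fun.
    by move=> x; exact: (@continuous_comp _ _ _ h (fun r : R => `|r|) x (chh x) (@norm_continuous _ R _)).
  have cN1 := @continuous_N R n 1.
  have cNk k : continuous (fun x : 'rV[R]_n => N 1 x ^+ k).
    elim: k => [|k ih]; first by under eq_fun do rewrite expr0; exact: cst_continuous.
    by under eq_fun do rewrite exprS; exact: continuousM_fun.
  apply: continuousM_fun; first exact: cst_continuous.
  apply: continuousM_fun; last exact: cst_continuous.
  by apply: continuousM_fun => //; exact: cst_continuous.
have I2 : intg2 (lebn n) (lebn n) G.
  apply: (intg2_le mG Igx IG1) => x.
  rewrite (_ : (fun y => `|G x y|) = (fun y => `|h x| * `|F y * N s (y - x) ^- n.+1|)); last first.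
    by apply/funext => y; rewrite /G normrM.
  rewrite RIZ; last exact: intg_norm.
  apply: ler_wpM2l => //.
  rewrite (_ : (fun y => _) = (fun y => (fun z => `|F (x + z) * N s z ^- n.+1|) (- x + y))); last first.
    by apply/funext => y; rewrite addrA subrr add0r (addrC _ y).
  rewrite (RI_shift (f := fun z => `|F (x + z) * N s z ^- n.+1|)); last by apply: intg_norm; exact: intg_gN.
  have [IFs Fs] := intg_gW x mF IF.
  apply: (@le_trans _ _ (d ^- n.+1 * RI (lebn n) (fun z => `|F (x + z)| * W z))).
    rewrite -RIZ//; apply: RI_le; [by apply: intg_norm; exact: intg_gN|exact: intgZ|] => z.
    rewrite normrM (ger0_norm (NX_ge0 _ _ _)) mulrCA; apply: ler_wpM2l => //.
    by apply: NX_lower => //; rewrite d0.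
  by apply: ler_wpM2l => //; rewrite invr_ge0 exprn_ge0// ltW.
have IG2 y : intg (lebn n) (G^~ y).
  rewrite (_ : G^~ y = fun x => F y * (h x * N s (y - x) ^- n.+1)); first exact: intgZ.
  by apply/funext => x; rewrite /G mulrCA.
have E1 : (fun x => RI (lebn n) (G x)) = (fun x => RI (lebn n) (fun z => F (x + z) * N s z ^- n.+1) * h x).
  by apply/funext => x; rewrite -RFx [RHS]mulrC; exact: (RIZ (h x) (IFx x)).
have E2 : (fun y => RI (lebn n) (G^~ y)) = (fun y => F y * RI (lebn n) (fun z => h (y + z) * N s z ^- n.+1)).
  apply/funext => y; rewrite -Rhy -(RIZ (F y) (Ihy y)); congr RI.
  by apply/funext => x; rewrite /G mulrCA.
have [J1 J2 E] := RI_fubini_eq I2 IG1 IG2 E1 E2.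
have IFh : intg (lebn n) (fun x => F x * h x).
  exact: intg_csupp (continuousM_fun cF chh) (csuppMr F ch).
have L1 : (fun x => lapker F s x * h x) = (fun x => @kappa R n / s * (F x * h x) -
    RI (lebn n) (fun z => F (x + z) * N s z ^- n.+1) * h x).
  by apply/funext => x; rewrite lapkerE//; ring.
have L2 : (fun x => F x * lapker h s x) = (fun x => @kappa R n / s * (F x * h x) -
    F x * RI (lebn n) (fun z => h (x + z) * N s z ^- n.+1)).
  by apply/funext => x; rewrite lapkerE//; ring.
rewrite L1 L2; split; [by apply: intgB => //; exact: intgZ|by apply: intgB => //; exact: intgZ|].
by rewrite RIB// ?RIB// ?E//; exact: intgZ.
Qed.

(** Measurability is read off from integrability: times a cut-off, the regularised operator is
    integrable by [lapker_sym]; then the cut-off and afterwards the regularisation are removed by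
    pointwise limits. *)
Lemma measurable_lapker0 F : smooth F -> intg (lebn n) (fun z => `|F z| * W z) ->
  measurable_fun setT (lapker F 0).
Proof.
move=> sF IF; have tc := @cutoff_tame R n 1 (lexx 1).
have mk k : measurable_fun setT (lapker F (harm k)).
  apply: (measurable_fun_cvg (h := fun j x => lapker F (harm k) x * chi (cutoff 1 j) x)).
    move=> j; have sc : smooth (@chi R n (cutoff 1 j)) by exact: bumpk_smooth bumpk_chi.
    have [I _ _] := lapker_sym (harm_gt0 k) sF IF sc (cutoff_csupp j ltr01).
    exact: intg_measurable I.
  move=> x _; rewrite -[X in _ --> X]mulr1; apply: cvgM; first exact: cvg_cst.
  exact: tame_cvg tc.
apply: (measurable_fun_cvg (h := fun k => lapker F (harm k))) => // x _.
by have [M M0 hM] := hess_exists x sF; have [] := sdiff_cvg sF IF M0 hM.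
Qed.

End half_laplacian.

(** * The principal value *)

Section iterated_integrals.
Context {R : realType} {n : nat}.
Implicit Types f : 'rV[R]_n -> R.

Lemma intg_integrable_Rn f : measurable_fun setT f -> integrable_Rn f -> intg (lebn n) f.
Proof.
move=> mf h.
have mnf : measurable_fun setT (fun x => `|f x|) := measurableT_comp (@normr_measurable R setT) mf.
have : intg (lebn n) (fun x => `|f x|).
  apply: intg_ge0P => //; move: h; rewrite /integrable_Rn iintE//.
  exact: (measurable_EFinP setT _).2 mnf.
by apply: intg_le.
Qed.

Lemma integral_RnE f : intg (lebn n) f -> integral_Rn f = RI (lebn n) f.
Proof.
move=> If; have mf := intg_measurable If.
have I (g : 'rV[R]_n -> R) : intg (lebn n) g -> intg (lebn n) (fun x => Num.max (g x) 0).
  move=> Ig; apply: (intg_le _ _ (intg_norm Ig)).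
    by apply: measurable_maxr => //; exact: intg_measurable Ig.
  by move=> x; rewrite ger0_norm ?le_max ?lexx ?orbT// ge_max ler_norm normr_ge0.
have E (g : 'rV[R]_n -> R) : intg (lebn n) g -> fine (iint (fun x => (Num.max (g x) 0)%:E)) = RI (lebn n) (fun x => Num.max (g x) 0).
  move=> Ig; rewrite iintE.
  - by rewrite -RI_EFin//; exact: I.
  - exact: (measurable_EFinP setT _).2 (intg_measurable (I g Ig)).
  - by move=> x; rewrite lee_fin le_max lexx orbT.
rewrite /integral_Rn (E f If) (E (fun x => - f x) (intgN If)) -RIB; [|exact: I|exact: I (intgN If)].
congr RI; apply/funext => x; have [h|h] := leP 0 (f x).
  by rewrite max_r ?subr0// oppr_le0.
by rewrite max_l ?oppr_ge0 ?(ltW h)// sub0r opprK.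
Qed.

End iterated_integrals.

Section principal_value.
Context {R : realType} {n : nat}.
Hypothesis n0 : (0 < n)%N.
Implicit Types (g h F v : 'rV[R]_n -> R) (x y z w : 'rV[R]_n) (s t : R).
Notation W := (fun z : 'rV[R]_n => N 1 z ^- n.+1).

Lemma intg_L_half F : continuous F -> L_half F -> intg (lebn n) (fun z => `|F z| * W z).
Proof.
move=> cF hF; have mF := continuous_measurable_rV cF.
have c1 k : continuous (fun x : 'rV[R]_n => enorm x ^+ k).
  elim: k => [|k ih]; first by under eq_fun do rewrite expr0; exact: cst_continuous.
  by under eq_fun do rewrite exprS; exact: continuousM_fun (@continuous_enorm R n) ih.
have e0 x : 0 <= enorm x by exact: sqrtr_ge0.
have p0 x : 0 < 1 + enorm x ^+ n.+1 by rewrite ltr_pwDl// exprn_ge0.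
have c2 : continuous (fun x : 'rV[R]_n => F x / (1 + enorm x ^+ n.+1)).
  move=> x; apply: cvgM (cF x) _; apply: cvgV; first by rewrite gt_eqF.
  exact: cvgD (cvg_cst (1 : R)) (c1 n.+1 x).
have I := intg_integrable_Rn (continuous_measurable_rV c2) hF.
apply: (intg_le _ _ (intgZ (2 ^+ n.+2) (intg_norm I))).
  apply: measurable_funM; last exact: continuous_measurable_rV (@continuous_NX R n 1 n.+1 ltr01).
  exact: (measurableT_comp (@normr_measurable R setT) mF).
move=> x; rewrite ger0_norm; last by nneg.
rewrite normrM mulrCA; apply: ler_wpM2l => //; rewrite ger0_norm; last by rewrite invr_ge0 ltW.
rewrite ler_pdivlMr// mulrC ler_pdivrMr ?exprn_gt0 ?N_gt0//.
have h1 : 1 <= N 1 x ^+ n.+1 by rewrite exprn_ege1// N_ge1.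
have h2 : enorm x ^+ n.+1 <= N 1 x ^+ n.+1.
  apply: lerXn2r; rewrite ?nnegrE ?N_ge0// -N0E.
  by rewrite -(@ler_sqr R) ?nnegrE ?N_ge0// !sqr_N expr1n expr0n add0r lerDr.
have h3 : 2 <= 2 ^+ n.+2 :> R by rewrite -[leLHS]expr1 ler_weXn2l// ler1n.
have := ler_wpM2r (le_trans ler01 h1) h3; lra.
Qed.

(** Averaging the truncated integral over the points [x + z] and [x - z] produces second
    differences, which are absolutely integrable against [|z|^(-n-1)]; sharp truncation and
    regularisation then have the same limit. *)
Lemma half_lapE F x : smooth F -> intg (lebn n) (fun z => `|F z| * W z) -> pv_exists F x ->
  half_lap F x = C_half R n * lapker F 0 x.
Proof.
move=> sF IF [Ipv cpv]; have cF := smooth_continuous sF; have mF := continuous_measurable_rV cF.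
pose q (e : R) z := if e < enorm z then enorm z ^- n.+1 else 0.
have qN e z : q e (- z) = q e z by rewrite /q -!N0E N_opp.
have mq e : 0 < e -> measurable_fun setT (q e).
  move=> e0; rewrite (_ : q e = fun z => if e < enorm z then (Num.max e (enorm z)) ^- n.+1 else 0).
    have me := continuous_measurable_rV (@continuous_enorm R n).
    apply: measurable_fun_if => //; first exact: measurable_fun_ltr.
    have cm : continuous (fun r : R => (Num.max e r) ^- n.+1).
      move=> r; have p : 0 < Num.max e r by rewrite lt_max e0.
      have cmax : {for r, continuous (fun r : R => Num.max e r)}.
        by apply: continuous_max => //; exact: cst_continuous.
      have c2 : {for Num.max e r, continuous (fun r : R => r ^- n.+1)}.
        by apply/differentiable_continuous/derivable1_diffP; have [] := is_derive_invX n.+1 p.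
      exact: (@continuous_comp _ _ _ (fun r : R => Num.max e r) (fun r : R => r ^- n.+1) r cmax c2).
    have m2 := measurableT_comp (continuous_measurable_fun cm) me.
    exact: measurable_funTS m2.
  by apply/funext => z; rewrite /q; case: ifPn => // h; rewrite max_r// ltW.
have pvE e y : pv_integrand F x e y = (F x - F y) * q e (x - y).
  by rewrite /pv_integrand /q; case: ifPn; rewrite ?mulr0.
have I e : 0 < e -> intg (lebn n) (pv_integrand F x e).
  move=> e0; apply: intg_integrable_Rn (Ipv e e0).
  rewrite (_ : pv_integrand F x e = fun y => (F x - F y) * q e (x - y)); last exact/funext.
  apply: measurable_funM; first exact: measurable_funB.
  have ms : measurable_fun setT (fun y : 'rV[R]_n => x - y).
    have := @measurable_affine R n (-1) x; congr measurable_fun.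
    by apply/funext => z; rewrite scaleN1r addrC.
  exact: (measurableT_comp (mq e e0) ms).
have E e : 0 < e -> integral_Rn (pv_integrand F x e) = 2^-1 * RI (lebn n) (fun z => sdiff F x z * q e z).
  move=> e0; have Ie := I e e0; rewrite integral_RnE//.
  have I1 := intg_shift x Ie; have I2 := intg_reflect x Ie.
  have -> : (fun z => sdiff F x z * q e z) =
      (fun z => pv_integrand F x e (x + z) + pv_integrand F x e (x - z)).
    apply/funext => z; rewrite !pvE /sdiff opprB addrCA subrr addr0 opprD addrA subrr add0r qN.
    by ring.
  by rewrite RID// RI_shift// RI_reflect//; field.
have Is e : 0 < e -> intg (lebn n) (fun z => sdiff F x z * q e z).
  move=> e0; have Ie := I e e0; have := intgD (intg_shift x Ie) (intg_reflect x Ie).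
  congr intg; apply/funext => z.
  by rewrite !pvE /sdiff opprB addrCA subrr addr0 opprD addrA subrr add0r qN; ring.
have [M M0 hM] := hess_exists x sF.
have I0 := intg_sdiffN n0 sF IF M0 hM (lexx 0).
have [||||_ L] := @RI_dct _ _ R (lebn n) (fun k z => sdiff F x z * q (harm k) z)
  (fun z => sdiff F x z * N 0 z ^- n.+1) (fun z => `|sdiff F x z * N 0 z ^- n.+1|).
- by move=> k; exact: intg_measurable (Is _ (harm_gt0 k)).
- move=> z; have [z0|z0] := eqVneq (sqn z) 0.
    by rewrite (sqn_eq0 z0) sdiff0 mul0r; under eq_fun do rewrite mul0r; exact: cvg_cst.
  have zp : 0 < enorm z by rewrite -N0E /N expr0n add0r sqrtr_gt0 lt_neqAle eq_sym z0 sqn_ge0.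
  apply: cvgM (cvg_cst _) _; apply: cvg_near_cst.
  have : \forall k \near \oo, harm k < enorm z by exact: (cvgr_lt 0 (@harm_cvg R) _ zp).
  by apply: filterS => k h; rewrite /q h N0E.
- by move=> k z; rewrite !normrM; apply: ler_wpM2l => //; rewrite /q N0E; case: ifP => //; rewrite normr0.
- exact: intg_norm.
(* The limit in [e] exists by assumption, so it can be computed along the sequence [harm]. *)
have /cvg_at_rightP /(_ (@harm R)) C : integral_Rn (pv_integrand F x e) @[e --> 0^'+] -->
  lim (integral_Rn (pv_integrand F x e) @[e --> 0^'+]) by exact: cpv.
have {}C := C (conj (@harm_gt0 R) (@harm_cvg R)).
rewrite /half_lap; congr (_ * _); apply: cvg_unique C _ => //.
rewrite (_ : (fun k => _) = fun k => 2^-1 * RI (lebn n) (fun z => sdiff F x z * q (harm k) z)).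
  exact: cvgM (cvg_cst _) L.
by apply/funext => k; rewrite E// harm_gt0.
Qed.

Lemma intg_DkW j t : 0 < t -> intg (lebn n) (fun z => `|Dk j t z| * W z).
Proof.
move=> t0; have [C C0 HC] := @Dk_dom R n j t t t0 (lexx t).
apply: (intg_le _ _ (intgZ C (@intg_N1X R n n0))).
  apply: measurable_funM; last exact: continuous_measurable_rV (@continuous_NX R n 1 n.+1 ltr01).
  exact: (measurableT_comp (@normr_measurable R setT) (measurable_Dk j t0)).
move=> z; rewrite ger0_norm; last by nneg.
apply: ler_wpM2r; first exact: NX_ge0.
apply: (le_trans (HC t z _)); rewrite ?lexx//.
by rewrite -[leRHS]mulr1; apply: ler_wpM2l => //; exact: NX_le1.
Qed.

(* [(kappa P_t - P_s * P_t) / s = kappa (P_t - P_(t+s)) / s] by the semigroup property. *)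
Lemma lapker_poisson t y : 0 < t -> lapker (Dk 0 t) 0 y = - @kappa R n * Dk 1 t y.
Proof.
move=> t0; have sD := homk_smooth t0 (@homk_Dk R n 0 t t0).
have ID := @intg_DkW 0 t t0.
have [M M0 hM] := hess_exists y sD.
have [_ L] := sdiff_cvg n0 sD ID M0 hM.
apply: cvg_unique L _ => //.
rewrite (_ : (fun k => _) = (fun k => - @kappa R n * ((harm k)^-1 * (Dk 0 (harm k + t) y - Dk 0 t y)))).
  apply: cvgM; first exact: cvg_cst.
  have [/cvg_ex[l /= Cl] El] := @is_derive_Dk R n 0 t y t0.
  have El' : l = Dk 1 t y by rewrite -El; apply/esym/cvg_lim.
  rewrite El' in Cl; move/cvgr_dnbhsP: Cl => /(_ (@harm R)) Cl.
  have {}Cl := Cl (conj (fun k => lt0r_neq0 (harm_gt0 k)) (@harm_cvg R)).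
  move: Cl; rewrite (_ : (fun k => _) = (fun k => (harm k)^-1 * (Dk 0 (harm k + t) y - Dk 0 t y)))//.
  by apply/funext => k; rewrite /= /GRing.scale/= mulr1.
apply/funext => k; have s0 := @harm_gt0 R k.
rewrite (lapkerE n0 sD ID)//.
have -> : RI (lebn n) (fun z => Dk 0 t (y + z) * N (harm k) z ^- n.+1) =
    (harm k)^-1 * (@kappa R n * Dk 0 (harm k + t) y).
  rewrite -(poisson_semigroup n0 y s0 t0) -RIZ; last exact: intg_DkDk.
  congr RI; apply/funext => z; rewrite [Dk 0 (harm k) z]Dk0 mulrA mulrA mulVf ?gt_eqF// mul1r.
  by rewrite mulrC.
by ring.
Qed.

Lemma N1_cube w : (forall l, `|w ord0 l| <= 1) -> N 1 w <= 1 + n%:R.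
Proof.
move=> h; rewrite -(@ler_sqr R) ?nnegrE ?N_ge0 ?addr_ge0// sqr_N expr1n.
apply: (@le_trans _ _ (1 + n%:R)); last by rewrite expr2 ler_peMr ?addr_ge0// lerDl.
rewrite lerD2l /sqn (le_trans (ler_sum _ (G := fun=> 1) _))//.
  by move=> i _; rewrite -[leLHS]real_normK ?num_real// exprn_ile1.
by rewrite sumr_const card_ord.
Qed.

Definition Wcube : R := 2 ^+ n.+1 * (1 + n%:R) ^+ n.+1.

Lemma W_cube y w : (forall l, `|w ord0 l| <= 1) -> W (y + w) <= Wcube * W y.
Proof.
move=> h; have := NX_submul n.+1 (- w) (y + w); rewrite addrCA addNr addr0 N_opp => H.
apply: (le_trans H); apply: ler_wpM2r; first exact: NX_ge0.
apply: ler_wpM2l; first by nneg.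
by apply: lerXn2r; rewrite ?nnegrE ?N_ge0 ?addr_ge0//; exact: N1_cube.
Qed.

Lemma hess_W h (A : R) y : 0 <= A -> (forall i j x, `|partial i (partial j h) x| <= A * W x) ->
  hess_bound h y (A * Wcube * W y).
Proof.
move=> A0 hA i j w w1; apply: (le_trans (hA i j (y + w))).
by rewrite -mulrA; apply: ler_wpM2l => //; exact: W_cube.
Qed.

Lemma intg_hW h (A : R) : measurable_fun setT h -> 0 <= A -> (forall x, `|h x| <= A * W x) ->
  intg (lebn n) (fun z => `|h z| * W z).
Proof.
move=> mh A0 hA; apply: (intg_le _ _ (intgZ A (@intg_N1X R n n0))).
  apply: measurable_funM; last exact: continuous_measurable_rV (@continuous_NX R n 1 n.+1 ltr01).
  exact: (measurableT_comp (@normr_measurable R setT) mh).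
move=> z; rewrite ger0_norm; last by nneg.
rewrite -[leRHS]mulr1; apply: ler_pM => //; first exact: NX_ge0.
exact: NX_le1.
Qed.

(** The near part inherits the decay of the Hessian, since [W] varies by a bounded factor on unit
    cubes; the far part is the convolution of [W] with itself. Uniformity in [s] and [h] provides
    majorants. *)
Lemma lapker_W (A : R) : 0 <= A -> exists2 C, 0 <= C & forall h s y, smooth h ->
  (forall x, `|h x| <= A * W x) -> (forall i j x, `|partial i (partial j h) x| <= A * W x) ->
  0 <= s -> `|lapker h s y| <= C * W y.
Proof.
move=> A0; have o0 : 0 <= RI (lebn n) (@omega R n 0) by apply: RI_ge0 => z; exact: omega_ge0.
have k0 := ltW (@kappa_gt0 R n n0).
have c0 := @sdiff_const_ge0 R n.
have w0 : 0 <= Wcube by rewrite /Wcube; nneg.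
exists (@sdiff_const R n * (A * Wcube * RI (lebn n) (@omega R n 0) + (A * @kappa R n +
   2 * (A * (2 ^+ n.+1 * 2 * @kappa R n))))) => [|h s y sh hA dhA s0].
  by nneg.
have mh := continuous_measurable_rV (smooth_continuous sh).
have IhW := intg_hW mh A0 hA.
have M0 : 0 <= A * Wcube * W y by nneg.
have hM := hess_W y A0 dhA.
have [Im Em] := intg_major n0 sh IhW y (A * Wcube * W y).
apply: (le_trans (lapker_bound n0 sh IhW M0 hM s0)); rewrite Em -[leRHS]mulrA; apply: ler_wpM2l => //.
rewrite [leRHS](_ : _ = A * Wcube * W y * RI (lebn n) (@omega R n 0) + (A * W y * @kappa R n +
  2 * (A * (2 ^+ n.+1 * 2 * @kappa R n * W y)))); last by ring.
rewrite lerD2l; apply: lerD; first by apply: ler_wpM2r.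
apply: ler_wpM2l => //.
have [IWW bWW] := intg_WW n0 y.
have [I1 _] := intg_gW y mh IhW.
apply: (@le_trans _ _ (RI (lebn n) (fun z => A * (W (y + z) * W z)))).
  apply: RI_le => //; first exact: intgZ.
  by move=> z; rewrite mulrA; apply: ler_wpM2r; [exact: NX_ge0|exact: hA].
by rewrite RIZ//; apply: ler_wpM2l.
Qed.

(** Symmetry is known for positive regularisation and compact support. The regularisation is removed
    first, with the truncated kernel [h j] fixed, and the truncation afterwards; [lapker_poisson]
    then evaluates the result. *)
Lemma lapker_dual F t : 0 < t -> smooth F -> intg (lebn n) (fun z => `|F z| * W z) ->
  intg (lebn n) (lapker F 0) ->
  RI (lebn n) (fun x => F x * Dk 1 t x) = - (@kappa R n)^-1 * RI (lebn n) (fun x => lapker F 0 x * Dk 0 t x).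
Proof.
move=> t0 sF IF IL; have cF := smooth_continuous sF; have mF := continuous_measurable_rV cF.
have k0 := @kappa_gt0 R n n0.
pose P := @Dk R n 0 t.
have sP : smooth P := homk_smooth t0 (@homk_Dk R n 0 t t0).
have tP : tame W (fun=> P) P.
  pose d := Num.min t 1.
  have d0 : 0 < d by rewrite lt_min t0 ltr01.
  have d1 : d <= 1 by rewrite ge_min lexx orbT.
  have dt : d <= t by rewrite ge_min lexx.
  have [_ _ H] := homk_tame t0 (@homk_Dk R n 0 t t0).
  split=> // s; have [[C C0 HC] L] := H s; split=> //.
  exists (C * d ^- n.+1) => [|k x]; first by have dd := ltW d0; nneg.
  apply: (le_trans (HC k x)); rewrite -mulrA; apply: ler_wpM2l => //.
  by apply: NX_lower => //; rewrite d0.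
pose c j : 'rV[R]_n -> R := chi (cutoff 1 j).
have tc : tame (fun=> 1) c (fun=> 1) := @cutoff_tame R n 1 (lexx 1).
have W0 x : 0 <= W x by exact: NX_ge0.
pose h j x := P x * c j x.
have th : tame W h (fun x => P x * 1) := tameM W0 tP tc.
have E1 : (fun x => P x * 1) = P by apply/funext => x; rewrite mulr1.
rewrite E1 in th.
have [sh _ _] := th.
have ch j : csupp (h j) by apply: csuppMr; exact: cutoff_csupp.
have [A A0 [hA dhA]] : exists2 A, 0 <= A & (forall j x, `|h j x| <= A * W x) /\
    (forall i l j x, `|partial i (partial l (h j)) x| <= A * W x).
  have [_ _ H] := th.
  have [C C0 HC] := (H [::]).1.
  pose D (p : 'I_n * 'I_n) := sval (cid2 (H [:: p.1; p.2]).1).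
  have D0 p : 0 <= D p by rewrite /D; case: cid2.
  have DP p j x : `|partial p.1 (partial p.2 (h j)) x| <= D p * W x.
    by rewrite /D; case: cid2 => C' /= _; exact.
  exists (C + \sum_p D p) => [|]; first by apply: addr_ge0 => //; exact: sumr_ge0.
  split=> [j x|i l j x].
    apply: (le_trans (HC j x)); apply: ler_wpM2r => //; rewrite lerDl; exact: sumr_ge0.
  apply: (le_trans (DP (i, l) j x)); apply: ler_wpM2r => //.
  rewrite (bigD1 (i, l))//= addrCA lerDl addr_ge0//; exact: sumr_ge0.
have [C C0 HC] := lapker_W A0.
have IhW j : intg (lebn n) (fun z => `|h j z| * W z).
  exact: intg_hW (continuous_measurable_rV (smooth_continuous (sh j))) A0 (hA j).
have Lh j y : lapker (h j) (harm k) y @[k --> \oo] --> lapker (h j) 0 y.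
  have M0 : 0 <= A * Wcube * W y by rewrite /Wcube; nneg.
  by have [] := sdiff_cvg n0 (sh j) (IhW j) M0 (hess_W y A0 (fun i l => dhA i l j)).
have LF x : lapker F (harm k) x @[k --> \oo] --> lapker F 0 x.
  by have [M M0 hM] := hess_exists x sF; have [] := sdiff_cvg n0 sF IF M0 hM.
have hk0 k : 0 <= @harm R k := ltW (harm_gt0 k).
have IFC : intg (lebn n) (fun x => C * (`|F x| * W x)) by exact: intgZ.
have key j : RI (lebn n) (fun x => lapker F 0 x * h j x) = RI (lebn n) (fun x => F x * lapker (h j) 0 x).
  have S k := lapker_sym n0 (harm_gt0 k) sF IF (sh j) (ch j).
  have [||||_ L2] := @RI_dct _ _ R (lebn n) (fun k x => F x * lapker (h j) (harm k) x)
    (fun x => F x * lapker (h j) 0 x) (fun x => C * (`|F x| * W x)) => //.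
  - by move=> k; have [_ I2 _] := S k; exact: intg_measurable I2.
  - by move=> x; exact: cvgM (cvg_cst (F x)) (Lh j x).
  - move=> k x; rewrite normrM mulrCA; apply: ler_wpM2l => //.
    exact: HC (sh j) (hA j) (fun i l => dhA i l j) (hk0 k).
  have [r hr] := ch j.
  have [M M0 hM] := @hess_cube R n F r sF.
  (* A continuous bound for the regularised operators on [F]. The Hessian constant [M] is valid only
     on the cube supporting [h j], which is enough after multiplication by [h j]. *)
  pose G x := @sdiff_const R n * (M * RI (lebn n) (@omega R n 0) + (`|F x| * @kappa R n + 
    2 * (2 ^+ n.+1 * N 1 x ^+ n.+1 * RI (lebn n) (fun z => `|F z| * W z)))).
  have GP k x : `|lapker F (harm k) x * h j x| <= `|G x * h j x|.
    have [[i xi]|xr] := pselect (exists i, r < `|x ord0 i|).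
      by rewrite (hr x)// ?mulr0//; exists i.
    have hMx : hess_bound F x M.
      by apply: hM => l; rewrite leNgt; apply/negP => xl; apply: xr; exists l.
    rewrite [leLHS]normrM [leRHS]normrM; apply: ler_wpM2r => //; apply: le_trans (ler_norm _).
    apply: (le_trans (lapker_bound n0 sF IF M0 hMx (hk0 k))).
    have [_ ->] := intg_major n0 sF IF x M.
    apply: ler_wpM2l; first exact: sdiff_const_ge0.
    rewrite lerD2l lerD2l; apply: ler_wpM2l => //.
    have [_ bF] := intg_gW x mF IF; exact: bF.
  have cG : continuous G.
    have cN1 := @continuous_N R n 1.
    have cNk k : continuous (fun x : 'rV[R]_n => N 1 x ^+ k).
      elim: k => [|k ih]; first by under eq_fun do rewrite expr0; exact: cst_continuous.
      by under eq_fun do rewrite exprS; exact: continuousM_fun.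
    have cn : continuous (fun x => `|F x|).
      by move=> x; exact: (@continuous_comp _ _ _ F (fun r : R => `|r|) x (cF x) (@norm_continuous _ R _)).
    apply: continuousM_fun; first exact: cst_continuous.
    apply: continuousD_fun; first exact: cst_continuous.
    apply: continuousD_fun; first exact: continuousM_fun cn (@cst_continuous _ _ _).
    apply: continuousM_fun; first exact: cst_continuous.
    apply: continuousM_fun; last exact: cst_continuous.
    by apply: continuousM_fun => //; exact: cst_continuous.
  have IG : intg (lebn n) (fun x => G x * h j x).
    exact: intg_csupp (continuousM_fun cG (smooth_continuous (sh j))) (csuppMr G (ch j)).
  have [||||_ L1] := @RI_dct _ _ R (lebn n) (fun k x => lapker F (harm k) x * h j x)
    (fun x => lapker F 0 x * h j x) (fun x => `|G x * h j x|) => //.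
  - by move=> k; have [I1 _ _] := S k; exact: intg_measurable I1.
  - by move=> x; exact: cvgM (LF x) (cvg_cst (h j x)).
  - exact: intg_norm.
  apply: cvg_unique L1 _ => //; move: L2; apply: cvg_trans.
  by rewrite (_ : (fun k => RI (lebn n) (fun x => F x * lapker (h j) (harm k) x)) =
    (fun k => RI (lebn n) (fun x => lapker F (harm k) x * h j x)))//; apply/funext => k; have [_ _ ->] := S k.
have hcv x : h j x @[j --> \oo] --> P x := tame_cvg (x := x) th.
(* The truncation is removed on this side by the integrability of [lapker F 0], on the other by the
   uniform bound of [lapker_W]. *)
have [||||_ L3] := @RI_dct _ _ R (lebn n) (fun j x => lapker F 0 x * h j x)
  (fun x => lapker F 0 x * P x) (fun x => A * `|lapker F 0 x|) => //.
- move=> j; apply: measurable_funM; first exact: intg_measurable IL.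
  exact: continuous_measurable_rV (smooth_continuous (sh j)).
- by move=> x; exact: cvgM (cvg_cst (lapker F 0 x)) (hcv x).
- move=> j x; rewrite normrM mulrC; apply: ler_wpM2r => //; apply: (le_trans (hA j x)).
  by rewrite -[leRHS]mulr1; apply: ler_wpM2l => //; exact: NX_le1.
- by apply: intgZ; exact: intg_norm.
have hLcv y : lapker (h j) 0 y @[j --> \oo] --> lapker P 0 y.
  pose M := A * Wcube * W y.
  have M0 : 0 <= M by rewrite /M /Wcube; nneg.
  pose U z := @sdiff_const R n * (M * omega 0 z + (3 * A) * W z).
  have IU : intg (lebn n) U.
    apply: intgZ; apply: intgD; first by apply: intgZ; exact: intg_omega0.
    by apply: intgZ; exact: intg_N1X.
  apply: cvgM; first exact: cvg_cst.
  have [||||_ L] := @RI_dct _ _ R (lebn n) (fun j z => sdiff (h j) y z * N 0 z ^- n.+1)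
    (fun z => sdiff P y z * N 0 z ^- n.+1) U => //.
  - move=> j; apply: intg_measurable (intg_sdiffN n0 (sh j) (IhW j) M0 _ (lexx 0)).
    exact: hess_W A0 (fun i l => dhA i l j).
  - move=> z; apply: cvgM (cvg_cst _).
    exact: cvgB (cvgB (cvgM (cvg_cst (2 : R)) (hcv y)) (hcv (y + z))) (hcv (y - z)).
  - move=> j z; apply: (le_trans (sdiff_le z (sh j) M0 (hess_W y A0 (fun i l => dhA i l j)) (lexx 0))).
    apply: ler_wpM2l; first exact: sdiff_const_ge0.
    rewrite lerD2l; apply: ler_wpM2r => //.
    have hA1 x : `|h j x| <= A.
      by apply: (le_trans (hA j x)); rewrite -[leRHS]mulr1; apply: ler_wpM2l => //; exact: NX_le1.
    have := hA1 y; have := hA1 (y + z); have := hA1 (y - z); lra.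
have [||||_ L4] := @RI_dct _ _ R (lebn n) (fun j x => F x * lapker (h j) 0 x)
  (fun x => F x * lapker P 0 x) (fun x => C * (`|F x| * W x)) => //.
- by move=> j; apply: measurable_funM => //; exact: measurable_lapker0 (sh j) (IhW j).
- by move=> x; exact: cvgM (cvg_cst (F x)) (hLcv x).
- move=> j x; rewrite normrM mulrCA; apply: ler_wpM2l => //.
  exact: HC (sh j) (hA j) (fun i l => dhA i l j) (lexx 0).
have E : RI (lebn n) (fun x => lapker F 0 x * P x) = RI (lebn n) (fun x => F x * lapker P 0 x).
  apply: cvg_unique L3 _ => //; move: L4; apply: cvg_trans.
  rewrite (_ : (fun j => RI (lebn n) (fun x => F x * lapker (h j) 0 x)) =
    (fun j => RI (lebn n) (fun x => lapker F 0 x * h j x)))//.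
  by apply/funext => j; rewrite key.
rewrite E (_ : (fun x => F x * lapker P 0 x) = (fun x => - @kappa R n * (F x * Dk 1 t x))).
  rewrite RIZ; last exact: intg_vDk.
  by rewrite mulrA mulrNN mulVf ?mul1r// gt_eqF.
by apply/funext => x; rewrite lapker_poisson// mulrCA.
Qed.

End principal_value.

(** * The representation of Poisson averages *)

Section representation.
Context {R : realType} {n : nat}.
Hypothesis n0 : (0 < n)%N.
Implicit Types (u v f : 'rV[R]_n -> R) (x z : 'rV[R]_n) (t : R).
Notation W := (fun z : 'rV[R]_n => N 1 z ^- n.+1).

Lemma by_parts_Dk k j t v : 0 < t -> smooth v -> intg (lebn n) (fun z => `|v z| * W z) ->
  intg (lebn n) (fun z => neglap_pow k v z * Dk j t z) ->
  RI (lebn n) (fun z => v z * Dk (j + k.*2) t z) = RI (lebn n) (fun z => neglap_pow k v z * Dk j t z).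
Proof.
move=> t0 sv Iv Iw; have mv := continuous_measurable_rV (smooth_continuous sv).
have cc l : csupp (@chi R n (cutoff 1 l)) by exact: cutoff_csupp.
have W0 z : 0 <= N t z ^- n.+1 :> R by exact: NX_ge0.
have -> : Dk (j + k.*2) t = neglap_pow k (@Dk R n j t) by rewrite (neglap_pow_Dk k j t0).
apply/esym; apply: (neglap_pow_by_parts W0 (@cutoff_tame R n 1 (lexx 1)) cc sv _ _ Iw).
- exact: homk_tame t0 (@homk_Dk R n j t t0).
- exact: (intg_vNX Iv mv t0).
Qed.

Lemma C_half_neq0 : C_half R n != 0.
Proof.
by rewrite /C_half gt_eqF// divr_gt0 ?exprn_gt0 ?pi_gt0// ltr0n fact_gt0.
Qed.

Lemma lapker_shift F x y : lapker (fun z => F (x + z)) 0 y = lapker F 0 (x + y) :> R.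
Proof. by rewrite /lapker; congr (_ * RI _ _); apply/funext => z; rewrite /sdiff !addrA. Qed.

Lemma neglap_n_half_lap u : odd n -> smooth u -> Q_well_defined u ->
  intg (lebn n) (fun z => `|neglap_pow n./2 u z| * W z) /\
  neglap_n u = (fun x => C_half R n * lapker (neglap_pow n./2 u) 0 x).
Proof.
rewrite /Q_well_defined /neglap_n => -> su [Lh pv].
have sF := smooth_neglap_pow n./2 su.
have IF := intg_L_half (smooth_continuous sF) Lh.
by split=> //; apply/funext => x; apply: half_lapE.
Qed.

Lemma intg_neglap_n u : smooth u -> finite_total_Q u -> intg (lebn n) (neglap_n u).
Proof.
move=> su [Qw IQ]; apply: intg_integrable_Rn.
  have [nodd|neven] := boolP (odd n).
    have [IF ->] := neglap_n_half_lap nodd su Qw.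
    apply: measurable_funM; first exact: measurable_cst.
    exact: measurable_lapker0 (smooth_neglap_pow _ su) IF.
  rewrite /neglap_n (negbTE neven).
  exact: continuous_measurable_rV (smooth_continuous (smooth_neglap_pow n./2 su)).
rewrite (_ : neglap_n u = fun x => Qcurv u x * expR (n%:R * u x))//.
apply/funext => x; rewrite /Qcurv mulrAC -expRD addrC subrr expR0 mul1r //.
Qed.

(** The [n] height derivatives are spent two at a time on Laplacians. For even [n] none remains and
    [lam] is 1; for odd [n] the last one becomes the half-Laplacian. The same [lam] serves every
    centre [x]. *)
Lemma representation u : smooth u -> finite_total_Q u ->
  exists lam : R, forall x t, 0 < t -> intg (lebn n) (fun z => `|u (x + z)| * W z) ->
    RI (lebn n) (fun z => u (x + z) * Dk n t z) =
    lam * RI (lebn n) (fun z => neglap_n u (x + z) * Dk 0 t z).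
Proof.
move=> su fQ; have If := intg_neglap_n su fQ; have [Qw _] := fQ.
have IfD x t : 0 < t -> intg (lebn n) (fun z => neglap_n u (x + z) * Dk 0 t z).
  move=> t0; have Ifx := intg_shift x If.
  apply: (intg_le _ _ (intgZ (t * t ^- n.+1) (intg_norm Ifx))).
    by apply: measurable_funM; [exact: intg_measurable Ifx|exact: measurable_Dk].
  move=> z; rewrite normrM mulrC; apply: ler_wpM2r => //.
  rewrite Dk0 ger0_norm; last by have tt := ltW t0; nneg.
  apply: ler_wpM2l; first exact: ltW.
  rewrite lef_pV2 ?posrE ?exprn_gt0 ?N_gt0//; apply: lerXn2r; rewrite ?nnegrE ?N_ge0 ?(ltW t0)//.
  exact: le_t_N.
have [nodd|neven] := boolP (odd n).
  have [IF Ef] := neglap_n_half_lap nodd su Qw.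
  set F := neglap_pow n./2 u in IF Ef.
  have sF : smooth F := smooth_neglap_pow n./2 su.
  have mF := continuous_measurable_rV (smooth_continuous sF).
  exists (- (@kappa R n)^-1 / C_half R n) => x t t0 Iv.
  have sv := smooth_shift x su; have sFx := smooth_shift x sF.
  have IFx := (intg_gW x mF IF).1.
  have mFx := continuous_measurable_rV (smooth_continuous sFx).
  have En : n = (1 + n./2.*2)%N by rewrite -[LHS]odd_double_half nodd.
  have I1 : intg (lebn n) (fun z => neglap_pow n./2 (fun y => u (x + y)) z * Dk 1 t z).
    by rewrite (neglap_pow_shift n./2 x su); exact: intg_vDk.
  have := by_parts_Dk t0 sv Iv I1; rewrite -En => ->.
  rewrite (neglap_pow_shift n./2 x su) -/F.
  have IL : intg (lebn n) (lapker (fun y => F (x + y)) 0).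
    have := intgZ (C_half R n)^-1 (intg_shift x If).
    congr intg; apply/funext => z; rewrite Ef -(lapker_shift F x z).
    by rewrite mulKf// C_half_neq0.
  rewrite (lapker_dual n0 t0 sFx IFx IL).
  rewrite (_ : (fun z => neglap_n u (x + z) * Dk 0 t z) =
    (fun z => C_half R n * (lapker (fun y => F (x + y)) 0 z * Dk 0 t z))); last first.
    by apply/funext => z; rewrite Ef -(lapker_shift F x z) [RHS]mulrA.
  rewrite RIZ; last first.
    have := intgZ (C_half R n)^-1 (IfD x t t0); congr intg; apply/funext => z.
    by rewrite Ef -(lapker_shift F x z) -[C_half R n * _ * _]mulrA mulKf// C_half_neq0.
  by rewrite mulrA -(mulrA (- _)) mulVf ?mulr1// C_half_neq0.
exists 1 => x t t0 Iv; have sv := smooth_shift x su.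
have En : n = (0 + n./2.*2)%N by rewrite add0n -[LHS]odd_double_half (negbTE neven).
have Eu : neglap_pow n./2 (fun y => u (x + y)) = (fun z => neglap_n u (x + z)).
  by rewrite (neglap_pow_shift n./2 x su) /neglap_n (negbTE neven).
have I1 : intg (lebn n) (fun z => neglap_pow n./2 (fun y => u (x + y)) z * Dk 0 t z).
  by rewrite Eu; exact: IfD.
by have := by_parts_Dk t0 sv Iv I1; rewrite -En Eu mul1r.
Qed.

End representation.

(** * Bounds on Poisson averages and potentials *)

Section pointwise.
Context {R : realType} {n : nat}.
Implicit Types (u v f m : 'rV[R]_n -> R) (x y z : 'rV[R]_n) (t e T : R).
Notation W := (fun z : 'rV[R]_n => N 1 z ^- n.+1).

Lemma curv_ineq_shift a b u m x : curv_ineq a b u m ->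
  curv_ineq a b (fun z => u (x + z)) (fun z => m (x + z)).
Proof.
move=> [su Im m0 H]; split; [exact: smooth_shift|exact: intg_shift|by move=> z; exact: m0|] => z.
rewrite (lap_shift x su) /grad_sq.
under eq_bigr do rewrite (partial_shift x _ su).
exact: H.
Qed.

Lemma compact_in_cube (K : set 'rV[R]_n) : compact K ->
  exists r : R, forall x, K x -> forall i, `|x ord0 i| <= r.
Proof.
move=> cK; have cS : {within K, continuous (@sqn R n)}.
  by apply: continuous_subspaceT; exact: continuous_sqn.
have [M [_ HM]] := compact_bounded (continuous_compact cS cK).
have h1 : M < `|M| + 1 by rewrite (le_lt_trans (ler_norm M))// ltrDl.
have HM1 := HM _ h1.
exists (1 + (`|M| + 1)) => x Kx i.
have := HM1 (sqn x) (ex_intro2 _ _ x Kx erefl).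
rewrite /= (ger0_norm (sqn_ge0 x)) => h.
have := coord_sqn x i; rewrite -[x ord0 i ^+ 2]real_normK ?num_real// => h2.
have := sqr_ge0 (`|x ord0 i| - 1); rewrite !expr2; move: h h2; rewrite expr2; have := normr_ge0 (x ord0 i); nra.
Qed.

Lemma curv_of_scalar u (C : R) (K : set 'rV[R]_n) : (3 <= n)%N -> smooth u -> 0 < C ->
  compact K -> (forall x, ~ K x -> C <= scalar_curv u x) ->
  exists m, curv_ineq ((n%:R - 2) / 2) (C / (2 * (n%:R - 1))) u m.
Proof.
move=> n3 su C0 cK H; have [r Hr] := compact_in_cube cK.
pose a : R := (n%:R - 2) / 2; pose b := C / (2 * (n%:R - 1)).
have n3' : 3 <= n%:R :> R by rewrite ler_nat.
have cE : continuous (fun x => a * grad_sq u x + b * expR (2 * u x) + lap u x).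
  apply: continuousD_fun; last exact: smooth_continuous (smooth_lap su).
  apply: continuousD_fun.
    exact: continuousM_fun (@cst_continuous _ _ _) (smooth_continuous (smooth_grad_sq su)).
  exact: continuousM_fun (@cst_continuous _ _ _) (continuous_expR_comp (c := 2) (smooth_continuous su)).
have [M M0 HM] := cube_bounded r cE.
(* A constant on a cube containing [K], large enough to compensate a possible failure of the
   inequality there. *)
exists (fun x => M * \prod_i \1_(`[- r, r]%classic) (x ord0 i)); split=> //.
- by apply: intgZ; exact: intg_cube.
- by move=> x; apply: mulr_ge0 => //; apply: prodr_ge0 => i _; rewrite indicE ler0n.
move=> x; have p0 : 0 <= M * \prod_i (\1_(`[- r, r]%classic) (x ord0 i) : R).
  by apply: mulr_ge0 => //; apply: prodr_ge0 => i _; rewrite indicE ler0n.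
have [Kx|nKx] := pselect (K x).
  rewrite big1 => [|i _]; last first.
    by rewrite indicE mem_set//= in_itv/= -ler_norml; exact: Hr.
  have := le_trans (ler_norm _) (HM x (Hr x Kx)); rewrite -/a -/b mulr1; lra.
have := H x nKx; rewrite /scalar_curv -/a => Cs.
suff : a * grad_sq u x + b * expR (2 * u x) <= - lap u x by move: p0; rewrite -/a -/b; lra.
have d0 : 0 < 2 * (n%:R - 1) :> R by lra.
rewrite -lerBrDl -/(expR _) /b mulrAC ler_pdivrMr// mulrC -ler_pdivlMl ?expR_gt0//.
rewrite -expRN; move: Cs; rewrite -/a.
move: (expR (- (2 * u x))) (lap u x) (grad_sq u x) => E L G; lra.
Qed.

Variables (a b : R) (a0 : 0 < a) (b0 : 0 < b).
Hypothesis n2 : (2 <= n)%N.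
Let n0 : (0 < n)%N := ltnW n2.

Lemma taylor_bound : exists C : R, forall v m T e, curv_ineq a b v m -> 1 <= T -> 0 < e -> e <= T ->
  RI (lebn n) (fun z => v z * taylor n e T z) <=
    @kappa R n * (- ln T + C * (1 + RI (lebn n) m)).
Proof.
have k0 := @kappa_gt0 R n n0.
have [J HJ] := jensen_poisson a0 b0 n2.
pose D j := sval (cid2 (middle_terms a0 b0 n2 j)).
have D0 j : 0 <= D j by rewrite /D; case: cid2.
have HD j v m T : curv_ineq a b v m -> 1 <= T ->
    `|T ^+ j.+1 * RI (lebn n) (fun x => v x * Dk j.+1 T x)| <= D j * (1 + RI (lebn n) m).
  by rewrite /D; case: cid2 => C _ /= H; exact: H.
have [p np] : exists p, n = p.+1 by exists n.-1; rewrite prednK.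
exists (2^-1 + `|J| + (@kappa R n)^-1 * \sum_(j < p) D j) => v m T e H T1 e0 eT.
have T0 : 0 < T := lt_le_trans ltr01 T1.
have [sv Im m0 _] := H; have mv := continuous_measurable_rV (smooth_continuous sv).
have Iv := growth a0 b0 n2 H.
have M0 : 0 <= RI (lebn n) m by apply: RI_ge0.
have E : RI (lebn n) (fun z => v z * taylor n e T z) =
    \sum_(j < n) ((-1) ^+ j * ((T - e) ^+ j / j`!%:R)) * RI (lebn n) (fun z => v z * Dk j T z).
  rewrite (_ : (fun z => v z * taylor n e T z) =
    (fun z => \sum_(j < n) ((-1) ^+ j * ((T - e) ^+ j / j`!%:R)) * (v z * Dk j T z))); last first.
    by apply/funext => z; rewrite /taylor mulr_sumr; apply: eq_bigr => j _; rewrite mulrCA.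
  rewrite RI_sum => [|j]; last by apply: intgZ; exact: intg_vDk.
  by apply: eq_bigr => j _; rewrite RIZ//; exact: intg_vDk.
pose g j := ((-1) ^+ j * ((T - e) ^+ j / j`!%:R)) * RI (lebn n) (fun z => v z * Dk j T z).
have Eg : RI (lebn n) (fun z => v z * taylor n e T z) = \sum_(j < p.+1) g j.
  by rewrite E -(big_mkord xpredT g) [in LHS](_ : n = p.+1)// big_mkord.
rewrite Eg big_ord_recl.
have t1 : g 0%N <= @kappa R n * (- ln T + 2^-1 * ln (1 + RI (lebn n) m) + J).
  by rewrite /g !expr0 fact0 divr1 !mul1r; exact: HJ.
have t2 : \sum_(j < p) g (lift ord0 j) <= (\sum_(j < p) D j) * (1 + RI (lebn n) m).
  rewrite mulr_suml; apply: ler_sum => j _; apply: (le_trans (ler_norm _)).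
  apply: le_trans (HD j v m T H T1).
  rewrite /g !normrM normrX normrN1 expr1n mul1r; apply: ler_wpM2r => //.
  have eT0 : 0 <= T - e by rewrite subr_ge0.
  rewrite !normrX normfV (@ger0_norm _ _`!%:R)// ler_pdivrMr ?ltr0n ?fact_gt0//.
  rewrite (ger0_norm eT0) (ger0_norm (ltW T0)) lift0.
  apply: (@le_trans _ _ (T ^+ j.+1)).
    by apply: lerXn2r; rewrite ?nnegrE ?(ltW T0)// gerBl ltW.
  by apply: ler_peMr; [have tt := ltW T0; nneg|rewrite ler1n fact_gt0].
have ln1 : ln (1 + RI (lebn n) m) <= 1 + RI (lebn n) m.
  have p1 : 0 < 1 + RI (lebn n) m by lra.
  have := @le_ln1Dx R (RI (lebn n) m); rewrite (lt_le_trans _ M0)// => h; have := h isT; lra.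
have Jn := ler_norm J; have Jp : `|J| <= `|J| * (1 + RI (lebn n) m) by apply: ler_peMr => //; lra.
set S := \sum_(j < p) D j in t2 *.
rewrite [leRHS](_ : _ = @kappa R n * (- ln T + (2^-1 + `|J|) * (1 + RI (lebn n) m)) + S * (1 + RI (lebn n) m)); last first.
  by field; rewrite gt_eqF.
apply: lerD t2; apply: (le_trans t1); apply: ler_wpM2l; first exact: ltW.
move: ln1 Jn Jp; rewrite mulrDl; lra.
Qed.

End pointwise.

(** * Exponentials of logarithmic potentials *)

Section potential.
Context {R : realType} {n : nat}.
Hypothesis n2 : (2 <= n)%N.
Let n0 : (0 < n)%N := ltnW n2.
Implicit Types (f g h w : 'rV[R]_n -> R) (x y z : 'rV[R]_n) (t e T : R).

(* Jensen's inequality for a measure of mass at most 1, the missing mass being put at [h = 0]. *)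
Lemma expR_RI_le w h : (forall z, 0 <= w z) -> intg (lebn n) w -> RI (lebn n) w <= 1 ->
  (forall z, 0 <= h z) -> intg (lebn n) (fun z => w z * h z) ->
  intg (lebn n) (fun z => w z * expR (h z)) ->
  expR (RI (lebn n) (fun z => w z * h z)) <= 1 + RI (lebn n) (fun z => w z * expR (h z)).
Proof.
move=> w0 Iw w1 h0 Iwh Iwe; set s := RI _ _.
have s0 : 0 <= s by apply: RI_ge0 => z; exact: mulr_ge0.
have tangent r : expR s * (1 + r - s) <= expR r.
  have -> : expR r = expR s * expR (r - s) by rewrite -expRD addrC subrK.
  apply: ler_wpM2l; first exact: expR_ge0.
  by have := @expR_ge1Dx R (r - s); lra.
have h1 : expR s * (1 - s) * RI (lebn n) w + expR s * s <= RI (lebn n) (fun z => w z * expR (h z)).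
  have I1 := intgZ (expR s * (1 - s)) Iw; have I2 := intgZ (expR s) Iwh.
  rewrite -RIZ// -[X in _ + X](RIZ (expR s) Iwh) -RID//; apply: RI_le => //; first exact: intgD.
  move=> z; have := ler_wpM2l (w0 z) (tangent (h z)); lra.
have h2 := tangent 0; rewrite expR0 addr0 in h2.
have h3 := ler_wpM2l (_ : 0 <= 1 - RI (lebn n) w) h2; rewrite subr_ge0 in h3.
have := h3 w1; have w00 : 0 <= RI (lebn n) w by apply: RI_ge0.
move: h1; move: (RI (lebn n) w) w00 (expR s) => q q0 E h1.
lra.
Qed.

(** Where [N e z <= 1], the exponent [n - 1 >= 1] gives [N^(-1) <= N^(1-n)], and [N 1 z ^+ 2 <= 2]
    costs the factor 2. *)
Lemma invN_le e z : 0 < e -> (N e z)^-1 <= 1 + 2 * riesz e z.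
Proof.
move=> e0; have Np := N_gt0 z e0; have r0 := riesz_ge0 e z.
have [h|h] := leP 1 (N e z); first by have : (N e z)^-1 <= 1 by [rewrite invf_le1]; lra.
suff : (N e z)^-1 <= 2 * riesz e z by lra.
have q1 : 1 <= (N e z)^-1 by rewrite invf_ge1// ltW.
have sz : sqn z <= 1.
  have : N e z ^+ 2 <= 1 by rewrite exprn_ile1 ?N_ge0// ltW.
  by rewrite sqr_N; have := sqr_ge0 e; lra.
apply: (@le_trans _ _ (N e z ^- n.-1)).
  by rewrite -exprVn -[leLHS]expr1 ler_weXn2l//; case: n n2 => [|[]].
rewrite /riesz [leRHS](_ : _ = N e z ^- n.-1 * (2 * N 1 z ^- 2)); last by ring.
apply: ler_peMr; first exact: NX_ge0.
by rewrite ler_pdivlMr ?exprn_gt0 ?N_gt0// mul1r sqr_N expr1n; lra.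
Qed.

Lemma measurable_invN e : 0 < e -> measurable_fun setT (fun z : 'rV[R]_n => (N e z)^-1).
Proof.
by move=> e0; have := continuous_measurable_rV (@continuous_NX R n e 1 e0).
Qed.

Lemma invN_le_cst e z : 0 < e -> 0 <= (N e z)^-1 <= e^-1.
Proof.
move=> e0; rewrite invr_ge0 N_ge0/= lef_pV2 ?posrE ?N_gt0//; exact: le_t_N.
Qed.

Lemma lnN_le_rho e T z : 0 < e -> 1 <= T -> ln (N T z) - ln (N e z) <= ln T + ln (1 + (N e z)^-1).
Proof.
move=> e0 T1; have T0 : 0 < T := lt_le_trans ltr01 T1.
have Np := N_gt0 z e0; have NT := N_gt0 z T0.
have p1 : 0 < 1 + (N e z)^-1 by rewrite addr_gt0// invr_gt0.
rewrite lerBlDl -!lnM ?posrE ?mulr_gt0// ler_ln ?posrE ?mulr_gt0//.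
rewrite [leRHS](_ : _ = T * N e z + T); last by field; rewrite gt_eqF.
have q0 : 0 <= T * N e z + T by apply: addr_ge0; [apply: mulr_ge0|]; exact: ltW.
rewrite -(@ler_sqr R) ?nnegrE ?N_ge0// sqr_N.
have h1 : N e z <= T * N e z by apply: ler_peMl => //; exact: ltW.
have h2 : sqn z <= N e z ^+ 2 by rewrite sqr_N lerDr sqr_ge0.
have h3 : N e z ^+ 2 <= (T * N e z) ^+ 2 by apply: lerXn2r; rewrite ?nnegrE ?mulr_ge0 ?N_ge0// ltW.
have h4 : 0 <= T * N e z * T by apply: mulr_ge0; [apply: mulr_ge0|]; exact: ltW.
move: h2 h3; rewrite !expr2; move: (T * N e z) h4 (N e z * N e z) => X h4 Y h2 h3.
have : 0 <= X * T + X * T + X * X - Y by lra.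
lra.
Qed.

(** By Fubini the integral in [x] comes first. The weight is integrable and at most 1, and [invN_le]
    with [riesz_mass] bounds its integral against [1/N] by a constant independent of the centre and
    of [e]; the mass of [w] is at most 1. *)
Lemma potential_mass (eta : R) : 0 < eta -> exists2 C, 0 <= C & forall w e,
  (forall z, 0 <= w z) -> intg (lebn n) w -> RI (lebn n) w <= 1 -> 0 < e <= 1 ->
  intg (lebn n) (fun x => N 1 x `^ (- (n%:R + eta)) * RI (lebn n) (fun z => w (x + z) * (N e z)^-1)) /\
  RI (lebn n) (fun x => N 1 x `^ (- (n%:R + eta)) * RI (lebn n) (fun z => w (x + z) * (N e z)^-1)) <= C.
Proof.
move=> eta0; pose P x := N 1 x `^ (- (n%:R + eta)) : R.
have IP : intg (lebn n) P := intg_powN eta0 n0.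
have P0 x : 0 <= P x by exact: powR_ge0.
have P1 x : P x <= 1.
  rewrite /P [leRHS](_ : 1 = N 1 x `^ 0); last by rewrite powRr0.
  by rewrite ler_powR ?N_ge1// oppr_le0 addr_ge0// ltW.
have [D D0 HD] := @riesz_mass R n n0.
exists (RI (lebn n) P + 2 * D) => [|w e w0 Iw w1 e01].
  by apply: addr_ge0; [exact: RI_ge0|nneg].
have /andP[e0 e1] := e01; have [ID ED] := HD e e01.
have mw := intg_measurable Iw; have mP := intg_measurable IP.
have iN z := invN_le_cst z e0.
pose G x y := P x * (w y * (N e (y - x))^-1).
have mG : measurable_fun setT (fun p : 'rV[R]_n * 'rV[R]_n => G p.1 p.2).
  have m1 : measurable_fun setT (fun p : 'rV[R]_n * 'rV[R]_n => p.2 - p.1).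
    apply/measurable_fun_rVP => i.
    rewrite (_ : (fun p => _) = (fun p : 'rV[R]_n * 'rV[R]_n => p.2 ord0 i - p.1 ord0 i)); last first.
      by apply/funext => p; rewrite !mxE.
    apply: measurable_funB.
      exact: (measurableT_comp (@measurable_coord R n i) measurable_snd).
    exact: (measurableT_comp (@measurable_coord R n i) measurable_fst).
  apply: measurable_funM; first exact: (measurableT_comp mP measurable_fst).
  apply: measurable_funM; first exact: (measurableT_comp mw measurable_snd).
  exact: (measurableT_comp (measurable_invN e0) m1).
have mNx x : measurable_fun setT (fun y : 'rV[R]_n => (N e (y - x))^-1).
  have ms : measurable_fun setT (fun y : 'rV[R]_n => y - x).
    have := @measurable_affine R n 1 (- x); congr measurable_fun.
    by apply/funext => z; rewrite scale1r.
  exact: (measurableT_comp (measurable_invN e0) ms).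
have mNy y : measurable_fun setT (fun x : 'rV[R]_n => (N e (y - x))^-1).
  have ms : measurable_fun setT (fun x : 'rV[R]_n => y - x).
    have := @measurable_affine R n (-1) y; congr measurable_fun.
    by apply/funext => z; rewrite scaleN1r addrC.
  exact: (measurableT_comp (measurable_invN e0) ms).
have Iwx x : intg (lebn n) (fun y => w y * (N e (y - x))^-1).
  apply: (intg_le _ _ (intgZ e^-1 Iw)); first exact: measurable_funM.
  move=> y; have /andP[h0 h1] := iN (y - x); rewrite ger0_norm ?mulr_ge0// mulrC.
  exact: ler_wpM2r.
have IPy y : intg (lebn n) (fun x => P x * (N e (y - x))^-1).
  apply: (intg_le _ _ (intgZ e^-1 IP)); first exact: measurable_funM.
  move=> x; have /andP[h0 h1] := iN (y - x); rewrite ger0_norm ?mulr_ge0// mulrC.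
  exact: ler_wpM2r.
have IG1 x : intg (lebn n) (G x) by exact: intgZ.
have EG2 y : G^~ y = (fun x => w y * (P x * (N e (y - x))^-1)) by apply/funext => x; rewrite /G mulrCA.
have IG2 y : intg (lebn n) (G^~ y) by rewrite EG2; exact: intgZ.
have I2 : intg2 (lebn n) (lebn n) G.
  apply: (intg2_le mG (intgZ (e^-1 * RI (lebn n) w) IP) IG1) => x.
  rewrite (_ : (fun y => `|G x y|) = G x); last first.
    apply/funext => y; have /andP[h0 _] := iN (y - x); rewrite ger0_norm// /G.
    by apply: mulr_ge0 => //; exact: mulr_ge0.
  rewrite /G (RIZ (P x) (Iwx x)) mulrC; apply: ler_wpM2r => //.
  rewrite -RIZ//; apply: RI_le => //; first exact: intgZ.
  by move=> y; have /andP[h0 h1] := iN (y - x); rewrite mulrC; exact: ler_wpM2r.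
have E1 : (fun x => RI (lebn n) (G x)) = (fun x => P x * RI (lebn n) (fun z => w (x + z) * (N e z)^-1)).
  apply/funext => x; rewrite /G (RIZ (P x) (Iwx x)); congr (_ * _).
  rewrite -(RI_shift x (Iwx x)); congr RI; apply/funext => z.
  by rewrite addrAC subrr add0r.
have [J1 J2 E] := RI_fubini_eq I2 IG1 IG2 E1 (erefl _).
split; [exact: J1|rewrite E].
have inner y : RI (lebn n) (fun x => P x * (N e (y - x))^-1) <= RI (lebn n) P + 2 * D.
  have Ir := intg_reflect y ID; have Er := RI_reflect y ID.
  apply: (@le_trans _ _ (RI (lebn n) (fun x => P x + 2 * riesz e (y - x)))).
    apply: RI_le => //; first by apply: intgD => //; exact: intgZ.
    move=> x; have h := invN_le (y - x) e0; have /andP[h0 _] := iN (y - x).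
    apply: (le_trans (ler_wpM2l (P0 x) h)); rewrite mulrDr mulr1 lerD2l.
    by apply: ler_piMl; [apply: mulr_ge0 => //; exact: riesz_ge0|exact: P1].
  rewrite RID//; last exact: intgZ.
  by rewrite RIZ// Er lerD2l; apply: ler_wpM2l.
apply: (@le_trans _ _ (RI (lebn n) (fun y => (RI (lebn n) P + 2 * D) * w y))).
  apply: RI_le => //; first exact: intgZ.
  by move=> y; rewrite EG2 (RIZ (w y) (IPy y)) mulrC; apply: ler_wpM2r.
rewrite RIZ//; apply: ler_piMr => //; apply: addr_ge0; [exact: RI_ge0|nneg].
Qed.

End potential.

(** * Volume growth *)

Section volume.
Context {R : realType} {n : nat}.
Implicit Types (u v f m : 'rV[R]_n -> R) (x y z : 'rV[R]_n).

Definition cubeI (r : R) x : R := \prod_i \1_(`[- r, r]%classic) (x ord0 i).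

Lemma cubeI_in r x : (forall i, `|x ord0 i| <= r) -> cubeI r x = 1.
Proof.
by move=> h; rewrite /cubeI big1// => i _; rewrite indicE mem_set//= in_itv/= -ler_norml; exact: h.
Qed.

Lemma cubeI_out r x : ~ (forall i, `|x ord0 i| <= r) -> cubeI r x = 0.
Proof.
move=> /existsNP[i xi]; rewrite /cubeI (bigD1 i)//= indicE memNset ?mul0r//=.
by rewrite in_itv/= -ler_norml.
Qed.

Lemma cubeI01 r x : 0 <= cubeI r x <= 1.
Proof.
have [h|h] := pselect (forall i, `|x ord0 i| <= r); last by rewrite cubeI_out// lexx ler01.
by rewrite cubeI_in// lexx ler01.
Qed.

Lemma RI_cubeI (r : R) : 0 <= r -> RI (lebn n) (cubeI r) = (2 * r) ^+ n.
Proof.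
move=> r0; pose I := fun t : R => \1_(`[- r, r]%classic) t : R.
have Ii : intg (@lebesgue_measure R) I by apply/integrable_indic_itv.
have I0 t : 0 <= I t by rewrite /I indicE ler0n.
have RI1 : RI (@lebesgue_measure R) I = 2 * r.
  apply: EFin_inj; rewrite RI_EFin// /I integral_indic//= setIT lebesgue_measure_itv/= lte_fin.
  case: ifPn => [h|]; first by rewrite -EFinD; congr EFin; lra.
  by rewrite -leNgt => h; congr EFin; lra.
by apply: EFin_inj; rewrite RI_EFin ?integral_tensor ?RI1//; exact: intg_cube.
Qed.

Lemma measurable_cubeI r : measurable_fun setT (cubeI r).
Proof. exact: intg_measurable (@intg_cube R n r). Qed.

Lemma sqn_cube (r : R) x : 0 <= r -> (forall i, `|x ord0 i| <= r) -> sqn x <= n%:R * r ^+ 2.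
Proof.
move=> r0 h; rewrite /sqn mulr_natl -[n in X in _ <= X]card_ord -sumr_const; apply: ler_sum => i _.
by rewrite -[leLHS]real_normK ?num_real//; apply: lerXn2r; rewrite ?nnegrE.
Qed.

Lemma tail_small f (eta : R) : intg (lebn n) f -> 0 < eta -> exists2 r : R, 0 <= r &
  RI (lebn n) (fun z => `|f z| * (1 - cubeI r z)) <= eta.
Proof.
move=> If eta0; have mf := intg_measurable If.
have [||||_ L] := @RI_dct _ _ R (lebn n) (fun k z => `|f z| * (1 - cubeI k%:R z)) (fun=> 0) (fun z => `|f z|).
- move=> k; apply: measurable_funM; first exact: (measurableT_comp (@normr_measurable R setT) mf).
  by apply: measurable_funB => //; exact: measurable_cubeI.
- move=> z; apply: cvg_near_cst.
  have : \forall k \near \oo, enorm z <= k%:R by exact: nbhs_infty_ger.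
  apply: filterS => k h; rewrite cubeI_in ?subrr ?mulr0// => i.
  exact: le_trans (coord_enorm z i) h.
- move=> k z; have /andP[h0 h1] := cubeI01 k%:R z.
  by rewrite normrM normr_id; apply: ler_piMr => //; rewrite ger0_norm; lra.
- exact: intg_norm.
rewrite (_ : RI (lebn n) (fun=> 0) = 0) in L; last exact: RI_eq0.
have [k hk] := filter_ex (cvgr_lt 0 L eta eta0).
by exists k%:R => //; exact: ltW.
Qed.

Variables (a b : R) (a0 : 0 < a) (b0 : 0 < b).
Hypothesis n2 : (2 <= n)%N.
Let n0 : (0 < n)%N := ltnW n2.
Notation W := (fun z : 'rV[R]_n => N 1 z ^- n.+1).

(** If [x + z] stays in a fixed cube and [x] is far, then [N 1 x <= 2 |z|]; hence with [T = N 1 x]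
    the ratio of the two lengths is below 3. *)
Lemma log_ratio_near (rho e : R) x z : 0 <= rho -> 0 < e -> 2 + 4 * n%:R * rho ^+ 2 <= N 1 x ^+ 2 ->
  (forall i, `|(x + z) ord0 i| <= rho) -> ln (N (N 1 x) z) - ln (N e z) <= ln 3.
Proof.
move=> rho0 e0 far h; have T0 : 0 < N 1 x by exact: N_gt0.
have NT := N_gt0 z T0; have Ne := N_gt0 z e0.
rewrite lerBlDr -lnM ?posrE// ler_ln ?posrE ?mulr_gt0//.
rewrite -(@ler_sqr R) ?nnegrE ?mulr_ge0 ?N_ge0// exprMn !sqr_N.
have h1 := sqn_cube rho0 h.
have := sqnD (x + z) (- z); rewrite addrK.
have -> : sqn (- z) = sqn z by rewrite /sqn; apply: eq_bigr => i _; rewrite mxE sqrrN.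
move: far; rewrite !sqr_N expr1n (_ : 3 ^+ 2 = 9 :> R); last by rewrite expr2 -natrM.
rewrite -[4 * _ * _]mulrA; have := sqr_ge0 e; have := sqn_ge0 z; move: h1; move: (n%:R * rho ^+ 2) => X; lra.
Qed.

Section one_metric.
Variables (u m : 'rV[R]_n -> R).
Hypotheses (Hc : curv_ineq a b u m) (fQ : finite_total_Q u).
Let su : smooth u. Proof. by have [] := Hc. Qed.
Let cu := smooth_continuous su.
Notation f := (neglap_n u).

(** The upper height is [T = N 1 x]. In the Taylor comparison the bulk of [f] then costs a constant,
    while the tail [w] costs [ln T] times its mass, which spoils the exponent [- n] by [eta] only,
    plus a local potential. *)
Lemma pointwise_bound (eta : R) : 0 < eta -> exists w : 'rV[R]_n -> R, exists C rho : R,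
  [/\ forall z, 0 <= w z, intg (lebn n) w, RI (lebn n) w <= eta, 0 <= C &
   forall x e, rho <= N 1 x ^+ 2 -> 0 < e <= 1 ->
     expR (n%:R / @kappa R n * RI (lebn n) (fun z => u (x + z) * Dk 0 e z)) <=
     C * (N 1 x `^ (eta - n%:R) * expR (RI (lebn n) (fun z => w (x + z) * ln (1 + (N e z)^-1))))].
Proof.
move=> eta0; have If := intg_neglap_n n0 su fQ; have mf := intg_measurable If.
have [lam Hlam] := representation n0 su fQ.
have [Ct HCt] := taylor_bound a0 b0 n2.
have k0 := @kappa_gt0 R n n0.
pose L := n%:R / @kappa R n * `|lam|.
have L0 : 0 <= L by apply: mulr_ge0 => //; apply: divr_ge0 => //; exact: ltW.
(* The tail of [f] is multiplied by [L] in [w]; dividing by [L + 1] keeps the mass below [eta] even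
   when [L] is 0. *)
have [r r0 Hr] := @tail_small f (eta / (L + 1)) If (divr_gt0 eta0 (ltr_pwDr ltr01 L0)).
pose w z := L * (`|f z| * (1 - cubeI r z)).
have c01 z : 0 <= 1 - cubeI r z <= 1 by have /andP[h0 h1] := cubeI01 r z; apply/andP; split; lra.
have w0 z : 0 <= w z by have /andP[h0 _] := c01 z; apply: mulr_ge0 => //; exact: mulr_ge0.
have Iw0 : intg (lebn n) (fun z => `|f z| * (1 - cubeI r z)).
  apply: (intg_le _ _ (intg_norm If)).
    apply: measurable_funM; first exact: (measurableT_comp (@normr_measurable R setT) mf).
    by apply: measurable_funB => //; exact: measurable_cubeI.
  by move=> z; have /andP[h0 h1] := c01 z; rewrite normrM normr_id ger0_norm//; exact: ler_piMr.
have Iw : intg (lebn n) w by exact: intgZ.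
have Rw : RI (lebn n) w <= eta.
  rewrite RIZ//; apply: (le_trans (ler_wpM2l L0 Hr)).
  rewrite mulrCA -[leRHS]mulr1; apply: ler_wpM2l; first exact: ltW.
  by rewrite ler_pdivrMr ?ltr_pwDr// mul1r lerDl.
pose F := RI (lebn n) (fun z => `|f z|).
pose M := RI (lebn n) m.
exists w, (expR (n%:R * (Ct * (1 + M)) + L * (ln 3 * F))), (2 + 4 * n%:R * r ^+ 2); split=> //.
move=> x e far /andP[e0 e1].
pose T := N 1 x; have T1 : 1 <= T := N_ge1 x; have T0 : 0 < T := lt_le_trans ltr01 T1.
have eT : e <= T := le_trans e1 T1.
have Hx := curv_ineq_shift x Hc.
have Iv := growth a0 b0 n2 Hx.
have mv : measurable_fun setT (fun z => u (x + z)).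
  exact: continuous_measurable_rV (continuous_shift (x := x) cu).
have Ifx := intg_shift x If.
have cmp := taylor_compare n0 Iv mv Ifx (fun t t0 => Hlam x t t0 Iv) e0 eT.
have tb := HCt _ _ T e Hx T1 e0 eT.
have EM : RI (lebn n) (fun z => m (x + z)) = M by rewrite RI_shift//; have [] := Hc.
rewrite EM in tb.
pose D z := ln (N T z) - ln (N e z).
have ID : intg (lebn n) (fun z => `|f (x + z)| * D z) by exact: intg_lnN.
have Iwx := intg_shift x Iw.
have h0 z : 0 <= ln (1 + (N e z)^-1) by apply: ln_ge0; rewrite lerDl invr_ge0 N_ge0.
have he z : ln (1 + (N e z)^-1) <= e^-1.
  have /andP[i0 i1] := invN_le_cst z e0.
  apply: le_trans i1; apply: le_ln1Dx; by apply: lt_le_trans i0; rewrite ltrN10.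
have mh : measurable_fun setT (fun z : 'rV[R]_n => ln (1 + (N e z)^-1)).
  apply: measurableT_comp; first exact: measurable_ln.
  by apply: measurable_funD => //; exact: measurable_invN.
have Iwh : intg (lebn n) (fun z => w (x + z) * ln (1 + (N e z)^-1)).
  apply: (intg_le _ _ (intgZ e^-1 Iwx)).
    by apply: measurable_funM => //; exact: intg_measurable Iwx.
  move=> z; rewrite (ger0_norm (mulr_ge0 (w0 _) (h0 z))) [leRHS]mulrC.
  exact: ler_wpM2l (w0 _) _ _ (he z).
have Ifn : intg (lebn n) (fun z => `|f (x + z)|) by exact: intg_norm.
have lnT0 : 0 <= ln T by exact: ln_ge0.
have bnd : L * RI (lebn n) (fun z => `|f (x + z)| * D z) <=
    L * (ln 3 * F) + (eta * ln T + RI (lebn n) (fun z => w (x + z) * ln (1 + (N e z)^-1))).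
  have EF : RI (lebn n) (fun z => `|f (x + z)|) = F.
    by rewrite (RI_shift x (f := fun z => `|f z|))//; exact: intg_norm.
  apply: (@le_trans _ _ (RI (lebn n) (fun z => L * (ln 3 * `|f (x + z)|) +
     (ln T * w (x + z) + w (x + z) * ln (1 + (N e z)^-1))))).
    rewrite -RIZ//; apply: RI_le.
    - exact: intgZ.
    - by apply: intgD; [do 2 apply: intgZ|apply: intgD => //; exact: intgZ].
    move=> z; have fz := normr_ge0 (f (x + z)).
    have l3 : 0 <= ln 3 :> R by apply: ln_ge0; rewrite ler1n.
    have p1 : 0 <= L * (ln 3 * `|f (x + z)|) by apply: mulr_ge0 => //; exact: mulr_ge0.
    have p2 : 0 <= ln T * w (x + z) by exact: mulr_ge0.
    have p3 : 0 <= w (x + z) * ln (1 + (N e z)^-1) by exact: mulr_ge0.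
    have [hc|hc] := pselect (forall i, `|(x + z) ord0 i| <= r).
      have := log_ratio_near r0 e0 far hc => hD.
      have : L * (`|f (x + z)| * D z) <= L * (ln 3 * `|f (x + z)|).
        by apply: ler_wpM2l => //; rewrite mulrC; exact: ler_wpM2r.
      lra.
    have hD := lnN_le_rho z e0 T1.
    have wE : w (x + z) = L * `|f (x + z)| by rewrite /w cubeI_out// subr0 mulr1.
    have : L * `|f (x + z)| * D z <= L * `|f (x + z)| * (ln T + ln (1 + (N e z)^-1)).
      by apply: ler_wpM2l => //; exact: mulr_ge0.
    rewrite -wE (mulrDr (w (x + z)) (ln T) (ln (1 + (N e z)^-1))) (mulrA L `|f (x + z)| (D z)) -wE (mulrC (w (x + z)) (ln T)).
    by move: p1; move: (L * (ln 3 * _)) (ln T * _) (_ * ln (1 + _)) (_ * D z) => q1 q2 q3 q4; lra.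
  rewrite RID; [|by do 2 apply: intgZ|by apply: intgD => //; exact: intgZ].
  rewrite RID//; last exact: intgZ.
  rewrite (RIZ L (intgZ (ln 3) Ifn)) (RIZ (ln 3) Ifn) EF (RIZ (ln T) Iwx) (RI_shift x Iw).
  by rewrite lerD2l lerD2r mulrC; apply: ler_wpM2r.
have nk0 : 0 < n%:R / @kappa R n by rewrite divr_gt0// ltr0n.
have main : n%:R / @kappa R n * RI (lebn n) (fun z => u (x + z) * Dk 0 e z) <=
   (n%:R * (Ct * (1 + M)) + L * (ln 3 * F)) + ((eta - n%:R) * ln T +
      RI (lebn n) (fun z => w (x + z) * ln (1 + (N e z)^-1))).
  have h1 := ler_wpM2l (ltW nk0) (le_trans cmp (lerD tb (lexx _))).
  apply: (le_trans h1); rewrite mulrDr.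
  have -> : n%:R / @kappa R n * (@kappa R n * (- ln T + Ct * (1 + M))) = n%:R * (- ln T + Ct * (1 + M)).
    by field; rewrite gt_eqF.
  rewrite [X in _ + X <= _](mulrA (n%:R / @kappa R n) `|lam|) -/L; move: bnd; rewrite /D.
  move: (RI (lebn n) (fun z => w (x + z) * _)) (L * RI _ _) (L * (ln 3 * F)) => q1 q2 q3 hq.
  by move: (n%:R : R) hq => q4; lra.
rewrite -ler_expR in main; apply: (le_trans main).
rewrite expRD; apply: ler_wpM2l; first exact: expR_ge0.
by rewrite expRD /powR gt_eqF.
Qed.

Definition ballV (r : R) x : R := if enorm x < r then expR (n%:R * u x) else 0.

Lemma measurable_ball (r : R) (g : 'rV[R]_n -> R) : measurable_fun setT g ->
  measurable_fun setT (fun x => if enorm x < r then g x else 0).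
Proof.
move=> mg; apply: measurable_fun_if => //.
  by apply: measurable_fun_ltr => //; exact: continuous_measurable_rV (@continuous_enorm R n).
exact: measurable_funTS.
Qed.

(** The condition [eta <= 1] bounds the mass of [w] by 1, so that Jensen's inequality makes the
    exponential of its potential at most [2 + Phi k], whose integral against [P] is bounded
    uniformly in [k]. *)
Lemma volume_growth (eta : R) : 0 < eta -> eta <= 1 -> exists2 D, 0 < D & forall r, 0 < r ->
  intg (lebn n) (ballV r) /\ RI (lebn n) (ballV r) <= D * (1 + r) `^ (2 * eta).
Proof.
move=> eta0 eta1; have k0 := @kappa_gt0 R n n0.
have [w [C [rho [w0 Iw Rw C0 HC]]]] := pointwise_bound eta0.
have Rw1 : RI (lebn n) w <= 1 := le_trans Rw eta1.
pose P x := N 1 x `^ (- (n%:R + eta)) : R.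
have IP : intg (lebn n) P := intg_powN eta0 n0.
have P0 x : 0 <= P x by exact: powR_ge0.
have [E E0 HE] := potential_mass n2 eta0.
pose Phi k x := RI (lebn n) (fun z => w (x + z) * (N (harm k) z)^-1).
(* Jensen's inequality with [expR (ln (1 + 1/N)) = 1 + 1/N] gives 1, plus the mass of [w], plus
   [Phi k x]; the first two together are at most 2. *)
pose H k x := P x * 2 + P x * Phi k x.
have e01 k := @harm01 R k; have e0 k := @harm_gt0 R k.
have IPhi k : intg (lebn n) (fun x => P x * Phi k x) := (HE w _ w0 Iw Rw1 (e01 k)).1.
have IP2 : intg (lebn n) (fun x => P x * 2).
  by have := intgZ 2 IP; congr intg; apply/funext => x; rewrite mulrC.
have IH k : intg (lebn n) (H k) by exact: intgD.
have RH k : RI (lebn n) (H k) <= 2 * RI (lebn n) P + E.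
  rewrite RID//; apply: lerD; last exact: (HE w _ w0 Iw Rw1 (e01 k)).2.
  by rewrite -RIZ// le_eqVlt; apply/orP; left; apply/eqP; congr RI; apply/funext => x; rewrite mulrC.
have Phi0 k x : 0 <= Phi k x.
  by apply: RI_ge0 => z; apply: mulr_ge0 => //; rewrite invr_ge0 N_ge0.
have H0 k x : 0 <= H k x by rewrite /H; apply: addr_ge0; apply: mulr_ge0.
pose U k x := n%:R / @kappa R n * RI (lebn n) (fun z => u (x + z) * Dk 0 (harm k) z).
have Ub k x : rho <= N 1 x ^+ 2 -> expR (U k x) <= C * N 1 x `^ (2 * eta) * H k x.
  move=> far; apply: (le_trans (HC x _ far (e01 k))); rewrite -mulrA; apply: ler_wpM2l => //.
  (* The decay [eta - n] is not integrable; borrowing [2 * eta] makes it so and is the source of the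
     growth rate of the volume. *)
  have -> : N 1 x `^ (eta - n%:R) = N 1 x `^ (2 * eta) * P x.
    rewrite /P -powRD; last by apply/implyP => _; rewrite gt_eqF// N_gt0.
    by congr (_ `^ _); ring.
  rewrite /H -mulrDr -mulrA; apply: ler_wpM2l; first exact: powR_ge0.
  apply: ler_wpM2l; first exact: P0.
  have Iwx := intg_shift x Iw; have mwx := intg_measurable Iwx.
  have Rwx : RI (lebn n) (fun z => w (x + z)) <= 1 by rewrite RI_shift.
  have iN z := invN_le_cst z (e0 k).
  have i0 z : 0 <= (N (harm k) z)^-1 by have /andP[] := iN z.
  have l0 z : 0 <= ln (1 + (N (harm k) z)^-1) by apply: ln_ge0; rewrite lerDl.
  have I1 : intg (lebn n) (fun z => w (x + z) * (N (harm k) z)^-1).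
    apply: (intg_le _ _ (intgZ (harm k)^-1 Iwx)).
      by apply: measurable_funM => //; exact: measurable_invN.
    by move=> z; have /andP[_ h1] := iN z; rewrite ger0_norm ?mulr_ge0// mulrC; apply: ler_wpM2r.
  have lle z : ln (1 + (N (harm k) z)^-1) <= (N (harm k) z)^-1.
    apply: le_ln1Dx; by apply: lt_le_trans (i0 z); rewrite ltrN10.
  have I2 : intg (lebn n) (fun z => w (x + z) * ln (1 + (N (harm k) z)^-1)).
    apply: (intg_le _ _ I1).
      apply: measurable_funM => //; apply: measurableT_comp; first exact: measurable_ln.
      by apply: measurable_funD => //; exact: measurable_invN.
    move=> z; rewrite (ger0_norm (mulr_ge0 (w0 _) (l0 z))); exact: ler_wpM2l (w0 _) _ _ (lle z).
  have Ee : (fun z => w (x + z) * expR (ln (1 + (N (harm k) z)^-1))) =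
      (fun z => w (x + z) + w (x + z) * (N (harm k) z)^-1).
    by apply/funext => z; rewrite lnK ?posrE ?ltr_pwDl// mulrDr mulr1.
  have I3 : intg (lebn n) (fun z => w (x + z) * expR (ln (1 + (N (harm k) z)^-1))).
    by rewrite Ee; exact: intgD.
  apply: (le_trans (expR_RI_le (fun z => w0 (x + z)) Iwx Rwx l0 I2 I3)).
  by rewrite Ee RID// -/(Phi k x); lra.
have Ucv x : expR (U k x) @[k --> \oo] --> expR (n%:R * u x).
  have Hx := curv_ineq_shift x Hc; have Iv := growth a0 b0 n2 Hx.
  have L := poisson_approx n0 Iv (continuous_shift (x := x) cu) e01 (@harm_cvg R).
  have L2 : U k x @[k --> \oo] --> n%:R / @kappa R n * (@kappa R n * u (x + 0)).
    exact: cvgM (cvg_cst _) L.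
  rewrite addr0 mulrA -(mulrA _ _ (@kappa R n)) mulVf ?mulr1 ?gt_eqF// in L2.
  exact: (cvg_comp _ _ L2 (@continuous_expR R (n%:R * u x))).
have ceu : continuous (fun x => expR (n%:R * u x)) := continuous_expR_comp (c := n%:R) cu.
(* Points with [N 1 x ^+ 2 < rho] lie in the cube of half-side [Q], where [exp(n u)] is bounded by
   continuity. *)
pose Q : R := `|rho| + 1.
have [B B0 HB] := cube_bounded Q ceu.
have mNN : measurable_fun setT (fun x : 'rV[R]_n => N 1 x ^+ 2).
  have cN := @continuous_N R n 1.
  rewrite (_ : (fun x : 'rV[R]_n => N 1 x ^+ 2) = fun x => N 1 x * N 1 x); last by apply/funext => x; rewrite expr2.
  exact: continuous_measurable_rV (continuousM_fun cN cN).
have KE0 : 0 <= C * (2 * RI (lebn n) P + E).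
  by apply: mulr_ge0 => //; apply: addr_ge0 => //; apply: mulr_ge0 => //; exact: RI_ge0.
have BQ0 : 0 <= B * (2 * Q) ^+ n by apply: mulr_ge0 => //; rewrite exprn_ge0// /Q mulr_ge0// addr_ge0.
exists (C * (2 * RI (lebn n) P + E) + B * (2 * Q) ^+ n + 1) => [|r r0].
  by rewrite ltr_wpDl// addr_ge0.
pose q := (1 + r) `^ (2 * eta).
have q1 : 1 <= q.
  by rewrite /q -[leLHS](powRr0 (1 + r)) ler_powR ?lerDl ?(ltW r0)// mulr_ge0// ltW.
pose J x : R := if rho <= N 1 x ^+ 2 then (if enorm x < r then 1 else 0) else 0.
have J01 x : 0 <= J x <= 1 by rewrite /J; case: ifP => _; [case: ifP => _|]; rewrite ?lexx ?ler01.
have mJ : measurable_fun setT J.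
  apply: measurable_fun_if => //; first exact: measurable_fun_ler.
  by apply: measurable_funTS; apply: measurable_ball.
have meu := continuous_measurable_rV ceu.
(* The upper bounds [H k] need not converge as the height tends to 0. Their minimum with [exp(n u)]
   does, to [exp(n u)], because they dominate [expR (U k x)], which has that limit. *)
have [||||IJ RJ] := @RI_fatou _ _ R (lebn n)
   (fun k x => J x * Num.min (C * q * H k x) (expR (n%:R * u x)))
   (fun x => J x * expR (n%:R * u x)) (C * q * (2 * RI (lebn n) P + E)).
- move=> k; apply: (intg_le _ _ (intgZ (C * q) (IH k))).
    apply: measurable_funM => //; apply: measurable_minr => //.
    by apply: measurable_funM => //; exact: intg_measurable (IH k).
  move=> x; have /andP[j0 j1] := J01 x.
  have m0 : 0 <= Num.min (C * q * H k x) (expR (n%:R * u x)).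
    rewrite le_min expR_ge0 andbT; apply: mulr_ge0 => //; apply: mulr_ge0 => //.
    exact: le_trans ler01 q1.
  rewrite ger0_norm ?mulr_ge0//; apply: (@le_trans _ _ (Num.min (C * q * H k x) (expR (n%:R * u x)))).
    exact: ler_piMl.
  by rewrite ge_min lexx.
- move=> k x; have /andP[j0 j1] := J01 x; apply: mulr_ge0 => //.
  rewrite le_min expR_ge0 andbT; apply: mulr_ge0 => //; apply: mulr_ge0 => //.
  exact: le_trans ler01 q1.
- move=> x; rewrite /J; case: ifPn => far; last first.
    by under eq_fun do rewrite mul0r; rewrite mul0r; exact: cvg_cst.
  case: ifPn => xr; last by under eq_fun do rewrite mul0r; rewrite mul0r; exact: cvg_cst.
  under eq_fun do rewrite mul1r; rewrite mul1r.
  pose Y := expR (n%:R * u x).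
  apply: (@squeeze_cvgr _ _ _ _ (fun k => Y - `|Y - expR (U k x)|) (fun=> Y)).
  + apply: nearW => k; rewrite [X in _ && X]ge_min lexx orbT andbT le_min [X in _ && X]lerBlDr lerDl normr_ge0 andbT.
    have UY : Y - `|Y - expR (U k x)| <= expR (U k x) by have := ler_norm (Y - expR (U k x)); lra.
    apply: (le_trans UY); apply: (le_trans (Ub k x far)).
    apply: ler_wpM2r; first exact: H0.
    apply: ler_wpM2l => //; rewrite /q; apply: ge0_ler_powR; rewrite ?nnegrE ?N_ge0 ?addr_ge0 ?(ltW r0)//.
      by rewrite mulr_ge0// ltW.
    rewrite -(@ler_sqr R) ?nnegrE ?N_ge0 ?addr_ge0 ?(ltW r0)// sqr_N expr1n.
    have : sqn x <= r ^+ 2.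
      have := ltW xr; rewrite -(@ler_sqr R) ?nnegrE ?(ltW r0) ?sqrtr_ge0// enormE.
      by rewrite sqr_sqrtr// sqn_ge0.
    by have := r0; rewrite !expr2; nra.
  + have L : Y - `|Y - expR (U k x)| @[k --> \oo] --> Y - `|Y - Y|.
      by apply: cvgB; [exact: cvg_cst|apply: cvg_norm; apply: cvgB; [exact: cvg_cst|exact: Ucv]].
    by rewrite subrr normr0 subr0 in L.
  + exact: cvg_cst.
- move=> k; apply: (@le_trans _ _ (RI (lebn n) (fun x => C * q * H k x))).
    apply: RI_le; [|exact: intgZ|].
      apply: (intg_le _ _ (intgZ (C * q) (IH k))).
        apply: measurable_funM => //; apply: measurable_minr => //.
        by apply: measurable_funM => //; exact: intg_measurable (IH k).
      move=> x; have /andP[j0 j1] := J01 x.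
      have m0 : 0 <= Num.min (C * q * H k x) (expR (n%:R * u x)).
        rewrite le_min expR_ge0 andbT; apply: mulr_ge0 => //; apply: mulr_ge0 => //.
        exact: le_trans ler01 q1.
      rewrite ger0_norm ?mulr_ge0//; apply: (@le_trans _ _ (Num.min (C * q * H k x) (expR (n%:R * u x)))).
        exact: ler_piMl.
      by rewrite ge_min lexx.
    move=> x; have /andP[j0 j1] := J01 x.
    have m0 : 0 <= Num.min (C * q * H k x) (expR (n%:R * u x)).
      rewrite le_min expR_ge0 andbT; apply: mulr_ge0 => //; apply: mulr_ge0 => //.
      exact: le_trans ler01 q1.
    apply: (@le_trans _ _ (Num.min (C * q * H k x) (expR (n%:R * u x)))); first exact: ler_piMl.
    by rewrite ge_min lexx.
  rewrite RIZ//; apply: ler_wpM2l; last exact: RH.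
  by apply: mulr_ge0 => //; exact: le_trans ler01 q1.
have split_le x : `|ballV r x| <= J x * expR (n%:R * u x) + B * cubeI Q x.
  have e00 := expR_ge0 (n%:R * u x); have /andP[c0 c1] := cubeI01 Q x; have /andP[j0 j1] := J01 x.
  have bc : 0 <= B * cubeI Q x by exact: mulr_ge0.
  rewrite /ballV; case: ifPn => [xr|_]; last by rewrite normr0 addr_ge0// mulr_ge0.
  rewrite ger0_norm// /J; case: ifPn => far; first by rewrite xr mul1r lerDl.
  have xQ i : `|x ord0 i| <= Q.
    apply: (le_trans (coord_enorm x i)).
    have ee : enorm x ^+ 2 = sqn x by rewrite enormE sqr_sqrtr// sqn_ge0.
    move: far; rewrite -ltNge sqr_N expr1n -ee /Q => far; rewrite leNgt; apply/negP => lt1.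
    by have := ler_norm rho; have := normr_ge0 rho; move: far lt1; rewrite expr2; nra.
  rewrite mul0r add0r cubeI_in// mulr1.
  by apply: le_trans (HB x xQ); exact: ler_norm.
have IC : intg (lebn n) (cubeI Q) by exact: (@intg_cube R n Q).
have IM : intg (lebn n) (fun x => J x * expR (n%:R * u x) + B * cubeI Q x).
  by apply: intgD => //; exact: intgZ.
have IV : intg (lebn n) (ballV r).
  apply: (intg_le _ _ IM); first exact: measurable_ball.
  exact: split_le.
split=> //; apply: (@le_trans _ _ (RI (lebn n) (fun x => J x * expR (n%:R * u x) + B * cubeI Q x))).
  by apply: RI_le => // x; apply: le_trans (split_le x); exact: ler_norm.
rewrite RID//; last exact: intgZ.
rewrite RIZ// RI_cubeI ?addr_ge0// -/q.
move: RJ BQ0; move: (2 * RI _ _ + E) (B * _) (RI _ _) => X Y Z; have := q1; nra.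
Qed.

End one_metric.
End volume.

(** * From volume bounds to the entropy *)

Lemma limf_esup_eq0 {R : realType} (f : R -> R) :
  (forall eps, 0 < eps -> exists M, forall r, M < r -> `|f r| <= eps) ->
  limf_esup (fun r : R => (f r)%:E) (+oo : set_system R) = 0%E.
Proof.
move=> h; rewrite limf_esupE; apply/eqP; rewrite eq_le; apply/andP; split.
  apply/lee_addgt0Pr => e e0; rewrite add0e; have [M HM] := h e e0.
  apply: (@le_trans _ _ (ereal_sup [set (f r)%:E | r in [set r | M < r]])).
    apply: ereal_inf_lbound; exists [set r | M < r] => //.
    by exists M; split => //; exact: num_real.
  apply: ge_ereal_sup => _ [r /= Mr <-]; rewrite lee_fin.
  exact: le_trans (ler_norm _) (HM r Mr).
apply: le_ereal_inf_tmp => _ [V [M [_ HV]] <-].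
apply/lee_addgt0Pr => e e0; have [M' HM'] := h e e0.
pose r := Num.max M M' + 1.
have r1 : M < r by rewrite ltr_pwDr// le_max lexx.
have r2 : M' < r by rewrite ltr_pwDr// le_max lexx orbT.
have : ((f r)%:E <= ereal_sup [set (f r)%:E | r in V])%E.
  by apply: ereal_sup_ubound; exists r => //; exact: HV.
move=> hs; apply: (@le_trans _ _ ((f r)%:E + e%:E)%E); last exact: leeD2r.
rewrite -EFinD lee_fin; have := HM' r r2; rewrite ler_norml => /andP[]; lra.
Qed.

(** The numerator grows at most like [2 eta ln r] and the denominator at least like [n ln r]. As
    [n >= 3], a margin of [eta ln r] is left to pay for all constants. *)
Lemma ln_ratio_small {R : realType} (n : nat) (c : R) (E V : R -> R) : (3 <= n)%N -> 0 < c ->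
  (forall r, 1 <= r -> (r / n%:R) ^+ n <= E r) ->
  (forall r, 1 <= r -> c <= V r) ->
  (forall eta, 0 < eta -> eta <= 1 -> exists2 D, 0 < D &
     forall r, 0 < r -> V r <= D * (1 + r) `^ (2 * eta)) ->
  forall eps, 0 < eps -> exists M, forall r, M < r -> `|ln (V r) / ln (E r)| <= eps.
Proof.
move=> n3 c0 HE Hc HV eps eps0.
pose eta : R := Num.min eps 1.
have eta0 : 0 < eta by rewrite lt_min eps0 ltr01.
have eta1 : eta <= 1 by rewrite ge_min lexx orbT.
have etae : eta <= eps by rewrite ge_min lexx.
have [D1 D0 HD] := HV eta eta0 eta1.
have n0 : 0 < n%:R :> R by rewrite ltr0n (leq_trans _ n3).
have n3R : 3 <= n%:R :> R by rewrite ler_nat.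
(* Beyond [expR S] the margin [eta * (ln r - n ln n)] exceeds the sum of the constants from [V]; the
   additional 1 makes it strictly positive. *)
pose S : R := (`|ln D1| + `|ln c| + 2 * eta * ln 2 + eta * (n%:R * ln n%:R) + 1) / eta + n%:R * ln n%:R.
exists (expR S + 1) => r Mr.
have r1 : 1 <= r by have := expR_gt0 S; lra.
have r0 : 0 < r by exact: lt_le_trans ltr01 r1.
have lS : S <= ln r.
  by rewrite -[leLHS]expRK ler_ln ?posrE ?expR_gt0//; have := expR_gt0 S; lra.
have ln20 : 0 <= ln 2 :> R by apply: ln_ge0; rewrite ler1n.
have lnn0 : 0 <= n%:R * ln n%:R :> R by apply: mulr_ge0; [exact: ltW|apply: ln_ge0; lra].
have rn0 : 0 < r / n%:R by exact: divr_gt0.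
have lE : n%:R * ln r - n%:R * ln n%:R <= ln (E r).
  have : ln ((r / n%:R) ^+ n) <= ln (E r).
    by rewrite ler_ln ?posrE ?exprn_gt0// ?HE//; apply: lt_le_trans (HE r r1); exact: exprn_gt0.
  by rewrite lnXn// ln_div ?posrE// -mulrBr mulr_natl.
have V0 : 0 < V r := lt_le_trans c0 (Hc r r1).
have lV0 : ln c <= ln (V r) by rewrite ler_ln ?posrE// Hc.
have lV : ln (V r) <= ln D1 + 2 * eta * (ln 2 + ln r).
  have p0 : 0 < 1 + r by rewrite addr_gt0.
  have : ln (V r) <= ln (D1 * (1 + r) `^ (2 * eta)).
    by rewrite ler_ln ?posrE ?mulr_gt0 ?powR_gt0// HD.
  rewrite lnM ?posrE ?powR_gt0// ln_powR => hh; apply: (le_trans hh).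
  rewrite lerD2l; apply: ler_wpM2l; first by rewrite mulr_ge0// ltW.
  by rewrite -lnM ?posrE// ler_ln ?posrE ?mulr_gt0//; lra.
move: lS; rewrite /S -lerBrDr ler_pdivrMr// => lS.
have a1 := ler_norm (ln D1); have a2 := ler_norm (- ln c); rewrite normrN in a2.
have a3 := normr_ge0 (ln D1); have a4 := normr_ge0 (ln c).
have e2 : 0 <= 2 * eta * ln 2 by rewrite mulr_ge0// mulr_ge0// ltW.
have e3 : 0 <= eta * (n%:R * ln n%:R) by rewrite mulr_ge0// ltW.
have lr0 : 0 < ln r - n%:R * ln n%:R by rewrite -(pmulr_lgt0 _ eta0); lra.
have lr1 : 3 * ln r <= n%:R * ln r by apply: ler_wpM2r => //; lra.
have lE0 : 0 < ln (E r) by lra.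
have key : `|ln (V r)| <= eta * ln (E r).
  apply: (@le_trans _ _ (eta * (3 * ln r - n%:R * ln n%:R))); last by apply: ler_wpM2l; [exact: ltW|lra].
  have e4 : 0 <= eta * ln r by apply: mulr_ge0; [exact: ltW|lra].
  move: lnn0 lr0 lE e3 e4 lS; move: (n%:R * ln n%:R) => X *.
  rewrite ler_norml; apply/andP; split; rewrite -?mulNr; nra.
rewrite normrM normfV (gtr0_norm lE0) ler_pdivrMr//; apply: (le_trans key).
by apply: ler_wpM2r => //; exact: ltW.
Qed.

Section final.
Context {R : realType} {n : nat}.
Implicit Types (u : 'rV[R]_n -> R).

Lemma iint_ball (g : 'rV[R]_n -> R) (r : R) : (forall x, 0 <= g x) ->
  measurable_fun setT g ->
  intg (lebn n) (fun x => if enorm x < r then g x else 0) ->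
  fine (iint (fun x => if enorm x < r then (g x)%:E else 0%E)) =
  RI (lebn n) (fun x => if enorm x < r then g x else 0).
Proof.
move=> g0 mg Ig.
rewrite (_ : (fun x => _) = EFin \o (fun x => if enorm x < r then g x else 0)); last first.
  by apply/funext => x /=; case: ifP.
rewrite iintE; first by rewrite /= -RI_EFin.
  exact/measurable_EFinP/intg_measurable/Ig.
by move=> x /=; rewrite lee_fin; case: ifP.
Qed.

(** With half-side [r / (2n)] the squared norm is at most [r^2 / (4n) < r^2], and the volume of the
    cube is the convenient [(r/n)^n]. *)
Lemma cubeI_le_ball (r : R) (x : 'rV[R]_n) : (0 < n)%N -> 0 < r ->
  cubeI (r / (2 * n%:R)) x <= (if enorm x < r then 1 else 0).
Proof.
move=> n0 r0; have n1 : 1 <= n%:R :> R by rewrite ler1n.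
have q0 : 0 < r / (2 * n%:R) by rewrite divr_gt0// mulr_gt0// ltr0n.
have [h|h] := pselect (forall i, `|x ord0 i| <= r / (2 * n%:R)); last first.
  by rewrite cubeI_out//; case: ifP.
rewrite cubeI_in// ifT//.
rewrite -(@ltr_sqr R) ?nnegrE ?(ltW r0) ?sqrtr_ge0// enormE sqr_sqrtr ?sqn_ge0//.
apply: (le_lt_trans (sqn_cube (ltW q0) h)).
have -> : n%:R * (r / (2 * n%:R)) ^+ 2 = r ^+ 2 / (4 * n%:R) by field; rewrite pnatr_eq0 -lt0n.
rewrite ltr_pdivrMr ?mulr_gt0 ?ltr0n//; have : 0 < r ^+ 2 by rewrite exprn_gt0.
by move: (r ^+ 2) => s; nra.
Qed.

Lemma evol_ball_ge (r : R) : (0 < n)%N -> 0 < r -> (r / n%:R) ^+ n <= fine (evol_ball n r).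
Proof.
move=> n0 r0; have I1 : intg (lebn n) (fun x : 'rV[R]_n => if enorm x < r then 1 else 0).
  apply: (intg_le _ _ (@intg_cube R n r)).
    exact: (@measurable_ball R n r (fun=> 1) (measurable_cst _)).
  move=> x; case: ifPn => [h|_]; last by rewrite normr0; have /andP[] := cubeI01 r x.
  rewrite normr1 -/(cubeI r x) cubeI_in// => i.
  exact: le_trans (coord_enorm x i) (ltW h).
rewrite /evol_ball (iint_ball (g := fun=> 1))//.
have q0 : 0 <= r / (2 * n%:R) by rewrite divr_ge0// ltW.
have -> : (r / n%:R) ^+ n = RI (lebn n) (@cubeI R n (r / (2 * n%:R))).
  by rewrite RI_cubeI//; congr (_ ^+ _); field; rewrite pnatr_eq0 -lt0n.
apply: RI_le => //; first exact: (@intg_cube R n (r / (2 * n%:R))).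
by move=> x; exact: cubeI_le_ball.
Qed.

Lemma gvol_ball_ge u : (0 < n)%N -> continuous u ->
  (forall r, 0 < r -> intg (lebn n) (ballV u r)) ->
  exists2 c : R, 0 < c & forall r, 1 <= r -> c <= RI (lebn n) (ballV u r).
Proof.
move=> n0 cu IV; pose q : R := 1 / (2 * n%:R).
have q0 : 0 < q by rewrite divr_gt0// mulr_gt0// ltr0n.
have [B B0 HB] := cube_bounded q cu.
exists (expR (- (n%:R * B)) * (2 * q) ^+ n).
  by rewrite mulr_gt0 ?expR_gt0// exprn_gt0// mulr_gt0.
move=> r r1; have r0 : 0 < r := lt_le_trans ltr01 r1.
rewrite -(RI_cubeI (ltW q0)) -RIZ; last exact: (@intg_cube R n q).
apply: RI_le; [by apply: intgZ; exact: (@intg_cube R n q)|exact: IV|].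
move=> x; rewrite /ballV.
have [h|h] := pselect (forall i, `|x ord0 i| <= q); last first.
  by rewrite cubeI_out// mulr0; case: ifP => // _; exact: expR_ge0.
have := cubeI_le_ball x n0 ltr01; rewrite -/q cubeI_in// mulr1.
case: ifPn => [x1 _|_]; last by rewrite leNgt ltr01.
rewrite (lt_le_trans x1 r1) ler_expR -mulrN; apply: ler_wpM2l => //.
by have := HB x h; rewrite ler_norml => /andP[].
Qed.

End final.

Theorem theorem1p5 (R : realType) (n : nat) (u : 'rV[R]_n -> R) (C : R) :
  (3 <= n)%N ->
  smooth u ->
  complete_metric u ->
  finite_total_Q u ->
  0 < C ->
  (exists K : set 'rV[R]_n, compact K /\
     forall x, ~ K x -> C <= scalar_curv u x) ->
  vol_entropy u = 0%E.
Proof.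
move=> n3 su _ fQ C0 [K [cK HK]].
have n2 : (2 <= n)%N := ltnW n3; have n0 : (0 < n)%N := ltnW n2.
have n3R : 3 <= n%:R :> R by rewrite ler_nat.
have [m Hc] := curv_of_scalar n3 su C0 cK HK.
have a0 : 0 < (n%:R - 2) / 2 :> R by rewrite divr_gt0//; lra.
have b0 : 0 < C / (2 * (n%:R - 1)) by rewrite divr_gt0// mulr_gt0//; lra.
have vg := volume_growth a0 b0 n2 Hc fQ.
have cu := smooth_continuous su.
have IV r : 0 < r -> intg (lebn n) (ballV u r).
  (* Any admissible [eta] gives integrability of [exp(n u)] over balls; here [eta] is 1. *)
  by move=> r0; have [D _ HD] := vg 1 ltr01 (lexx 1); have [] := HD r r0.
have [c c0 Hc1] := gvol_ball_ge n0 cu IV.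
have ceu : continuous (fun x => expR (n%:R * u x)) := continuous_expR_comp (c := n%:R) cu.
have gE r : 0 < r -> fine (gvol_ball u r) = RI (lebn n) (ballV u r).
  move=> r0; apply: (iint_ball (g := fun x => expR (n%:R * u x))) => [x||].
  - exact: expR_ge0.
  - exact: continuous_measurable_rV ceu.
  - exact: IV.
apply: limf_esup_eq0.
apply: (@ln_ratio_small R n c (fun r => fine (evol_ball n r)) (fun r => fine (gvol_ball u r)) n3 c0).
- by move=> r r1; apply: evol_ball_ge => //; exact: lt_le_trans ltr01 r1.
- by move=> r r1; rewrite gE ?Hc1//; exact: lt_le_trans ltr01 r1.
- move=> eta eta0 eta1; have [D D0 HD] := vg eta eta0 eta1.
  by exists D => // r r0; rewrite gE//; have [] := HD r r0.
Qed.
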